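(* Assume Continuity, Strong convexity, Stochastic noise and Unbiased compression (all stated in the context). Let the iterates be generated by EF-SOBA with $\beta<\min\{\frac2{\mu_g+L_g},\frac{\mu_gn}{96\omega_\ell\omega_1L_g^2}\}$, $\gamma\le\min\{\frac1{L_g},\frac{\mu_gn}{432\omega_\ell\omega_1L_g^2}\}$, $\rho\ge C_f/\mu_g$, $\delta_\ell=(1+\omega_\ell)^{-1}$, $\delta_u=(1+\omega_u)^{-1}$, $m_{x,i}^0=h_{x,i}^0$ for $i=1,\dots,n$, and $\alpha\le\min\{\frac1{2L_{\nabla\Phi}},C_3\}$, where $$C_3^{-2}=2\Big[\frac{4L_{\nabla\Phi}^2}{\theta^2}+72\omega_u(1+\omega_u)L_5^2+12\omega_2(L_2^2+25\kappa_g^2L_1^2)\Big(\frac{4L_{y^\star}^2}{\beta^2\mu_g^2}+\frac{16\omega_\ell\omega_1L_3^2\beta}{\mu_gn}\Big)+12\omega_2L_g^2\Big(\frac{12L_{z^\star}^2}{\gamma^2\mu_g^2}+\frac{72\omega_\ell\omega_1L_4^2\gamma}{\mu_gn}\Big)\Big].$$ Then \begin{align*} \frac1K\sum_{k=0}^{K-1}\mathbb E\|\nabla\Phi(x^k)\|_2^2\le{}&\frac{2\Delta_\Phi^0}{K\alpha}+\frac{2\Delta_x^0}{K\theta}+\frac{12\omega_u(1+\omega_u)\theta\Delta_h^0}{K}+\frac{24\omega_2(L_2^2+25\kappa_g^2L_1^2)\Delta_y^0}{\mu_gK\beta}+\frac{48\omega_2L_g^2\Delta_z^0}{\mu_gK\gamma}\\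 &+\frac{48\omega_2(1+6\omega_\ell\omega_1)(L_2^2+25\kappa_g^2L_1^2)\beta}{\mu_gn}\sigma^2+\Big(\frac{2\theta}n+36\omega_u(1+\omega_u)\theta^2+\frac{72\omega_2(1+6\omega_\ell\omega_1)L_g^2\gamma}{\mu_gn}\Big)\sigma_1^2\\ &+\frac{48\omega_2\omega_\ell(1+4\omega_\ell)(L_2^2+25\kappa_g^2L_1^2)\beta}{\mu_gKn^2}\sum_{i=1}^n\|\mathbb E(D_{y,i}^0)-m_{y,i}^0\|_2^2\\ &+\frac{72\omega_2\omega_\ell(1+4\omega_\ell)L_g^2\gamma}{\mu_gKn^2}\sum_{i=1}^n\|\mathbb E(D_{z,i}^0)-m_{z,i}^0\|_2^2 . \end{align*} If one further chooses $\alpha=(2L_{\nabla\Phi}+C_3^{-1})^{-1}$, $\rho=C_f/\mu_g$, $\delta_\ell=\frac1{1+\omega_\ell}$, $\delta_u=\frac1{1+\omega_u}$, $$\beta=\Big(\tfrac{\mu_g+L_g}2+\tfrac{96\omega_\ell\omega_1L_g^2}{\mu_gn}+\sqrt{\tfrac{2\omega_\ell(1+4\omega_\ell)\Delta_{m_y}^0}{n\Delta_y^0}}+\sqrt{\tfrac{2K\sigma^2(1+6\omega_\ell\omega_1)}{n\Delta_y^0}}\Big)^{-1},$$ $$\gamma=\Big(L_g+\tfrac{432\omega_\ell\omega_1L_g^2}{\mu_gn}+\sqrt{\tfrac{3\omega_\ell(1+4\omega_\ell)\Delta_{m_z}^0}{2n\Delta_z^0}}+\sqrt{\tfrac{K\sigma_1^2(1+6\omega_\ell\omega_1)}{n\Delta_z^0}}\Big)^{-1},$$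 $$\theta=\Big(1+\sqrt{\tfrac{6\omega_u(1+\omega_u)\Delta_h^0}{\Delta_x^0}}+\sqrt{\tfrac{K\sigma_1^2}{n\Delta_x^0}}+\sqrt[3]{\tfrac{18\omega_u(1+\omega_u)K\sigma_1^2}{\Delta_x^0}}\Big)^{-1},$$ then EF-SOBA converges as order \begin{align*} \frac1K\sum_{k=0}^{K-1}\mathbb E\|\nabla\Phi(x^k)\|_2^2=\mathcal O\Big(&\frac{(1+\omega_u)^2(1+\omega_\ell)^{3/2}\sqrt\Delta\,\sigma}{\sqrt{nK}}+\frac{\omega_u^{1/3}(1+\omega_u)^{1/3}\Delta^{2/3}\sigma^{2/3}}{K^{2/3}}+\frac{(1+\omega_u)\Delta}{K}\\ &+\frac{(1+\omega_u)^2\sqrt{\omega_\ell(1+\omega_\ell)}\,\Delta}{\sqrt nK}+\frac{(1+\omega_u)^2\omega_\ell^3\Delta}{nK}\Big). \end{align*}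
   Context: Setting. $n\ge1$ workers; $f_i,g_i:\mathbb R^{d_x}\times\mathbb R^{d_y}\to\mathbb R$ with $f_i(x,y)=\mathbb E_{\phi\sim\mathcal D_{f_i}}[F(x,y;\phi)]$, $g_i(x,y)=\mathbb E_{\xi\sim\mathcal D_{g_i}}[G(x,y;\xi)]$; $f=\frac1n\sum_if_i$, $g=\frac1n\sum_ig_i$; $y^\star(x)=\arg\min_yg(x,y)$; $\Phi(x)=f(x,y^\star(x))$; $z^\star(x)=-[\nabla^2_{yy}g(x,y^\star(x))]^{-1}\nabla_yf(x,y^\star(x))$. $\nabla^2_{xy}g\in\mathbb R^{d_x\times d_y}$; $\|\cdot\|_2$ is the Euclidean norm of vectors and the spectral norm of matrices. $K\ge1$ is the number of iterations. Continuity: for all $i$, $f_i$ is $C_f$-Lipschitz in $y$, and $\nabla f_i,\nabla g_i,\nabla^2_{xy}g_i,\nabla^2_{yy}g_i$ are Lipschitz in $(x,y)$ with constants $L_f,L_g,L_{g_{xy}},L_{g_{yy}}$. Strong convexity: every $g_i$ is $\mu_g$-strongly convex in $y$. Stochastic noise: at every $(x,y)$, for every $i$, $\nabla F(x,y;\phi)$, $\nabla_yG(x,y;\xi)$, $\nabla^2_{xy}G(x,y;\xi)$, $\nabla^2_{yy}G(x,y;\xi)$ are unbiased estimates of $\nabla f_i,\nabla_yg_i,\nabla^2_{xy}g_i,\nabla^2_{yy}g_i$, each with mean squared error (in $\|\cdot\|_2$) at most $\sigma^2$. Unbiased compression: a random map $\mathcal C$ is $\omega$-unbiased ($\omega\ge0$)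 if $\mathbb E[\mathcal C(v)]=v$ and $\mathbb E\|\mathcal C(v)-v\|_2^2\le\omega\|v\|_2^2$ for all $v$. The upper-level compressors $\mathcal C_i^u$ are $\omega_u$-unbiased, the lower-level compressors $\mathcal C_i^\ell$ are $\omega_\ell$-unbiased; fresh randomness is used at each iteration, and outputs of different workers are mutually independent conditioned on the inputs. EF-SOBA. Positive parameters $\alpha,\beta,\gamma,\theta,\rho,\delta_u,\delta_\ell$; initial $x^0,y^0,z^0$ ($\|z^0\|_2\le\rho$), $m_{x,i}^0,m_{y,i}^0,m_{z,i}^0,h_{x,i}^0$; $\hat h_x^0=\frac1n\sum_im_{x,i}^0$, $m_y^0=\frac1n\sum_im_{y,i}^0$, $m_z^0=\frac1n\sum_im_{z,i}^0$. At iteration $k$, worker $i$ draws fresh independent samples $\phi_i^k\sim\mathcal D_{f_i},\xi_i^k\sim\mathcal D_{g_i}$ and forms $D_{x,i}^k=\nabla_{xy}^2G(x^k,y^k;\xi_i^k)z^k+\nabla_xF(x^k,y^k;\phi_i^k)$, $D_{y,i}^k=\nabla_yG(x^k,y^k;\xi_i^k)$, $D_{z,i}^k=\nabla_{yy}^2G(x^k,y^k;\xi_i^k)z^k+\nabla_yF(x^k,y^k;\phi_i^k)$; sets $h_{x,i}^{k+1}=(1-\theta)h_{x,i}^k+\theta D_{x,i}^k$; computes the compressed messages $c_{x,i}^k=\mathcal C_i^u(h_{x,i}^{k+1}-m_{x,i}^k)$, $c_{y,i}^k=\mathcal C_i^\ell(D_{y,i}^k-m_{y,i}^k)$, $c_{z,i}^k=\mathcal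 C_i^\ell(D_{z,i}^k-m_{z,i}^k)$; and sets $m_{x,i}^{k+1}=m_{x,i}^k+\delta_uc_{x,i}^k$, $m_{y,i}^{k+1}=m_{y,i}^k+\delta_\ell c_{y,i}^k$, $m_{z,i}^{k+1}=m_{z,i}^k+\delta_\ell c_{z,i}^k$. The server sets $\hat D_y^k=m_y^k+\frac1n\sum_ic_{y,i}^k$, $\hat D_z^k=m_z^k+\frac1n\sum_ic_{z,i}^k$, $x^{k+1}=x^k-\alpha\hat h_x^k$, $y^{k+1}=y^k-\beta\hat D_y^k$, $\tilde z^{k+1}=z^k-\gamma\hat D_z^k$, $z^{k+1}=\min\{1,\rho/\|\tilde z^{k+1}\|_2\}\tilde z^{k+1}$, $\hat h_x^{k+1}=\hat h_x^k+\frac{\delta_u}n\sum_ic_{x,i}^k$, $m_y^{k+1}=m_y^k+\frac{\delta_\ell}n\sum_ic_{y,i}^k$, $m_z^{k+1}=m_z^k+\frac{\delta_\ell}n\sum_ic_{z,i}^k$. Constants. $L_{\nabla\Phi},L_{y^\star},L_{z^\star}>0$ are Lipschitz constants of $\nabla\Phi,y^\star,z^\star$ (they exist under Continuity and Strong convexity). $\kappa_g=L_g/\mu_g$, $L_1^2=L_f^2+L_{g_{yy}}^2\rho^2$, $L_2^2=L_f^2+L_{g_{xy}}^2\rho^2$, $L_3^2=L_g^2(1+3L_{y^\star}^2)$, $L_4^2=L_1^2(1+3L_{y^\star}^2)+3L_g^2L_{z^\star}^2$, $L_5^2=L_2^2(1+3L_{y^\star}^2)+3L_g^2L_{z^\star}^2$,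 $\sigma_1^2=\sigma^2(1+\rho^2)$, $\omega_1=1+6\omega_\ell(1+\omega_\ell)$, $\omega_2=1+36\omega_u(1+\omega_u)$. With $h_x^0=\frac1n\sum_ih_{x,i}^0$: $\Delta_\Phi^0=\Phi(x^0)$, $\Delta_x^0=\|h_x^0-\nabla\Phi(x^0)\|_2^2$, $\Delta_h^0=\frac1n\sum_i\|h_{x,i}^0-\mathbb E(D_{x,i}^0)\|_2^2$, $\Delta_y^0=\|y^0-y^\star(x^0)\|_2^2$, $\Delta_z^0=\|z^0-z^\star(x^0)\|_2^2$, $\Delta_{m_y}^0=\frac1n\sum_i\|\mathbb E(D_{y,i}^0)-m_{y,i}^0\|_2^2$, $\Delta_{m_z}^0=\frac1n\sum_i\|\mathbb E(D_{z,i}^0)-m_{z,i}^0\|_2^2$; $\Delta$ is the maximum of these seven quantities. Parameter upper bounds with a zero denominator are read as $+\infty$.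
   Formalization: Assumes Φ ≥ 0 everywhere and, for the explicit bound, θ ≤ 1 (false otherwise); for the rate, Δ_x⁰, Δ_y⁰, Δ_z⁰ are positive and the O-constant depends on the problem constants and on a bound for Δ/Δ_x⁰, Δ/Δ_y⁰, Δ/Δ_z⁰. *)

(* Defs.v *)
From HB Require Import structures.
From mathcomp Require Import all_boot all_order all_algebra.
From mathcomp Require Import all_classical all_reals all_analysis.

Set Implicit Arguments.
Unset Strict Implicit.
Unset Printing Implicit Defensive.

Import Order.TTheory GRing.Theory Num.Theory.
Import numFieldNormedType.Exports.

Local Open Scope classical_set_scope.
Local Open Scope ring_scope.

(* The library norm of a matrix is the maximum of its entries; it is only used
   (through the topology) in [differentiable] and ['D_v f]. *)
Definition enorm {R : realType} {d : nat} (v : 'cV[R]_d) : R :=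
  Num.sqrt (\sum_(j < d) v j 0 ^+ 2).

Definition opnorm {R : realType} {a b : nat} (A : 'M[R]_(a, b)) : R :=
  sup [set enorm (A *m v) | v in [set v : 'cV[R]_b | enorm v <= 1]].

Definition grad {R : realType} {d : nat} (h : 'cV[R]_d -> R) (x : 'cV[R]_d) :
    'cV[R]_d :=
  \col_j 'D_(delta_mx j 0) h x.

Definition gradx {R : realType} {p q : nat} (h : 'cV[R]_p -> 'cV[R]_q -> R)
    (x : 'cV[R]_p) (y : 'cV[R]_q) : 'cV[R]_p :=
  grad (fun x' => h x' y) x.

Definition grady {R : realType} {p q : nat} (h : 'cV[R]_p -> 'cV[R]_q -> R)
    (x : 'cV[R]_p) (y : 'cV[R]_q) : 'cV[R]_q :=
  grad (h x) y.

Definition gradxy {R : realType} {p q : nat} (h : 'cV[R]_p -> 'cV[R]_q -> R)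
    (x : 'cV[R]_p) (y : 'cV[R]_q) : 'cV[R]_(p + q) :=
  col_mx (gradx h x y) (grady h x y).

(* Entry (a, b) is the derivative along x_a of the derivative along y_b. *)
Definition hess_xy {R : realType} {p q : nat} (h : 'cV[R]_p -> 'cV[R]_q -> R)
    (x : 'cV[R]_p) (y : 'cV[R]_q) : 'M[R]_(p, q) :=
  \matrix_(a < p, b < q) 'D_(delta_mx a 0) (fun x' => grady h x' y b 0) x.

Definition hess_yy {R : realType} {p q : nat} (h : 'cV[R]_p -> 'cV[R]_q -> R)
    (x : 'cV[R]_p) (y : 'cV[R]_q) : 'M[R]_q :=
  \matrix_(a < q, b < q) 'D_(delta_mx a 0) (fun y' => grady h x y' b 0) y.

Definition differentiable2 {R : realType} {p q : nat}
    (h : 'cV[R]_p -> 'cV[R]_q -> R) : Prop :=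
  forall u : 'cV[R]_p * 'cV[R]_q,
    differentiable (fun v : 'cV[R]_p * 'cV[R]_q => h v.1 v.2) u.

(* Differentiable, with a differentiable partial gradient in y, so that both
   blocks [hess_xy] and [hess_yy] are genuine derivatives. *)
Definition twice_differentiable2 {R : realType} {p q : nat}
    (h : 'cV[R]_p -> 'cV[R]_q -> R) : Prop :=
  differentiable2 h /\
  forall b : 'I_q, differentiable2 (fun x y => grady h x y b 0).

Definition lipschitz_xy {R : realType} {p q a b : nat}
    (nrm : 'M[R]_(a, b) -> R) (L : R)
    (H : 'cV[R]_p -> 'cV[R]_q -> 'M[R]_(a, b)) : Prop :=
  forall x y x' y',
    nrm (H x y - H x' y') <= L * enorm (col_mx (x - x') (y - y')).

Definition lipschitz_cst {R : realType} {a b : nat} (L : R)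
    (h : 'cV[R]_a -> 'cV[R]_b) : Prop :=
  forall x x', enorm (h x - h x') <= L * enorm (x - x').

Definition strongly_convex {R : realType} {d : nat} (mu : R)
    (h : 'cV[R]_d -> R) : Prop :=
  forall (y y' : 'cV[R]_d) (t : R), 0 <= t <= 1 ->
    h (t *: y + (1 - t) *: y') <=
      t * h y + (1 - t) * h y' - mu / 2 * t * (1 - t) * enorm (y - y') ^+ 2.

(* R^d with its Borel sigma-algebra; the carrier is convertible to 'cV_d. *)
Definition borel (R : realType) (d : nat) :=
  g_sigma_algebraType [set A : set 'cV[R]_d | open A].

Definition unbiased {dT} {T : measurableType dT} {R : realType}
    (P : probability T R) {a b : nat}
    (X : T -> 'M[R]_(a, b)) (M : 'M[R]_(a, b)) : Prop :=
  forall i j, P.-integrable setT (fun t => (X t i j)%:E) /\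
              (\int[P]_t (X t i j)%:E = (M i j)%:E)%E.

Definition mse_le {dT} {T : measurableType dT} {R : realType}
    (P : probability T R) {a b : nat} (nrm : 'M[R]_(a, b) -> R)
    (X : T -> 'M[R]_(a, b)) (M : 'M[R]_(a, b)) (s2 : R) : Prop :=
  (\int[P]_t (nrm (X t - M) ^+ 2)%:E <= s2%:E)%E.

Definition mean_vec {dT} {T : measurableType dT} {R : realType}
    (P : probability T R) {d : nat} (X : T -> 'cV[R]_d) : 'cV[R]_d :=
  \col_j fine ('E_P[fun t => X t j ord0])%E.

Definition has_law {d1} {O : measurableType d1} {d2} {T : measurableType d2}
    {R : realType} (P : probability O R) (X : O -> T) (D : probability T R) :
    Prop :=
  measurable_fun setT X /\ forall B, measurable B -> P (X @^-1` B) = D B.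

Definition events {d1} {O : measurableType d1} {d2} {T : measurableType d2}
    (X : O -> T) : set (set O) :=
  preimage_set_system setT X measurable.

Definition mutually_independent {dO} {O : measurableType dO} {R : realType}
    (P : probability O R) {I : choiceType} (E : I -> set (set O)) : Prop :=
  forall (s : seq I) (A : I -> set O), uniq s ->
    (forall i, i \in s -> E i (A i)) ->
    P (\bigcap_(i in [set` s]) A i) = (\prod_(i <- s) fine (P (A i)))%:E.

(* A random map: given the input v, the output is [cmap v s] for a random seed
   s of law [seed_law]. *)
Record compressor (R : realType) (d : nat) := Compressor {
  cdisp : measure_display;
  seed : measurableType cdisp;
  seed_law : probability seed R;
  cmap : 'cV[R]_d -> seed -> 'cV[R]_d
}.

Definition omega_unbiased {R : realType} {d : nat} (omega : R)
    (C : compressor R d) : Prop :=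
  [/\ 0 <= omega,
      measurable_fun setT
        (fun u : borel R d * seed C => cmap u.1 u.2 : borel R d) &
      forall v : 'cV[R]_d,
        unbiased (seed_law C) (cmap v) v /\
        mse_le (seed_law C) enorm (cmap v) v (omega * enorm v ^+ 2)].

Record problem (R : realType) (n p q : nat) := Problem {
  dphi : measure_display;
  Tphi : measurableType dphi;
  dxi : measure_display;
  Txi : measurableType dxi;
  lossF : Tphi -> 'cV[R]_p -> 'cV[R]_q -> R;
  lossG : Txi -> 'cV[R]_p -> 'cV[R]_q -> R;
  Df : 'I_n -> probability Tphi R;
  Dg : 'I_n -> probability Txi R
}.

Record constants (R : realType) := Constants {
  C_f : R; L_f : R; L_g : R; L_gxy : R; L_gyy : R; mu_g : R;
  L_Phi : R; L_ystar : R; L_zstar : R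
}.

Section Problem.
Context {R : realType} {n p q : nat} (pb : problem R n p q).

Definition f_ (i : 'I_n) (x : 'cV[R]_p) (y : 'cV[R]_q) : R :=
  fine ('E_(Df pb i)[fun t => lossF t x y])%E.

Definition g_ (i : 'I_n) (x : 'cV[R]_p) (y : 'cV[R]_q) : R :=
  fine ('E_(Dg pb i)[fun t => lossG t x y])%E.

Definition fbar (x : 'cV[R]_p) (y : 'cV[R]_q) : R :=
  n%:R^-1 * \sum_(i < n) f_ i x y.

Definition gbar (x : 'cV[R]_p) (y : 'cV[R]_q) : R :=
  n%:R^-1 * \sum_(i < n) g_ i x y.

(* A minimizer exists and is unique under strong convexity; 0 is the default
   value of [xget] when there is none. *)
Definition ystar (x : 'cV[R]_p) : 'cV[R]_q :=
  xget 0 [set y | forall y', gbar x y <= gbar x y'].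

Definition Phi (x : 'cV[R]_p) : R := fbar x (ystar x).

Definition zstar (x : 'cV[R]_p) : 'cV[R]_q :=
  - (invmx (hess_yy gbar x (ystar x)) *m grady fbar x (ystar x)).

(* The sample losses are jointly measurable and integrable, so that f_i and g_i
   are genuine expectations, and have the derivatives used as oracles. *)
Definition regular_losses : Prop :=
  [/\ measurable_fun setT (fun u : borel R p * borel R q * Tphi pb =>
        lossF u.2 u.1.1 u.1.2),
      measurable_fun setT (fun u : borel R p * borel R q * Txi pb =>
        lossG u.2 u.1.1 u.1.2),
      (forall i x y,
        (Df pb i).-integrable setT (fun t => (lossF t x y)%:E) /\
        (Dg pb i).-integrable setT (fun t => (lossG t x y)%:E)),
      (forall t : Tphi pb, differentiable2 (lossF t)) &
      (forall t : Txi pb, twice_differentiable2 (lossG t))].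

Definition continuity_assumption (c : constants R) : Prop :=
  [/\ 0 <= C_f c, 0 <= L_f c, 0 <= L_g c, 0 <= L_gxy c & 0 <= L_gyy c] /\
  forall i : 'I_n,
  [/\ differentiable2 (f_ i) /\ twice_differentiable2 (g_ i),
      (forall x y y', `|f_ i x y - f_ i x y'| <= C_f c * enorm (y - y')),
      lipschitz_xy enorm (L_f c) (gradxy (f_ i)),
      lipschitz_xy enorm (L_g c) (gradxy (g_ i)) &
      lipschitz_xy opnorm (L_gxy c) (hess_xy (g_ i)) /\
      lipschitz_xy opnorm (L_gyy c) (hess_yy (g_ i))].

Definition strong_convexity_assumption (c : constants R) : Prop :=
  0 < mu_g c /\ forall (i : 'I_n) x, strongly_convex (mu_g c) (g_ i x).

Definition noise_assumption (sigma : R) : Prop :=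
  0 <= sigma /\ forall (i : 'I_n) x y,
  [/\ unbiased (Df pb i) (fun t => gradxy (lossF t) x y)
        (gradxy (f_ i) x y) /\
      mse_le (Df pb i) enorm (fun t => gradxy (lossF t) x y)
        (gradxy (f_ i) x y) (sigma ^+ 2),
      unbiased (Dg pb i) (fun t => grady (lossG t) x y) (grady (g_ i) x y) /\
      mse_le (Dg pb i) enorm (fun t => grady (lossG t) x y)
        (grady (g_ i) x y) (sigma ^+ 2),
      unbiased (Dg pb i) (fun t => hess_xy (lossG t) x y)
        (hess_xy (g_ i) x y) /\
      mse_le (Dg pb i) opnorm (fun t => hess_xy (lossG t) x y)
        (hess_xy (g_ i) x y) (sigma ^+ 2) &
      unbiased (Dg pb i) (fun t => hess_yy (lossG t) x y)
        (hess_yy (g_ i) x y) /\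
      mse_le (Dg pb i) opnorm (fun t => hess_yy (lossG t) x y)
        (hess_yy (g_ i) x y) (sigma ^+ 2)].

Definition derived_lipschitz (c : constants R) : Prop :=
  [/\ 0 < L_Phi c, 0 < L_ystar c & 0 < L_zstar c] /\
  [/\ lipschitz_cst (L_Phi c) (grad Phi),
      lipschitz_cst (L_ystar c) ystar &
      lipschitz_cst (L_zstar c) zstar].

End Problem.

Record hyperparams (R : realType) := Hyperparams {
  alpha : R; beta : R; gamma : R; theta : R; rho : R; delta_u : R; delta_l : R
}.

Record initial (R : realType) (n p q : nat) := Initial {
  x0 : 'cV[R]_p; y0 : 'cV[R]_q; z0 : 'cV[R]_q;
  mx0 : 'I_n -> 'cV[R]_p; my0 : 'I_n -> 'cV[R]_q; mz0 : 'I_n -> 'cV[R]_q;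
  hx0 : 'I_n -> 'cV[R]_p
}.

(* [s_mx], [s_my], [s_mz], [s_hx] are held by the workers; [s_hhat], [s_smy],
   [s_smz] (written \hat h_x, m_y, m_z in mathematics) by the server. *)
Record state (R : realType) (n p q : nat) := State {
  s_x : 'cV[R]_p; s_y : 'cV[R]_q; s_z : 'cV[R]_q;
  s_mx : 'I_n -> 'cV[R]_p; s_my : 'I_n -> 'cV[R]_q; s_mz : 'I_n -> 'cV[R]_q;
  s_hx : 'I_n -> 'cV[R]_p;
  s_hhat : 'cV[R]_p; s_smy : 'cV[R]_q; s_smz : 'cV[R]_q
}.

Definition vmean {R : realType} {n d : nat} (v : 'I_n -> 'cV[R]_d) :
    'cV[R]_d :=
  n%:R^-1 *: \sum_(i < n) v i.

Section Algorithm.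
Context {R : realType} {n p q : nat} (pb : problem R n p q).
Context (Cu : 'I_n -> compressor R p) (Cl : 'I_n -> compressor R q).

(* The samples and the compression seeds of worker i at iteration k. *)
Record randomness := Randomness {
  dOm : measure_display;
  Om : measurableType dOm;
  Pr : probability Om R;
  phi : nat -> 'I_n -> Om -> Tphi pb;
  xi : nat -> 'I_n -> Om -> Txi pb;
  ux : nat -> forall i : 'I_n, Om -> seed (Cu i);
  uy : nat -> forall i : 'I_n, Om -> seed (Cl i);
  uz : nat -> forall i : 'I_n, Om -> seed (Cl i)
}.
Arguments phi : clear implicits.
Arguments xi : clear implicits.
Arguments ux : clear implicits.
Arguments uy : clear implicits.
Arguments uz : clear implicits.

Definition sources (rd : randomness)
    (j : (nat * 'I_n) + (nat * 'I_n) + (nat * 'I_n)) : set (set (Om rd)) :=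
  match j with
  | inl (inl ki) => events (phi rd ki.1 ki.2)
  | inl (inr ki) => events (xi rd ki.1 ki.2)
  | inr ki => events (fun w =>
      (ux rd ki.1 ki.2 w, uy rd ki.1 ki.2 w, uz rd ki.1 ki.2 w))
  end.

(* All samples and all compression seeds are fresh and independent across
   iterations and workers. No independence is imposed between the three seeds
   used by one worker within one iteration. *)
Definition fresh_randomness (rd : randomness) : Prop :=
  (forall k i,
    [/\ has_law (Pr rd) (phi rd k i) (Df pb i),
        has_law (Pr rd) (xi rd k i) (Dg pb i),
        has_law (Pr rd) (ux rd k i) (seed_law (Cu i)),
        has_law (Pr rd) (uy rd k i) (seed_law (Cl i)) &
        has_law (Pr rd) (uz rd k i) (seed_law (Cl i))]) /\
  mutually_independent (Pr rd) (@sources rd).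

Definition dir_x (x : 'cV[R]_p) (y z : 'cV[R]_q) (s : Tphi pb) (t : Txi pb) :
    'cV[R]_p :=
  hess_xy (lossG t) x y *m z + gradx (lossF s) x y.

Definition dir_y (x : 'cV[R]_p) (y : 'cV[R]_q) (t : Txi pb) : 'cV[R]_q :=
  grady (lossG t) x y.

Definition dir_z (x : 'cV[R]_p) (y z : 'cV[R]_q) (s : Tphi pb) (t : Txi pb) :
    'cV[R]_q :=
  hess_yy (lossG t) x y *m z + grady (lossF s) x y.

(* For v = 0 the result is 0 whatever the value of the factor, so that the
   convention rho / 0 = 0 of the library is harmless. *)
Definition clip (r : R) {d : nat} (v : 'cV[R]_d) : 'cV[R]_d :=
  Num.min 1 (r / enorm v) *: v.

Definition init_state (ini : initial R n p q) : state R n p q := {|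
  s_x := x0 ini; s_y := y0 ini; s_z := z0 ini;
  s_mx := mx0 ini; s_my := my0 ini; s_mz := mz0 ini; s_hx := hx0 ini;
  s_hhat := vmean (mx0 ini); s_smy := vmean (my0 ini); s_smz := vmean (mz0 ini)
|}.

Definition step (par : hyperparams R) (st : state R n p q)
    (phik : 'I_n -> Tphi pb) (xik : 'I_n -> Txi pb)
    (uxk : forall i, seed (Cu i)) (uyk uzk : forall i, seed (Cl i)) :
    state R n p q :=
  let: State x y z mx my mz hx hhat smy smz := st in
  let Dx i := dir_x x y z (phik i) (xik i) in
  let Dy i := dir_y x y (xik i) in
  let Dz i := dir_z x y z (phik i) (xik i) in
  let hx' i := (1 - theta par) *: hx i + theta par *: Dx i in
  let cx i := cmap (hx' i - mx i) (uxk i) in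
  let cy i := cmap (Dy i - my i) (uyk i) in
  let cz i := cmap (Dz i - mz i) (uzk i) in
  let Dyhat := smy + vmean cy in
  let Dzhat := smz + vmean cz in
  {| s_x := x - alpha par *: hhat;
     s_y := y - beta par *: Dyhat;
     s_z := clip (rho par) (z - gamma par *: Dzhat);
     s_mx := fun i => mx i + delta_u par *: cx i;
     s_my := fun i => my i + delta_l par *: cy i;
     s_mz := fun i => mz i + delta_l par *: cz i;
     s_hx := hx';
     s_hhat := hhat + delta_u par *: vmean cx;
     s_smy := smy + delta_l par *: vmean cy;
     s_smz := smz + delta_l par *: vmean cz |}.

Fixpoint efsoba (rd : randomness) (par : hyperparams R)
    (ini : initial R n p q) (k : nat) (w : Om rd) : state R n p q :=
  if k is k'.+1 then
    step par (efsoba par ini k' w)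
      (fun i => phi rd k' i w) (fun i => xi rd k' i w)
      (fun i => ux rd k' i w) (fun i => uy rd k' i w) (fun i => uz rd k' i w)
  else init_state ini.

Definition avg_sq_grad (rd : randomness) (par : hyperparams R)
    (ini : initial R n p q) (K : nat) : \bar R :=
  ((K%:R^-1)%:E * \sum_(0 <= k < K)
     'E_(Pr rd)[fun w =>
       (enorm (grad (Phi pb) (s_x (efsoba par ini k w))) ^+ 2)%R])%E.

Definition mean_Dx0 (rd : randomness) (ini : initial R n p q) (i : 'I_n) :=
  mean_vec (Pr rd) (fun w =>
    dir_x (x0 ini) (y0 ini) (z0 ini) (phi rd 0 i w) (xi rd 0 i w)).

Definition mean_Dy0 (rd : randomness) (ini : initial R n p q) (i : 'I_n) :=
  mean_vec (Pr rd) (fun w => dir_y (x0 ini) (y0 ini) (xi rd 0 i w)).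

Definition mean_Dz0 (rd : randomness) (ini : initial R n p q) (i : 'I_n) :=
  mean_vec (Pr rd) (fun w =>
    dir_z (x0 ini) (y0 ini) (z0 ini) (phi rd 0 i w) (xi rd 0 i w)).

Definition Delta_Phi (ini : initial R n p q) : R := Phi pb (x0 ini).

Definition Delta_x (ini : initial R n p q) : R :=
  enorm (vmean (hx0 ini) - grad (Phi pb) (x0 ini)) ^+ 2.

Definition Delta_h (rd : randomness) (ini : initial R n p q) : R :=
  n%:R^-1 * \sum_(i < n) enorm (hx0 ini i - mean_Dx0 rd ini i) ^+ 2.

Definition Delta_y (ini : initial R n p q) : R :=
  enorm (y0 ini - ystar pb (x0 ini)) ^+ 2.

Definition Delta_z (ini : initial R n p q) : R :=
  enorm (z0 ini - zstar pb (x0 ini)) ^+ 2.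

Definition Delta_my (rd : randomness) (ini : initial R n p q) : R :=
  n%:R^-1 * \sum_(i < n) enorm (mean_Dy0 rd ini i - my0 ini i) ^+ 2.

Definition Delta_mz (rd : randomness) (ini : initial R n p q) : R :=
  n%:R^-1 * \sum_(i < n) enorm (mean_Dz0 rd ini i - mz0 ini i) ^+ 2.

Definition Delta_max (rd : randomness) (ini : initial R n p q) : R :=
  Num.max (Delta_Phi ini) (Num.max (Delta_x ini) (Num.max (Delta_h rd ini)
    (Num.max (Delta_y ini) (Num.max (Delta_z ini)
      (Num.max (Delta_my rd ini) (Delta_mz rd ini)))))).

Definition efsoba_setting (rd : randomness) (c : constants R)
    (par : hyperparams R) (ini : initial R n p q)
    (sigma omega_u omega_l : R) : Prop :=
  [/\ regular_losses pb,
      continuity_assumption pb c,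
      strong_convexity_assumption pb c,
      noise_assumption pb sigma &
      derived_lipschitz pb c] /\
  [/\ (forall i, omega_unbiased omega_u (Cu i)),
      (forall i, omega_unbiased omega_l (Cl i)) &
      fresh_randomness rd] /\
  [/\ 0 < alpha par, 0 < beta par, 0 < gamma par & 0 < theta par] /\
  [/\ 0 < rho par, 0 < delta_u par, 0 < delta_l par &
      enorm (z0 ini) <= rho par].

End Algorithm.

(* An upper bound a / 0 is no constraint. *)
Definition quot_oo {R : realType} (a b : R) : \bar R :=
  if b == 0 then +oo%E else (a / b)%:E.

Section Constants.
Context {R : realType} (c : constants R) (par : hyperparams R).

Definition kappa_g : R := L_g c / mu_g c.
Definition L1sq : R := L_f c ^+ 2 + L_gyy c ^+ 2 * rho par ^+ 2.
Definition L2sq : R := L_f c ^+ 2 + L_gxy c ^+ 2 * rho par ^+ 2.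
Definition L3sq : R := L_g c ^+ 2 * (1 + 3 * L_ystar c ^+ 2).
Definition L4sq : R :=
  L1sq * (1 + 3 * L_ystar c ^+ 2) + 3 * L_g c ^+ 2 * L_zstar c ^+ 2.
Definition L5sq : R :=
  L2sq * (1 + 3 * L_ystar c ^+ 2) + 3 * L_g c ^+ 2 * L_zstar c ^+ 2.
Definition sigma1sq (sigma : R) : R := sigma ^+ 2 * (1 + rho par ^+ 2).
Definition omega1 (omega_l : R) : R := 1 + 6 * omega_l * (1 + omega_l).
Definition omega2 (omega_u : R) : R := 1 + 36 * omega_u * (1 + omega_u).

Definition C3 (n : nat) (omega_u omega_l : R) : R :=
  (Num.sqrt (2 *
    (4 * L_Phi c ^+ 2 / theta par ^+ 2
     + 72 * omega_u * (1 + omega_u) * L5sq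
     + 12 * omega2 omega_u * (L2sq + 25 * kappa_g ^+ 2 * L1sq) *
         (4 * L_ystar c ^+ 2 / (beta par ^+ 2 * mu_g c ^+ 2)
          + 16 * omega_l * omega1 omega_l * L3sq * beta par / (mu_g c * n%:R))
     + 12 * omega2 omega_u * L_g c ^+ 2 *
         (12 * L_zstar c ^+ 2 / (gamma par ^+ 2 * mu_g c ^+ 2)
          + 72 * omega_l * omega1 omega_l * L4sq * gamma par
              / (mu_g c * n%:R)))))^-1.

End Constants.

(* Main.v *)
(* Let s_i^k be the inexactness that worker i's momentum inherits from y^j, z^j
   with j < k: s_i^(k+1) = (1 - theta) s_i^k + theta (E D_x,i^k - D*_x,i(x^k)),
   where D*_x,i(x) is the expected direction at (x, y*(x), z*(x)). The errors of
   h_x,i^k are measured against D*_x,i(x^k) + s_i^k, so that each of them, and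
   likewise y^k - y*(x^k), z^k - z*(x^k) and the errors of the memories, obeys a
   one-step recursion: samples and seeds are independent of the past, so the
   past may be frozen when taking expectations, and the distinct workers' noises
   are orthogonal, whence the factors 1/n. A weighted sum of these errors and of
   Phi(x^k) decreases, up to noise, by the squared gradient norm.

   The start s^0 is free. With s^0 = 0 one gets the explicit bound. With s_i^0
   the inexactness of (y^0, z^0), the initial momentum error is Delta_h^0 alone,
   and the prescribed beta, gamma, theta balance each initial error against the
   matching noise term, which gives the order. *)
Require Import Defs.
From HB Require Import structures.
From mathcomp Require Import all_boot all_order all_algebra.
From mathcomp Require Import all_classical all_reals all_analysis.
From mathcomp Require Import measurable_realfun ring lra.

Set Implicit Arguments.
Unset Strict Implicit.
Unset Printing Implicit Defensive.

Import Order.TTheory GRing.Theory Num.Theory.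
Import numFieldNormedType.Exports.

Local Open Scope classical_set_scope.
Local Open Scope ring_scope.

(** * Euclidean and spectral norms *)

(** The order is not a corollary of the explicit bound. There [omega2], of size (1 + omega_u)^2,
    multiplies Delta_y / (K beta), and the prescribed 1 / beta is at least (mu_g + L_g) / 2, so a
    term (1 + omega_u)^2 Delta / K would remain where the order allows only (1 + omega_u) Delta / K.
    Both claims are therefore drawn from one sharper inequality, whose weights for the errors of y
    and z are free of omega_u.

    The lag s makes this possible. Compression amplifies the momentum error of each worker by a
    factor of order omega_u (1 + omega_u). Once s is subtracted, that error no longer feels the
    inexactness of y and z. The lag itself enters the memory error with coefficient 1 / (1 +
    omega_u), which cancels the weight 4 (1 + omega_u) of that error.

    In the order, omega_u then comes only from alpha, theta and the initial memory error. Starting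
    the lag at 0 would put the inexactness of (y^0, z^0) into the amplified error, with a weight of
    order omega_u^2 theta that the prescribed theta need not balance. *)

Section Euclid.
Context {R : realType}.

Definition dot {d : nat} (u v : 'cV[R]_d) : R := (u^T *m v) 0 0.

Section Dim.
Context {d : nat}.
Implicit Types u v w : 'cV[R]_d.

Lemma dotE u v : dot u v = \sum_j u j 0 * v j 0.
Proof. by rewrite /dot mxE; apply: eq_bigr => j _; rewrite mxE. Qed.

Lemma dotC u v : dot u v = dot v u.
Proof. by rewrite !dotE; apply: eq_bigr => j _; rewrite mulrC. Qed.

Lemma dotDr u v w : dot u (v + w) = dot u v + dot u w.
Proof. by rewrite /dot mulmxDr mxE. Qed.

Lemma dotDl u v w : dot (v + w) u = dot v u + dot w u.
Proof. by rewrite dotC dotDr !(dotC u). Qed.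

Lemma dotZr a u v : dot u (a *: v) = a * dot u v.
Proof. by rewrite /dot -scalemxAr mxE. Qed.

Lemma dotZl a u v : dot (a *: u) v = a * dot u v.
Proof. by rewrite dotC dotZr dotC. Qed.

Lemma dotNr u v : dot u (- v) = - dot u v.
Proof. by rewrite -scaleN1r dotZr mulN1r. Qed.

Lemma dotNl u v : dot (- u) v = - dot u v.
Proof. by rewrite dotC dotNr dotC. Qed.

Lemma dotBr u v w : dot u (v - w) = dot u v - dot u w.
Proof. by rewrite dotDr dotNr. Qed.

Lemma dotBl u v w : dot (v - w) u = dot v u - dot w u.
Proof. by rewrite dotDl dotNl. Qed.

Lemma dot0r u : dot u 0 = 0. Proof. by rewrite -(scale0r 0) dotZr mul0r. Qed.

Lemma dot0l u : dot 0 u = 0. Proof. by rewrite dotC dot0r. Qed.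

Lemma dot_sumr I (r : seq I) u (v : I -> 'cV[R]_d) :
  dot u (\sum_(i <- r) v i) = \sum_(i <- r) dot u (v i).
Proof.
elim: r => [|i r IH]; first by rewrite !big_nil dot0r.
by rewrite !big_cons dotDr IH.
Qed.

Lemma enorm_ge0 u : 0 <= enorm u. Proof. exact: sqrtr_ge0. Qed.

Lemma enorm_sqr u : enorm u ^+ 2 = dot u u.
Proof.
rewrite /enorm sqr_sqrtr; last by apply: sumr_ge0 => j _; exact: sqr_ge0.
by rewrite dotE; apply: eq_bigr => j _; rewrite expr2.
Qed.

Lemma enormE u : enorm u = Num.sqrt (dot u u).
Proof. by rewrite -enorm_sqr sqrtr_sqr ger0_norm // enorm_ge0. Qed.

Lemma enorm_eq0 u : enorm u = 0 -> u = 0.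
Proof.
move=> u0; have : dot u u = 0 by rewrite -enorm_sqr u0 expr0n.
rewrite dotE => /eqP; rewrite psumr_eq0 => [|j _]; last by rewrite -expr2 sqr_ge0.
move=> /allP H; apply/matrixP => i j; rewrite ord1 mxE.
by have := H i (mem_index_enum _); rewrite implyTb mulf_eq0 orbb => /eqP.
Qed.

Lemma enorm0 : enorm (0 : 'cV[R]_d) = 0.
Proof. by rewrite enormE dot0r sqrtr0. Qed.

Lemma enormZ a u : enorm (a *: u) = `|a| * enorm u.
Proof.
by rewrite !enormE dotZl dotZr mulrA -expr2 sqrtrM ?sqr_ge0 // sqrtr_sqr.
Qed.

Lemma enormN u : enorm (- u) = enorm u.
Proof. by rewrite !enormE dotNl dotNr opprK. Qed.

Lemma enormBC u v : enorm (u - v) = enorm (v - u).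
Proof. by rewrite -opprB enormN. Qed.

Lemma enorm_sqrD u v : enorm (u + v) ^+ 2 = enorm u ^+ 2 + 2 * dot u v + enorm v ^+ 2.
Proof. by rewrite !enorm_sqr !(dotDl, dotDr) (dotC v u); ring. Qed.

Lemma enorm_sqrB u v : enorm (u - v) ^+ 2 = enorm u ^+ 2 - 2 * dot u v + enorm v ^+ 2.
Proof. by rewrite enorm_sqrD dotNr enormN; ring. Qed.

Lemma enorm_sqrZ a u : enorm (a *: u) ^+ 2 = a ^+ 2 * enorm u ^+ 2.
Proof. by rewrite enormZ exprMn real_normK // num_real. Qed.

Lemma cauchy_schwarz u v : dot u v <= enorm u * enorm v.
Proof.
have [v0|v0] := eqVneq (enorm v) 0.
  by rewrite v0 (enorm_eq0 v0) dot0r mulr0.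
have vp : 0 < enorm v by rewrite lt_neqAle eq_sym v0 enorm_ge0.
have [u0|u0] := eqVneq (enorm u) 0.
  by rewrite u0 (enorm_eq0 u0) dot0l mul0r.
have up : 0 < enorm u by rewrite lt_neqAle eq_sym u0 enorm_ge0.
have := sqr_ge0 (enorm ((enorm v) *: u - (enorm u) *: v)).
rewrite enorm_sqrB !enorm_sqrZ dotZl dotZr => H.
have : 2 * (enorm u * enorm v) * dot u v <= 2 * (enorm u * enorm v) * (enorm u * enorm v) by nra.
by rewrite ler_pM2l // !mulr_gt0.
Qed.

Lemma enormD u v : enorm (u + v) <= enorm u + enorm v.
Proof.
rewrite -(@ler_pXn2r _ 2) ?nnegrE ?addr_ge0 ?enorm_ge0 // enorm_sqrD.
by have := cauchy_schwarz u v; nra.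
Qed.

Lemma enormB u v : enorm (u - v) <= enorm u + enorm v.
Proof. by rewrite -(enormN v); exact: enormD. Qed.

Lemma young u v c : 0 < c ->
  enorm (u + v) ^+ 2 <= (1 + c) * enorm u ^+ 2 + (1 + c^-1) * enorm v ^+ 2.
Proof.
move=> c0; rewrite enorm_sqrD.
have := sqr_ge0 (enorm (c *: u - v)); rewrite enorm_sqrB enorm_sqrZ dotZl => H.
have : 2 * dot u v <= c * enorm u ^+ 2 + c^-1 * enorm v ^+ 2.
  rewrite -(ler_pM2l c0).
  by rewrite [leRHS](_ : _ = c ^+ 2 * enorm u ^+ 2 + enorm v ^+ 2); [nra|field; rewrite gt_eqF].
by nra.
Qed.

Lemma enorm_convex t u v : 0 <= t <= 1 ->
  enorm ((1 - t) *: u + t *: v) ^+ 2 <= (1 - t) * enorm u ^+ 2 + t * enorm v ^+ 2.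
Proof.
move=> /andP[t0 t1]; rewrite enorm_sqrD !enorm_sqrZ dotZl dotZr.
have := sqr_ge0 (enorm (u - v)); rewrite enorm_sqrB => H.
have : 0 <= t * (1 - t) by rewrite mulr_ge0 // subr_ge0.
by nra.
Qed.

Lemma enorm_sqrD2 u v : enorm (u + v) ^+ 2 <= 2 * enorm u ^+ 2 + 2 * enorm v ^+ 2.
Proof. by have := young u v ltr01; rewrite invr1; nra. Qed.

Lemma enorm_ler (u : 'cV[R]_d) b : 0 <= b -> enorm u ^+ 2 <= b ^+ 2 -> enorm u <= b.
Proof. by move=> b0; rewrite ler_pXn2r // nnegrE ?enorm_ge0. Qed.

Lemma enorm_delta j : enorm (delta_mx j 0 : 'cV[R]_d) = 1.
Proof.
rewrite enormE dotE (bigD1 j) //= !mxE eqxx /= mulr1 big1 ?addr0 ?sqrtr1 // => i ij.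
by rewrite !mxE (negbTE ij) mul0r.
Qed.

Lemma dot_delta u j : dot u (delta_mx j 0) = u j 0.
Proof.
rewrite dotE (bigD1 j) //= !mxE !eqxx /= mulr1 big1 ?addr0 // => i ij.
by rewrite !mxE (negbTE ij) mulr0.
Qed.

Lemma coord_enorm u j : `|u j 0| <= enorm u.
Proof.
rewrite -sqrtr_sqr /enorm ler_sqrt ?sumr_ge0 // => [|i _]; last exact: sqr_ge0.
by rewrite (bigD1 j) //= lerDl sumr_ge0 // => i _; exact: sqr_ge0.
Qed.

Lemma vec_sum_delta u : u = \sum_j u j 0 *: delta_mx j 0.
Proof.
by rewrite [LHS]matrix_sum_delta; apply: eq_bigr => i _; rewrite big_ord1.
Qed.

Lemma enorm_sum I (r : seq I) (v : I -> 'cV[R]_d) :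
  enorm (\sum_(i <- r) v i) <= \sum_(i <- r) enorm (v i).
Proof.
elim/big_rec2: _ => [|i y x _ H]; first by rewrite enorm0.
by apply: le_trans (enormD _ _) _; rewrite lerD2l.
Qed.

Lemma enorm_le_sum u : enorm u <= \sum_j `|u j 0|.
Proof.
rewrite {1}(vec_sum_delta u); apply: le_trans (enorm_sum _ _) _.
by apply: ler_sum => j _; rewrite enormZ enorm_delta mulr1.
Qed.

Lemma enorm_sqrD3 u v w :
  enorm (u + v + w) ^+ 2 <= 3 * (enorm u ^+ 2 + enorm v ^+ 2 + enorm w ^+ 2).
Proof.
rewrite -addrA; apply: le_trans (young u (v + w) (ltr0Sn _ 1)) _.
by have := enorm_sqrD2 v w; lra.
Qed.

Lemma vmean_enorm_sqr n (v : 'I_n -> 'cV[R]_d) :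
  enorm (vmean v) ^+ 2 <= n%:R^-1 * \sum_i enorm (v i) ^+ 2.
Proof.
(* For [n = 0] the convention that the inverse of 0 is 0 makes both sides vanish. *)
case: n v => [|n] v; first by rewrite /vmean invr0 scale0r enorm0 mul0r expr0n.
have n0 : (n.+1%:R : R) != 0 by rewrite pnatr_eq0.
(* The squared deviations from the mean add up to n times the gap of the claim. *)
have : 0 <= \sum_i enorm (v i - vmean v) ^+ 2 by apply: sumr_ge0 => i _; exact: sqr_ge0.
have -> : \sum_i enorm (v i - vmean v) ^+ 2 =
    \sum_i enorm (v i) ^+ 2 - n.+1%:R * enorm (vmean v) ^+ 2.
  under eq_bigr do rewrite enorm_sqrB.
  rewrite big_split sumrB /= -mulr_sumr.
  have -> : \sum_i dot (v i) (vmean v) = n.+1%:R * enorm (vmean v) ^+ 2.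
    under eq_bigr do rewrite dotC.
    rewrite -dot_sumr enorm_sqr {3}/vmean dotZr mulrA divff // mul1r.
    by [].
  by rewrite sumr_const card_ord -mulr_natl; ring.
by rewrite subr_ge0 ler_pdivlMl // ltr0n.
Qed.

End Dim.

Section Dims.
Context {a b : nat}.
Implicit Types A : 'M[R]_(a, b).

Lemma dot_mulmxl A (u : 'cV[R]_a) v : dot u (A *m v) = dot (A^T *m u) v.
Proof. by rewrite /dot trmx_mul trmxK mulmxA. Qed.

(** Test against w = A^T u itself: its squared norm is the product of u with A w. Difference
    quotients of a gradient produce transposed Hessian blocks; this lemma transfers their bounds to
    the blocks themselves, so symmetry of second derivatives never enters. *)
Lemma bounded_trmx A c : 0 <= c -> (forall v, enorm (A *m v) <= c * enorm v) ->
  forall u, enorm (A^T *m u) <= c * enorm u.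
Proof.
move=> c0 H u; set w := A^T *m u.
have [w0|w0] := eqVneq (enorm w) 0; first by rewrite w0 mulr_ge0 // enorm_ge0.
have wp : 0 < enorm w by rewrite lt_neqAle eq_sym w0 enorm_ge0.
rewrite -(ler_pM2r wp) -expr2 enorm_sqr -dot_mulmxl.
apply: le_trans (cauchy_schwarz _ _) _.
by rewrite mulrAC [leRHS]mulrC; apply: ler_wpM2l; [exact: enorm_ge0|exact: H].
Qed.

(** A crude constant suffices. It keeps the set in [opnorm] bounded above, so that its [sup] is a
    genuine supremum, and it preserves a small remainder under an inverse matrix in
    [implicit_derive]. *)
Lemma mulmx_bounded A : exists2 M, 0 <= M & forall v, enorm (A *m v) <= M * enorm v.
Proof.
exists (\sum_i \sum_j `|A i j|).
  by apply: sumr_ge0 => i _; apply: sumr_ge0.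
move=> v; apply: le_trans (enorm_le_sum _) _; rewrite mulr_suml.
apply: ler_sum => i _; rewrite mxE mulr_suml; apply: le_trans (ler_norm_sum _ _ _) _.
by apply: ler_sum => j _; rewrite normrM ler_wpM2l // coord_enorm.
Qed.

Lemma enorm_mulmx A v : enorm (A *m v) <= opnorm A * enorm v.
Proof.
have [v0|v0] := eqVneq (enorm v) 0.
  by rewrite (enorm_eq0 v0) mulmx0 !enorm0 mulr0.
have vp : 0 < enorm v by rewrite lt_neqAle eq_sym v0 enorm_ge0.
rewrite -ler_pdivrMr //.
have -> : enorm (A *m v) / enorm v = enorm (A *m ((enorm v)^-1 *: v)).
  by rewrite -scalemxAr enormZ ger0_norm ?invr_ge0 ?enorm_ge0 // mulrC.
apply: sup_ubound.
  have [M M0 HM] := mulmx_bounded A.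
  exists M => _ [w /= w1 <-]; apply: le_trans (HM w) _.
  by rewrite -[leRHS]mulr1 ler_wpM2l.
exists ((enorm v)^-1 *: v) => //=.
by rewrite enormZ ger0_norm ?invr_ge0 ?enorm_ge0 // mulVf.
Qed.

Lemma opnorm_ge0 A : 0 <= opnorm A.
Proof.
apply: sup_ubound.
  have [M M0 HM] := mulmx_bounded A.
  exists M => _ [w /= w1 <-]; apply: le_trans (HM w) _.
  by rewrite -[leRHS]mulr1 ler_wpM2l.
by exists 0; rewrite /= ?enorm0 ?ler01 // mulmx0 enorm0.
Qed.

End Dims.

(** Cauchy-Schwarz turns coercivity into mu |v| <= |A v|, which gives injectivity, hence
    invertibility of a square matrix, and the bound on the inverse at the same time. *)
Lemma coercive_inv d (A : 'M[R]_d) mu : 0 < mu ->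
  (forall v, mu * enorm v ^+ 2 <= dot v (A *m v)) ->
  A \in unitmx /\ forall v, enorm (invmx A *m v) <= mu^-1 * enorm v.
Proof.
move=> mu0 H.
have below v : mu * enorm v <= enorm (A *m v).
  have [v0|v0] := eqVneq (enorm v) 0; first by rewrite v0 mulr0 enorm_ge0.
  have vp : 0 < enorm v by rewrite lt_neqAle eq_sym v0 enorm_ge0.
  rewrite -(ler_pM2r vp) -mulrA -expr2; apply: le_trans (H v) _.
  by rewrite mulrC; apply: le_trans (cauchy_schwarz _ _) _; rewrite mulrC.
have uA : A \in unitmx.
  (* A row of the left kernel of A^T, once transposed, is a vector annihilated by A. *)
  rewrite -unitmx_tr -row_free_unit -kermx_eq0; apply/eqP/row_matrixP => i.
  rewrite row0; apply: trmx_inj; rewrite trmx0; apply: enorm_eq0.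
  apply/eqP; rewrite eq_le enorm_ge0 andbT -(ler_pM2l mu0) mulr0.
  apply: le_trans (below _) _.
  have /(congr1 trmx) : row i (kermx A^T) *m A^T = 0.
    by apply/sub_kermxP; rewrite row_sub.
  by rewrite trmx_mul trmxK trmx0 => ->; rewrite enorm0.
split=> // v; rewrite -(ler_pM2l mu0) mulrA divff ?gt_eqF // mul1r.
by apply: le_trans (below _) _; rewrite mulmxA mulmxV // mul1mx.
Qed.

Lemma clip_le (r : R) d (v : 'cV[R]_d) : 0 < r -> enorm (clip r v) <= r.
Proof.
move=> r0; rewrite /clip enormZ.
have [v0|v0] := eqVneq (enorm v) 0; first by rewrite v0 mulr0 ltW.
have vp : 0 < enorm v by rewrite lt_neqAle eq_sym v0 enorm_ge0.
rewrite ger0_norm; last by rewrite le_min ler01 divr_ge0 // ltW.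
by rewrite -ler_pdivlMr // ge_min lexx orbT.
Qed.

(** With t = r / |v| < 1, the difference of the two sides is (1 - t)^2 |v|^2 + 2 (1 - t) (t |v|^2 -
    <v, z>), and <v, z> <= r |v| = t |v|^2 because z lies in the ball. *)
Lemma clip_nonexpansive (r : R) d (v z : 'cV[R]_d) : 0 < r -> enorm z <= r ->
  enorm (clip r v - z) ^+ 2 <= enorm (v - z) ^+ 2.
Proof.
move=> r0 zr; rewrite /clip.
have [v0|v0] := eqVneq (enorm v) 0; first by rewrite (enorm_eq0 v0) scaler0.
have vp : 0 < enorm v by rewrite lt_neqAle eq_sym v0 enorm_ge0.
have [rv|vr] := leP 1 (r / enorm v); first by rewrite scale1r.
set t := r / enorm v in vr *.
have tv : t * enorm v = r by rewrite /t mulfVK.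
have t0 : 0 <= t by rewrite divr_ge0 // ltW.
rewrite !enorm_sqrB enorm_sqrZ dotZl.
have vz : dot v z <= t * enorm v ^+ 2.
  apply: le_trans (cauchy_schwarz _ _) _.
  by rewrite expr2 mulrCA tv ler_wpM2l // enorm_ge0.
have : 0 <= (1 - t) * (t * enorm v ^+ 2 - dot v z).
  by rewrite mulr_ge0 // subr_ge0 // ltW.
have : 0 <= (1 - t) ^+ 2 * enorm v ^+ 2 by rewrite mulr_ge0 ?sqr_ge0.
by nra.
Qed.

Lemma enorm_col_mx p q (u : 'cV[R]_p) (v : 'cV[R]_q) :
  enorm (col_mx u v) ^+ 2 = enorm u ^+ 2 + enorm v ^+ 2.
Proof.
rewrite !enorm_sqr !dotE big_split_ord /=.
by congr (_ + _); apply: eq_bigr => i _; rewrite ?col_mxEu ?col_mxEd.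
Qed.

End Euclid.

(** * Independence and random vectors *)

Section Independence.
Context {d : measure_display} {O : measurableType d} {R : realType}
  (P : probability O R) {I : choiceType} (E : I -> set (set O)).
Hypothesis E_meas : forall i, E i `<=` measurable.
Hypothesis E_I : forall i, setI_closed (E i).
Hypothesis E_T : forall i, E i setT.
Hypothesis E_indep : mutually_independent P E.

(** The carrier is still O: a function on O is declared to depend only on the sources in J by
    changing the type of its domain and nothing else. *)
Definition sub_sigma (J : set I) : measurableType (\bigcup_(j in J) E j).-sigma :=
  g_sigma_algebraType (\bigcup_(j in J) E j).

(** A pi-system generating [sub_sigma J]. The family F is total, with an event of E at every index,
    so that two cylinders can be intersected after completing each with [setT]. *)
Definition cylinders (J : set I) : set (set O) :=
  [set A | exists (s : seq I) (F : I -> set O), [/\ uniq s,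
    (forall i, i \in s -> J i), (forall i, E i (F i)) & A = \bigcap_(i in [set` s]) F i]].

Lemma cylinders_setI J : setI_closed (cylinders J).
Proof.
move=> _ _ [s [F [us sJ EF ->]]] [t [G [ut tJ EG ->]]].
exists (undup (s ++ t)).
exists (fun i => (if i \in s then F i else setT) `&` (if i \in t then G i else setT)).
split => //; first exact: undup_uniq.
- by move=> i; rewrite mem_undup mem_cat => /orP[/sJ|/tJ].
- by move=> i; apply: E_I; case: ifP.
- apply/seteqP; split => w /=.
    by move=> [Fw Gw] i; rewrite /= mem_undup mem_cat => _; split; case: ifPn => // it;
      [exact: Fw|exact: Gw].
  move=> H; split => i /= it; have := H i; rewrite /= mem_undup mem_cat it ?orbT /=.
    by move=> /(_ isT) [].
  by move=> /(_ isT) [_].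
Qed.

Lemma cylinders_indep J1 J2 A B : J1 `&` J2 = set0 ->
  cylinders J1 A -> cylinders J2 B -> P (A `&` B) = (P A * P B)%E.
Proof.
move=> J12 [s [F [us sJ EF ->]]] [t [G [ut tJ EG ->]]].
pose H i := if i \in s then F i else G i.
have st i : i \in t -> i \notin s.
  move=> it; apply/negP => is_; suff: (J1 `&` J2) i by rewrite J12.
  by split; [exact: sJ|exact: tJ].
have EH i : E i (H i) by rewrite /H; case: ifP.
have -> : \bigcap_(i in [set` s]) F i `&` \bigcap_(i in [set` t]) G i =
    \bigcap_(i in [set` s ++ t]) H i.
  apply/seteqP; split => w /=.
    move=> [Fw Gw] i; rewrite /= mem_cat /H; case: ifPn => [is_ _|nis /= it].
      exact: Fw.
    exact: Gw.
  move=> Hw; split => i /= ii; have := Hw i; rewrite /= mem_cat ii ?orbT => /(_ isT).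
    by rewrite /H ii.
  by rewrite /H (negbTE (st _ ii)).
have ust : uniq (s ++ t).
  rewrite cat_uniq us ut andbT /=; apply/hasPn => i it; exact: st.
rewrite !E_indep // big_cat /= EFinM; congr (_%:E * _%:E)%E.
  by apply: eq_big_seq => i is_; rewrite /H is_.
by apply: eq_big_seq => i it; rewrite /H (negbTE (st _ it)).
Qed.

Lemma cylinders_meas J : cylinders J `<=` measurable.
Proof.
move=> _ [s [F [us sJ EF ->]]].
rewrite bigcap_seq; apply: bigsetI_measurable => i _; exact: E_meas.
Qed.

Lemma sub_sigma_cylinders J (A : set O) :
  measurable (A : set (sub_sigma J)) -> <<s cylinders J >> A.
Proof.
apply: smallest_sub; first exact: smallest_sigma_algebra.
move=> B [j Jj EB]; apply: sub_sigma_algebra.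
exists [:: j]; exists (fun i => if i == j then B else setT); split => //.
- by move=> i; rewrite inE => /eqP ->.
- by move=> i; case: eqP => [->|_].
- apply/seteqP; split => w /=; last by move/(_ j); rewrite /= mem_head eqxx; exact.
  by move=> Bw i /=; rewrite inE => /eqP ->; rewrite eqxx.
Qed.

Lemma sub_sigma_meas J (A : set O) :
  measurable (A : set (sub_sigma J)) -> measurable A.
Proof.
apply: smallest_sub; first exact: sigma_algebra_measurable.
by move=> B [j Jj EB]; apply: (E_meas EB).
Qed.

Lemma measurable_sub_sigma J d' (T : measurableType d') (f : sub_sigma J -> T) :
  measurable_fun setT f -> measurable_fun setT (f : O -> T).
Proof. by move=> mf _ B mB; apply: (@sub_sigma_meas J); exact: mf. Qed.

Lemma sub_sigma_mono J J' d' (T : measurableType d') (f : O -> T) : J `<=` J' ->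
  measurable_fun setT (f : sub_sigma J -> T) ->
  measurable_fun setT (f : sub_sigma J' -> T).
Proof.
move=> JJ' mf _ B mB; have := mf measurableT B mB.
by apply: sub_sigma_algebra2 => C [j Jj Cj]; exists j => //; exact: JJ'.
Qed.

(** Dynkin's argument, run once for each factor: independence of cylinders is first extended from
    J1-cylinders to all J1-events against a fixed J2-cylinder, then from J2-cylinders to all
    J2-events. *)
Lemma sub_sigma_indep J1 J2 (A B : set O) : J1 `&` J2 = set0 ->
  measurable (A : set (sub_sigma J1)) -> measurable (B : set (sub_sigma J2)) ->
  P (A `&` B) = (P A * P B)%E.
Proof.
move=> J12 /sub_sigma_cylinders sA /sub_sigma_cylinders sB.
have cT J : cylinders J setT.
  by exists [::]; exists (fun=> setT); split => //; apply/seteqP; split.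
have key (J : set I) (C : set O) (mC : measurable C) :
  (forall D, cylinders J D -> P (D `&` C) = (P D * P C)%E) ->
  forall D, <<s cylinders J >> D -> P (D `&` C) = (P D * P C)%E.
  move=> H D sD.
  have PC0 : 0 <= fine (P C) by rewrite fine_ge0.
  have mD : measurable D.
    move: D sD; apply: smallest_sub; first exact: sigma_algebra_measurable.
    exact: cylinders_meas.
  (* The two finite measures compared are D |-> P (D /\ C) and D |-> P D * P C. *)
  have := @g_sigma_algebra_measure_unique _ R O (cylinders J) (@cylinders_meas J)
    (fun=> setT) (fun=> cT J) _ (mrestr P mC) (mscale (NngNum PC0) P)
    (@cylinders_setI J) _ _ D sD.
  have scE X : mscale (NngNum PC0) P X = (P X * P C)%E.
    by rewrite -[LHS]/((fine (P C))%:E * P X)%E fineK ?fin_num_measure // muleC.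
  rewrite -[P (D `&` C)]/(mrestr P mC D) => ->; first exact: scE.
  - by apply/seteqP; split => // w _; exists 0%N.
  - by move=> A' /H HA; exact: etrans HA (esym (scE A')).
  - have PT : (P (setT `&` C) < +oo)%E.
      by rewrite setTI; exact: le_lt_trans (probability_le1 _ mC) (ltry _).
    by move=> k; exact: PT.
have mB : measurable B.
  move: B sB; apply: smallest_sub; first exact: sigma_algebra_measurable.
  exact: cylinders_meas.
apply: (key J1) => // A' cA'.
rewrite setIC [RHS]muleC.
apply: (key J2) => //; first exact: cylinders_meas cA'.
move=> B' cB'; rewrite setIC muleC; exact: (cylinders_indep J12).
Qed.

(** Under the diagonal map w |-> (w, w) the image of P on the product of the two sub-sigma-algebras
    is a product measure, by independence; Tonelli then integrates the second argument with the
    first one frozen. This plays the part of conditional expectation in the whole development. *)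
Lemma freeze2 J1 J2 (f : sub_sigma J1 * sub_sigma J2 -> \bar R) : J1 `&` J2 = set0 ->
  measurable_fun [set: sub_sigma J1 * sub_sigma J2] f -> (forall u, 0 <= f u)%E ->
  (\int[P]_w f (w, w) = \int[P]_w \int[P]_v f (w, v))%E.
Proof.
move=> J12 mf f0.
have mid J : measurable_fun setT (fun w : O => w : sub_sigma J).
  by move=> _ B mB; rewrite setTI; apply: sub_sigma_meas mB.
have md : measurable_fun setT (fun w : O => (w : sub_sigma J1, w : sub_sigma J2)).
  by apply: measurable_fun_pair.
pose m1 := isMeasurableFun.Build _ _ _ _ _ (mid J1).
pose f1 : {mfun O >-> sub_sigma J1} := HB.pack (fun w : O => w : sub_sigma J1) m1.
pose m2 := isMeasurableFun.Build _ _ _ _ _ (mid J2).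
pose f2 : {mfun O >-> sub_sigma J2} := HB.pack (fun w : O => w : sub_sigma J2) m2.
pose m12 := isMeasurableFun.Build _ _ _ _ _ md.
pose f12 : {mfun O >-> (sub_sigma J1 * sub_sigma J2)%type} :=
  HB.pack (fun w : O => (w : sub_sigma J1, w : sub_sigma J2)) m12.
have E12 : forall X : set (sub_sigma J1 * sub_sigma J2), measurable X ->
    (distribution P f1 \x distribution P f2)%E X = distribution P f12 X.
  apply: product_measure_unique => A B mA mB.
  exact: (sub_sigma_indep J12).
rewrite -[LHS](@ge0_integral_distribution _ _ _ _ _ P f12 f) //.
rewrite -(eq_measure_integral (distribution P f12) (m1 := (distribution P f1 \x distribution P f2)%E)); last by move=> A mA _; exact: E12.
rewrite fubini_tonelli1 //.
rewrite (@ge0_integral_distribution _ _ _ _ _ P f1) //; last 2 first.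
- exact: measurable_fun_fubini_tonelli_F.
- by move=> x; apply: integral_ge0.
apply: eq_integral => w _ /=; rewrite /fubini_F (@ge0_integral_distribution _ _ _ _ _ P f2) //.
exact: measurableT_comp.
Qed.

Lemma sub_sigma_id J J' : J `<=` J' ->
  measurable_fun [set: sub_sigma J'] (id : sub_sigma J' -> sub_sigma J).
Proof.
move=> JJ' _ B mB; rewrite setTI.
by move: mB; apply: sub_sigma_algebra2 => C [j Jj Cj]; exists j => //; exact: JJ'.
Qed.

Lemma sub_sigma_ambient J : measurable_fun [set: O] (id : O -> sub_sigma J).
Proof. by move=> _ B mB; rewrite setTI; exact: sub_sigma_meas mB. Qed.

Lemma measurable_partial_integral J d1 (T : measurableType d1)
    (f : T * sub_sigma J -> \bar R) :
  measurable_fun [set: T * sub_sigma J] f -> (forall u, 0 <= f u)%E ->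
  measurable_fun [set: T] (fun u => \int[P]_v f (u, v))%E.
Proof.
move=> mf f0.
pose m2 := isMeasurableFun.Build _ _ _ _ _ (@sub_sigma_ambient J).
pose f2 : {mfun O >-> sub_sigma J} := HB.pack (id : O -> sub_sigma J) m2.
rewrite (_ : (fun u => _) = fubini_F (distribution P f2) f).
  exact: measurable_fun_fubini_tonelli_F.
apply/funext => u; rewrite /fubini_F (@ge0_integral_distribution _ _ _ _ _ P f2) //.
exact: measurableT_comp.
Qed.

End Independence.

(* Coordinatewise, which avoids choosing a sigma-algebra on the type of vectors. *)
Definition mvec {d} {T : measurableType d} {R : realType} {a b}
    (f : T -> 'M[R]_(a, b)) := forall i j, measurable_fun setT (fun t => f t i j).

Section Mvec.
Context {d : measure_display} {T : measurableType d} {R : realType}.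

Lemma mvecD a b (f g : T -> 'M[R]_(a, b)) : mvec f -> mvec g -> mvec (fun t => f t + g t).
Proof.
move=> mf mg i j; under eq_fun do rewrite mxE.
exact: measurable_funD.
Qed.

Lemma mvecZ a b (h : T -> R) (f : T -> 'M[R]_(a, b)) : measurable_fun setT h -> mvec f ->
  mvec (fun t => h t *: f t).
Proof.
move=> mh mf i j; under eq_fun do rewrite mxE.
exact: measurable_funM.
Qed.

Lemma mvec_cst a b (M : 'M[R]_(a, b)) : mvec (fun _ : T => M).
Proof. by move=> i j; exact: measurable_cst. Qed.

Lemma mvecN a b (f : T -> 'M[R]_(a, b)) : mvec f -> mvec (fun t => - f t).
Proof.
move=> mf i j; under eq_fun do rewrite mxE.
exact: measurableT_comp.
Qed.

Lemma mvecB a b (f g : T -> 'M[R]_(a, b)) : mvec f -> mvec g -> mvec (fun t => f t - g t).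
Proof. by move=> mf mg; apply: mvecD => //; exact: mvecN. Qed.

Lemma mvec_sum a b (I : Type) (r : seq I) (f : I -> T -> 'M[R]_(a, b)) :
  (forall i, mvec (f i)) -> mvec (fun t => \sum_(i <- r) f i t).
Proof.
move=> mf i j; under eq_fun do rewrite summxE.
by apply: measurable_sum => k; exact: mf.
Qed.

Lemma mvec_sum_seq a b (I : eqType) (r : seq I) (f : I -> T -> 'M[R]_(a, b)) :
  (forall i, i \in r -> mvec (f i)) -> mvec (fun t => \sum_(i <- r) f i t).
Proof.
elim: r => [|k r IH] mf.
  by under eq_fun do rewrite big_nil; exact: mvec_cst.
under eq_fun do rewrite big_cons.
apply: mvecD; first by apply: mf; exact: mem_head.
by apply: IH => i ir; apply: mf; rewrite inE ir orbT.
Qed.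

Lemma mvecM a b c (f : T -> 'M[R]_(a, b)) (g : T -> 'M[R]_(b, c)) : mvec f -> mvec g ->
  mvec (fun t => f t *m g t).
Proof.
move=> mf mg i j; under eq_fun do rewrite mxE.
by apply: measurable_sum => k; apply: measurable_funM.
Qed.

Lemma mvec_vmean n a (f : 'I_n -> T -> 'cV[R]_a) : (forall i, mvec (f i)) ->
  mvec (fun t => vmean (f^~ t)).
Proof. by move=> mf; apply: mvecZ => //; exact: mvec_sum. Qed.

Lemma measurable_enorm a (f : T -> 'cV[R]_a) : mvec f ->
  measurable_fun setT (fun t => enorm (f t)).
Proof.
move=> mf; rewrite /enorm; apply: (@measurableT_comp _ _ _ _ _ _ (@Num.sqrt R)).
  apply: continuous_measurable_fun; exact: sqrt_continuous.
by apply: measurable_sum => j; apply: measurable_funX.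
Qed.

Lemma measurable_enorm2 a (f : T -> 'cV[R]_a) : mvec f ->
  measurable_fun setT (fun t => enorm (f t) ^+ 2).
Proof. by move=> mf; apply: measurable_funX; exact: measurable_enorm. Qed.

Lemma mvec_clip a r (f : T -> 'cV[R]_a) : mvec f -> mvec (fun t => clip r (f t)).
Proof.
move=> mf; apply: mvecZ => //; apply: measurable_minr => //.
apply: measurable_funM => //.
under eq_fun do rewrite -powR_inv1 ?sqrtr_ge0 //.
apply: (measurableT_comp (measurable_powR _)); exact: measurable_enorm.
Qed.

Lemma mvec_comp d' (T' : measurableType d') a b (f : T -> 'M[R]_(a, b)) (h : T' -> T) :
  mvec f -> measurable_fun setT h -> mvec (f \o h).
Proof. by move=> mf mh i j; exact: measurableT_comp (mf i j) mh. Qed.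

End Mvec.

Section RandomVectors.
Context {d : measure_display} {T : measurableType d} {R : realType} (P : probability T R).

(* Unlike [ge0_le_integral], no measurability is required. *)
Lemma le_integral_ge0 (f g : T -> \bar R) : (forall t, 0 <= f t)%E ->
  (forall t, f t <= g t)%E -> (\int[P]_t f t <= \int[P]_t g t)%E.
Proof.
move=> f0 fg; have g0 t : (0 <= g t)%E by exact: le_trans (f0 t) (fg t).
rewrite !ge0_integralTE //; apply: ub_ereal_sup => _ [h /= hf <-].
by apply: ereal_sup_ubound; exists h => //= t; exact: le_trans (hf t) (fg t).
Qed.

Lemma integral_prob_cst (c : R) : (\int[P]_t c%:E = c%:E)%E.
Proof. by rewrite integral_cst // [X in (_ * X)%E]probability_setT mule1. Qed.

Lemma unbiased_mvec a b (X : T -> 'M[R]_(a, b)) M : unbiased P X M -> mvec X.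
Proof.
by move=> H i j; have [/integrableP[mX _] _] := H i j; exact/measurable_EFinP.
Qed.

Lemma unbiasedD a b (X Y : T -> 'M[R]_(a, b)) M N : unbiased P X M -> unbiased P Y N ->
  unbiased P (fun t => X t + Y t) (M + N).
Proof.
move=> HX HY i j; have [iX eX] := HX i j; have [iY eY] := HY i j.
have E t : ((X t + Y t) i j)%:E = ((X t i j)%:E + (Y t i j)%:E)%E by rewrite mxE.
split.
  apply: eq_integrable (integrableD _ iX iY) => // t _; exact/esym/E.
by rewrite (eq_integral _ _ (fun t _ => E t)) integralD // eX eY mxE.
Qed.

Lemma unbiasedMr a b c (X : T -> 'M[R]_(a, b)) M (z : 'M[R]_(b, c)) : unbiased P X M ->
  unbiased P (fun t => X t *m z) (M *m z).
Proof.
move=> HX i j.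
have E t : ((X t *m z) i j)%:E = (\sum_k (z k j)%:E * (X t i k)%:E)%E.
  by rewrite mxE sumEFin; congr EFin; apply: eq_bigr => k _; rewrite mulrC.
have iX k : P.-integrable setT (fun t => (z k j)%:E * (X t i k)%:E)%E.
  by apply: integrableZl => //; have [] := HX i k.
split.
  apply: eq_integrable (integrable_sum _ _ (fun k _ => iX k)) => // t _; exact/esym/E.
rewrite (eq_integral _ _ (fun t _ => E t)) integral_sum //.
rewrite mxE -sumEFin; apply: eq_bigr => k _; have [iXk eXk] := HX i k.
by rewrite integralZl // eXk -EFinM mulrC.
Qed.

Lemma integral_dot n (X : T -> 'cV[R]_n) M (u : 'cV[R]_n) : unbiased P X M ->
  P.-integrable setT (fun t => (dot u (X t))%:E) /\
  (\int[P]_t (dot u (X t))%:E = (dot u M)%:E)%E.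
Proof.
move=> HX.
have E t : (dot u (X t))%:E = (\sum_k (u k 0)%:E * (X t k 0)%:E)%E.
  by rewrite dotE -sumEFin.
have iX k : P.-integrable setT (fun t => (u k 0)%:E * (X t k 0)%:E)%E.
  by apply: integrableZl => //; have [] := HX k 0.
split.
  apply: eq_integrable (integrable_sum _ _ (fun k _ => iX k)) => // t _; exact/esym/E.
rewrite (eq_integral _ _ (fun t _ => E t)) integral_sum //.
rewrite dotE -sumEFin; apply: eq_bigr => k _; have [iXk eXk] := HX k 0.
by rewrite integralZl // eXk.
Qed.

(** Unbiasedness kills the cross term around the mean. The bound s does double duty: it limits the
    variance and makes the square integrable, which is needed to split the integral. *)
Lemma bias_variance n (X : T -> 'cV[R]_n) M s (a : 'cV[R]_n) c :
  unbiased P X M -> mse_le P enorm X M s ->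
  (\int[P]_t (enorm (a + c *: X t) ^+ 2)%:E <= (enorm (a + c *: M) ^+ 2 + c ^+ 2 * s)%:E)%E.
Proof.
move=> HX sX; set A := a + c *: M.
have mXM : measurable_fun setT (fun t => enorm (X t - M) ^+ 2).
  by apply: measurable_enorm2; apply: mvecB (unbiased_mvec HX) (mvec_cst _).
have [iu eu] := integral_dot ((2 * c) *: A) HX.
have E t : (enorm (a + c *: X t) ^+ 2)%:E =
    ((enorm A ^+ 2 - dot ((2 * c) *: A) M)%:E + (dot ((2 * c) *: A) (X t))%:E +
     (c ^+ 2)%:E * (enorm (X t - M) ^+ 2)%:E)%E.
  rewrite -EFinM -!EFinD; congr EFin.
  have -> : a + c *: X t = A + c *: (X t - M) by rewrite /A -addrA -scalerDr (addrC M) subrK.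
  by rewrite enorm_sqrD enorm_sqrZ !dotZl !dotZr dotBr; ring.
rewrite (eq_integral _ _ (fun t _ => E t)).
have i3 : P.-integrable setT (fun t => (c ^+ 2)%:E * (enorm (X t - M) ^+ 2)%:E)%E.
  apply: integrableZl => //; apply/integrableP; split; first exact/measurable_EFinP.
  apply: le_lt_trans (ltry s); apply: le_trans sX; apply: le_integral_ge0 => t //.
  by rewrite abse_EFin ger0_norm ?sqr_ge0.
have i1 : P.-integrable setT (EFin \o (fun=> enorm A ^+ 2 - dot ((2 * c) *: A) M)).
  exact: finite_measure_integrable_cst.
rewrite integralD //; last exact: integrableD.
rewrite integralD // integral_prob_cst eu -EFinD subrK.
rewrite EFinD leeD2l // integralZl //; last first.
  apply/integrableP; split; first exact/measurable_EFinP.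
  apply: le_lt_trans (ltry s); apply: le_trans sX; apply: le_integral_ge0 => t //.
  by rewrite abse_EFin ger0_norm ?sqr_ge0.
by rewrite [(c ^+ 2 * s)%:E]EFinM; apply: lee_wpmul2l => //; rewrite lee_fin sqr_ge0.
Qed.

End RandomVectors.

Section Law.
Context {d : measure_display} {O : measurableType d} {R : realType} (P : probability O R).
Context {d' : measure_display} {T : measurableType d'} (D : probability T R) (X : O -> T).
Hypothesis lX : has_law P X D.

Lemma has_law_ge0_integral (f : T -> \bar R) : measurable_fun setT f ->
  (forall t, 0 <= f t)%E -> (\int[P]_w f (X w) = \int[D]_t f t)%E.
Proof.
move=> mf f0; have [mX eX] := lX.
rewrite -[LHS](@ge0_integral_pushforward _ _ _ _ R X mX P setT f) //.
by apply: eq_measure_integral => A mA _; exact: eX.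
Qed.

Lemma has_law_unbiased a b (Z : T -> 'M[R]_(a, b)) M : unbiased D Z M ->
  unbiased P (fun w => Z (X w)) M.
Proof.
move=> HZ i j; have [iZ eZ] := HZ i j; have [mX eX] := lX.
have mZ : measurable_fun setT (fun t => (Z t i j)%:E) by case/integrableP: iZ.
have iZX : P.-integrable (X @^-1` setT) ((fun t => (Z t i j)%:E) \o X).
  rewrite preimage_setT; apply/integrableP; split; first exact: measurableT_comp mZ mX.
  have /integrableP[_] := iZ; congr (_ < _)%E; apply/esym.
  by apply: (has_law_ge0_integral (f := fun t => `|(Z t i j)%:E|%E)) => //; exact: measurableT_comp.
split; first by rewrite preimage_setT in iZX.
rewrite -eZ -[LHS](@integral_pushforward _ _ _ _ R X mX P setT _ mZ) //.
by apply: eq_measure_integral => A mA _; exact: eX.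
Qed.

Lemma has_law_mse_le a (Z : T -> 'cV[R]_a) M s : mvec Z -> mse_le D enorm Z M s ->
  mse_le P enorm (fun w => Z (X w)) M s.
Proof.
move=> mZ; rewrite /mse_le -(has_law_ge0_integral (f := fun t => (enorm (Z t - M) ^+ 2)%:E)) //.
  by apply/measurable_EFinP; apply: measurable_enorm2; apply: mvecB => //; exact: mvec_cst.
by move=> t; rewrite lee_fin sqr_ge0.
Qed.

End Law.

Section IndependentSums.
Context {d : measure_display} {O : measurableType d} {R : realType}
  (P : probability O R) {I : choiceType} (E : I -> set (set O)).
Hypothesis E_meas : forall i, E i `<=` measurable.
Hypothesis E_I : forall i, setI_closed (E i).
Hypothesis E_T : forall i, E i setT.
Hypothesis E_indep : mutually_independent P E.

(* The summands are integrated out one at a time, the others being frozen. *)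
Lemma indep_sum_variance n m (X : 'I_n -> O -> 'cV[R]_m) (M : 'I_n -> 'cV[R]_m) s
    (J : 'I_n -> set I) (r : seq 'I_n) a c :
  uniq r -> (forall i j, i != j -> J i `&` J j = set0) ->
  (forall i, @mvec _ (sub_sigma E (J i)) R _ _ (X i)) ->
  (forall i, unbiased P (X i) (M i)) -> (forall i, mse_le P enorm (X i) (M i) (s i)) ->
  (\int[P]_w (enorm (a + c *: \sum_(i <- r) X i w) ^+ 2)%:E <=
    (enorm (a + c *: \sum_(i <- r) M i) ^+ 2 + c ^+ 2 * \sum_(i <- r) s i)%:E)%E.
Proof.
move=> + dJ mX uX sX; elim: r a => [|i r IH] a.
  by move=> _; under eq_integral do rewrite big_nil; rewrite !big_nil mulr0 addr0 integral_prob_cst.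
move=> /andP[ir ur].
pose J' := \bigcup_(k in [set` r]) J k.
have dJ' : J' `&` J i = set0.
  apply/seteqP; split => // x [[k /= kr Jk] Ji].
  have ki : k != i by apply: contraNneq ir => <-.
  by have : (J k `&` J i) x by []; rewrite (dJ _ _ ki).
pose f (u : sub_sigma E J' * sub_sigma E (J i)) :=
  (enorm ((a + c *: \sum_(k <- r) X k u.1) + c *: X i u.2) ^+ 2)%:E.
have mXJ k : k \in r -> @mvec _ (sub_sigma E J') R _ _ (X k).
  move=> kr i' j'; apply: (sub_sigma_mono (J := J k)); last exact: mX.
  by move=> x Jx; exists k.
have mS : @mvec _ (sub_sigma E J') R _ _ (fun w => \sum_(k <- r) X k w).
  exact: mvec_sum_seq.
have mf : measurable_fun setT f.
  apply/measurable_EFinP; apply: measurable_enorm2; apply: mvecD; last first.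
    by apply: mvecZ => //; exact: (mvec_comp (mX i) measurable_snd).
  apply: mvecD; first exact: mvec_cst.
  by apply: mvecZ => //; exact: (mvec_comp mS measurable_fst).
have f0 u : (0 <= f u)%E by rewrite lee_fin sqr_ge0.
have E1 w : (enorm (a + c *: \sum_(k <- i :: r) X k w) ^+ 2)%:E = f (w, w).
  by rewrite /f big_cons scalerDr addrA addrAC.
rewrite (eq_integral _ _ (fun w _ => E1 w)) (freeze2 E_meas E_I E_T E_indep dJ' mf f0).
(* With the other summands frozen, integrating out [X i] replaces it by [M i] and costs
   [c ^+ 2 * s i]. The induction hypothesis is then used at the shifted constant a + c M_i, whence
   the generalisation over [a]. *)
apply: (@le_trans _ _ (\int[P]_w ((enorm ((a + c *: M i) + c *: \sum_(k <- r) X k w) ^+ 2)%:E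
    + (c ^+ 2 * s i)%:E))%E).
  apply: le_integral_ge0 => w; first exact: integral_ge0.
  rewrite (addrAC a) -EFinD.
  exact: (bias_variance (a + c *: \sum_(k <- r) X k w) c (uX i) (sX i)).
have s0 : 0 <= s i.
  rewrite -lee_fin; apply: le_trans (sX i); apply: integral_ge0 => w _.
  by rewrite lee_fin sqr_ge0.
have mS' : measurable_fun [set: O] (fun w => enorm ((a + c *: M i) + c *: \sum_(k <- r) X k w) ^+ 2).
  apply: (measurable_sub_sigma E_meas (J := J')); apply: measurable_enorm2.
  by apply: mvecD; [exact: mvec_cst|exact: mvecZ].
rewrite ge0_integralD //=; last 3 first.
- by move=> w _; rewrite lee_fin sqr_ge0.
- exact/measurable_EFinP.
- by move=> w _; rewrite lee_fin mulr_ge0 ?sqr_ge0.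
rewrite integral_prob_cst !big_cons scalerDr addrA.
apply: le_trans (leeD2r _ (IH _ ur)) _.
by rewrite -EFinD lee_fin; lra.
Qed.

End IndependentSums.

(** * Strong convexity and hypergradients *)

Section Calculus.
Context {R : realType}.

Section Partial.
Context {p q : nat} (h : 'cV[R]_p -> 'cV[R]_q -> R).
Hypothesis dh : differentiable2 h.
Let H (w : 'cV[R]_p * 'cV[R]_q) := h w.1 w.2.

Lemma partial_x x y u : derivable (h^~ y) x u /\ 'D_u (h^~ y) x = 'd H (x, y) (u, 0).
Proof.
have E : (fun t : R => t^-1 *: (((h^~ y) \o shift x) (t *: u) - h x y)) =
    (fun t : R => t^-1 *: ((H \o shift (x, y)) (t *: (u, 0)) - H (x, y))).
  by apply/funext => t; rewrite /H /= scaler0 add0r.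
split.
  by rewrite /derivable E; exact: (diff_derivable (v := (u, 0)) (dh (x, y))).
by rewrite -(deriveE _ (dh (x, y))) /derive E.
Qed.

Lemma partial_y x y u : derivable (h x) y u /\ 'D_u (h x) y = 'd H (x, y) (0, u).
Proof.
have E : (fun t : R => t^-1 *: (((h x) \o shift y) (t *: u) - h x y)) =
    (fun t : R => t^-1 *: ((H \o shift (x, y)) (t *: (0, u)) - H (x, y))).
  by apply/funext => t; rewrite /H /= scaler0 add0r.
split.
  by rewrite /derivable E; exact: (diff_derivable (v := (0, u)) (dh (x, y))).
by rewrite -(deriveE _ (dh (x, y))) /derive E.
Qed.

Lemma diff2E x y u v : 'd H (x, y) (u, v) = dot (gradx h x y) u + dot (grady h x y) v.
Proof.
have -> : (u, v) = (u, 0) + (0, v).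
  by rewrite -[RHS]/(u + 0, 0 + v) addr0 add0r.
rewrite linearD; congr (_ + _).
  have -> : (u, 0 : 'cV[R]_q) = \sum_j u j 0 *: (delta_mx j 0, 0).
    rewrite {1}(vec_sum_delta u); elim/big_rec2: _ => // j a b _ <-.
    by rewrite -[RHS]/(_ + _, u j 0 *: 0 + 0) scaler0 addr0.
  rewrite linear_sum dotE; apply: eq_bigr => j _.
  rewrite linearZ -(partial_x x y (delta_mx j 0)).2 /= mulrC.
  by rewrite /gradx mxE.
have -> : (0 : 'cV[R]_p, v) = \sum_j v j 0 *: (0, delta_mx j 0).
  rewrite {1}(vec_sum_delta v); elim/big_rec2: _ => // j a b _ <-.
  by rewrite -[RHS]/(v j 0 *: 0 + 0, _ + _) scaler0 addr0.
rewrite linear_sum dotE; apply: eq_bigr => j _.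
rewrite linearZ -(partial_y x y (delta_mx j 0)).2 /= mulrC.
by rewrite /grady mxE.
Qed.

Lemma is_derive_curve (X : R -> 'cV[R]_p) (Y : R -> 'cV[R]_q) (t : R) u v :
  is_derive t (1 : R) X u -> is_derive t (1 : R) Y v ->
  is_derive t (1 : R) (fun s => h (X s) (Y s))
    (dot (gradx h (X t) (Y t)) u + dot (grady h (X t) (Y t)) v).
Proof.
move=> [dX eX] [dY eY].
have /derivable1_diffP dX' := dX; have /derivable1_diffP dY' := dY.
have dXY : differentiable (fun s => (X s, Y s)) t by exact: differentiable_pair.
have dc : differentiable (H \o (fun s => (X s, Y s))) t by exact: differentiable_comp.
apply: DeriveDef; first exact/derivable1_diffP.
rewrite -[LHS]/('D_1 (H \o (fun s => (X s, Y s))) t) (deriveE _ dc).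
rewrite (diff_comp dXY (dh _)) /= (diff_pair dX' dY').
by rewrite diff2E -(deriveE _ dX') -(deriveE _ dY') eX eY.
Qed.

End Partial.

Lemma is_derive_line d (x u : 'cV[R]_d) (t : R) : is_derive t (1 : R) (fun s : R => x + s *: u) u.
Proof.
apply: DeriveDef.
  by apply/derivable1_diffP; apply: differentiableD.
rewrite /derive; apply/cvg_lim => //.
apply: cvg_near_cst; near=> s => /=.
rewrite opprD addrACA subrr add0r -scalerBl addrK scalerA mulrC.
have s0 : s != 0 by near: s; exact: nbhs_dnbhs_neq.
by rewrite [_%:A]mulr1 divff // scale1r.
Unshelve. all: by end_near. Qed.

Lemma is_derive_at0 (V : normedModType R) (f : R -> V) (s : R) d :
  is_derive (0 : R) (1 : R) (fun t => f (s + t)) d -> is_derive s (1 : R) f d.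
Proof.
move=> [df ef].
have E : (fun t : R => t^-1 *: ((f \o shift s) (t *: 1) - f s)) =
    (fun t : R => t^-1 *: (((fun t => f (s + t)) \o shift 0) (t *: 1) - f (s + 0))).
  by apply/funext => t /=; rewrite !addr0 (addrC s).
apply: DeriveDef; first by rewrite /derivable E.
by rewrite /derive E.
Qed.

Lemma harmonic_dnbhs : (fun n : nat => n.+1%:R^-1 : R) @ \oo --> (0 : R)^'.
Proof.
move=> A nA; have H : nbhs (0 : R) [set t | t != 0 -> A t] by exact: nA.
have K : \forall n \near \oo, (n.+1%:R^-1 : R) != 0 -> A n.+1%:R^-1.
  exact: (@cvg_harmonic R _ H).
suff : \forall n \near \oo, A (n.+1%:R^-1 : R) by [].
by apply: filterS K => n; apply; rewrite invr_eq0 pnatr_eq0.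
Qed.

(** Derivatives are handled as limits along the steps 1 / (n + 1). Inequalities between difference
    quotients then pass to the limit, and derivatives of measurable functions are measurable as
    limits of sequences. *)
Lemma derive_seq (V : normedModType R) (W : normedModType R) (f : V -> W) a v :
  derivable f a v ->
  (fun n : nat => n.+1%:R *: (f (a + n.+1%:R^-1 *: v) - f a)) @ \oo --> 'D_v f a.
Proof.
move=> df; have : (fun t : R => t^-1 *: ((f \o shift a) (t *: v) - f a)) @ 0^' --> 'D_v f a.
  exact: df.
move=> /(cvg_comp _ _ harmonic_dnbhs); apply: cvg_trans; apply: near_eq_cvg.
by apply: nearW => n /=; rewrite invrK (addrC a).
Qed.

Lemma is_derive_seq (W : normedModType R) (f : R -> W) d : is_derive (0 : R) (1 : R) f d ->
  (fun n : nat => n.+1%:R *: (f (n.+1%:R^-1) - f 0)) @ \oo --> d.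
Proof.
move=> [df <-]; have := derive_seq df; apply: cvg_trans; apply: near_eq_cvg.
by apply: nearW => n /=; rewrite add0r [_%:A]mulr1.
Qed.

Lemma seq_lim_le (a : R^nat) l C K : a @ \oo --> l ->
  (forall n, a n <= C + K * n.+1%:R^-1) -> l <= C.
Proof.
move=> al aC.
have b : (fun n => C + K * n.+1%:R^-1) @ \oo --> C.
  rewrite -[X in _ --> X](addr0 C) -[X in _ + X](mulr0 K).
  by apply: cvgD; [exact: cvg_cst|apply: cvgMl_tmp; exact: cvg_harmonic].
by apply: (ler_cvg_to al b); apply: nearW.
Qed.

Lemma cvgn_sum (I : Type) (r : seq I) (f : I -> R^nat) (l : I -> R) :
  (forall i, f i @ \oo --> l i) ->
  (fun n => \sum_(i <- r) f i n) @ \oo --> \sum_(i <- r) l i.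
Proof.
move=> fl; elim: r => [|i r IH].
  by under eq_fun do rewrite big_nil; rewrite big_nil; exact: cvg_cst.
by under eq_fun do rewrite big_cons; rewrite big_cons; apply: cvgD => //; exact: fl.
Qed.

(** Convergence of coordinates is enough, since Euclidean quantities are polynomial in them through
    [dot]; the maximum norm of the ambient topology stays out of the estimates. *)
Definition vcvg {a b} (f : nat -> 'M[R]_(a, b)) (l : 'M[R]_(a, b)) :=
  forall i j, (fun n => f n i j) @ \oo --> l i j.

Lemma vcvg_dot d (f : nat -> 'cV[R]_d) l (u : nat -> 'cV[R]_d) m :
  vcvg f l -> vcvg u m -> (fun n => dot (f n) (u n)) @ \oo --> dot l m.
Proof.
move=> fl um; under eq_fun do rewrite dotE; rewrite dotE.
by apply: cvgn_sum => j; apply: cvgM; [exact: fl|exact: um].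
Qed.

Lemma vcvg_cst a b (M : 'M[R]_(a, b)) : vcvg (fun=> M) M.
Proof. by move=> i j; exact: cvg_cst. Qed.

Lemma vcvg_le d (f : nat -> 'cV[R]_d) l c : 0 <= c -> vcvg f l ->
  (forall n, enorm (f n) <= c) -> enorm l <= c.
Proof.
move=> c0 fl fc; apply: enorm_ler => //; rewrite enorm_sqr.
apply: (@seq_lim_le (fun n => dot (f n) (f n)) _ _ 0); first exact: vcvg_dot.
by move=> n; rewrite mul0r addr0 -enorm_sqr ler_pXn2r // nnegrE ?enorm_ge0.
Qed.

Lemma descent d (F : 'cV[R]_d -> R) (G : 'cV[R]_d -> 'cV[R]_d) L :
  (forall x u, is_derive (0 : R) (1 : R) (fun t => F (x + t *: u)) (dot (G x) u)) ->
  lipschitz_cst L G ->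
  forall x u, F (x + u) <= F x + dot (G x) u + L / 2 * enorm u ^+ 2.
Proof.
move=> dF LG x u.
have dline t : is_derive (t : R) (1 : R) (fun s => F (x + s *: u)) (dot (G (x + t *: u)) u).
  apply: is_derive_at0; under eq_fun do rewrite scalerDl addrA.
  exact: dF.
(* F along the segment minus its quadratic majorant. The mean value theorem reduces the claim to the
   derivative being nonpositive, so no integral remainder is needed. *)
pose psi t := F (x + t *: u) - (t * dot (G x) u + t ^+ 2 * (L / 2 * enorm u ^+ 2)).
pose dpsi t := dot (G (x + t *: u)) u - (dot (G x) u + t * (L * enorm u ^+ 2)).
have dpsiE (t : R) : is_derive t (1 : R) psi (dpsi t).
  rewrite /psi; apply: is_derive_eq; rewrite /dpsi.
  by rewrite !scaler1 !scaler0 /GRing.scale /=; field.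
have [] := @MVT R psi dpsi 0 1 ltr01.
  by apply: derivable_within_continuous => t _; exact: ex_derive.
move=> t; rewrite in_itv /= => /andP[t0 t1].
rewrite /psi /dpsi subr0 mulr1 scale1r scale0r addr0 mul1r mul0r expr1n mul1r expr0n /= mul0r addr0 subr0.
suff : dot (G (x + t *: u)) u - (dot (G x) u + t * (L * enorm u ^+ 2)) <= 0 by lra.
rewrite opprD addrA subr_le0 -dotBl.
apply: le_trans (cauchy_schwarz _ _) _.
rewrite expr2 !mulrA ler_wpM2r ?enorm_ge0 //.
apply: le_trans (LG _ _) _.
by rewrite addrAC subrr add0r enormZ gtr0_norm // mulrA (mulrC t).
Qed.

(** Divide the convexity inequality at the weight t = 1 / (n + 1) by t; the surplus mu / 2 * t *
    |u|^2 vanishes in the limit. *)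
Lemma strongly_convex_first_order d (F : 'cV[R]_d -> R) mu x g u : strongly_convex mu F ->
  is_derive (0 : R) (1 : R) (fun t => F (x + t *: u)) (dot g u) ->
  F x + dot g u + mu / 2 * enorm u ^+ 2 <= F (x + u).
Proof.
move=> sF /is_derive_seq dF.
suff : dot g u <= F (x + u) - F x - mu / 2 * enorm u ^+ 2 by lra.
apply: (@seq_lim_le _ _ _ (mu / 2 * enorm u ^+ 2) dF) => n.
set t := n.+1%:R^-1.
have t0 : 0 < t by rewrite invr_gt0.
have t1 : t <= 1 by rewrite invf_le1 // ler1n.
have := sF (x + u) x t; rewrite (ltW t0) t1 => /(_ isT).
have -> : t *: (x + u) + (1 - t) *: x = x + t *: u.
  by apply/matrixP => i j; rewrite !mxE; ring.
rewrite scale0r addr0 (_ : x + u - x = u); last by rewrite addrAC subrr add0r.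
have -> : n.+1%:R = t^-1 by rewrite /t invrK.
move=> H; rewrite -(ler_pM2l t0) [leLHS]mulrA divff ?gt_eqF // mul1r.
by move: H; lra.
Qed.

Section StronglyConvex.
Context {d : nat} (F : 'cV[R]_d -> R) (G : 'cV[R]_d -> 'cV[R]_d) (mu L : R).
Hypothesis dF : forall x u, is_derive (0 : R) (1 : R) (fun t => F (x + t *: u)) (dot (G x) u).
Hypothesis LG : lipschitz_cst L G.
Hypothesis sF : strongly_convex mu F.

(** G minus mu times the identity is the gradient of a convex, (L - mu)-smooth function. The usual
    cocoercivity inequality is the case t = 1 / (L - mu); keeping t free avoids a division that
    fails when L = mu. *)
Lemma cocoercive y y' t (e := G y' - G y - mu *: (y' - y)) :
  (2 * t - (L - mu) * t ^+ 2) * enorm e ^+ 2 <= dot e (y' - y).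
Proof.
(* The first-order lower bound from x and the descent upper bound from x' are compared at the same
   point x' - t f. Adding this to its version with x and x' exchanged eliminates F. *)
have key x x' D f : x' = x + D -> f = G x' - G x - mu *: D ->
    F x + dot (G x) D + mu / 2 * enorm D ^+ 2
      + (t - (L - mu) / 2 * t ^+ 2) * enorm f ^+ 2 <= F x'.
  move=> eD ef.
  have lo := strongly_convex_first_order sF (dF x (D - t *: f)).
  have up := descent dF LG x' (- (t *: f)).
  rewrite addrA -eD in lo; have := le_trans lo up.
  rewrite enorm_sqrB enormN !enorm_sqrZ dotBr dotNr !dotZr.
  have : enorm f ^+ 2 = dot (G x' - G x - mu *: D) f by rewrite -ef enorm_sqr.
  by rewrite !dotBl dotZl => /(congr1 ( *%R t)); lra.
set D := y' - y in e *.
have eD : y' = y + D by rewrite /D addrC subrK.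
have k1 := key y y' D e eD erefl.
have k2 := key y' y (- D) (- e) _ _; rewrite !enormN dotNr in k2.
have -> : dot e D = dot (G y') D - dot (G y) D - mu * enorm D ^+ 2.
  by rewrite /e !dotBl dotZl enorm_sqr.
suff: F y' - dot (G y') D + mu / 2 * enorm D ^+ 2 +
     (t - (L - mu) / 2 * t ^+ 2) * enorm e ^+ 2 <= F y by move: k1; lra.
by apply: k2; [rewrite eD addrK|rewrite /e; apply/matrixP => i j; rewrite !mxE; ring].
Qed.

Lemma strongly_monotone y y' : mu * enorm (y' - y) ^+ 2 <= dot (G y' - G y) (y' - y).
Proof.
have := cocoercive y y' 0.
by rewrite /= expr0n /= !mulr0 subr0 mul0r (dotBl _ (G y' - G y)) dotZl enorm_sqr subr_ge0.
Qed.

(** Compare the lower and upper quadratic bounds along a unit vector. In dimension zero the two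
    hypotheses hold for arbitrary constants, so a positive dimension is essential. *)
Lemma strong_convexity_le_lipschitz : (0 < d)%N -> mu <= L.
Proof.
case: d F G dF LG sF => // d' F' G' dF' LG' sF' _.
pose u : 'cV[R]_d'.+1 := delta_mx 0 0.
have u1 : enorm u = 1 by exact: enorm_delta.
have H1 := descent dF' LG' 0 u; have H2 := strongly_convex_first_order sF' (dF' 0 u).
by move: (le_trans H2 H1); rewrite u1 expr1n; lra.
Qed.

(** Write the difference as a D - b e with a = 1 - b mu and e as in [cocoercive]. After expanding
    the square it remains to see that b |e|^2 <= 2 a <D, e>, which is cocoercivity at t = b / (2 a),
    since b (mu + L) <= 2 means (L - mu) b <= 2 a. *)
Lemma gradient_step_contraction b y y' : 0 < b -> mu <= L -> b * (mu + L) <= 2 ->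
  enorm ((y' - b *: G y') - (y - b *: G y)) <= (1 - b * mu) * enorm (y' - y).
Proof.
move=> b0 muL bL; set D := y' - y; set a := 1 - b * mu.
have a0 : 0 <= a by rewrite /a; nra.
pose e := G y' - G y - mu *: D.
have -> : (y' - b *: G y') - (y - b *: G y) = a *: D - b *: e.
  by rewrite /a /e /D; apply/matrixP => i j; rewrite !mxE; ring.
apply: enorm_ler; first by rewrite mulr_ge0 // enorm_ge0.
rewrite enorm_sqrB !enorm_sqrZ dotZl dotZr exprMn.
have co t : (2 * t - (L - mu) * t ^+ 2) * enorm e ^+ 2 <= dot D e.
  by rewrite dotC; exact: cocoercive.
have s0 := sqr_ge0 (enorm e); move: co s0; set s := enorm e ^+ 2; set v := dot D e => co s0.
suff : b * s <= 2 * a * v by nra.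
(* If a = 0 the step-size condition forces L <= mu, so t may be taken arbitrarily large in
   [cocoercive]. The value t = (|v| + 1) / s then contradicts s > 0. *)
have [az|an] := eqVneq a 0.
  have LM : L - mu <= 0 by rewrite -(pmulr_rle0 _ b0); move: az; rewrite /a; lra.
  rewrite az mulr0 mul0r; have [->|sn] := eqVneq s 0; first by rewrite mulr0.
  have sp : 0 < s by rewrite lt_neqAle eq_sym sn.
  exfalso; have := co ((`|v| + 1) / s).
  have := ler_norm v; set t := (`|v| + 1) / s.
  have ts : t * s = `|v| + 1 by rewrite /t mulfVK.
  have t20 : 0 <= (mu - L) * t ^+ 2 * s
    by apply: mulr_ge0 => //; apply: mulr_ge0; [rewrite subr_ge0 -subr_le0|exact: sqr_ge0].
  by have := normr_ge0 v; nra.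
have ap : 0 < a by rewrite lt_neqAle eq_sym an.
have := co (b / (2 * a)) => H.
have Lb : (L - mu) * b <= 2 * a by rewrite /a; lra.
have : 2 * a * ((2 * (b / (2 * a)) - (L - mu) * (b / (2 * a)) ^+ 2) * s) <= 2 * a * v.
  by rewrite ler_pM2l // mulr_gt0.
apply: le_trans.
rewrite [leRHS](_ : _ = b * s * (2 - (L - mu) * b / (2 * a))); last by field.
have : (L - mu) * b / (2 * a) <= 1 by rewrite ler_pdivrMr ?mul1r // mulr_gt0.
have : 0 <= b * s by rewrite mulr_ge0 // ltW.
by nra.
Qed.

End StronglyConvex.

Lemma lipschitz_derivative d m (A : 'cV[R]_d -> 'cV[R]_m) c y u l : 0 <= c ->
  (forall x x', enorm (A x - A x') <= c * enorm (x - x')) ->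
  vcvg (fun n => n.+1%:R *: (A (y + n.+1%:R^-1 *: u) - A y)) l -> enorm l <= c * enorm u.
Proof.
move=> c0 LA /vcvg_le; apply; first by rewrite mulr_ge0 // enorm_ge0.
move=> n; rewrite enormZ ger0_norm // -ler_pdivlMl //.
apply: le_trans (LA _ _) _.
by rewrite addrAC subrr add0r enormZ ger0_norm ?invr_ge0 // mulrCA.
Qed.

Lemma scaleB_coord d (a : R) (M N : 'cV[R]_d) i :
  (a *: (M - N)) i 0 = a * (M i 0 - N i 0).
Proof. by rewrite !mxE. Qed.

Section TwiceDifferentiable.
Context {p q : nat} (h : 'cV[R]_p -> 'cV[R]_q -> R) (L : R).
Hypothesis dh : twice_differentiable2 h.
Hypothesis L0 : 0 <= L.
Hypothesis Lh : lipschitz_xy enorm L (gradxy h).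

(** The transposes come from the layout of the Hessian blocks: the row index is the direction of
    differentiation, the column index the component of the gradient. *)
Lemma hess_seq x y u v :
  vcvg (fun n : nat => n.+1%:R *: (grady h (x + n.+1%:R^-1 *: u) (y + n.+1%:R^-1 *: v) - grady h x y))
    ((hess_xy h x y)^T *m u + (hess_yy h x y)^T *m v).
Proof.
move=> b j; rewrite (ord1 j).
have := is_derive_curve (dh.2 b) (is_derive_line x u 0) (is_derive_line y v 0).
rewrite !scale0r !addr0 => /is_derive_seq; rewrite !scale0r !addr0.
have -> : dot (gradx (fun x0 y0 => grady h x0 y0 b 0) x y) u +
    dot (grady (fun x0 y0 => grady h x0 y0 b 0) x y) v =
  ((hess_xy h x y)^T *m u + (hess_yy h x y)^T *m v) b 0.
  by rewrite !dotE !mxE; congr (_ + _); apply: eq_bigr => i _; rewrite !mxE.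
by under [X in _ -> X @ _ --> _]eq_fun do rewrite scaleB_coord.
Qed.

Lemma gradient_lipschitz x y x' y' :
  enorm (gradx h x y - gradx h x' y') <= L * enorm (col_mx (x - x') (y - y')) /\
  enorm (grady h x y - grady h x' y') <= L * enorm (col_mx (x - x') (y - y')).
Proof.
have := Lh x y x' y'; rewrite /gradxy opp_col_mx add_col_mx => H.
by split; apply: le_trans H; apply: enorm_ler; rewrite ?enorm_ge0 // enorm_col_mx
  ?lerDl ?lerDr sqr_ge0.
Qed.

Lemma enorm_col_mxl p' (u : 'cV[R]_p') q' : enorm (col_mx u (0 : 'cV[R]_q')) = enorm u.
Proof. by rewrite -[LHS]ger0_norm ?enorm_ge0 // -sqrtr_sqr enorm_col_mx enorm0 expr0n addr0 sqrtr_sqr ger0_norm ?enorm_ge0. Qed.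

Lemma enorm_col_mxr p' (u : 'cV[R]_p') q' : enorm (col_mx (0 : 'cV[R]_q') u) = enorm u.
Proof. by rewrite -[LHS]ger0_norm ?enorm_ge0 // -sqrtr_sqr enorm_col_mx enorm0 expr0n add0r sqrtr_sqr ger0_norm ?enorm_ge0. Qed.

Lemma grady_lipschitz x : lipschitz_cst L (grady h x).
Proof.
by move=> y y'; have := (gradient_lipschitz x y x y').2; rewrite subrr enorm_col_mxr.
Qed.

Lemma hess_xy_bound x y z : enorm (hess_xy h x y *m z) <= L * enorm z.
Proof.
rewrite -[hess_xy h x y]trmxK; apply: bounded_trmx => // u.
apply: (@lipschitz_derivative _ _ (grady h^~ y) L x u) => //.
  by move=> x1 x2; have := (gradient_lipschitz x1 y x2 y).2; rewrite subrr enorm_col_mxl.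
have := @hess_seq x y u 0; rewrite mulmx0 addr0.
by under eq_fun do rewrite scaler0 addr0.
Qed.

Lemma hess_yy_seq x y u :
  vcvg (fun n : nat => n.+1%:R *: (grady h x (y + n.+1%:R^-1 *: u) - grady h x y))
    ((hess_yy h x y)^T *m u).
Proof.
have := @hess_seq x y 0 u; rewrite mulmx0 add0r.
by under eq_fun do rewrite scaler0 addr0.
Qed.

Lemma hess_yy_bound x y z : enorm (hess_yy h x y *m z) <= L * enorm z.
Proof.
rewrite -[hess_yy h x y]trmxK; apply: bounded_trmx => // u.
exact: (lipschitz_derivative L0 (grady_lipschitz x) (@hess_yy_seq x y u)).
Qed.

Lemma is_derive_grady x y u : is_derive (0 : R) (1 : R) (fun t => h x (y + t *: u)) (dot (grady h x y) u).
Proof.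
have := is_derive_curve dh.1 (is_derive_cst x (0 : R) (1 : R)) (is_derive_line y u 0).
by rewrite scale0r addr0 dot0r add0r.
Qed.

Context (mu : R).
Hypothesis mu0 : 0 < mu.
Hypothesis sh : forall x, strongly_convex mu (h x).

(** The limit of strong monotonicity of the gradient between y and y + v / (n + 1). *)
Lemma hess_yy_coercive x y v : mu * enorm v ^+ 2 <= dot v (hess_yy h x y *m v).
Proof.
rewrite dot_mulmxl -subr_le0 dotC.
apply: (@seq_lim_le (fun n => mu * enorm v ^+ 2 -
  dot v (n.+1%:R *: (grady h x (y + n.+1%:R^-1 *: v) - grady h x y))) _ _ 0).
  have H := vcvg_dot (@vcvg_cst _ _ v) (@hess_yy_seq x y v).
  exact: (cvgB (cvg_cst (mu * enorm v ^+ 2)) H).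
move=> n; rewrite mul0r addr0 subr_le0 dotZr.
have := strongly_monotone (is_derive_grady x) (grady_lipschitz x) (@sh x) y (y + n.+1%:R^-1 *: v).
rewrite (_ : y + _ - y = n.+1%:R^-1 *: v); last by rewrite addrAC subrr add0r.
rewrite enorm_sqrZ dotZr dotC => H.
have n0 : (0 : R) < n.+1%:R by [].
rewrite -(ler_pM2l (_ : 0 < n.+1%:R^-1 ^+ 2)); last by rewrite exprn_gt0 // invr_gt0.
apply: le_trans (_ : _ <= n.+1%:R^-1 * dot v (grady h x (y + n.+1%:R^-1 *: v) - grady h x y)) _.
  by move: H; rewrite mulrCA.
by rewrite le_eqVlt; apply/orP; left; apply/eqP; field.
Qed.

Hypothesis muL : mu <= L.

(** The matrix is the transpose of the derivative of the gradient step y |-> y - g * grad, which is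
    already known to be a contraction. The eigenvalues of the Hessian are never considered. *)
Lemma hess_yy_contraction g x y z : 0 < g -> g * (mu + L) <= 2 ->
  enorm (z - g *: (hess_yy h x y *m z)) <= (1 - g * mu) * enorm z.
Proof.
move=> g0 gL.
have c0 : 0 <= 1 - g * mu.
  by have : g * mu <= g * L; [rewrite ler_pM2l|move: gL; rewrite mulrDr; lra].
have -> : z - g *: (hess_yy h x y *m z) = (1%:M - g *: (hess_yy h x y)^T)^T *m z.
  rewrite (_ : _^T = 1%:M - g *: hess_yy h x y); first by rewrite mulmxBl mul1mx -scalemxAl.
  by move: (hess_yy h x y) => M; apply/matrixP => i j; rewrite !mxE eq_sym.
apply: bounded_trmx => // u.
pose T y := y - g *: grady h x y.
apply: (@lipschitz_derivative _ _ T (1 - g * mu) y u) => //.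
  by move=> y1 y2; exact: (gradient_step_contraction (is_derive_grady x) (grady_lipschitz x) (@sh x)).
rewrite mulmxBl mul1mx -scalemxAl => i j; rewrite (ord1 j).
have E n : (n.+1%:R *: (T (y + n.+1%:R^-1 *: u) - T y)) i 0 =
   u i 0 - g * (n.+1%:R *: (grady h x (y + n.+1%:R^-1 *: u) - grady h x y)) i 0.
  rewrite /T; move: (grady h x y) (grady h x _) => a b; rewrite !mxE.
  by field; rewrite addrC natr1 pnatr_eq0.
under eq_fun do rewrite E.
have H := @hess_yy_seq x y u i 0.
have -> : (u - g *: ((hess_yy h x y)^T *m u)) i 0 = u i 0 - g * ((hess_yy h x y)^T *m u) i 0.
  by move: (_ *m u) => a; rewrite !mxE.
exact: (cvgB (cvg_cst (u i 0)) (cvgMl_tmp H)).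
Qed.

Lemma minimizer_grady0 x y : (forall y', h x y <= h x y') -> grady h x y = 0.
Proof.
move=> ymin; apply: enorm_eq0; apply/eqP; rewrite -sqrf_eq0 eq_le sqr_ge0 andbT.
have /is_derive_seq H := is_derive_grady x y (- grady h x y).
rewrite enorm_sqr -oppr_ge0 -dotNr -oppr_le0.
apply: (@seq_lim_le _ _ _ 0 (cvgN H)) => n.
by rewrite mul0r addr0 /= scale0r addr0 oppr_le0 mulr_ge0 // subr_ge0.
Qed.

Lemma minimizer_exists x : exists y, forall y', h x y <= h x y'.
Proof.
(* Beyond this radius the strongly convex lower bound at 0 exceeds h(x, 0): the quadratic term mu /
   2 * |y|^2 dominates |grad| * |y|. *)
pose r := 2 * enorm (grady h x 0) / mu.
have r0 : 0 <= r by rewrite divr_ge0 ?mulr_ge0 ?enorm_ge0 // ltW.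
(* A maximum-norm box of row vectors, which contains the Euclidean ball of radius r; it replaces the
   ball as the compact set on which the minimum is attained. *)
pose A := [set v : 'rV[R]_q | forall i, (`[- r, r]%classic : set R) (v 0 i)].
have cA : compact A by apply: (@rV_compact _ _ (fun=> `[- r, r]%classic)) => _; exact: segment_compact.
have A0 : A !=set0 by exists 0 => i /=; rewrite mxE in_itv /= oppr_le0 r0.
have hc : continuous (h x).
  move=> y.
  have : differentiable ((fun w : 'cV[R]_p * 'cV[R]_q => h w.1 w.2) \o (fun y : 'cV[R]_q => (x, y))) y.
    by apply: differentiable_comp; [exact: differentiable_pair|exact: dh.1].
  exact: differentiable_continuous.
have tc : continuous (fun v : 'rV[R]_q => v^T).
  move=> v B /nbhs_ballP[e e0 eB]; apply/nbhs_ballP; exists e => // w [_ vw].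
  by apply: eB; split => // i j; rewrite !mxE.
have fc : continuous (fun v : 'rV[R]_q => h x v^T).
  by move=> v; apply: (@continuous_comp _ _ _ (fun v : 'rV[R]_q => v^T) (h x)); [exact: tc|exact: hc].
have [v Av vmin] := EVT_min_rV A0 cA (continuous_subspaceT fc).
exists v^T => y'.
have vm0 : h x v^T <= h x 0.
  have := vmin 0; rewrite trmx0; apply.
  by rewrite inE => i /=; rewrite mxE in_itv /= oppr_le0 r0.
have [yr|yr] := leP (enorm y') r.
  rewrite -[y']trmxK; apply: vmin; rewrite inE => i /=; rewrite mxE in_itv /=.
  by rewrite -ler_norml; apply: le_trans (coord_enorm _ _) yr.
apply: le_trans vm0 _.
have := strongly_convex_first_order (@sh x) (is_derive_grady x 0 y').
rewrite add0r; apply: le_trans.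
have := cauchy_schwarz (- grady h x 0) y'; rewrite dotNl enormN => cs.
have mr : mu * r = 2 * enorm (grady h x 0) by rewrite /r mulrC mulfVK ?gt_eqF.
have : 0 <= mu * (enorm y' - r) * enorm y'.
  by rewrite !mulr_ge0 ?enorm_ge0 ?(ltW mu0) // subr_ge0 ltW.
by nra.
Qed.

End TwiceDifferentiable.

End Calculus.

(** * Implicit differentiation of the lower-level solution *)

Section Implicit.
Context {R : realType} {p q : nat}.

Lemma mx_norm_le_enorm d (v : 'cV[R]_d) : `|v| <= enorm v.
Proof.
rewrite /Num.Def.normr /= mx_normrE; apply: bigmax_le; first exact: enorm_ge0.
by move=> [i j] _ /=; rewrite (ord1 j); exact: coord_enorm.
Qed.

Context (h : 'cV[R]_p -> 'cV[R]_q -> R) (ys : 'cV[R]_p -> 'cV[R]_q) (Ly : R).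
Hypothesis dh : twice_differentiable2 h.
Hypothesis Ly0 : 0 <= Ly.
Hypothesis Lys : lipschitz_cst Ly ys.
Hypothesis ys0 : forall x, grady h x (ys x) = 0.
Hypothesis uH : forall x, hess_yy h x (ys x) \in unitmx.

(** Because [ys] is already known to be Lipschitz, no fixed-point argument is required. The
    increment of (x, ys x) along t u has size O(t), the partial gradient vanishes at both of its
    ends, and so its differential there is o(t). *)
Lemma implicit_linearization x u e : 0 < e -> \forall t \near (0 : R)^',
  enorm (t *: ((hess_xy h x (ys x))^T *m u) +
    (hess_yy h x (ys x))^T *m (ys (x + t *: u) - ys x)) <= e * `|t|.
Proof.
move=> e0; set y := ys x.
(* The increment [w t] has norm at most C |t|; the summand 1 keeps C positive when u = 0. *)
pose C := (1 + Ly) * enorm u + 1.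
have C0 : 0 < C by rewrite ltr_wpDl // mulr_ge0 ?enorm_ge0 // addr_ge0.
(* The Euclidean norm is bounded by a sum of q coordinate errors; dividing by q + 1 rather than q
   also covers q = 0. *)
pose e' := e / (C * q.+1%:R).
have e'0 : 0 < e' by rewrite divr_gt0 // mulr_gt0.
pose w t : 'cV[R]_p * 'cV[R]_q := (t *: u, ys (x + t *: u) - y).
have wC t : `|w t| <= C * `|t|.
  rewrite prod_normE ge_max; apply/andP; split.
    apply: le_trans (mx_norm_le_enorm _) _; rewrite enormZ mulrC ler_wpM2r //.
    by rewrite /C; have := mulr_ge0 Ly0 (enorm_ge0 u); have := enorm_ge0 u; lra.
  apply: le_trans (mx_norm_le_enorm _) _; apply: le_trans (Lys _ _) _.
  rewrite addrAC subrr add0r enormZ (mulrC `|t|) mulrA ler_wpM2r //.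
  by rewrite /C; have := mulr_ge0 Ly0 (enorm_ge0 u); have := enorm_ge0 u; lra.
have Gb (b : 'I_q) : \forall t \near (0 : R)^',
    `|(t *: ((hess_xy h x y)^T *m u) + (hess_yy h x y)^T *m (ys (x + t *: u) - y)) b 0|
      <= e' * (C * `|t|).
  pose G (v : 'cV[R]_p * 'cV[R]_q) := grady h v.1 v.2 b 0.
  have := diff_locally (dh.2 b (x, y)); rewrite -/G => /eqaddoP /(_ e' e'0).
  move=> /nbhs_ballP[r /= r0 rH].
  near=> t.
  have tr : C * `|t| < r.
    rewrite -ltr_pdivlMl // mulrC; near: t; apply: dnbhs0_lt.
    by rewrite divr_gt0.
  have /rH : ball (0 : 'cV[R]_p * 'cV[R]_q) r (w t).
    rewrite -ball_normE /= sub0r normrN; exact: le_lt_trans (wC t) tr.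
  rewrite /= => H; apply: le_trans (_ : _ <= e' * `|w t|) _; last by rewrite ler_wpM2l // ltW.
  apply: le_trans H; rewrite le_eqVlt; apply/orP; left; apply/eqP; rewrite -normrN; congr `|_|.
  rewrite -[(G \o _ - _) _]/(G (w t + (x, y)) - (G (x, y) + 'd G (x, y) (w t))).
  have -> : G (w t + (x, y)) = 0.
    by rewrite /G /w /= subrK addrC ys0 mxE.
  have -> : G (x, y) = 0 by rewrite /G /= /y ys0 mxE.
  rewrite sub0r add0r opprK (diff2E (dh.2 b) x y).
  rewrite !dotE !mxE mulr_sumr; congr (_ + _); apply: eq_bigr => i _; rewrite !mxE //.
  by rewrite mulrCA.
have : \forall t \near (0 : R)^', forall b : 'I_q,
    `|(t *: ((hess_xy h x y)^T *m u) + (hess_yy h x y)^T *m (ys (x + t *: u) - y)) b 0|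
      <= e' * (C * `|t|).
  exact: filter_forall.
apply: filterS => t Ht; apply: le_trans (enorm_le_sum _) _.
apply: le_trans (ler_sum _ (fun b _ => Ht b)) _.
rewrite sumr_const card_ord -mulr_natl mulrA mulrA ler_wpM2r //.
have -> : e = e' * (C * q.+1%:R) by rewrite /e' mulfVK // mulf_neq0 ?gt_eqF.
rewrite -mulrA [leLHS]mulrC -!mulrA; apply: ler_wpM2l; first exact: ltW.
apply: ler_wpM2l; first by rewrite invr_ge0 mulr_ge0 // ltW.
by apply: ler_wpM2l; [exact: ltW|rewrite ler_nat].
Unshelve. all: by end_near. Qed.

(** Apply the inverse Hessian to the linearization: it is a bounded map, so the remainder stays o(t)
    and the derivative of [ys] can be read off. *)
Lemma implicit_derive x u : is_derive (0 : R) (1 : R) (fun t => ys (x + t *: u))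
  (- (invmx (hess_yy h x (ys x))^T *m ((hess_xy h x (ys x))^T *m u))).
Proof.
set J := (hess_yy h x (ys x))^T; set v := (hess_xy h x (ys x))^T *m u.
have uJ : J \in unitmx by rewrite unitmx_tr.
have [M M0 HM] := mulmx_bounded (invmx J).
have cv : (fun t : R => t^-1 *: (((fun t => ys (x + t *: u)) \o shift 0) (t *: 1) - ys (x + 0 *: u)))
    @ (0 : R)^' --> - (invmx J *m v).
  apply/cvgrPdist_le => eps eps0.
  have M1 : 0 < M + 1 by rewrite ltr_wpDl.
  have := implicit_linearization x u (divr_gt0 eps0 M1).
  move=> H; near=> t.
  have t0 : t != 0 by near: t; exact: nbhs_dnbhs_neq.
  have : enorm (t *: v + J *m (ys (x + t *: u) - ys x)) <= eps / (M + 1) * `|t|.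
    by near: t; exact: H.
  rewrite /= addr0 [_%:A]mulr1 scale0r addr0; set k := ys (x + t *: u) - ys x => Hk.
  apply: le_trans (mx_norm_le_enorm _) _.
  have -> : - (invmx J *m v) - t^-1 *: k = - (t^-1 *: (invmx J *m (t *: v + J *m k))).
    have -> : invmx J *m (t *: v + J *m k) = t *: (invmx J *m v) + k.
      by rewrite mulmxDr (mulmxA (invmx J) J) mulVmx // mul1mx -(scalemxAr t (invmx J) v).
    move: (invmx J *m v) k {Hk} => a b.
    by apply/matrixP => i j; rewrite !mxE; field.
  rewrite enormN enormZ normfV ler_pdivrMl ?normr_gt0 //.
  apply: le_trans (HM _) _; apply: le_trans (ler_wpM2l M0 Hk) _.
  rewrite mulrA [leRHS]mulrC ler_wpM2r // mulrCA ler_piMr ?(ltW eps0) //.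
  by rewrite ler_pdivrMr // mul1r lerDl.
apply: DeriveDef.
  by apply/cvg_ex; eexists; exact: cv.
by rewrite /derive; apply/cvg_lim.
Unshelve. all: by end_near. Qed.

Context (f : 'cV[R]_p -> 'cV[R]_q -> R).
Hypothesis df : differentiable2 f.

Definition hypergrad x := gradx f x (ys x) -
  hess_xy h x (ys x) *m (invmx (hess_yy h x (ys x)) *m grady f x (ys x)).

Lemma is_derive_hyper x u : is_derive (0 : R) (1 : R) (fun t => f (x + t *: u) (ys (x + t *: u)))
  (dot (hypergrad x) u).
Proof.
have := is_derive_curve df (is_derive_line x u 0) (implicit_derive x u).
(* Moving the matrices to the other side of [dot] undoes the transpositions of [implicit_derive], so
   the untransposed inverse of [hypergrad] appears without any symmetry. *)
rewrite !scale0r !addr0 dotNr !dot_mulmxl !trmxK trmx_inv trmxK.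
by rewrite /hypergrad dotBl.
Qed.

Lemma grad_hyper x : grad (fun x => f x (ys x)) x = hypergrad x.
Proof.
apply/matrixP => j k; rewrite (ord1 k) mxE -dot_delta.
have [_ <-] := is_derive_hyper x (delta_mx j 0).
rewrite /derive.
set a := (fun t : R => t^-1 *: _); set b := (fun t : R => t^-1 *: _).
suff -> : a = b by [].
by apply/funext => t; rewrite /a /b /= !addr0 [_%:A]mulr1 scale0r addr0 (addrC x).
Qed.
End Implicit.

(** * Measurability of the oracles *)

Section Borel.
Context {R : realType}.

(** Boxes with rational centres and radii 1 / (k + 1) form a countable base, so the preimage of an
    open set is a countable union of events on coordinates. *)
Lemma open_rational_box d (A : set 'cV[R]_d) v : open A -> A v ->
  exists (c : 'cV[rat]_d) (k : nat),
    (forall j, `|v j 0 - ratr (c j 0)| < k.+1%:R^-1) /\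
    (forall w : 'cV[R]_d, (forall j, `|w j 0 - ratr (c j 0)| < k.+1%:R^-1) -> A w).
Proof.
move=> oA Av; have /nbhs_ballP[e /= e0 eA] : nbhs v A by exact: open_nbhs_nbhs.
have [k ke] : exists k : nat, k.+1%:R^-1 < e / 2.
  have e20 : 0 < e / 2 by rewrite divr_gt0.
  have [k _ H] := near_infty_natSinv_lt (PosNum e20).
  by exists k; exact: (H k (leqnn k)).
have kp : (0 : R) < k.+1%:R^-1 by rewrite invr_gt0.
have /choice[c cP] : forall j : 'I_d, exists r : rat, `|v j 0 - ratr r| < k.+1%:R^-1.
  move: (k.+1%:R^-1 : R) kp => dl dl0 j; have lt : v j 0 - dl < v j 0 + dl by lra.
  have [r] := rat_in_itvoo lt.
  by rewrite in_itv /= => /andP[r1 r2]; exists r; rewrite ltr_norml; lra.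
exists (\col_j c j), k; split => [j|w Hw]; first by rewrite mxE.
apply: eA; split => // i j; rewrite (ord1 j).
have := Hw i; rewrite mxE => Hi; have := cP i => Hv.
rewrite -ball_normE /=.
have -> : v i 0 - w i 0 = (v i 0 - ratr (c i)) - (w i 0 - ratr (c i)) by ring.
apply: le_lt_trans (ler_normB _ _) _.
by move: (k.+1%:R^-1 : R) ke Hi Hv => dl; lra.
Qed.

Context {dT : measure_display} {T : measurableType dT}.

Lemma mvec_preimage_open d (X : T -> 'cV[R]_d) (A : set 'cV[R]_d) : mvec X -> open A ->
  measurable (X @^-1` A).
Proof.
move=> mX oA.
pose box (ck : 'cV[rat]_d * nat) := [set w : 'cV[R]_d |
  forall j, `|w j 0 - ratr (ck.1 j 0)| < ck.2.+1%:R^-1].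
have mbox ck : measurable (X @^-1` box ck).
  have -> : X @^-1` box ck = \bigcap_(j in [set: 'I_d])
      ((fun t => `|X t j 0 - ratr (ck.1 j 0)|) @^-1` `]-oo, ck.2.+1%:R^-1[%classic).
    by apply/seteqP; split => t H j; [move=> _; have := H j|have := H j Logic.I];
      rewrite /= in_itv.
  apply: fin_bigcap_measurable => // j _.
  rewrite -[X in measurable X]setTI.
  apply: (@measurableT_comp _ _ _ _ _ _ (@Num.norm R R) _ (fun t => X t j 0 - ratr (ck.1 j 0))) => //.
  apply: measurable_funB => //; exact: mX.
have -> : X @^-1` A = \bigcup_n (if unpickle n is Some ck then
    if `[< box ck `<=` A >] then X @^-1` box ck else set0 else set0).
  apply/seteqP; split => t /=.
    move=> At; have [c [k [H1 H2]]] := open_rational_box oA At.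
    exists (pickle (c, k)) => //; rewrite pickleK ifT //.
    by apply/asboolP => w; exact: H2.
  by move=> [n _]; case: unpickle => // ck; case: asboolP => // H; exact: H.
apply: bigcup_measurable => n _; case: unpickle => // ck; case: ifP => // _.
Qed.

Lemma mvec_borel d (X : T -> 'cV[R]_d) : mvec X ->
  measurable_fun setT (X : T -> borel R d).
Proof.
move=> mX; apply: (@measurability _ _ T (borel R d) setT X [set A : set 'cV[R]_d | open A]) => //.
by move=> _ [B oB <-]; rewrite setTI; exact: mvec_preimage_open.
Qed.

Lemma mvec_continuous d (X : T -> 'cV[R]_d) (h : 'cV[R]_d -> R) : mvec X -> continuous h ->
  measurable_fun setT (fun t => h (X t)).
Proof.
move=> mX ch; apply: (measurability _ (RGenOpens.measurableE R)).
move=> _ [_ [a [b ->] <-]]; rewrite setTI.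
apply: (mvec_preimage_open mX (A := h @^-1` `]a, b[%classic)).
by move/continuousP: ch; apply; exact: interval_open.
Qed.

Lemma mvec_lipschitz d m (X : T -> 'cV[R]_d) (h : 'cV[R]_d -> 'cV[R]_m) L : mvec X ->
  lipschitz_cst L h -> mvec (fun t => h (X t)).
Proof.
move=> mX Lh i j; rewrite (ord1 j).
apply: (@mvec_continuous _ _ (fun v => h v i 0) mX).
move=> v B /nbhs_ballP[eps /= eps0 eB].
have L1 : 0 < `|L| + 1 by rewrite ltr_wpDl.
(* The radius is a maximum-norm radius, whereas the Lipschitz bound is Euclidean: the factor d + 1
   converts between the two and is positive even for d = 0. *)
pose dl := eps / 2 / ((`|L| + 1) * d.+1%:R).
have dl0 : 0 < dl by rewrite !divr_gt0 // mulr_gt0.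
apply/nbhs_ballP; exists dl => // w [_ vw].
apply: eB; rewrite -ball_normE /=.
have -> : h v i 0 - h w i 0 = (h v - h w) i 0 by rewrite !mxE.
apply: le_lt_trans (coord_enorm _ _) _; apply: le_lt_trans (Lh _ _) _.
apply: le_lt_trans (_ : _ <= (`|L| + 1) * enorm (v - w)) _.
  by apply: ler_wpM2r; [exact: enorm_ge0|have := ler_norm L; lra].
have : enorm (v - w) <= d.+1%:R * dl.
  apply: le_trans (enorm_le_sum _) _.
  apply: le_trans (_ : _ <= \sum_(k < d) dl) _.
    apply: ler_sum => k _; rewrite !mxE.
    by have := vw k 0; rewrite -ball_normE /= => /ltW.
  rewrite sumr_const card_ord -(mulr_natl dl).
  by apply: ler_wpM2r; [exact: ltW|rewrite ler_nat].
rewrite -(ler_pM2l L1) => H1; apply: le_lt_trans H1 _.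
have -> : (`|L| + 1) * (d.+1%:R * dl) = eps / 2.
  by rewrite /dl; field; rewrite addrC natr1 pnatr_eq0 /= gt_eqF.
by rewrite ltr_pdivrMr // ltr_pMr // ltr1n.
Qed.

End Borel.

Section JointMeasurability.
Context {R : realType} {p q : nat} {dS : measure_display} {S : measurableType dS}.

(* Joint measurability of an oracle, phrased through substitution of measurable
   arguments so that the sigma-algebra on vectors never appears. *)
Definition jmeas (h : S -> 'cV[R]_p -> 'cV[R]_q -> R) :=
  forall (dT : measure_display) (T : measurableType dT) (s : T -> S)
    (X : T -> 'cV[R]_p) (Y : T -> 'cV[R]_q),
    measurable_fun setT s -> mvec X -> mvec Y ->
    measurable_fun setT (fun t => h (s t) (X t) (Y t)).

Lemma borel_jmeas h :
  measurable_fun setT (fun u : borel R p * borel R q * S => h u.2 u.1.1 u.1.2) -> jmeas h.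
Proof.
move=> mh dT T s X Y ms mX mY.
have mf : measurable_fun setT (fun t => ((X t : borel R p), (Y t : borel R q), s t)).
  by apply: measurable_fun_pair => //; apply: measurable_fun_pair; exact: mvec_borel.
exact: (measurableT_comp mh mf).
Qed.

Lemma jmeas_gradx h : jmeas h -> (forall s, differentiable2 (h s)) ->
  forall j, jmeas (fun s x y => gradx (h s) x y j 0).
Proof.
move=> mh dh j dT T s X Y ms mX mY.
pose f n t := n.+1%:R * (h (s t) (X t + n.+1%:R^-1 *: delta_mx j 0) (Y t) - h (s t) (X t) (Y t)).
apply: (@measurable_fun_cvg _ _ _ setT f) => [n|t _].
  apply: measurable_funM => //; apply: measurable_funB; apply: mh => //.
  by apply: mvecD => //; exact: mvec_cst.
have [dd _] := partial_x (dh (s t)) (X t) (Y t) (delta_mx j 0).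
by have := derive_seq dd; rewrite mxE.
Qed.

Lemma jmeas_grady h : jmeas h -> (forall s, differentiable2 (h s)) ->
  forall j, jmeas (fun s x y => grady (h s) x y j 0).
Proof.
move=> mh dh j dT T s X Y ms mX mY.
pose f n t := n.+1%:R * (h (s t) (X t) (Y t + n.+1%:R^-1 *: delta_mx j 0) - h (s t) (X t) (Y t)).
apply: (@measurable_fun_cvg _ _ _ setT f) => [n|t _].
  apply: measurable_funM => //; apply: measurable_funB; apply: mh => //.
  by apply: mvecD => //; exact: mvec_cst.
have [dd _] := partial_y (dh (s t)) (X t) (Y t) (delta_mx j 0).
by have := derive_seq dd; rewrite mxE.
Qed.

Lemma jmeas_hess h : jmeas h -> (forall s, twice_differentiable2 (h s)) ->
  forall i j, jmeas (fun s x y => hess_yy (h s) x y i j).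
Proof.
move=> mh dh i j dT T s X Y ms mX mY.
have mg := jmeas_grady mh (fun s => (dh s).1) j.
have := jmeas_grady mg (fun s => (dh s).2 j) i ms mX mY.
by congr (measurable_fun setT _); apply/funext => t; rewrite !mxE.
Qed.

Lemma jmeas_hess_xy h : jmeas h -> (forall s, twice_differentiable2 (h s)) ->
  forall i j, jmeas (fun s x y => hess_xy (h s) x y i j).
Proof.
move=> mh dh i j dT T s X Y ms mX mY.
have mg := jmeas_grady mh (fun s => (dh s).1) j.
have := jmeas_gradx mg (fun s => (dh s).2 j) i ms mX mY.
by congr (measurable_fun setT _); apply/funext => t; rewrite !mxE.
Qed.

End JointMeasurability.

(** * Regularity and noise of the averaged problem *)

Section Averages.
Context {R : realType} {n p q : nat}.
Implicit Types F : 'I_n -> 'cV[R]_p -> 'cV[R]_q -> R.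

Definition avg F x y := n%:R^-1 * \sum_(i < n) F i x y.

Lemma avg_differentiable2 F : (forall i, differentiable2 (F i)) -> differentiable2 (avg F).
Proof.
move=> dF u.
have -> : (fun v : 'cV[R]_p * 'cV[R]_q => avg F v.1 v.2) =
    n%:R^-1 *: (\sum_(i < n) (fun v : 'cV[R]_p * 'cV[R]_q => F i v.1 v.2)).
  by apply/funext => v; rewrite /avg scalrfctE fct_sumE.
apply: differentiableZ; apply: differentiable_sum => i; exact: dF.
Qed.

Lemma derive_avg (V : normedModType R) (f : 'I_n -> V -> R) a v :
  (forall i, derivable (f i) a v) ->
  'D_v (fun x => n%:R^-1 * \sum_(i < n) f i x) a = n%:R^-1 * \sum_(i < n) 'D_v (f i) a.
Proof.
move=> df.
have -> : (fun x => n%:R^-1 * \sum_(i < n) f i x) = n%:R^-1 *: (\sum_(i < n) f i).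
  by apply/funext => x; rewrite scalrfctE fct_sumE.
by rewrite deriveZ ?derive_sum //; apply: derivable_sum.
Qed.

Lemma gradx_avg F x y : (forall i, differentiable2 (F i)) ->
  gradx (avg F) x y = vmean (fun i => gradx (F i) x y).
Proof.
move=> dF; apply/matrixP => j k; rewrite !mxE summxE.
rewrite (derive_avg (f := fun i x => F i x y)); last by move=> i; have [] := partial_x (dF i) x y (delta_mx j 0).
by congr (_ * _); apply: eq_bigr => i _; rewrite !mxE.
Qed.

Lemma grady_avg F x y : (forall i, differentiable2 (F i)) ->
  grady (avg F) x y = vmean (fun i => grady (F i) x y).
Proof.
move=> dF; apply/matrixP => j k; rewrite !mxE summxE.
rewrite (derive_avg (f := fun i => F i x)); last by move=> i; have [] := partial_y (dF i) x y (delta_mx j 0).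
by congr (_ * _); apply: eq_bigr => i _; rewrite !mxE.
Qed.

Lemma grady_avg_coord F j : (forall i, differentiable2 (F i)) ->
  (fun x y => grady (avg F) x y j 0) = avg (fun i x y => grady (F i) x y j 0).
Proof.
by move=> dF; apply/funext => x; apply/funext => y; rewrite grady_avg // !mxE summxE.
Qed.

Lemma avg_twice_differentiable2 F : (forall i, twice_differentiable2 (F i)) ->
  twice_differentiable2 (avg F).
Proof.
move=> dF; split; first by apply: avg_differentiable2 => i; have [] := dF i.
move=> b; rewrite (grady_avg_coord b); last by move=> i; have [] := dF i.
by apply: avg_differentiable2 => i; have [] := dF i.
Qed.

Lemma hess_xy_avg F x y z : (forall i, twice_differentiable2 (F i)) ->
  hess_xy (avg F) x y *m z = vmean (fun i => hess_xy (F i) x y *m z).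
Proof.
move=> dF; rewrite /vmean -mulmx_suml scalemxAl; congr (_ *m z).
apply/matrixP => a b; rewrite !mxE summxE.
have -> : (fun x' => grady (avg F) x' y b 0) = (avg (fun i x y => grady (F i) x y b 0))^~ y.
  by rewrite -grady_avg_coord // => i; have [] := dF i.
rewrite (derive_avg (f := fun i x => grady (F i) x y b 0)).
  by congr (_ * _); apply: eq_bigr => i _; rewrite !mxE.
by move=> i; have [] := partial_x ((dF i).2 b) x y (delta_mx a 0).
Qed.

Lemma hess_yy_avg F x y z : (forall i, twice_differentiable2 (F i)) ->
  hess_yy (avg F) x y *m z = vmean (fun i => hess_yy (F i) x y *m z).
Proof.
move=> dF; rewrite /vmean -mulmx_suml scalemxAl; congr (_ *m z).
apply/matrixP => a b; rewrite !mxE summxE.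
have -> : (fun y' => grady (avg F) x y' b 0) = (avg (fun i x y => grady (F i) x y b 0)) x.
  by rewrite -grady_avg_coord // => i; have [] := dF i.
rewrite (derive_avg (f := fun i => (fun y => grady (F i) x y b 0))).
  by congr (_ * _); apply: eq_bigr => i _; rewrite !mxE.
by move=> i; have [] := partial_y ((dF i).2 b) x y (delta_mx a 0).
Qed.

Lemma vmeanD d (u v : 'I_n -> 'cV[R]_d) : vmean (fun i => u i + v i) = vmean u + vmean v.
Proof. by rewrite /vmean big_split scalerDr. Qed.

Lemma vmeanB d (u v : 'I_n -> 'cV[R]_d) : vmean (fun i => u i - v i) = vmean u - vmean v.
Proof. by rewrite /vmean sumrB scalerBr. Qed.

Lemma vmeanZ d a (u : 'I_n -> 'cV[R]_d) : vmean (fun i => a *: u i) = a *: vmean u.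
Proof. by rewrite /vmean -scaler_sumr !scalerA mulrC. Qed.

Hypothesis n0 : (0 < n)%N.

Lemma mean_cst (c : R) : n%:R^-1 * \sum_(i < n) c = c.
Proof. by rewrite sumr_const card_ord -[c *+ n]mulr_natl mulrA mulVf ?mul1r // pnatr_eq0 -lt0n. Qed.

Lemma mean_le (u v : 'I_n -> R) : (forall i, u i <= v i) ->
  n%:R^-1 * \sum_(i < n) u i <= n%:R^-1 * \sum_(i < n) v i.
Proof. by move=> uv; rewrite ler_wpM2l ?invr_ge0 // ler_sum. Qed.

Lemma vmean_le d (u : 'I_n -> 'cV[R]_d) b : 0 <= b -> (forall i, enorm (u i) <= b) ->
  enorm (vmean u) <= b.
Proof.
move=> b0 ub; apply: enorm_ler => //; apply: le_trans (vmean_enorm_sqr _) _.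
rewrite -[leRHS]mean_cst; apply: mean_le => i.
by rewrite ler_pXn2r // nnegrE ?enorm_ge0.
Qed.

Lemma gradxy_avg F x y : (forall i, differentiable2 (F i)) ->
  gradxy (avg F) x y = vmean (fun i => gradxy (F i) x y).
Proof.
move=> dF; rewrite /gradxy gradx_avg // grady_avg // /vmean -scale_col_mx; congr (_ *: _).
by elim/big_rec3: _ => [|i a b e _ <-]; rewrite ?col_mx0 // add_col_mx.
Qed.

Lemma avg_lipschitz F L : 0 <= L -> (forall i, differentiable2 (F i)) ->
  (forall i, lipschitz_xy enorm L (gradxy (F i))) -> lipschitz_xy enorm L (gradxy (avg F)).
Proof.
move=> L0 dF LF x y x' y'; rewrite !gradxy_avg // -vmeanB.
by apply: vmean_le => [|i]; [rewrite mulr_ge0 // enorm_ge0|exact: LF].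
Qed.

Lemma avg_strongly_convex F mu x : (forall i, strongly_convex mu (F i x)) ->
  strongly_convex mu (avg F x).
Proof.
move=> sF y y' t t01; rewrite /avg.
apply: le_trans (mean_le (fun i => sF i y y' t t01)) _.
move: (mu / 2 * t * _ * _) => K.
rewrite sumrB big_split /= -!mulr_sumr mulrBr mean_cst mulrDr.
by rewrite le_eqVlt; apply/orP; left; apply/eqP; ring.
Qed.

End Averages.

Lemma sqr_convex {R : realType} (t a b : R) : 0 <= t <= 1 ->
  ((1 - t) * a + t * b) ^+ 2 <= (1 - t) * a ^+ 2 + t * b ^+ 2.
Proof.
move=> /andP[t0 t1].
have : 0 <= t * (1 - t) * (a - b) ^+ 2.
  by apply: mulr_ge0 (sqr_ge0 _); rewrite mulr_ge0 // subr_ge0.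
by lra.
Qed.

Lemma affine_diff {R : realType} a b (H H' : 'M[R]_(a, b)) z z' u u' :
  (H *m z + u) - (H' *m z' + u') = H *m (z - z') + (H - H') *m z' + (u - u') :> 'cV[R]_a.
Proof.
rewrite mulmxBr mulmxBl; move: (H *m z) (H *m z') (H' *m z') => h1 h2 h3.
by apply/matrixP => i j; rewrite !mxE; ring.
Qed.

Lemma affine_diff_same {R : realType} a b (H H' : 'M[R]_(a, b)) z u u' :
  (H *m z + u) - (H' *m z + u') = (H - H') *m z + (u - u') :> 'cV[R]_a.
Proof. by rewrite affine_diff subrr mulmx0 add0r. Qed.

Section ProblemFacts.
Context {R : realType} {n p q : nat} (pb : problem R n p q) (c : constants R)
  (par : hyperparams R).
Hypothesis n0 : (0 < n)%N.
Hypothesis q0 : (0 < q)%N.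
Hypothesis cont : continuity_assumption pb c.
Hypothesis sc : strong_convexity_assumption pb c.
Hypothesis dl : derived_lipschitz pb c.
Hypothesis rho_ge : C_f c / mu_g c <= rho par.

Notation ys := (ystar pb).
Notation zs := (zstar pb).
Notation Lg := (L_g c).
Notation mu := (mu_g c).
Notation r := (rho par).

Definition mDx i x y (z : 'cV[R]_q) := hess_xy (g_ pb i) x y *m z + gradx (f_ pb i) x y.
Definition mDy i x y := grady (g_ pb i) x y.
Definition mDz i x y (z : 'cV[R]_q) := hess_yy (g_ pb i) x y *m z + grady (f_ pb i) x y.
(** Worker i's mean directions at the exact lower-level solution and multiplier. They depend on x
    alone and move only when x moves, which makes them the natural targets of the memories and of
    the momentum. *)
Definition refx i x := mDx i x (ys x) (zs x).
Definition refy i x := mDy i x (ys x).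
Definition refz i x := mDz i x (ys x) (zs x).

Lemma mu_gt0 : 0 < mu. Proof. by have [] := sc. Qed.
Lemma Lg_ge0 : 0 <= Lg. Proof. by have [[]] := cont. Qed.

Lemma df_ i : differentiable2 (f_ pb i).
Proof. by have [_ /(_ i) [[]]] := cont. Qed.

Lemma dg_ i : twice_differentiable2 (g_ pb i).
Proof. by have [_ /(_ i) [[]]] := cont. Qed.

Lemma dfbar : differentiable2 (fbar pb).
Proof. exact: (avg_differentiable2 df_). Qed.

Lemma dgbar : twice_differentiable2 (gbar pb).
Proof. exact: (avg_twice_differentiable2 dg_). Qed.

Lemma Lgbar : lipschitz_xy enorm Lg (gradxy (gbar pb)).
Proof.
apply: (avg_lipschitz n0 Lg_ge0 (fun i => (dg_ i).1)) => i.
by have [_ /(_ i) []] := cont.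
Qed.

Lemma Lg_ i : lipschitz_xy enorm Lg (gradxy (g_ pb i)).
Proof. by have [_ /(_ i) []] := cont. Qed.

Lemma Lf_ i : lipschitz_xy enorm (L_f c) (gradxy (f_ pb i)).
Proof. by have [_ /(_ i) []] := cont. Qed.

Lemma sgbar x : strongly_convex mu (gbar pb x).
Proof. by apply: (avg_strongly_convex n0) => i; have [_] := sc; apply. Qed.

Lemma mu_le_Lg : mu <= Lg.
Proof.
exact: (strong_convexity_le_lipschitz (is_derive_grady dgbar 0)
  (grady_lipschitz Lgbar 0) (sgbar 0) q0).
Qed.

Lemma Lg_gt0 : 0 < Lg. Proof. exact: lt_le_trans mu_gt0 mu_le_Lg. Qed.

Lemma ystar_min x y : gbar pb x (ys x) <= gbar pb x y.
Proof.
move: y; rewrite /ystar; case: xgetP => [y -> H //|H].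
have [y Hy] := minimizer_exists dgbar mu_gt0 sgbar x.
by case: (H y).
Qed.

Lemma grady_ystar x : grady (gbar pb) x (ys x) = 0.
Proof. by apply: (minimizer_grady0 dgbar) => y; exact: ystar_min. Qed.

Lemma hess_unit x y : hess_yy (gbar pb) x y \in unitmx /\
  forall v, enorm (invmx (hess_yy (gbar pb) x y) *m v) <= mu^-1 * enorm v.
Proof.
apply: coercive_inv mu_gt0 _ => v.
exact: (hess_yy_coercive dgbar Lgbar sgbar).
Qed.

Lemma zstar_eq x : hess_yy (gbar pb) x (ys x) *m zs x + grady (fbar pb) x (ys x) = 0.
Proof.
by rewrite /zstar mulmxN mulmxA mulmxV ?mul1mx ?addNr //; have [] := hess_unit x (ys x).
Qed.

(** The derivative of f_i along its own gradient is the squared norm of that gradient, while the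
    Lipschitz property bounds the same derivative by C_f times the norm. *)
Lemma grady_f_bound i x y : enorm (grady (f_ pb i) x y) <= C_f c.
Proof.
have Cf0 : 0 <= C_f c by have [[]] := cont.
set g := grady _ _ _.
have [g0|gn] := eqVneq (enorm g) 0; first by rewrite g0.
have gp : 0 < enorm g by rewrite lt_neqAle eq_sym gn enorm_ge0.
have := is_derive_curve (df_ i) (is_derive_cst x (0 : R) (1 : R)) (is_derive_line y g 0).
rewrite scale0r addr0 dot0r add0r => /is_derive_seq H.
rewrite -(ler_pM2r gp) -expr2 enorm_sqr.
apply: (@seq_lim_le _ _ _ _ 0 H) => k.
rewrite mul0r addr0 scale0r addr0 -ler_pdivlMl //.
apply: le_trans (ler_norm _) _.
have [_ /(_ i) [_ Hf _ _ _]] := cont; apply: le_trans (Hf _ _ _) _.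
by rewrite addrAC subrr add0r enormZ ger0_norm ?invr_ge0 // mulrCA.
Qed.

(** This is the purpose of rho >= C_f / mu_g: the target z*(x) lies in the clipping ball, so
    clipping never moves z away from it, and Hessian differences multiplied by z*(x) stay under
    control. *)
Lemma zstar_le x : enorm (zs x) <= r.
Proof.
apply: le_trans rho_ge; rewrite /zstar enormN.
have [_ H] := hess_unit x (ys x); apply: le_trans (H _) _.
rewrite mulrC ler_wpM2r ?invr_ge0 ?(ltW mu_gt0) //.
rewrite (grady_avg _ _ df_); apply: vmean_le => // [|i]; last exact: grady_f_bound.
by have [[]] := cont.
Qed.

Lemma ys_lipschitz : lipschitz_cst (L_ystar c) ys. Proof. by have [_ []] := dl. Qed.
Lemma zs_lipschitz : lipschitz_cst (L_zstar c) zs. Proof. by have [_ []] := dl. Qed.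
Lemma Lys_ge0 : 0 <= L_ystar c. Proof. by have [[_ /ltW]] := dl. Qed.
Lemma hypergradE x : hypergrad (gbar pb) ys (fbar pb) x = vmean (fun i => refx i x).
Proof.
rewrite /hypergrad (gradx_avg _ _ df_) /refx /mDx vmeanD -(hess_xy_avg _ _ _ dg_).
by rewrite /zstar mulmxN addrC.
Qed.

(** Averaging the exact directions over the workers gives the hypergradient. Hence the averaged
    momentum error [errB] without lag is the distance from the averaged momentum to the gradient of
    Phi. *)
Lemma grad_PhiE x : grad (Phi pb) x = vmean (fun i => refx i x).
Proof.
rewrite -hypergradE; apply: (grad_hyper dgbar Lys_ge0 ys_lipschitz grady_ystar _ dfbar).
by move=> x'; have [] := hess_unit x' (ys x').
Qed.

Lemma Phi_descent x u :
  Phi pb (x + u) <= Phi pb x + dot (grad (Phi pb) x) u + L_Phi c / 2 * enorm u ^+ 2.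
Proof.
apply: descent; last by have [_ []] := dl.
move=> {}x {}u; rewrite grad_PhiE -hypergradE.
apply: (is_derive_hyper dgbar Lys_ge0 ys_lipschitz grady_ystar _ dfbar).
by move=> x'; have [] := hess_unit x' (ys x').
Qed.

Lemma sqr_le (a b : R) : 0 <= a -> a <= b -> a ^+ 2 <= b ^+ 2.
Proof. by move=> a0 ab; rewrite ler_pXn2r // nnegrE // (le_trans a0). Qed.

Lemma opnorm_lip_sqr {a b} (H H' : 'M[R]_(a, b)) L e z : 0 <= L -> 0 <= e ->
  opnorm (H - H') <= L * e -> enorm z <= r ->
  enorm ((H - H') *m z) ^+ 2 <= L ^+ 2 * r ^+ 2 * e ^+ 2.
Proof.
move=> L0 e0 HL zr.
have -> : L ^+ 2 * r ^+ 2 * e ^+ 2 = (L * e * r) ^+ 2 by ring.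
apply: sqr_le; first exact: enorm_ge0.
apply: le_trans (enorm_mulmx _ _) _.
by apply: ler_pM => //; [exact: opnorm_ge0|exact: enorm_ge0].
Qed.

(** The Hessian difference is multiplied by z', so only z' has to lie in the ball; z is multiplied
    by a single Hessian, whose norm is at most L_g. *)
Lemma mDx_lipschitz i x y z x' y' z' : enorm z' <= r ->
  enorm (mDx i x y z - mDx i x' y' z') ^+ 2 <=
    3 * L2sq c par * (enorm (x - x') ^+ 2 + enorm (y - y') ^+ 2)
    + 3 * Lg ^+ 2 * enorm (z - z') ^+ 2.
Proof.
move=> z'r; have [[_ Lf0 _ Lgxy0 _] /(_ i) [_ _ _ _ [Hxy _]]] := cont.
set H := hess_xy (g_ pb i) x y; set H' := hess_xy (g_ pb i) x' y'.
have -> : mDx i x y z - mDx i x' y' z' = H *m (z - z') + (H - H') *m z' +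
    (gradx (f_ pb i) x y - gradx (f_ pb i) x' y').
  exact: affine_diff.
apply: le_trans (enorm_sqrD3 _ _ _) _.
have h1 : enorm (H *m (z - z')) ^+ 2 <= Lg ^+ 2 * enorm (z - z') ^+ 2.
  rewrite -exprMn; apply: sqr_le; first exact: enorm_ge0.
  exact: (hess_xy_bound (dg_ i) Lg_ge0 (@Lg_ i)).
have h2 := opnorm_lip_sqr Lgxy0 (enorm_ge0 _) (Hxy x y x' y') z'r.
have h3 := sqr_le (enorm_ge0 _) (gradient_lipschitz (@Lf_ i) x y x' y').1.
rewrite enorm_col_mx in h2; rewrite exprMn enorm_col_mx in h3.
by rewrite /L2sq; lra.
Qed.

Lemma mDz_lipschitz i x y z x' y' z' : enorm z' <= r ->
  enorm (mDz i x y z - mDz i x' y' z') ^+ 2 <=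
    3 * L1sq c par * (enorm (x - x') ^+ 2 + enorm (y - y') ^+ 2)
    + 3 * Lg ^+ 2 * enorm (z - z') ^+ 2.
Proof.
move=> z'r; have [[_ Lf0 _ _ Lgyy0] /(_ i) [_ _ _ _ [_ Hyy]]] := cont.
set H := hess_yy (g_ pb i) x y; set H' := hess_yy (g_ pb i) x' y'.
have -> : mDz i x y z - mDz i x' y' z' = H *m (z - z') + (H - H') *m z' +
    (grady (f_ pb i) x y - grady (f_ pb i) x' y').
  exact: affine_diff.
apply: le_trans (enorm_sqrD3 _ _ _) _.
have h1 : enorm (H *m (z - z')) ^+ 2 <= Lg ^+ 2 * enorm (z - z') ^+ 2.
  rewrite -exprMn; apply: sqr_le; first exact: enorm_ge0.
  exact: (hess_yy_bound (dg_ i) Lg_ge0 (@Lg_ i)).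
have h2 := opnorm_lip_sqr Lgyy0 (enorm_ge0 _) (Hyy x y x' y') z'r.
have h3 := sqr_le (enorm_ge0 _) (gradient_lipschitz (@Lf_ i) x y x' y').2.
rewrite enorm_col_mx in h2; rewrite exprMn enorm_col_mx in h3.
by rewrite /L1sq; lra.
Qed.

(** With z common to both points only two differences remain, hence the constant 2 in place of 3. *)
Lemma mDz_lipschitz_y i x y y' z : enorm z <= r ->
  enorm (mDz i x y z - mDz i x y' z) ^+ 2 <= 2 * L1sq c par * enorm (y - y') ^+ 2.
Proof.
move=> zr; have [[_ Lf0 _ _ Lgyy0] /(_ i) [_ _ _ _ [_ Hyy]]] := cont.
set H := hess_yy (g_ pb i) x y; set H' := hess_yy (g_ pb i) x y'.
have -> : mDz i x y z - mDz i x y' z = (H - H') *m z +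
    (grady (f_ pb i) x y - grady (f_ pb i) x y').
  exact: affine_diff_same.
apply: le_trans (enorm_sqrD2 _ _) _.
have h2 := opnorm_lip_sqr Lgyy0 (enorm_ge0 _) (Hyy x y x y') zr.
have h3 := sqr_le (enorm_ge0 _) (gradient_lipschitz (@Lf_ i) x y x y').2.
rewrite (subrr x) enorm_col_mxr in h2; rewrite exprMn (subrr x) enorm_col_mxr in h3.
by rewrite /L1sq; lra.
Qed.

Lemma mDy_lipschitz i x y x' y' :
  enorm (mDy i x y - mDy i x' y') ^+ 2 <=
    Lg ^+ 2 * (enorm (x - x') ^+ 2 + enorm (y - y') ^+ 2).
Proof.
have := sqr_le (enorm_ge0 _) (gradient_lipschitz (@Lg_ i) x y x' y').2.
by rewrite exprMn enorm_col_mx.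
Qed.

Lemma ys_lipschitz_sqr x x' : enorm (ys x - ys x') ^+ 2 <= L_ystar c ^+ 2 * enorm (x - x') ^+ 2.
Proof. by rewrite -exprMn; apply: sqr_le; [exact: enorm_ge0|exact: ys_lipschitz]. Qed.

Lemma zs_lipschitz_sqr x x' : enorm (zs x - zs x') ^+ 2 <= L_zstar c ^+ 2 * enorm (x - x') ^+ 2.
Proof. by rewrite -exprMn; apply: sqr_le; [exact: enorm_ge0|exact: zs_lipschitz]. Qed.

Lemma L1sq_ge0 : 0 <= L1sq c par.
Proof. exact: addr_ge0 (sqr_ge0 _) (mulr_ge0 (sqr_ge0 _) (sqr_ge0 _)). Qed.
Lemma L2sq_ge0 : 0 <= L2sq c par.
Proof. exact: addr_ge0 (sqr_ge0 _) (mulr_ge0 (sqr_ge0 _) (sqr_ge0 _)). Qed.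

Lemma refx_lipschitz i x x' :
  enorm (refx i x - refx i x') ^+ 2 <= 3 * L5sq c par * enorm (x - x') ^+ 2.
Proof.
apply: le_trans (mDx_lipschitz i _ _ _ _ _ (zstar_le x')) _.
have hy := ler_wpM2l L2sq_ge0 (ys_lipschitz_sqr x x').
have hz := ler_wpM2l (sqr_ge0 Lg) (zs_lipschitz_sqr x x').
have h1 : 0 <= L2sq c par * (L_ystar c ^+ 2 * enorm (x - x') ^+ 2).
  exact: mulr_ge0 L2sq_ge0 (mulr_ge0 (sqr_ge0 _) (sqr_ge0 _)).
have h2 : 0 <= Lg ^+ 2 * (L_zstar c ^+ 2 * enorm (x - x') ^+ 2) by exact: mulr_ge0 (sqr_ge0 _) (mulr_ge0 (sqr_ge0 _) (sqr_ge0 _)).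
by rewrite /L5sq; lra.
Qed.

Lemma refz_lipschitz i x x' :
  enorm (refz i x - refz i x') ^+ 2 <= 3 * L4sq c par * enorm (x - x') ^+ 2.
Proof.
apply: le_trans (mDz_lipschitz i _ _ _ _ _ (zstar_le x')) _.
have hy := ler_wpM2l L1sq_ge0 (ys_lipschitz_sqr x x').
have hz := ler_wpM2l (sqr_ge0 Lg) (zs_lipschitz_sqr x x').
have h1 : 0 <= L1sq c par * (L_ystar c ^+ 2 * enorm (x - x') ^+ 2).
  exact: mulr_ge0 L1sq_ge0 (mulr_ge0 (sqr_ge0 _) (sqr_ge0 _)).
have h2 : 0 <= Lg ^+ 2 * (L_zstar c ^+ 2 * enorm (x - x') ^+ 2) by exact: mulr_ge0 (sqr_ge0 _) (mulr_ge0 (sqr_ge0 _) (sqr_ge0 _)).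
by rewrite /L4sq; lra.
Qed.

Lemma refy_lipschitz i x x' :
  enorm (refy i x - refy i x') ^+ 2 <= L3sq c * enorm (x - x') ^+ 2.
Proof.
apply: le_trans (mDy_lipschitz i _ _ _ _) _.
have hy := ler_wpM2l (sqr_ge0 Lg) (ys_lipschitz_sqr x x').
have h1 : 0 <= Lg ^+ 2 * (L_ystar c ^+ 2 * enorm (x - x') ^+ 2) by exact: mulr_ge0 (sqr_ge0 _) (mulr_ge0 (sqr_ge0 _) (sqr_ge0 _)).
by rewrite /L3sq; lra.
Qed.

Lemma mDx_ref i x y z :
  enorm (mDx i x y z - refx i x) ^+ 2 <=
    3 * L2sq c par * enorm (y - ys x) ^+ 2 + 3 * Lg ^+ 2 * enorm (z - zs x) ^+ 2.
Proof.
by have := mDx_lipschitz i x y z x (ys x) (zstar_le x); rewrite subrr enorm0 expr0n add0r.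
Qed.

Lemma mDz_ref i x y z :
  enorm (mDz i x y z - refz i x) ^+ 2 <=
    3 * L1sq c par * enorm (y - ys x) ^+ 2 + 3 * Lg ^+ 2 * enorm (z - zs x) ^+ 2.
Proof.
by have := mDz_lipschitz i x y z x (ys x) (zstar_le x); rewrite subrr enorm0 expr0n add0r.
Qed.

Lemma mDy_ref i x y : enorm (mDy i x y - refy i x) ^+ 2 <= Lg ^+ 2 * enorm (y - ys x) ^+ 2.
Proof. by have := mDy_lipschitz i x y x (ys x); rewrite subrr enorm0 expr0n add0r. Qed.

Lemma y_contraction b x y : 0 < b -> b * (mu + Lg) <= 2 ->
  enorm (y - b *: vmean (fun i => mDy i x y) - ys x) ^+ 2 <=
    (1 - b * mu) ^+ 2 * enorm (y - ys x) ^+ 2.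
Proof.
move=> b0 bL; rewrite -exprMn; apply: sqr_le; first exact: enorm_ge0.
have := gradient_step_contraction (is_derive_grady dgbar x) (grady_lipschitz Lgbar x)
  (@sgbar x) (ys x) y b0 mu_le_Lg bL.
by rewrite grady_ystar scaler0 subr0 (grady_avg _ _ (fun i => (dg_ i).1)).
Qed.

(** The z-step is affine: the error D = z - z* is multiplied by I - g H, a contraction of factor 1 -
    g mu, and a residual e due to y differing from y* is subtracted. Reading g |e| as g mu times |e|
    / mu makes the bound a convex combination, whose square is at most the combination of the
    squares. *)
Lemma z_contraction g x y z : 0 < g -> g * Lg <= 1 ->
  enorm (z - g *: vmean (fun i => mDz i x y z) - zs x) ^+ 2 <=
    (1 - g * mu) * enorm (z - zs x) ^+ 2 + 2 * (g / mu) * L1sq c par * enorm (y - ys x) ^+ 2.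
Proof.
move=> g0 gL; have mu0 := mu_gt0; have muL := mu_le_Lg.
have gmu : 0 <= g * mu <= 1.
  apply/andP; split; first exact: mulr_ge0 (ltW g0) (ltW mu0).
  by apply: le_trans gL; rewrite ler_pM2l.
set H := hess_yy (gbar pb) x y.
(* The subtracted mean is zero by [zstar_eq]; it is kept so that e is visibly a difference in y with
   z* fixed. *)
set e := vmean (fun i => mDz i x y (zs x) - mDz i x (ys x) (zs x)).
have mDzE w y' : vmean (fun i => mDz i x y' w) = hess_yy (gbar pb) x y' *m w + grady (fbar pb) x y'.
  by rewrite /mDz vmeanD -(hess_yy_avg _ _ _ dg_) -(grady_avg _ _ df_).
have eE : e = H *m zs x + grady (fbar pb) x y.
  rewrite /e (vmeanB (fun i => mDz i x y (zs x)) (fun i => mDz i x (ys x) (zs x))).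
  have E2 := etrans (mDzE (zs x) (ys x)) (zstar_eq x).
  exact: etrans (congr2 (fun a b => a - b) (mDzE (zs x) y) E2) (subr0 _).
set D := z - zs x.
pose w := D - g *: (H *m D).
have -> : z - g *: vmean (fun i => mDz i x y z) - zs x = w - g *: e.
  rewrite (mDzE z y) eE /w /D -/H (mulmxBr H).
  move: (H *m z) (H *m zs x) (grady _ _ _) => a b f.
  by apply/matrixP => i j; rewrite !mxE; ring.
have wb : enorm w <= (1 - g * mu) * enorm D.
  apply: (hess_yy_contraction dgbar Lgbar sgbar muL) => //.
  by have : g * mu <= g * Lg; [rewrite ler_pM2l|rewrite mulrDr; lra].
have eb : enorm e ^+ 2 <= 2 * L1sq c par * enorm (y - ys x) ^+ 2.
  apply: le_trans (vmean_enorm_sqr _) _; rewrite -[leRHS](mean_cst n0).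
  by apply: mean_le => i; apply: mDz_lipschitz_y; exact: zstar_le.
have : enorm (w - g *: e) <= (1 - g * mu) * enorm D + g * mu * (enorm e / mu).
  apply: le_trans (enormB _ _) _; rewrite enormZ (ger0_norm (ltW g0)).
  by rewrite [X in _ <= _ + X](_ : _ = g * enorm e) ?lerD2r //; field; rewrite gt_eqF.
move=> /(sqr_le (enorm_ge0 _)) H1; apply: le_trans H1 _.
set t := g * mu in gmu *; set A := enorm D; set B := enorm e / mu.
apply: (@le_trans _ _ ((1 - t) * A ^+ 2 + t * B ^+ 2)).
  exact: sqr_convex.
rewrite lerD2l /t /B expr_div_n.
have -> : g * mu * (enorm e ^+ 2 / mu ^+ 2) = g / mu * enorm e ^+ 2 by field; rewrite gt_eqF.
have -> : 2 * (g / mu) * L1sq c par * enorm (y - ys x) ^+ 2 =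
  g / mu * (2 * L1sq c par * enorm (y - ys x) ^+ 2) by ring.
by rewrite ler_wpM2l // divr_ge0 // ltW.
Qed.

End ProblemFacts.

Section Oracles.
Context {R : realType} {n p q : nat} (pb : problem R n p q) (sigma : R).
Hypothesis reg : regular_losses pb.
Hypothesis noise : noise_assumption pb sigma.

Lemma jmeas_lossF : jmeas (@lossF _ _ _ _ pb).
Proof. by have [H _ _ _ _] := reg; exact: borel_jmeas. Qed.

Lemma jmeas_lossG : jmeas (@lossG _ _ _ _ pb).
Proof. by have [_ H _ _ _] := reg; exact: borel_jmeas. Qed.

Section Measurability.
Context {d : measure_display} {T : measurableType d} (s : T -> Tphi pb) (t : T -> Txi pb)
  (X : T -> 'cV[R]_p) (Y Z : T -> 'cV[R]_q).
Hypotheses (ms : measurable_fun setT s) (mt : measurable_fun setT t)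
  (mX : mvec X) (mY : mvec Y) (mZ : mvec Z).

Lemma mvec_gradxF : mvec (fun w => gradx (lossF (s w)) (X w) (Y w)).
Proof.
have [_ _ _ dF _] := reg; move=> i j; rewrite (ord1 j).
exact: (jmeas_gradx jmeas_lossF dF i ms mX mY).
Qed.

Lemma mvec_gradyF : mvec (fun w => grady (lossF (s w)) (X w) (Y w)).
Proof.
have [_ _ _ dF _] := reg; move=> i j; rewrite (ord1 j).
exact: (jmeas_grady jmeas_lossF dF i ms mX mY).
Qed.

Lemma mvec_gradyG : mvec (fun w => grady (lossG (t w)) (X w) (Y w)).
Proof.
have [_ _ _ _ dG] := reg; move=> i j; rewrite (ord1 j).
exact: (jmeas_grady jmeas_lossG (fun s => (dG s).1) i mt mX mY).
Qed.

Lemma mvec_hess_xyG : mvec (fun w => hess_xy (lossG (t w)) (X w) (Y w)).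
Proof. by have [_ _ _ _ dG] := reg; move=> i j; exact: (@jmeas_hess_xy _ _ _ _ _ _ jmeas_lossG dG i j _ _ t X Y mt mX mY). Qed.

Lemma mvec_hess_yyG : mvec (fun w => hess_yy (lossG (t w)) (X w) (Y w)).
Proof. by have [_ _ _ _ dG] := reg; move=> i j; exact: (@jmeas_hess _ _ _ _ _ _ jmeas_lossG dG i j _ _ t X Y mt mX mY). Qed.

Lemma mvec_dir_x : mvec (fun w => dir_x (X w) (Y w) (Z w) (s w) (t w)).
Proof. by apply: mvecD mvec_gradxF; apply: mvecM mvec_hess_xyG mZ. Qed.

Lemma mvec_dir_y : mvec (fun w => dir_y (X w) (Y w) (t w)).
Proof. exact: mvec_gradyG. Qed.

Lemma mvec_dir_z : mvec (fun w => dir_z (X w) (Y w) (Z w) (s w) (t w)).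
Proof. by apply: mvecD mvec_gradyF; apply: mvecM mvec_hess_yyG mZ. Qed.

End Measurability.

(** The factor |z|^2 is taken out of the integral on the side of X z, whose norm is measurable. The
    comparison with [opnorm] is then pointwise, and no measurability of [opnorm] is required. *)
Lemma hess_noise d {T : measurableType d} (P : probability T R) a b
    (X : T -> 'M[R]_(a, b)) M s z :
  mvec X -> mse_le P opnorm X M s -> 0 <= s ->
  mse_le P enorm (fun t => X t *m z) (M *m z) (s * enorm z ^+ 2).
Proof.
move=> mX sX s0; rewrite /mse_le.
have [z0|zn] := eqVneq (enorm z) 0.
  rewrite (enorm_eq0 z0); under eq_integral do rewrite !mulmx0 subr0 enorm0 expr0n.
  by rewrite integral0 lee_fin enorm0 expr0n mulr0.
have zp : 0 < enorm z ^+ 2 by rewrite exprn_gt0 // lt_neqAle eq_sym zn enorm_ge0.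
have E t : (enorm (X t *m z - M *m z) ^+ 2)%:E =
    ((enorm z ^+ 2)%:E * (enorm ((X t - M) *m z) ^+ 2 / enorm z ^+ 2)%:E)%E.
  by rewrite -EFinM mulmxBl mulrC divfK // gt_eqF.
rewrite (eq_integral _ _ (fun t _ => E t)) ge0_integralZl_EFin //; last 3 first.
- by move=> t _; rewrite lee_fin divr_ge0 ?sqr_ge0.
- apply/measurable_EFinP; apply: measurable_funM => //; apply: measurable_enorm2.
  apply: mvecM; last exact: mvec_cst.
  by apply: mvecB => //; exact: mvec_cst.
- exact: ltW.
rewrite (mulrC s) (EFinM (enorm z ^+ 2) s); apply: lee_wpmul2l; first by rewrite lee_fin ltW.
apply: le_trans sX; apply: le_integral_ge0 => t; first by rewrite lee_fin divr_ge0 ?sqr_ge0.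
rewrite lee_fin ler_pdivrMr // -exprMn ler_pXn2r ?nnegrE ?enorm_ge0 ?mulr_ge0 ?enorm_ge0 ?opnorm_ge0 //.
exact: enorm_mulmx.
Qed.

Section Laws.
Context {d : measure_display} {O : measurableType d} (P : probability O R) (i : 'I_n)
  (s : O -> Tphi pb) (t : O -> Txi pb) (x : 'cV[R]_p) (y z : 'cV[R]_q).
Hypotheses (ls : has_law P s (Df pb i)) (lt : has_law P t (Dg pb i)).

Lemma gradxF_oracle : unbiased P (fun w => gradx (lossF (s w)) x y) (gradx (f_ pb i) x y) /\
  mse_le P enorm (fun w => gradx (lossF (s w)) x y) (gradx (f_ pb i) x y) (sigma ^+ 2).
Proof.
have [_ /(_ i x y) [[uF sF] _ _ _]] := noise.
split.
  apply: (has_law_unbiased ls (Z := fun t => gradx (lossF t) x y)) => a b.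
  have := uF (lshift q a) b; rewrite col_mxEu.
  by under eq_fun do rewrite col_mxEu.
apply: (has_law_mse_le ls (Z := fun t => gradx (lossF t) x y)).
  by apply: mvec_gradxF => //; exact: mvec_cst.
apply: le_trans sF; apply: le_integral_ge0 => w; first by rewrite lee_fin sqr_ge0.
by rewrite lee_fin /gradxy opp_col_mx add_col_mx enorm_col_mx lerDl sqr_ge0.
Qed.

Lemma gradyF_oracle : unbiased P (fun w => grady (lossF (s w)) x y) (grady (f_ pb i) x y) /\
  mse_le P enorm (fun w => grady (lossF (s w)) x y) (grady (f_ pb i) x y) (sigma ^+ 2).
Proof.
have [_ /(_ i x y) [[uF sF] _ _ _]] := noise.
split.
  apply: (has_law_unbiased ls (Z := fun t => grady (lossF t) x y)) => a b.
  have := uF (rshift p a) b; rewrite col_mxEd.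
  by under eq_fun do rewrite col_mxEd.
apply: (has_law_mse_le ls (Z := fun t => grady (lossF t) x y)).
  by apply: mvec_gradyF => //; exact: mvec_cst.
apply: le_trans sF; apply: le_integral_ge0 => w; first by rewrite lee_fin sqr_ge0.
by rewrite lee_fin /gradxy opp_col_mx add_col_mx enorm_col_mx lerDr sqr_ge0.
Qed.

Lemma dir_y_oracle : unbiased P (fun w => dir_y x y (t w)) (mDy pb i x y) /\
  mse_le P enorm (fun w => dir_y x y (t w)) (mDy pb i x y) (sigma ^+ 2).
Proof.
have [_ /(_ i x y) [_ [uG sG] _ _]] := noise.
split; first exact: (has_law_unbiased lt (Z := fun t => grady (lossG t) x y)).
apply: (has_law_mse_le lt (Z := fun t => grady (lossG t) x y)) => //.
by apply: mvec_gradyG => //; exact: mvec_cst.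
Qed.

Lemma hess_xyG_oracle :
  unbiased P (fun w => hess_xy (lossG (t w)) x y *m z) (hess_xy (g_ pb i) x y *m z) /\
  mse_le P enorm (fun w => hess_xy (lossG (t w)) x y *m z) (hess_xy (g_ pb i) x y *m z)
    (sigma ^+ 2 * enorm z ^+ 2).
Proof.
have [_ /(_ i x y) [_ _ [uG sG] _]] := noise.
have mH : mvec (fun t : Txi pb => hess_xy (lossG t) x y).
  exact: (@mvec_hess_xyG _ (Txi pb) id (fun=> x) (fun=> y) (@measurable_id _ _ _) (@mvec_cst _ _ _ _ _ x) (@mvec_cst _ _ _ _ _ y)).
split.
  apply: unbiasedMr; exact: (has_law_unbiased lt (Z := fun t => hess_xy (lossG t) x y)).
apply: (has_law_mse_le lt (Z := fun t => hess_xy (lossG t) x y *m z)).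
  by apply: mvecM => //; exact: mvec_cst.
by apply: hess_noise => //; exact: sqr_ge0.
Qed.

Lemma hess_yyG_oracle :
  unbiased P (fun w => hess_yy (lossG (t w)) x y *m z) (hess_yy (g_ pb i) x y *m z) /\
  mse_le P enorm (fun w => hess_yy (lossG (t w)) x y *m z) (hess_yy (g_ pb i) x y *m z)
    (sigma ^+ 2 * enorm z ^+ 2).
Proof.
have [_ /(_ i x y) [_ _ _ [uG sG]]] := noise.
have mH : mvec (fun t : Txi pb => hess_yy (lossG t) x y).
  exact: (@mvec_hess_yyG _ (Txi pb) id (fun=> x) (fun=> y) (@measurable_id _ _ _) (@mvec_cst _ _ _ _ _ x) (@mvec_cst _ _ _ _ _ y)).
split.
  apply: unbiasedMr; exact: (has_law_unbiased lt (Z := fun t => hess_yy (lossG t) x y)).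
apply: (has_law_mse_le lt (Z := fun t => hess_yy (lossG t) x y *m z)).
  by apply: mvecM => //; exact: mvec_cst.
by apply: hess_noise => //; exact: sqr_ge0.
Qed.

End Laws.

Section IndependentNoise.
Context {d : measure_display} {O : measurableType d} (P : probability O R)
  {I : choiceType} (E : I -> set (set O)).
Hypothesis E_meas : forall i, E i `<=` measurable.
Hypothesis E_I : forall i, setI_closed (E i).
Hypothesis E_T : forall i, E i setT.
Hypothesis E_indep : mutually_independent P E.

(** A is frozen and the unbiasedness of B removes the cross term. The noises of the Hessian sample
    and of the gradient sample thus add up without a factor 2, which yields exactly sigma^2 (1 +
    rho^2) for a direction. *)
Lemma independent_mseD m (A B : O -> 'cV[R]_m) MA MB sA sB J1 J2 : J1 `&` J2 = set0 ->
  @mvec _ (sub_sigma E J1) R _ _ A -> @mvec _ (sub_sigma E J2) R _ _ B ->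
  mse_le P enorm A MA sA -> unbiased P B MB -> mse_le P enorm B MB sB ->
  mse_le P enorm (fun w => A w + B w) (MA + MB) (sA + sB).
Proof.
move=> J12 mA mB sA' uB sB'.
pose f (u : sub_sigma E J1 * sub_sigma E J2) := (enorm ((A u.1 - (MA + MB)) + 1 *: B u.2) ^+ 2)%:E.
have mf : measurable_fun setT f.
  apply/measurable_EFinP; apply: measurable_enorm2; apply: mvecD.
    by apply: mvecB; [exact: (mvec_comp mA measurable_fst)|exact: mvec_cst].
  by apply: mvecZ => //; exact: (mvec_comp mB measurable_snd).
have f0 u : (0 <= f u)%E by rewrite lee_fin sqr_ge0.
rewrite /mse_le (_ : (\int[P]_t _)%E = (\int[P]_w f (w, w))%E); last first.
  by apply: eq_integral => w _; rewrite /f scale1r addrAC.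
rewrite (freeze2 E_meas E_I E_T E_indep J12 mf f0).
apply: (@le_trans _ _ (\int[P]_w ((enorm (A w - MA) ^+ 2)%:E + sB%:E))%E).
  apply: le_integral_ge0 => w; first exact: integral_ge0.
  apply: le_trans (bias_variance (A w - (MA + MB)) 1 uB sB') _.
  have -> : A w - (MA + MB) + 1 *: MB = A w - MA by rewrite scale1r opprD addrA subrK.
  by rewrite expr1n mul1r EFinD.
have sB0 : 0 <= sB.
  rewrite -lee_fin; apply: le_trans sB'; apply: integral_ge0 => w _.
  by rewrite lee_fin sqr_ge0.
rewrite ge0_integralD //; last 2 first.
- by move=> w _; rewrite lee_fin sqr_ge0.
- apply/measurable_EFinP; apply: (measurable_sub_sigma E_meas (J := J1)).
  by apply: measurable_enorm2; apply: mvecB => //; exact: mvec_cst.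
by rewrite integral_prob_cst EFinD leeD2r.
Qed.

End IndependentNoise.

End Oracles.

(** * Freshness of the samples *)

Lemma borel_mvec {R : realType} {d} {dT} {T : measurableType dT} (X : T -> 'cV[R]_d) :
  measurable_fun setT (X : T -> borel R d) -> mvec X.
Proof.
move=> mX i j; rewrite (ord1 j).
apply: (@measurableT_comp _ _ _ _ _ _ (fun v : borel R d => (v : 'cV[R]_d) i 0)) => //.
apply: (measurability _ (RGenOpens.measurableE R)).
move=> _ [_ [a [b ->] <-]]; rewrite setTI; apply: sub_sigma_algebra.
rewrite /=; apply: open_comp; last exact: interval_open.
by move=> v _; exact: coord_continuous.
Qed.

Section Randomness.
Context {R : realType} {n p q : nat} {pb : problem R n p q}
  {Cu : 'I_n -> compressor R p} {Cl : 'I_n -> compressor R q} (rd : randomness pb Cu Cl).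

Definition src : choiceType := ((nat * 'I_n) + (nat * 'I_n) + (nat * 'I_n))%type.
Definition src_time (j : src) : nat :=
  match j with inl (inl a) => a.1 | inl (inr a) => a.1 | inr a => a.1 end.
(** Two splittings are used. [past] against [fresh] freezes the state at the start of iteration k;
    [samples] against [seeds] freezes, inside that iteration, the vectors handed to the
    compressors. *)
Definition past k : set src := [set j | (src_time j < k)%N].
Definition fresh k : set src := [set j | src_time j = k].
Definition samples k : set src :=
  [set j | match j with inl (inl a) => a.1 = k | inl (inr a) => a.1 = k | inr _ => False end].
Definition seeds k : set src :=
  [set j | match j with inr a => a.1 = k | _ => False end].

Lemma past_fresh k : past k `&` fresh k = set0.
Proof. by apply/seteqP; split => // j []; rewrite /past /fresh /= => + E; rewrite E ltnn. Qed.

Lemma samples_seeds k : samples k `&` seeds k = set0.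
Proof. by apply/seteqP; split => // -[[a|a]|a] []. Qed.

Lemma past_mono k : past k `<=` past k.+1.
Proof. by move=> j; exact: ltnW. Qed.

Lemma fresh_past k : fresh k `<=` past k.+1.
Proof. by move=> j; rewrite /fresh /past /= => ->. Qed.

Hypothesis fr : fresh_randomness rd.
Notation E := (@sources _ _ _ _ _ _ _ rd).
Notation P := (Pr rd).
Notation samF := (@phi _ _ _ _ _ _ _ rd).
Notation samG := (@xi _ _ _ _ _ _ _ rd).
Notation sdx := (@ux _ _ _ _ _ _ _ rd).
Notation sdy := (@uy _ _ _ _ _ _ _ rd).
Notation sdz := (@uz _ _ _ _ _ _ _ rd).

Let m1 k i : measurable_fun setT (samF k i). Proof. by have [/(_ k i) [[]]] := fr. Qed.
Let m2 k i : measurable_fun setT (samG k i). Proof. by have [/(_ k i) [_ []]] := fr. Qed.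
Let m3 k i : measurable_fun setT (sdx k i). Proof. by have [/(_ k i) [_ _ []]] := fr. Qed.
Let m4 k i : measurable_fun setT (sdy k i). Proof. by have [/(_ k i) [_ _ _ []]] := fr. Qed.
Let m5 k i : measurable_fun setT (sdz k i). Proof. by have [/(_ k i) [_ _ _ _ []]] := fr. Qed.

Lemma src_meas (j : src) : E j `<=` measurable.
Proof.
have H d1 d2 (A : measurableType d1) (B : measurableType d2) (X : A -> B) :
    measurable_fun setT X -> events X `<=` measurable.
  by move=> mX _ [C mC <-]; exact: mX.
case: j => [[a|a]|a]; apply: H => //.
by apply: measurable_fun_pair => //; exact: measurable_fun_pair.
Qed.

Lemma src_setI (j : src) : setI_closed (E j).
Proof.
have H d1 d2 (A : measurableType d1) (B : measurableType d2) (X : A -> B) :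
    setI_closed (events X).
  move=> _ _ [C mC <-] [D mD <-]; exists (C `&` D); first exact: measurableI.
  by rewrite !setTI.
by case: j => [[a|a]|a]; exact: H.
Qed.

Lemma src_setT (j : src) : E j setT.
Proof.
have H d1 d2 (A : measurableType d1) (B : measurableType d2) (X : A -> B) :
    events X setT by exists setT => //; rewrite preimage_setT setTI.
by case: j => [[a|a]|a]; exact: H.
Qed.

Lemma src_indep : @mutually_independent _ _ _ P src E. Proof. by have [] := fr. Qed.

Let mev (J : set src) j d2 (B : measurableType d2) (X : Om rd -> B) : J j -> E j = events X ->
  measurable_fun setT (X : sub_sigma E J -> B).
Proof.
move=> Jj EX _ C mC; rewrite setTI; apply: sub_sigma_algebra; exists j => //.
by rewrite EX; exists C => //; rewrite setTI.
Qed.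

Lemma phi_sub (J : set src) k i : J (inl (inl (k, i))) ->
  measurable_fun setT (samF k i : sub_sigma E J -> _).
Proof. by move=> Jj; apply: (mev Jj). Qed.

Lemma xi_sub (J : set src) k i : J (inl (inr (k, i))) ->
  measurable_fun setT (samG k i : sub_sigma E J -> _).
Proof. by move=> Jj; apply: (mev Jj). Qed.

Let m345 (J : set src) k i : J (inr (k, i)) -> measurable_fun setT
  ((fun w => (sdx k i w, sdy k i w, sdz k i w)) : sub_sigma E J -> _).
Proof. by move=> Jj; apply: (mev Jj). Qed.

Lemma ux_sub (J : set src) k i : J (inr (k, i)) ->
  measurable_fun setT (sdx k i : sub_sigma E J -> _).
Proof.
by move=> /m345 H; apply: (measurableT_comp (f := fun u => u.1.1) _ H); exact: measurableT_comp.
Qed.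

Lemma uy_sub (J : set src) k i : J (inr (k, i)) ->
  measurable_fun setT (sdy k i : sub_sigma E J -> _).
Proof.
by move=> /m345 H; apply: (measurableT_comp (f := fun u => u.1.2) _ H); exact: measurableT_comp.
Qed.

Lemma uz_sub (J : set src) k i : J (inr (k, i)) ->
  measurable_fun setT (sdz k i : sub_sigma E J -> _).
Proof. by move=> /m345 H; apply: (measurableT_comp (f := snd) _ H). Qed.

End Randomness.

Lemma mvec_cmap {R : realType} {d} {dT} {T : measurableType dT} w (C : compressor R d)
    (V : T -> 'cV[R]_d) (u : T -> seed C) :
  omega_unbiased w C -> mvec V -> measurable_fun setT u -> mvec (fun t => cmap (V t) (u t)).
Proof.
move=> [_ mC _] mV mu; apply: borel_mvec.
have mVu : measurable_fun setT (fun t => ((V t : borel R d), u t)).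
  by apply: measurable_fun_pair => //; exact: mvec_borel.
exact: (measurableT_comp mC mVu).
Qed.

Record mstate {R : realType} {n p q : nat} {dT} {T : measurableType dT}
    (st : T -> state R n p q) : Prop := MState {
  ms_x : mvec (fun t => s_x (st t));
  ms_y : mvec (fun t => s_y (st t));
  ms_z : mvec (fun t => s_z (st t));
  ms_mx : forall i, mvec (fun t => s_mx (st t) i);
  ms_my : forall i, mvec (fun t => s_my (st t) i);
  ms_mz : forall i, mvec (fun t => s_mz (st t) i);
  ms_hx : forall i, mvec (fun t => s_hx (st t) i);
  ms_hhat : mvec (fun t => s_hhat (st t));
  ms_smy : mvec (fun t => s_smy (st t));
  ms_smz : mvec (fun t => s_smz (st t))
}.

Lemma mstate_comp {R : realType} {n p q : nat} {dT dT'} {T : measurableType dT}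
    {T' : measurableType dT'} (st : T -> state R n p q) (h : T' -> T) :
  measurable_fun setT h -> mstate st -> mstate (st \o h).
Proof.
move=> mh [mx my mz mmx mmy mmz mhx mhh msy msz].
split => [|||i|i|i|i|||].
- exact: mvec_comp mx mh.
- exact: mvec_comp my mh.
- exact: mvec_comp mz mh.
- exact: mvec_comp (mmx i) mh.
- exact: mvec_comp (mmy i) mh.
- exact: mvec_comp (mmz i) mh.
- exact: mvec_comp (mhx i) mh.
- exact: mvec_comp mhh mh.
- exact: mvec_comp msy mh.
- exact: mvec_comp msz mh.
Qed.

Section StepMeasurability.
Context {R : realType} {n p q : nat} {pb : problem R n p q}
  {Cu : 'I_n -> compressor R p} {Cl : 'I_n -> compressor R q} (par : hyperparams R)
  (wu wl : R).
Hypothesis reg : regular_losses pb.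
Hypothesis hCu : forall i, omega_unbiased wu (Cu i).
Hypothesis hCl : forall i, omega_unbiased wl (Cl i).

Section Generic.
Context {dT : measure_display} {T : measurableType dT} (st : T -> state R n p q)
  (F : 'I_n -> T -> Tphi pb) (G : 'I_n -> T -> Txi pb) (a : forall i, T -> seed (Cu i))
  (b b' : forall i, T -> seed (Cl i)).
Hypothesis mst : mstate st.
Hypothesis mF : forall i, measurable_fun setT (F i).
Hypothesis mG : forall i, measurable_fun setT (G i).
Hypothesis ma : forall i, measurable_fun setT (a i).
Hypothesis mb : forall i, measurable_fun setT (b i).
Hypothesis mb' : forall i, measurable_fun setT (b' i).

(** [step] matches on its state and reduces only on an explicit [State]; the version with
    projections can be rewritten on an arbitrary state. *)
Lemma stepE (s : state R n p q) phik xik (uxk : forall i, seed (Cu i))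
    (uyk uzk : forall i, seed (Cl i)) :
  step (pb := pb) par s phik xik uxk uyk uzk =
  let Dx i := dir_x (s_x s) (s_y s) (s_z s) (phik i) (xik i) in
  let Dy i := dir_y (s_x s) (s_y s) (xik i) in
  let Dz i := dir_z (s_x s) (s_y s) (s_z s) (phik i) (xik i) in
  let hx' i := (1 - theta par) *: s_hx s i + theta par *: Dx i in
  let cx i := cmap (hx' i - s_mx s i) (uxk i) in
  let cy i := cmap (Dy i - s_my s i) (uyk i) in
  let cz i := cmap (Dz i - s_mz s i) (uzk i) in
  {| s_x := s_x s - alpha par *: s_hhat s;
     s_y := s_y s - beta par *: (s_smy s + vmean cy);
     s_z := clip (rho par) (s_z s - gamma par *: (s_smz s + vmean cz));
     s_mx := fun i => s_mx s i + delta_u par *: cx i;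
     s_my := fun i => s_my s i + delta_l par *: cy i;
     s_mz := fun i => s_mz s i + delta_l par *: cz i;
     s_hx := hx';
     s_hhat := s_hhat s + delta_u par *: vmean cx;
     s_smy := s_smy s + delta_l par *: vmean cy;
     s_smz := s_smz s + delta_l par *: vmean cz |}.
Proof. by case: s. Qed.

Lemma mstate_step : mstate (fun t =>
  step par (st t) (F^~ t) (G^~ t) (fun i => a i t) (fun i => b i t) (fun i => b' i t)).
Proof.
have [mx my mz mmx mmy mmz mhx mhh msy msz] := mst.
have mc (r : R) : measurable_fun [set: T] (fun=> r) by exact: measurable_cst.
pose hx' i t := (1 - theta par) *: s_hx (st t) i +
  theta par *: dir_x (s_x (st t)) (s_y (st t)) (s_z (st t)) (F i t) (G i t).
have mhx' i : mvec (hx' i).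
  apply: mvecD; apply: mvecZ => //; exact: mvec_dir_x.
have mcx i : mvec (fun t => cmap (hx' i t - s_mx (st t) i) (a i t)).
  by apply: (mvec_cmap (hCu i)) => //; exact: mvecB.
have mcy i : mvec (fun t => cmap (dir_y (s_x (st t)) (s_y (st t)) (G i t) - s_my (st t) i) (b i t)).
  by apply: (mvec_cmap (hCl i)) => //; apply: mvecB => //; exact: mvec_dir_y.
have mcz i : mvec (fun t => cmap (dir_z (s_x (st t)) (s_y (st t)) (s_z (st t)) (F i t) (G i t)
    - s_mz (st t) i) (b' i t)).
  by apply: (mvec_cmap (hCl i)) => //; apply: mvecB => //; exact: mvec_dir_z.
under eq_fun do rewrite stepE /=.
split => /= [|||i|i|i|i|||].
- by apply: mvecB => //; exact: mvecZ.
- apply: mvecB => //; apply: mvecZ => //; apply: mvecD => //.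
  exact: (mvec_vmean mcy).
- apply: mvec_clip; apply: mvecB => //; apply: mvecZ => //; apply: mvecD => //.
  exact: (mvec_vmean mcz).
- apply: mvecD => //; apply: mvecZ => //; exact: mcx.
- apply: mvecD => //; apply: mvecZ => //; exact: mcy.
- apply: mvecD => //; apply: mvecZ => //; exact: mcz.
- exact: mhx'.
- apply: mvecD => //; apply: mvecZ => //; exact: (mvec_vmean mcx).
- apply: mvecD => //; apply: mvecZ => //; exact: (mvec_vmean mcy).
- apply: mvecD => //; apply: mvecZ => //; exact: (mvec_vmean mcz).
Qed.

End Generic.

Context (rd : randomness pb Cu Cl) (ini : initial R n p q).
Hypothesis fr : fresh_randomness rd.
Notation E := (@sources _ _ _ _ _ _ _ rd).

Definition nxt k (s : state R n p q) (w : Om rd) : state R n p q :=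
  step par s (fun i => phi k i w) (fun i => xi k i w)
    (fun i => ux k i w) (fun i => uy k i w) (fun i => uz k i w).

Lemma mstate_nxt k {dT} {T : measurableType dT} (st : T -> state R n p q)
    (h : T -> sub_sigma E (fresh k)) :
  mstate st -> measurable_fun setT h -> mstate (fun t => nxt k (st t) (h t)).
Proof.
move=> mst mh; apply: (@mstate_step _ T st (fun i t => phi k i (h t))
  (fun i t => xi k i (h t)) (fun i t => ux k i (h t)) (fun i t => uy k i (h t))
  (fun i t => uz k i (h t))) => // i.
- by apply: (measurableT_comp _ mh); exact: (phi_sub (rd := rd)).
- by apply: (measurableT_comp _ mh); exact: (xi_sub (rd := rd)).
- by apply: (measurableT_comp _ mh); exact: (ux_sub (rd := rd)).
- by apply: (measurableT_comp _ mh); exact: (uy_sub (rd := rd)).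
- by apply: (measurableT_comp _ mh); exact: (uz_sub (rd := rd)).
Qed.

Lemma mstate_efsoba k : @mstate R n p q _ (sub_sigma E (past k)) (efsoba par ini k).
Proof.
elim: k => [|k IH].
  by split => [|||i|i|i|i|||]; exact: mvec_cst.
apply: (@mstate_nxt k _ (sub_sigma E (past k.+1)) (efsoba par ini k) id).
  have mid : measurable_fun [set: sub_sigma E (past k.+1)]
      (id : sub_sigma E (past k.+1) -> sub_sigma E (past k)).
    exact: (sub_sigma_id (@past_mono n k)).
  exact: (mstate_comp mid IH).
exact: (sub_sigma_id (@fresh_past n k)).
Qed.

End StepMeasurability.

(** * One-step estimates *)

Section SmoothMeasurability.
Context {R : realType} {p q : nat}.

Lemma differentiable2_measurable (h : 'cV[R]_p -> 'cV[R]_q -> R) dT (T : measurableType dT)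
    (X : T -> 'cV[R]_p) (Y : T -> 'cV[R]_q) :
  differentiable2 h -> mvec X -> mvec Y -> measurable_fun setT (fun t => h (X t) (Y t)).
Proof.
move=> dh mX mY.
have mXY : mvec (fun t => col_mx (X t) (Y t)).
  move=> i j; under eq_fun do rewrite mxE.
  by case: (fintype.split i) => k; [exact: mX|exact: mY].
have cu : continuous (fun v : 'cV[R]_(p + q) => (usubmx v, dsubmx v)).
  move=> v B /nbhs_ballP[e /= e0 eB]; apply/nbhs_ballP; exists e => // w [_ vw].
  by apply: eB; split; split => //= i j; rewrite !mxE; exact: vw.
have ch : continuous (fun v : 'cV[R]_(p + q) => h (usubmx v) (dsubmx v)).
  move=> v; exact: (continuous_comp (cu v) (differentiable_continuous (dh (usubmx v, dsubmx v)))).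
have := mvec_continuous mXY ch.
by under eq_fun do rewrite col_mxKu col_mxKd.
Qed.

Lemma lipschitz_of_sqr a b (L : R) (h : 'cV[R]_a -> 'cV[R]_b) : 0 <= L ->
  (forall x x', enorm (h x - h x') ^+ 2 <= L * enorm (x - x') ^+ 2) ->
  lipschitz_cst (Num.sqrt L) h.
Proof.
move=> L0 H x x'; apply: enorm_ler; first by rewrite mulr_ge0 ?sqrtr_ge0 ?enorm_ge0.
by rewrite exprMn (sqr_sqrtr L0); exact: H.
Qed.

Lemma differentiable2_jmeas dT (T : measurableType dT) (h : 'cV[R]_p -> 'cV[R]_q -> R) :
  differentiable2 h -> jmeas (fun _ : T => h).
Proof. by move=> dh dT' T' s X Y _; exact: differentiable2_measurable. Qed.

End SmoothMeasurability.

Section Expectation.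
Context {d : measure_display} {T : measurableType d} {R : realType} (P : probability T R).

Lemma expect_le_add (F G : T -> R) a b c : 0 <= c ->
  (forall t, 0 <= F t) -> (forall t, 0 <= G t) ->
  measurable_fun setT F -> measurable_fun setT G ->
  (\int[P]_t (F t)%:E <= a%:E)%E -> (\int[P]_t (G t)%:E <= b%:E)%E ->
  (\int[P]_t (F t + c * G t)%:E <= (a + c * b)%:E)%E.
Proof.
move=> c0 F0 G0 mF mG Fa Gb.
under eq_integral do rewrite EFinD EFinM.
rewrite ge0_integralD //.
- rewrite ge0_integralZl //.
  + by rewrite EFinD EFinM; apply: leeD => //; apply: lee_wpmul2l.
  + exact/measurable_EFinP.
  + by move=> t _; rewrite lee_fin.
- by move=> t _; rewrite lee_fin.
- exact/measurable_EFinP.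
- by move=> t _; rewrite mule_ge0 // lee_fin.
- by apply/measurable_EFinP; exact: measurable_funM.
Qed.

Lemma expect_mean_le n (F : 'I_n -> T -> R) (a : 'I_n -> R) :
  (forall i t, 0 <= F i t) -> (forall i, measurable_fun setT (F i)) ->
  (forall i, \int[P]_t (F i t)%:E <= (a i)%:E)%E ->
  (\int[P]_t (n%:R^-1 * \sum_i F i t)%:E <= (n%:R^-1 * \sum_i a i)%:E)%E.
Proof.
move=> F0 mF Fa.
under eq_integral do rewrite EFinM -sumEFin.
rewrite ge0_integralZl //.
- rewrite EFinM; apply: lee_wpmul2l; first by rewrite lee_fin invr_ge0.
  rewrite ge0_integral_sum //.
  + by rewrite -sumEFin; apply: lee_sum => i _; exact: Fa.
  + by move=> i; exact/measurable_EFinP.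
  + by move=> i t _; rewrite lee_fin.
- by apply: emeasurable_sum => i; exact/measurable_EFinP.
- by move=> t _; apply: sume_ge0 => i _; rewrite lee_fin.
Qed.

End Expectation.

Lemma cmap_oracle {R : realType} {dO} {O : measurableType dO} (P : probability O R) d w
    (C : compressor R d) (u : O -> seed C) v :
  omega_unbiased w C -> has_law P u (seed_law C) ->
  unbiased P (fun t => cmap v (u t)) v /\
  mse_le P enorm (fun t => cmap v (u t)) v (w * enorm v ^+ 2).
Proof.
move=> [_ _ /(_ v) [uC sC]] lu; split; first exact: (has_law_unbiased lu (Z := cmap v)).
exact: (has_law_mse_le lu (Z := cmap v) (unbiased_mvec uC)).
Qed.

Section TwoLayers.
Context {d : measure_display} {O : measurableType d} {R : realType} (P : probability O R)
  {I : choiceType} (E : I -> set (set O)).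
Hypothesis E_meas : forall i, E i `<=` measurable.
Hypothesis E_I : forall i, setI_closed (E i).
Hypothesis E_T : forall i, E i setT.
Hypothesis E_indep : mutually_independent P E.
Context (J1 J2 : set I).
Hypothesis J12 : J1 `&` J2 = set0.

(* With the step 1/(1+w), the memory contracts towards any reference r, even
   one that depends on the sample through which h is built. *)
Lemma memory_contraction a w (C : compressor R a) (m : 'cV[R]_a) (h r : O -> 'cV[R]_a)
    (u : O -> seed C) :
  omega_unbiased w C -> has_law P u (seed_law C) ->
  measurable_fun setT (u : sub_sigma E J2 -> _) ->
  @mvec _ (sub_sigma E J1) R _ _ h -> @mvec _ (sub_sigma E J1) R _ _ r ->
  (\int[P]_t (enorm (m + (1 + w)^-1 *: cmap (h t - m) (u t) - r t) ^+ 2)%:E <=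
   \int[P]_t ((1 - (1 + w)^-1) * enorm (m - r t) ^+ 2
              + (1 + w)^-1 * enorm (h t - r t) ^+ 2)%:E)%E.
Proof.
move=> hC lu mu mh mr; have [w0 _ _] := hC.
pose f (v : sub_sigma E J1 * sub_sigma E J2) :=
  (enorm (m + (1 + w)^-1 *: cmap (h v.1 - m) (u v.2) - r v.1) ^+ 2)%:E.
have mf : measurable_fun setT f.
  apply/measurable_EFinP; apply: measurable_enorm2; apply: mvecB.
    apply: mvecD; first exact: mvec_cst.
    apply: mvecZ => //; apply: (mvec_cmap hC).
      by apply: mvecB; [exact: (mvec_comp mh measurable_fst)|exact: mvec_cst].
    exact: (measurableT_comp mu measurable_snd).
  exact: (mvec_comp mr measurable_fst).
have f0 v : (0 <= f v)%E by rewrite lee_fin sqr_ge0.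
rewrite (_ : (\int[P]_t (enorm (m + (1 + w)^-1 *: cmap (h t - m) (u t) - r t) ^+ 2)%:E)%E
  = (\int[P]_t f (t, t))%E) //.
rewrite (freeze2 E_meas E_I E_T E_indep J12 mf f0).
apply: le_integral_ge0 => t; first exact: integral_ge0.
have [uC sC] := cmap_oracle (h t - m) hC lu.
have -> : (\int[P]_v f (t, v))%E =
    (\int[P]_v (enorm ((m - r t) + (1 + w)^-1 *: cmap (h t - m) (u v)) ^+ 2)%:E)%E.
  by apply: eq_integral => v _; rewrite /f /= addrAC.
apply: le_trans (bias_variance (m - r t) (1 + w)^-1 uC sC) _.
rewrite lee_fin; have -> : h t - r t = (m - r t) + (h t - m) by rewrite [RHS]addrC addrA subrK.
move: (h t - m) (m - r t) => b b'.
rewrite !enorm_sqrD enorm_sqrZ dotZr.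
have w1 : 1 + w != 0 by rewrite gt_eqF // ltr_wpDr.
(* An equality: with d = 1 / (1 + w) the variance completes the quadratic term, d^2 (1 + w) = d, and
   |b' + d b|^2 + d^2 w |b|^2 becomes (1 - d) |b'|^2 + d |b' + b|^2. *)
by rewrite le_eqVlt; apply/orP; left; apply/eqP; field.
Qed.

(** Two nested freezings, the samples first and then the seeds, each with orthogonal noises across
    workers; [K1 i] and [K2 i] are worker i's own sources in the two layers. The sampling variance
    counts 1 + w times: once in the mean of the directions, and w times through the compressed
    vectors. *)
Lemma aggregate_variance n a (w s : R) (C : 'I_n -> compressor R a) (D : 'I_n -> O -> 'cV[R]_a)
    (M mv : 'I_n -> 'cV[R]_a) (u : forall i, O -> seed (C i)) (K1 K2 : 'I_n -> set I) (b : 'cV[R]_a) (c : R) :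
  (0 < n)%N -> 0 <= w ->
  (forall i j, i != j -> K1 i `&` K1 j = set0) -> (forall i j, i != j -> K2 i `&` K2 j = set0) ->
  (forall i, K1 i `<=` J1) -> (forall i, K2 i `<=` J2) ->
  (forall i, omega_unbiased w (C i)) -> (forall i, has_law P (u i) (seed_law (C i))) ->
  (forall i, measurable_fun setT (u i : sub_sigma E (K2 i) -> _)) ->
  (forall i, @mvec _ (sub_sigma E (K1 i)) R _ _ (D i)) ->
  (forall i, unbiased P (D i) (M i)) -> (forall i, mse_le P enorm (D i) (M i) s) ->
  (\int[P]_t (enorm (b + c *: (vmean mv + vmean (fun i => cmap (D i t - mv i) (u i t)))) ^+ 2)%:E <=
   (enorm (b + c *: vmean M) ^+ 2 +
    c ^+ 2 / n%:R * ((1 + w) * s + w * (n%:R^-1 * \sum_i enorm (M i - mv i) ^+ 2)))%:E)%E.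
Proof.
move=> n0 w0 dK1 dK2 K1J K2J hC lu mu mD uD sD.
have nn0 : (n%:R : R) != 0 by rewrite pnatr_eq0 -lt0n.
have mDJ i : @mvec _ (sub_sigma E J1) R _ _ (D i).
  by move=> i' j'; apply: sub_sigma_mono (mD i i' j'); exact: K1J.
have mDO i : mvec (D i).
  by move=> i' j'; exact: (measurable_sub_sigma E_meas (mD i i' j')).
have muJ i : measurable_fun setT (u i : sub_sigma E J2 -> _).
  by apply: sub_sigma_mono (mu i); exact: K2J.
pose f (v : sub_sigma E J1 * sub_sigma E J2) :=
  (enorm (b + c *: (vmean mv + vmean (fun i => cmap (D i v.1 - mv i) (u i v.2)))) ^+ 2)%:E.
have mcm i : mvec (fun v : sub_sigma E J1 * sub_sigma E J2 => cmap (D i v.1 - mv i) (u i v.2)).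
  apply: (mvec_cmap (hC i)).
    by apply: mvecB; [exact: (mvec_comp (mDJ i) measurable_fst)|exact: mvec_cst].
  exact: (measurableT_comp (muJ i) measurable_snd).
have mf : measurable_fun setT f.
  apply/measurable_EFinP; apply: measurable_enorm2; apply: mvecD; first exact: mvec_cst.
  apply: mvecZ => //; apply: mvecD; first exact: mvec_cst.
  exact: (mvec_vmean mcm).
have f0 v : (0 <= f v)%E by rewrite lee_fin sqr_ge0.
rewrite (_ : (\int[P]_t (enorm (b + c *: (vmean mv + vmean (fun i => cmap (D i t - mv i) (u i t)))) ^+ 2)%:E)%E
  = (\int[P]_t f (t, t))%E) //.
rewrite (freeze2 E_meas E_I E_T E_indep J12 mf f0).
pose F t := enorm (b + (c / n%:R) *: \sum_i D i t) ^+ 2.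
pose G t := n%:R^-1 * \sum_i enorm (D i t - mv i) ^+ 2.
(* The seeds are integrated out here: F is the error of the uncompressed aggregate and G the mean
   squared length of the vectors that were compressed. *)
apply: (@le_trans _ _ (\int[P]_t (F t + c ^+ 2 / n%:R * w * G t)%:E)%E).
  apply: le_integral_ge0 => t; first exact: integral_ge0.
  have oC i := cmap_oracle (D i t - mv i) (hC i) (lu i).
  have mC i : @mvec _ (sub_sigma E (K2 i)) R _ _ (fun v => cmap (D i t - mv i) (u i v)).
    by apply: (mvec_cmap (hC i)) => //; exact: mvec_cst.
  have := indep_sum_variance E_meas E_I E_T E_indep (b + c *: vmean mv) (c / n%:R)
    (index_enum_uniq 'I_n) dK2 mC (fun i => (oC i).1) (fun i => (oC i).2).
  have -> : (\int[P]_v f (t, v))%E = (\int[P]_v (enorm (b + c *: vmean mv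
      + (c / n%:R) *: \sum_i cmap (D i t - mv i) (u i v)) ^+ 2)%:E)%E.
    apply: eq_integral => v _; rewrite /f /= scalerDr addrA; congr ((enorm (_ + _) ^+ 2)%:E).
    by rewrite /vmean scalerA.
  move=> /le_trans; apply; rewrite lee_fin.
  have -> : b + c *: vmean mv + (c / n%:R) *: \sum_i (D i t - mv i) =
      b + (c / n%:R) *: \sum_i D i t.
    by rewrite sumrB /vmean scalerBr scalerA -addrA (addrC (_ *: _)) subrK.
  rewrite lerD2l /G -mulr_sumr le_eqVlt; apply/orP; left; apply/eqP.
  by move: (\sum_i _) => S; field.
have mF : measurable_fun setT F.
  apply: measurable_enorm2; apply: mvecD; first exact: mvec_cst.
  by apply: mvecZ => //; exact: mvec_sum.
have mGi i : measurable_fun setT (fun t => enorm (D i t - mv i) ^+ 2).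
  by apply: measurable_enorm2; apply: mvecB => //; exact: mvec_cst.
have Fle : (\int[P]_t (F t)%:E <= (enorm (b + c *: vmean M) ^+ 2 + c ^+ 2 / n%:R * s)%:E)%E.
  have := indep_sum_variance E_meas E_I E_T E_indep b (c / n%:R)
    (index_enum_uniq 'I_n) dK1 mD uD sD.
  move=> /le_trans; apply; rewrite lee_fin sumr_const card_ord -[s *+ n]mulr_natl.
  by rewrite /vmean scalerA lerD2l le_eqVlt; apply/orP; left; apply/eqP; field.
have Gle : (\int[P]_t (G t)%:E <= (n%:R^-1 * \sum_i (enorm (M i - mv i) ^+ 2 + s))%:E)%E.
  apply: expect_mean_le => // [i t|i]; first exact: sqr_ge0.
  under eq_integral do rewrite -[D i _]scale1r addrC.
  apply: le_trans (bias_variance (- mv i) 1 (uD i) (sD i)) _.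
  by rewrite scale1r expr1n mul1r (addrC (- mv i)).
apply: le_trans (expect_le_add _ _ _ mF _ Fle Gle) _.
- by rewrite mulr_ge0 // divr_ge0 // sqr_ge0.
- by move=> t; exact: sqr_ge0.
- by move=> t; rewrite mulr_ge0 ?invr_ge0 // sumr_ge0 // => i _; exact: sqr_ge0.
- by apply: measurable_funM => //; apply: measurable_sum => i; exact: mGi.
rewrite lee_fin big_split /= mulrDr (mean_cst n0).
rewrite le_eqVlt; apply/orP; left; apply/eqP.
by move: (\sum_i _) => S; field.
Qed.

(** Contraction towards the new reference r', followed by Young's inequality to return to the old r.
    The parameter 1 / (1 + 2 w) is chosen so that (1 - d) (1 + 1 / (1 + 2 w)) = 1 - 1 / (1 + 2 w)
    for d = 1 / (1 + w): about half of the contraction survives, and the motion of the reference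
    costs 2 + 2 w. *)
Lemma memory_tracking a (w sg : R) (C : compressor R a) (m M r r' : 'cV[R]_a) (D : O -> 'cV[R]_a)
    (u : O -> seed C) :
  omega_unbiased w C -> has_law P u (seed_law C) ->
  measurable_fun setT (u : sub_sigma E J2 -> _) -> @mvec _ (sub_sigma E J1) R _ _ D ->
  unbiased P D M -> mse_le P enorm D M sg ->
  (\int[P]_t (enorm (m + (1 + w)^-1 *: cmap (D t - m) (u t) - r') ^+ 2)%:E <=
   ((1 - (1 + 2 * w)^-1) * enorm (m - r) ^+ 2
    + (2 / (1 + 2 * w) * (enorm (M - r) ^+ 2 + sg) + (2 + 2 * w) * enorm (r - r') ^+ 2))%:E)%E.
Proof.
move=> hC lu mu mD uD sD; have [w0 _ _] := hC.
have mr : @mvec _ (sub_sigma E J1) R _ _ (fun _ : O => r') by exact: mvec_cst.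
apply: le_trans (memory_contraction m hC lu mu mD mr) _.
have mDO : mvec D by move=> i j; exact: (measurable_sub_sigma E_meas (mD i j)).
have w1 : 0 < 1 + w by rewrite ltr_wpDr.
have w2 : 0 < 1 + 2 * w by rewrite ltr_wpDr // mulr_ge0.
have cst : (\int[P]_t (((1 - (1 + w)^-1) * enorm (m - r') ^+ 2)%:E) <=
    ((1 - (1 + w)^-1) * enorm (m - r') ^+ 2)%:E)%E by rewrite integral_prob_cst.
have Dle : (\int[P]_t (enorm (D t - r') ^+ 2)%:E <= (enorm (M - r') ^+ 2 + sg)%:E)%E.
  under eq_integral do rewrite -[D _]scale1r addrC.
  apply: le_trans (bias_variance (- r') 1 uD sD) _.
  by rewrite scale1r expr1n mul1r (addrC (- r')).
have d1 : (1 + w)^-1 <= 1 by rewrite invf_le1 // lerDl.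
have sg0 : 0 <= sg.
  rewrite -lee_fin; apply: le_trans sD; apply: integral_ge0 => t _.
  by rewrite lee_fin sqr_ge0.
apply: le_trans (expect_le_add _ _ _ _ _ cst Dle) _ => //.
- by rewrite invr_ge0 ltW.
- by move=> t; rewrite mulr_ge0 ?sqr_ge0 // subr_ge0.
- by move=> t; exact: sqr_ge0.
- by apply: measurable_enorm2; apply: mvecB => //; exact: mvec_cst.
rewrite lee_fin.
have y1 := young (m - r) (r - r') (_ : 0 < (1 + 2 * w)^-1); rewrite addrA subrK invrK in y1.
have y2 := young (M - r) (r - r') (_ : 0 < (1 + 2 * w)^-1); rewrite addrA subrK invrK in y2.
move: {y1 y2} (y1 (etrans (invr_gt0 _) w2)) (y2 (etrans (invr_gt0 _) w2)).
move: (enorm (m - r') ^+ 2) (enorm (m - r) ^+ 2) (enorm (M - r') ^+ 2) (enorm (M - r) ^+ 2)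
  (enorm (r - r') ^+ 2) => A1 A2 B1 B2 D1 y1 y2.
have dg0 : 0 <= 1 - (1 + w)^-1 by rewrite subr_ge0.
have dp0 : 0 <= (1 + w)^-1 by rewrite invr_ge0 ltW.
have H1 := ler_wpM2l dg0 y1; have H2 := ler_wpM2l dp0 y2.
have H3 : 0 <= sg * ((1 + w)^-1 * (1 + 2 * w)^-1).
  by rewrite mulr_ge0 // mulr_ge0 // invr_ge0 ltW.
(* The only slack left over is in the noise, where 1 / (1 + w) is rounded up to 2 / (1 + 2 w). *)
have E0 : (1 - (1 + 2 * w)^-1) * A2 + (2 / (1 + 2 * w) * (B2 + sg) + (2 + 2 * w) * D1) =
  (1 - (1 + w)^-1) * ((1 + (1 + 2 * w)^-1) * A2 + (1 + (1 + 2 * w)) * D1) +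
  ((1 + w)^-1 * ((1 + (1 + 2 * w)^-1) * B2 + (1 + (1 + 2 * w)) * D1) + (1 + w)^-1 * sg)
  + sg * ((1 + w)^-1 * (1 + 2 * w)^-1).
  by field; rewrite !gt_eqF.
by rewrite E0; lra.
Qed.

End TwoLayers.

Section OneStep.
Context {R : realType} {n p q : nat} (pb : problem R n p q) (c : constants R)
  (Cu : 'I_n -> compressor R p) (Cl : 'I_n -> compressor R q) (rd : randomness pb Cu Cl)
  (par : hyperparams R) (sigma wu wl : R).
Hypothesis n0 : (0 < n)%N.
Hypothesis q0 : (0 < q)%N.
Hypothesis reg : regular_losses pb.
Hypothesis cont : continuity_assumption pb c.
Hypothesis sc : strong_convexity_assumption pb c.
Hypothesis noise : noise_assumption pb sigma.
Hypothesis dl : derived_lipschitz pb c.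
Hypothesis hCu : forall i, omega_unbiased wu (Cu i).
Hypothesis hCl : forall i, omega_unbiased wl (Cl i).
Hypothesis fr : fresh_randomness rd.
Hypothesis rho_ge : C_f c / mu_g c <= rho par.
Hypothesis rho_gt0 : 0 < rho par.

Notation P := (Pr rd).
Notation E := (@sources _ _ _ _ _ _ _ rd).
Notation ys := (ystar pb).
Notation zs := (zstar pb).
Notation s1 := (sigma1sq par sigma).
Notation src := (src (n := n)).
Notation refx := (refx pb).
Notation refy := (refy pb).
Notation refz := (refz pb).

Definition coherent (st : state R n p q) :=
  [/\ s_hhat st = vmean (s_mx st), s_smy st = vmean (s_my st),
      s_smz st = vmean (s_mz st) & enorm (s_z st) <= rho par].

Definition errY (st : state R n p q) := enorm (s_y st - ys (s_x st)) ^+ 2.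
Definition errZ (st : state R n p q) := enorm (s_z st - zs (s_x st)) ^+ 2.
Definition errRy (st : state R n p q) := n%:R^-1 * \sum_i enorm (s_my st i - refy i (s_x st)) ^+ 2.
Definition errRz (st : state R n p q) := n%:R^-1 * \sum_i enorm (s_mz st i - refz i (s_x st)) ^+ 2.
Definition errS (s : 'I_n -> 'cV[R]_p) := n%:R^-1 * \sum_i enorm (s i) ^+ 2.
(** The memory is compared with the momentum minus the lag. The input of the compressor then differs
    from this target by the lag alone, which is why the lag enters [step_M] with the small
    coefficient (1 + wu)^-1. *)
Definition errM (st : state R n p q) (s : 'I_n -> 'cV[R]_p) :=
  n%:R^-1 * \sum_i enorm (s_mx st i - (s_hx st i - s i)) ^+ 2.
Definition errW (st : state R n p q) (s : 'I_n -> 'cV[R]_p) :=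
  n%:R^-1 * \sum_i enorm (refx i (s_x st) - s_hx st i + s i) ^+ 2.
(** The norm of the mean, against the mean of the norms in [errW]: its sampling noise is smaller by
    1/n, and it is the error that the descent of Phi feels. The larger [errW] matters only through
    compression. *)
Definition errB (st : state R n p q) (s : 'I_n -> 'cV[R]_p) :=
  enorm (vmean (fun i => refx i (s_x st) - s_hx st i + s i)) ^+ 2.

(* The part of the momentum error that is due to the inexactness of y and z. *)
Definition drift (st : state R n p q) (s : 'I_n -> 'cV[R]_p) i :=
  (1 - theta par) *: s i +
  theta par *: (mDx pb i (s_x st) (s_y st) (s_z st) - refx i (s_x st)).

Context (k : nat) (st : state R n p q) (s : 'I_n -> 'cV[R]_p).
Hypothesis coh : coherent st.
Notation nx := (@nxt _ _ _ _ pb Cu Cl par rd k st).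
Notation x := (s_x st).
Notation y := (s_y st).
Notation z := (s_z st).
Notation x' := (x - alpha par *: vmean (s_mx st)).
Notation X := (enorm (x' - x) ^+ 2).
Notation Dx := (fun i w => dir_x x y z (phi k i w) (xi k i w)).
Notation Dy := (fun i w => dir_y x y (xi k i w)).
Notation Dz := (fun i w => dir_z x y z (phi k i w) (xi k i w)).

Lemma nxE w : s_x (nx w) = x'.
Proof. by rewrite /nxt stepE /=; have [-> _ _ _] := coh. Qed.

Lemma coherent_nxt w : coherent (nx w).
Proof.
have [hh my mz _] := coh; rewrite /nxt stepE; split => /=.
- by rewrite hh -vmeanZ -vmeanD.
- by rewrite my -vmeanZ -vmeanD.
- by rewrite mz -vmeanZ -vmeanD.
- exact: clip_le.
Qed.

Lemma mnx : mstate nx.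
Proof.
have H : @mstate _ _ _ _ _ (sub_sigma E (fresh k)) nx.
  apply: (mstate_nxt par reg hCu hCl (rd := rd) (k := k) (T := sub_sigma E (fresh k))
    (st := fun=> st) (h := id)) => //.
  by split => [|||i|i|i|i|||]; exact: mvec_cst.
have sub d (f : sub_sigma E (fresh k) -> 'cV[R]_d) : mvec f -> @mvec _ (Om rd) _ _ _ f.
  by move=> mf i j; exact: (measurable_sub_sigma (src_meas fr) (mf i j)).
by case: H => *; split => *; exact: sub.
Qed.

Definition worker i : set src := [set inl (inl (k, i)); inl (inr (k, i))].
Definition wseed i : set src := [set inr (k, i)].

Lemma worker_disj i j : i != j -> worker i `&` worker j = set0.
Proof.
move=> ij; apply/seteqP; split => // a [/= H1 H2].
by case: H1 H2 => -> [] // [e]; rewrite e eqxx in ij.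
Qed.

Lemma wseed_disj i j : i != j -> wseed i `&` wseed j = set0.
Proof.
move=> ij; apply/seteqP; split => // a [/= -> [e]].
by rewrite e eqxx in ij.
Qed.

Lemma worker_samples i : worker i `<=` samples k.
Proof. by move=> a [] ->. Qed.

Lemma wseed_seeds i : wseed i `<=` seeds k.
Proof. by move=> a ->. Qed.

Let laws i : [/\ has_law P (phi k i) (Df pb i), has_law P (xi k i) (Dg pb i),
  has_law P (ux k i) (seed_law (Cu i)), has_law P (uy k i) (seed_law (Cl i)) &
  has_law P (uz k i) (seed_law (Cl i))].
Proof. by have [/(_ k i)] := fr. Qed.

Let mphi (J : set src) i : worker i `<=` J ->
  measurable_fun setT (phi k i : sub_sigma E J -> Tphi pb).
Proof. by move=> H; apply: phi_sub; apply: H; left. Qed.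

Let mxi (J : set src) i : worker i `<=` J ->
  measurable_fun setT (xi k i : sub_sigma E J -> Txi pb).
Proof. by move=> H; apply: xi_sub; apply: H; right. Qed.

Lemma mvec_Dx (J : set src) i : worker i `<=` J -> @mvec _ (sub_sigma E J) R _ _ (Dx i).
Proof.
by move=> H; apply: (mvec_dir_x reg (mphi H) (mxi H)); exact: mvec_cst.
Qed.

Lemma mvec_Dy (J : set src) i : worker i `<=` J -> @mvec _ (sub_sigma E J) R _ _ (Dy i).
Proof.
by move=> H; apply: (mvec_dir_y reg (mxi H)); exact: mvec_cst.
Qed.

Lemma mvec_Dz (J : set src) i : worker i `<=` J -> @mvec _ (sub_sigma E J) R _ _ (Dz i).
Proof.
by move=> H; apply: (mvec_dir_z reg (mphi H) (mxi H)); exact: mvec_cst.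
Qed.

Lemma oracle_y i : unbiased P (Dy i) (mDy pb i x y) /\
  mse_le P enorm (Dy i) (mDy pb i x y) (sigma ^+ 2).
Proof. by have [_ lx _ _ _] := laws i; exact: (dir_y_oracle reg noise x y lx). Qed.

Let gfree i : [set inl (inr (k, i))] `&` [set inl (inl (k, i))] = set0 :> set src.
Proof. by apply/seteqP; split => // a [/= ->]. Qed.

Let s1_ge : enorm z <= rho par -> sigma ^+ 2 * enorm z ^+ 2 + sigma ^+ 2 <= s1.
Proof.
move=> zr; rewrite /sigma1sq mulrDr mulr1 addrC lerD2l ler_wpM2l ?sqr_ge0 //.
by apply: sqr_le => //; exact: enorm_ge0.
Qed.

Lemma oracle_x i : unbiased P (Dx i) (mDx pb i x y z) /\
  mse_le P enorm (Dx i) (mDx pb i x y z) s1.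
Proof.
have [lp lx _ _ _] := laws i; have [_ _ _ zr] := coh.
have [uH sH] := hess_xyG_oracle reg noise x y z lx.
have [uF sF] := gradxF_oracle reg noise x y lp.
split; first exact: unbiasedD.
apply: (@le_trans _ _ (sigma ^+ 2 * enorm z ^+ 2 + sigma ^+ 2)%:E); last first.
  by rewrite lee_fin; exact: s1_ge.
apply: (independent_mseD (src_meas fr) (@src_setI _ _ _ _ _ _ _ rd)
  (@src_setT _ _ _ _ _ _ _ rd) (src_indep fr) (gfree i)) => //.
  apply: mvecM; last exact: mvec_cst.
  by apply: (mvec_hess_xyG reg); [exact: (xi_sub (rd := rd))|exact: mvec_cst|exact: mvec_cst].
by apply: (mvec_gradxF reg); [exact: (phi_sub (rd := rd))|exact: mvec_cst|exact: mvec_cst].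
Qed.

Lemma oracle_z i : unbiased P (Dz i) (mDz pb i x y z) /\
  mse_le P enorm (Dz i) (mDz pb i x y z) s1.
Proof.
have [lp lx _ _ _] := laws i; have [_ _ _ zr] := coh.
have [uH sH] := hess_yyG_oracle reg noise x y z lx.
have [uF sF] := gradyF_oracle reg noise x y lp.
split; first exact: unbiasedD.
apply: (@le_trans _ _ (sigma ^+ 2 * enorm z ^+ 2 + sigma ^+ 2)%:E); last first.
  by rewrite lee_fin; exact: s1_ge.
apply: (independent_mseD (src_meas fr) (@src_setI _ _ _ _ _ _ _ rd)
  (@src_setT _ _ _ _ _ _ _ rd) (src_indep fr) (gfree i)) => //.
  apply: mvecM; last exact: mvec_cst.
  by apply: (mvec_hess_yyG reg); [exact: (xi_sub (rd := rd))|exact: mvec_cst|exact: mvec_cst].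
by apply: (mvec_gradyF reg); [exact: (phi_sub (rd := rd))|exact: mvec_cst|exact: mvec_cst].
Qed.

Let Emeas := src_meas fr.
Let EI : forall i : src, setI_closed (E i) := @src_setI _ _ _ _ _ _ _ rd.
Let ET : forall i : src, E i setT := @src_setT _ _ _ _ _ _ _ rd.
Let Eind := src_indep fr.

Lemma nx_hx w i : s_hx (nx w) i = (1 - theta par) *: s_hx st i + theta par *: Dx i w.
Proof. by rewrite /nxt stepE. Qed.

Lemma nx_mx w i : s_mx (nx w) i =
  s_mx st i + delta_u par *: cmap (s_hx (nx w) i - s_mx st i) (ux k i w).
Proof. by rewrite /nxt stepE. Qed.

Lemma nx_my w i : s_my (nx w) i =
  s_my st i + delta_l par *: cmap (Dy i w - s_my st i) (uy k i w).
Proof. by rewrite /nxt stepE. Qed.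

Lemma nx_mz w i : s_mz (nx w) i =
  s_mz st i + delta_l par *: cmap (Dz i w - s_mz st i) (uz k i w).
Proof. by rewrite /nxt stepE. Qed.

Lemma nx_y w : s_y (nx w) = y - beta par *:
  (vmean (s_my st) + vmean (fun i => cmap (Dy i w - s_my st i) (uy k i w))).
Proof. by have [_ <- _ _] := coh; rewrite /nxt stepE. Qed.

Lemma nx_z w : s_z (nx w) = clip (rho par) (z - gamma par *:
  (vmean (s_mz st) + vmean (fun i => cmap (Dz i w - s_mz st i) (uz k i w)))).
Proof. by have [_ _ <- _] := coh; rewrite /nxt stepE. Qed.

Lemma enorm_convex_shift d t (u v : 'cV[R]_d) : 0 < t <= 1 ->
  enorm ((1 - t) *: u + v) ^+ 2 <= (1 - t) * enorm u ^+ 2 + t^-1 * enorm v ^+ 2.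
Proof.
move=> /andP[t0 t1]; have t01 : 0 <= t <= 1 by rewrite ltW.
have := enorm_convex u (t^-1 *: v) t01.
rewrite scalerA divff ?gt_eqF // scale1r enorm_sqrZ => /le_trans; apply.
by rewrite lerD2l expr2 !mulrA divff ?gt_eqF // mul1r.
Qed.

(** A contraction of the norm, not merely of its square, leaves room for the shift: u is 1 - t times
    a vector no longer than w, and a convex combination with v / t keeps the whole rate 1 - t. At t
    = 1 the vector u vanishes. *)
Lemma enorm_contraction_shift d t (u v w : 'cV[R]_d) : 0 < t <= 1 ->
  enorm u ^+ 2 <= (1 - t) ^+ 2 * enorm w ^+ 2 ->
  enorm (u + v) ^+ 2 <= (1 - t) * enorm w ^+ 2 + t^-1 * enorm v ^+ 2.
Proof.
move=> /[dup] t01 /andP[t0 t1] H.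
have [t1'|tn] := eqVneq t 1.
  rewrite t1' subrr expr0n mul0r in H.
  have /eqP : enorm u ^+ 2 = 0 by apply/eqP; rewrite eq_le H sqr_ge0.
  by rewrite expf_eq0 => /eqP/enorm_eq0 ->; rewrite t1' subrr mul0r !add0r invr1 mul1r.
have s0 : 0 < 1 - t by rewrite subr_gt0 lt_neqAle tn.
have := enorm_convex_shift ((1 - t)^-1 *: u) v t01.
rewrite scalerA divff ?gt_eqF // scale1r enorm_sqrZ => /le_trans; apply.
rewrite lerD2r ler_pM2l // exprVn mulrC ler_pdivrMr ?exprn_gt0 //.
by rewrite mulrC.
Qed.

Lemma mean_affine (a b : R) (u : 'I_n -> R) :
  n%:R^-1 * \sum_i (a * u i + b) = a * (n%:R^-1 * \sum_i u i) + b.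
Proof. by rewrite big_split /= mulrDr (mean_cst n0) -mulr_sumr mulrCA. Qed.

(** The polarization identity expresses -<G, m> through |G - m|^2, |G|^2 and |m|^2. The difference G
    - m splits into the momentum error and the memory error, between which the lag s cancels. *)
Lemma step_Phi : 0 < alpha par -> 2 * alpha par * L_Phi c <= 1 ->
  2 / alpha par * Phi pb x' <= 2 / alpha par * Phi pb x - enorm (grad (Phi pb) x) ^+ 2
    - X / (2 * alpha par ^+ 2) + 2 * errM st s + 2 * errB st s.
Proof.
move=> a0 aL; set G := grad (Phi pb) x; set m := vmean (s_mx st).
have XE : X = alpha par ^+ 2 * enorm m ^+ 2.
  by rewrite (addrC x) addrK enormN enorm_sqrZ.
have := Phi_descent n0 cont sc dl x (- (alpha par *: m)); rewrite -/G enormN enorm_sqrZ dotNr dotZr => D.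
have Gm : enorm (G - m) ^+ 2 <= 2 * errB st s + 2 * errM st s.
  have -> : G - m = vmean (fun i => refx i x - s_hx st i + s i) -
      vmean (fun i => s_mx st i - (s_hx st i - s i)).
    rewrite /G (grad_PhiE n0 cont sc dl x) -!vmeanB; congr (vmean _); apply/funext => i.
    by move: (refx i x) => u; apply/matrixP => a b; rewrite !mxE; ring.
  apply: le_trans (enorm_sqrD2 _ _) _; rewrite enormN lerD2l ler_pM2l //.
  exact: vmean_enorm_sqr.
rewrite enorm_sqrB in Gm; rewrite XE.
have -> : 2 / alpha par * Phi pb x - enorm G ^+ 2 - alpha par ^+ 2 * enorm m ^+ 2 / (2 * alpha par ^+ 2)
    + 2 * errM st s + 2 * errB st s = 2 / alpha par * (Phi pb x + alpha par / 2 *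
    (2 * errM st s + 2 * errB st s - enorm G ^+ 2 - enorm m ^+ 2 / 2)).
  by field; rewrite gt_eqF.
rewrite ler_pM2l ?divr_gt0 //; apply: le_trans D _; rewrite -addrA lerD2l.
(* The step-size condition spends half of the available -(alpha / 2) |m|^2 on the smoothness term;
   the other half becomes -X / (2 alpha^2), which pays for the motion of x in all other errors. *)
have H1 : L_Phi c / 2 * (alpha par ^+ 2 * enorm m ^+ 2) <= alpha par / 4 * enorm m ^+ 2.
  rewrite mulrA; apply: ler_wpM2r; first exact: sqr_ge0.
  by rewrite expr2; nra.
have H2 := ler_wpM2l (ltW a0) Gm.
by move: H1 H2; move: (enorm m ^+ 2) (enorm G ^+ 2) (errB st s) (errM st s) (dot G m) => *; lra.
Qed.

(** [drift] adds to the lag exactly the inexactness that the new sample brings into the momentum. In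
    expectation the corrected error is therefore (1 - theta) times the old one plus the motion of
    the reference, with no trace of y or z. *)
Lemma step_W : 0 < theta par <= 1 ->
  (\int[P]_w (errW (nx w) (drift st s))%:E <=
    ((1 - theta par) * errW st s + (3 / theta par * L5sq c par * X + theta par ^+ 2 * s1))%:E)%E.
Proof.
move=> t01; have [t0 t1] := andP t01.
rewrite /errW; under eq_integral do rewrite nxE.
rewrite -mean_affine.
apply: (expect_mean_le (F := fun i w => enorm (refx i x' - s_hx (nx w) i + drift st s i) ^+ 2)) => [i w|i|i].
- exact: sqr_ge0.
- apply: measurable_enorm2; apply: mvecD; last exact: mvec_cst.
  by apply: mvecB; [exact: mvec_cst|exact: (ms_hx mnx)].
have [uD sD] := oracle_x i.
have E0 w : refx i x' - s_hx (nx w) i + drift st s i =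
    (refx i x' - (1 - theta par) *: s_hx st i + drift st s i) + (- theta par) *: Dx i w.
  rewrite nx_hx; move: (Dx i w) (refx i x') (drift st s i) => u v v'.
  by apply/matrixP => i' j'; rewrite !mxE; ring.
under eq_integral do rewrite E0.
have := bias_variance (refx i x' - (1 - theta par) *: s_hx st i + drift st s i) (- theta par) uD sD.
move=> /le_trans; apply; rewrite lee_fin sqrrN [leRHS]addrA lerD2r.
have -> : refx i x' - (1 - theta par) *: s_hx st i + drift st s i + - theta par *: mDx pb i x y z =
    (1 - theta par) *: (refx i x - s_hx st i + s i) + (refx i x' - refx i x).
  rewrite /drift; move: (refx i x') (refx i x) (mDx pb i x y z) => u v v'.
  by apply/matrixP => a b; rewrite !mxE; ring.
apply: le_trans (enorm_convex_shift _ _ t01) _; rewrite lerD2l.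
have := refx_lipschitz n0 cont sc dl rho_ge i x' x.
rewrite -(ler_pM2l (_ : 0 < (theta par)^-1)) ?invr_gt0 //.
by move=> /le_trans; apply; rewrite le_eqVlt; apply/orP; left; apply/eqP; ring.
Qed.

(** The same cancellation after averaging: orthogonality of the workers divides the noise by n, and
    the averaged reference is the hypergradient, so L_Phi replaces the constant of a single
    worker. *)
Lemma step_B : 0 < theta par <= 1 ->
  (\int[P]_w (errB (nx w) (drift st s))%:E <=
    ((1 - theta par) * errB st s + ((theta par)^-1 * L_Phi c ^+ 2 * X
      + theta par ^+ 2 * s1 / n%:R))%:E)%E.
Proof.
move=> t01; have [t0 t1] := andP t01.
have nn0 : (n%:R : R) != 0 by rewrite pnatr_eq0 -lt0n.
pose a := vmean (fun i => refx i x' - (1 - theta par) *: s_hx st i + drift st s i).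
have E0 w : vmean (fun i => refx i x' - s_hx (nx w) i + drift st s i) =
    a + (- theta par / n%:R) *: \sum_i Dx i w.
  have -> : (- theta par / n%:R) *: \sum_i Dx i w = vmean (fun i => (- theta par) *: Dx i w).
    by rewrite vmeanZ /vmean scalerA.
  rewrite -vmeanD; congr (vmean _); apply/funext => i.
  rewrite nx_hx; move: (Dx i w) (refx i x') (drift st s i) => u v v'.
  by apply/matrixP => i' j'; rewrite !mxE; ring.
rewrite /errB; under eq_integral do rewrite nxE E0.
have := indep_sum_variance Emeas EI ET Eind a (- theta par / n%:R) (index_enum_uniq 'I_n)
  worker_disj (fun i => mvec_Dx (@subset_refl _ (worker i))) (fun i => (oracle_x i).1) (fun i => (oracle_x i).2).
move=> /le_trans; apply; rewrite lee_fin.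
have -> : a + (- theta par / n%:R) *: \sum_i mDx pb i x y z =
    (1 - theta par) *: vmean (fun i => refx i x - s_hx st i + s i) +
    (grad (Phi pb) x' - grad (Phi pb) x).
  have -> : (- theta par / n%:R) *: \sum_i mDx pb i x y z = vmean (fun i => (- theta par) *: mDx pb i x y z).
    by rewrite vmeanZ /vmean scalerA.
  rewrite (grad_PhiE n0 cont sc dl x) (grad_PhiE n0 cont sc dl x') -[(1 - theta par) *: vmean _]vmeanZ -vmeanB -!vmeanD.
  congr (vmean _); apply/funext => i; rewrite /drift.
  move: (refx i x') (refx i x) (mDx pb i x y z) => u v v'.
  by apply/matrixP => i' j'; rewrite !mxE; ring.
rewrite sumr_const card_ord -[s1 *+ n]mulr_natl [leRHS]addrA; apply: lerD; last first.
  by rewrite le_eqVlt; apply/orP; left; apply/eqP; field.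
apply: le_trans (enorm_convex_shift _ _ t01) _; rewrite lerD2l -mulrA.
apply: ler_wpM2l; first by rewrite invr_ge0 ltW.
have [_ [LP _ _]] := dl.
by rewrite -exprMn; apply: sqr_le; [exact: enorm_ge0|exact: LP].
Qed.

(** The new lag is a convex combination, so the inexactness enters with the factor theta; treating
    it as a perturbation of the momentum would cost 1 / theta on its square. *)
Lemma step_S : 0 < theta par <= 1 ->
  errS (drift st s) <= (1 - theta par) * errS s +
    theta par * (3 * L2sq c par * errY st + 3 * L_g c ^+ 2 * errZ st).
Proof.
move=> /andP[t0 t1]; rewrite /errS -mean_affine; apply: mean_le => i.
have t01 : 0 <= theta par <= 1 by rewrite ltW.
apply: le_trans (enorm_convex (s i) _ t01) _; rewrite lerD2l; apply: ler_wpM2l; first exact: ltW.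
exact: (mDx_ref n0 cont sc rho_ge).
Qed.

(** [memory_contraction] is applied to the random reference h - s', with h the new momentum and s'
    the new lag. The distance from the compressor's input h to it is the deterministic lag, and the
    old memory misses it by the old error minus theta times the momentum error, up to sampling
    noise. *)
Lemma step_M : 0 < theta par <= 1 -> delta_u par = (1 + wu)^-1 ->
  (\int[P]_w (errM (nx w) (drift st s))%:E <=
    ((1 - (2 * (1 + wu))^-1) * errM st s
     + (wu * (1 + 2 * wu) / (1 + wu) * theta par ^+ 2 * errW st s)
     + (wu / (1 + wu) * theta par ^+ 2 * s1) + (1 + wu)^-1 * errS (drift st s))%:E)%E.
Proof.
move=> t01 du; have [t0 t1] := andP t01.
have wu0 : 0 <= wu by have [] := hCu (Ordinal n0).
have w1 : 0 < 1 + wu by rewrite ltr_wpDr.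
pose b i := (1 - (2 * (1 + wu))^-1) * enorm (s_mx st i - (s_hx st i - s i)) ^+ 2
  + wu * (1 + 2 * wu) / (1 + wu) * theta par ^+ 2 * enorm (refx i x - s_hx st i + s i) ^+ 2
  + wu / (1 + wu) * theta par ^+ 2 * s1 + (1 + wu)^-1 * enorm (drift st s i) ^+ 2.
suff H i : (\int[P]_w (enorm (s_mx (nx w) i - (s_hx (nx w) i - drift st s i)) ^+ 2)%:E <= (b i)%:E)%E.
  apply: le_trans (expect_mean_le _ _ H) _ => [i w|i|]; first exact: sqr_ge0.
    apply: measurable_enorm2; apply: mvecB; first exact: (ms_mx mnx).
    by apply: mvecB; [exact: (ms_hx mnx)|exact: mvec_cst].
  rewrite lee_fin le_eqVlt; apply/orP; left; apply/eqP; rewrite /b /errM /errW /errS.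
  rewrite big_split /= mulrDr -mulr_sumr big_split /= mulrDr mean_cst //.
  rewrite big_split /= mulrDr -!mulr_sumr.
  by rewrite (mulrCA _ (1 + wu)^-1) !(mulrCA n%:R^-1).
have [_ _ lu _ _] := laws i; have [uD sD] := oracle_x i.
pose h (w : Om rd) := (1 - theta par) *: s_hx st i + theta par *: Dx i w.
have mD := mvec_Dx (@worker_samples i).
have mh : @mvec _ (sub_sigma E (samples k)) R _ _ h.
  by apply: mvecD; [exact: mvec_cst|exact: mvecZ].
have mr : @mvec _ (sub_sigma E (samples k)) R _ _ (fun w => h w - drift st s i).
  by apply: mvecB => //; exact: mvec_cst.
have mu : measurable_fun setT (ux k i : sub_sigma E (seeds k) -> seed (Cu i)).
  exact: (ux_sub (rd := rd)).
under eq_integral do rewrite nx_mx nx_hx du.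
have := memory_contraction Emeas EI ET Eind (samples_seeds k) (s_mx st i) (hCu i) lu mu mh mr.
move=> /le_trans; apply.
set a0 := s_mx st i + drift st s i - (1 - theta par) *: s_hx st i.
have E1 w : s_mx st i - (h w - drift st s i) = a0 + (- theta par) *: Dx i w.
  rewrite /h /a0; move: (Dx i w) (drift st s i) => u v.
  by apply/matrixP => i' j'; rewrite !mxE; ring.
have E2 w : h w - (h w - drift st s i) = drift st s i by rewrite opprB addrCA subrr addr0.
under eq_integral do rewrite E1 E2 addrC.
have cst : (\int[P]_t ((1 + wu)^-1 * enorm (drift st s i) ^+ 2)%:E <=
    ((1 + wu)^-1 * enorm (drift st s i) ^+ 2)%:E)%E by rewrite integral_prob_cst.
have Gle := bias_variance a0 (- theta par) uD sD.
have d1 : (1 + wu)^-1 <= 1 by rewrite invf_le1 // lerDl.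
have mDO := unbiased_mvec uD.
apply: le_trans (expect_le_add _ _ _ _ _ cst Gle) _ => //.
- by rewrite subr_ge0.
- by move=> w; rewrite mulr_ge0 ?sqr_ge0 // invr_ge0 ltW.
- by move=> w; exact: sqr_ge0.
- by apply: measurable_enorm2; apply: mvecD; [exact: mvec_cst|exact: mvecZ].
have -> : a0 + (- theta par) *: mDx pb i x y z =
    (s_mx st i - (s_hx st i - s i)) - theta par *: (refx i x - s_hx st i + s i).
  rewrite /a0 /drift; move: (refx i x) (mDx pb i x y z) => u v.
  by apply/matrixP => i' j'; rewrite !mxE; ring.
rewrite lee_fin /b sqrrN.
move: (s_mx st i - (s_hx st i - s i)) (refx i x - s_hx st i + s i) (drift st s i) => A B D.
(* Up to the factor (1 + wu)^-1 / 2, this square is exactly the gap of the inequality. *)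
have Y0 := sqr_ge0 (enorm (A + (2 * wu * theta par) *: B)).
rewrite enorm_sqrD enorm_sqrZ dotZr in Y0.
rewrite enorm_sqrB enorm_sqrZ dotZr.
move: (enorm A ^+ 2) (enorm B ^+ 2) (enorm D ^+ 2) (dot A B) Y0 => a' b' d' ab Y0.
have dp : 0 < (1 + wu)^-1 by rewrite invr_gt0.
rewrite -subr_ge0 (_ : _ - _ = (1 + wu)^-1 / 2 *
  (a' + 2 * (2 * wu * theta par * ab) + (2 * wu * theta par) ^+ 2 * b')); last by field; rewrite gt_eqF.
by rewrite mulr_ge0 // ltW // divr_gt0.
Qed.

Lemma step_Y : 0 < beta par -> beta par * (mu_g c + L_g c) <= 2 ->
  (\int[P]_w (errY (nx w))%:E <=
    ((1 - beta par * mu_g c) * errY st + (beta par * mu_g c)^-1 * L_ystar c ^+ 2 * X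
     + beta par ^+ 2 / n%:R * ((1 + wl) * sigma ^+ 2
        + wl * (6 / 5 * errRy st + 6 * L_g c ^+ 2 * errY st)))%:E)%E.
Proof.
move=> b0 bL; have mu0 := mu_gt0 sc; have muL := mu_le_Lg n0 q0 cont sc.
have wl0 : 0 <= wl by have [] := hCl (Ordinal n0).
have bm0 : 0 < beta par * mu_g c by rewrite mulr_gt0.
have bm1 : beta par * mu_g c <= 1 by nra.
have laws' i : has_law P (uy k i) (seed_law (Cl i)) by have [] := laws i.
have mu i : measurable_fun setT (uy k i : sub_sigma E (wseed i) -> seed (Cl i)).
  exact: (uy_sub (rd := rd)).
have := aggregate_variance Emeas EI ET Eind (samples_seeds k) (s_my st) (y - ys x') (- beta par) n0 wl0
  worker_disj wseed_disj worker_samples wseed_seeds hCl laws' mu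
  (fun i => mvec_Dy (@subset_refl _ (worker i))) (fun i => (oracle_y i).1) (fun i => (oracle_y i).2).
have E0 w : s_y (nx w) - ys (s_x (nx w)) = (y - ys x') + (- beta par) *:
    (vmean (s_my st) + vmean (fun i => cmap (Dy i w - s_my st i) (uy k i w))).
  by rewrite nxE nx_y; move: (ys x') (_ + vmean _) => u v; rewrite scaleNr (addrAC y).
under [in X in _ -> X]eq_integral do rewrite /errY E0.
move=> /le_trans; apply; rewrite lee_fin sqrrN; apply: lerD.
  have -> : y - ys x' + - beta par *: vmean (fun i => mDy pb i x y) =
      (y - beta par *: vmean (fun i => mDy pb i x y) - ys x) + (ys x - ys x').
    move: (ys x) (ys x') (vmean _) => u v v'.
    by apply/matrixP => i' j'; rewrite !mxE; ring.
  have H1 := y_contraction n0 q0 cont sc x y b0 bL.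
  have bm01 : 0 < beta par * mu_g c <= 1 by rewrite bm0.
  apply: le_trans (enorm_contraction_shift (ys x - ys x') bm01 H1) _.
  have H2 := ys_lipschitz_sqr dl x x'; rewrite (enormBC x) in H2.
  by rewrite lerD2l -mulrA; apply: ler_wpM2l => //; rewrite invr_ge0 ltW.
apply: ler_wpM2l; first by rewrite divr_ge0 ?sqr_ge0.
rewrite lerD2l; apply: ler_wpM2l => //.
rewrite /errRy -mean_affine; apply: mean_le => i.
have -> : mDy pb i x y - s_my st i = (refy i x - s_my st i) + (mDy pb i x y - refy i x).
  by rewrite [RHS]addrC addrA subrK.
(* Young's parameter 1/5 keeps the coefficient of the memory error at 6/5, at the price of 6 on the
   inexactness, which the step-size limit makes small. *)
have c5 : 0 < 5^-1 :> R by rewrite invr_gt0.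
apply: le_trans (young _ _ c5) _; rewrite invrK (enormBC (refy i x)).
have := mDy_ref cont i x y.
move: (enorm (s_my st i - refy i x) ^+ 2) (enorm (mDy pb i x y - refy i x) ^+ 2) => u v.
by rewrite -/(errY st); lra.
Qed.

Lemma step_Ry : delta_l par = (1 + wl)^-1 ->
  (\int[P]_w (errRy (nx w))%:E <=
    ((1 - (1 + 2 * wl)^-1) * errRy st
     + (2 / (1 + 2 * wl) * (sigma ^+ 2 + L_g c ^+ 2 * errY st) + (2 + 2 * wl) * (L3sq c * X)))%:E)%E.
Proof.
move=> dL; rewrite -mean_affine.
have wl0 : 0 <= wl by have [] := hCl (Ordinal n0).
apply: expect_mean_le => [i w|i|i]; first exact: sqr_ge0.
  rewrite (_ : (fun w => _) = (fun w => enorm (s_my (nx w) i - refy i x') ^+ 2)).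
    by apply: measurable_enorm2; apply: mvecB; [exact: (ms_my mnx)|exact: mvec_cst].
  by apply/funext => w; rewrite nxE.
under eq_integral do rewrite nxE nx_my dL.
have [_ _ _ lu _] := laws i; have [uD sD] := oracle_y i.
have mu : measurable_fun setT (uy k i : sub_sigma E (seeds k) -> seed (Cl i)).
  exact: (uy_sub (rd := rd)).
have := memory_tracking Emeas EI ET Eind (samples_seeds k) (s_my st i) (refy i x) (refy i x')
  (hCl i) lu mu (mvec_Dy (@worker_samples i)) uD sD.
move=> /le_trans; apply; rewrite lee_fin lerD2l; apply: lerD.
  apply: ler_wpM2l; first by rewrite divr_ge0 // addr_ge0 // mulr_ge0.
  by rewrite [leRHS]addrC lerD2r; exact: (mDy_ref cont).
apply: ler_wpM2l; first by rewrite addr_ge0 // mulr_ge0.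
by rewrite (enormBC x'); exact: (refy_lipschitz cont dl).
Qed.

Lemma step_Rz : delta_l par = (1 + wl)^-1 ->
  (\int[P]_w (errRz (nx w))%:E <=
    ((1 - (1 + 2 * wl)^-1) * errRz st
     + (2 / (1 + 2 * wl) * (s1 + (3 * L1sq c par * errY st + 3 * L_g c ^+ 2 * errZ st))
        + (2 + 2 * wl) * (3 * L4sq c par * X)))%:E)%E.
Proof.
move=> dL; rewrite -mean_affine.
have wl0 : 0 <= wl by have [] := hCl (Ordinal n0).
apply: expect_mean_le => [i w|i|i]; first exact: sqr_ge0.
  rewrite (_ : (fun w => _) = (fun w => enorm (s_mz (nx w) i - refz i x') ^+ 2)).
    by apply: measurable_enorm2; apply: mvecB; [exact: (ms_mz mnx)|exact: mvec_cst].
  by apply/funext => w; rewrite nxE.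
under eq_integral do rewrite nxE nx_mz dL.
have [_ _ _ _ lu] := laws i; have [uD sD] := oracle_z i.
have mu : measurable_fun setT (uz k i : sub_sigma E (seeds k) -> seed (Cl i)).
  exact: (uz_sub (rd := rd)).
have := memory_tracking Emeas EI ET Eind (samples_seeds k) (s_mz st i) (refz i x) (refz i x')
  (hCl i) lu mu (mvec_Dz (@worker_samples i)) uD sD.
move=> /le_trans; apply; rewrite lee_fin lerD2l; apply: lerD.
  apply: ler_wpM2l; first by rewrite divr_ge0 // addr_ge0 // mulr_ge0.
  by rewrite [leRHS]addrC lerD2r; exact: (mDz_ref n0 cont sc rho_ge).
apply: ler_wpM2l; first by rewrite addr_ge0 // mulr_ge0.
by rewrite (enormBC x'); exact: (refz_lipschitz n0 cont sc dl rho_ge).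
Qed.

(** For z the contraction holds with 1 - t on the square only, the residual of y having used up the
    rest. Young's inequality with t / 2 leaves the rate 1 - t / 2; since t <= 1, the constant 2
    grows to at most 3 and 1 + 2 / t is at most 3 / t. *)
Lemma young_shift_bound (t e l Z Y A D b X' : R) : 0 < t <= 1 -> 0 <= e -> 0 <= l ->
  0 <= Z -> 0 <= Y -> 0 <= D ->
  A <= (1 - t) * Z + 2 * e * l * Y -> D <= b * X' ->
  (1 + t / 2) * A + (1 + (t / 2)^-1) * D <= (1 - t / 2) * Z + 3 * e * l * Y + 3 / t * b * X'.
Proof.
move=> /andP[t0 t1] e0 l0 Z0 Y0 D0 H1 H2; apply: lerD.
  have tp : 0 <= 1 + t / 2 by rewrite addr_ge0 // divr_ge0 // ltW.
  apply: le_trans (ler_wpM2l tp H1) _.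
  have elY : 0 <= e * l * Y by rewrite !mulr_ge0.
  rewrite -subr_ge0 (_ : _ - _ = t * t / 2 * Z + (1 - t) * (e * l * Y)); last by field.
  by rewrite addr_ge0 // mulr_ge0 ?subr_ge0 // !mulr_ge0 // ltW.
have H3 : (1 + (t / 2)^-1) * D <= 3 / t * D.
  apply: ler_wpM2r => //; rewrite -subr_ge0 (_ : _ - _ = (1 - t) / t); last by field; rewrite gt_eqF.
  by rewrite divr_ge0 ?subr_ge0 // ltW.
apply: le_trans H3 _; rewrite -[leRHS]mulrA; apply: ler_wpM2l => //.
by rewrite divr_ge0 // ltW.
Qed.

Lemma step_Z : 0 < gamma par -> gamma par * L_g c <= 1 ->
  (\int[P]_w (errZ (nx w))%:E <=
    ((1 - gamma par * mu_g c / 2) * errZ st + 3 * (gamma par / mu_g c) * L1sq c par * errY st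
     + 3 / (gamma par * mu_g c) * L_zstar c ^+ 2 * X
     + gamma par ^+ 2 / n%:R * ((1 + wl) * s1
        + wl * (6 / 5 * errRz st + 6 * (3 * L1sq c par * errY st + 3 * L_g c ^+ 2 * errZ st))))%:E)%E.
Proof.
move=> g0 gL; have mu0 := mu_gt0 sc; have muL := mu_le_Lg n0 q0 cont sc.
have wl0 : 0 <= wl by have [] := hCl (Ordinal n0).
have gm0 : 0 < gamma par * mu_g c by rewrite mulr_gt0.
have gm1 : gamma par * mu_g c <= 1 by nra.
have laws' i : has_law P (uz k i) (seed_law (Cl i)) by have [] := laws i.
have mu i : measurable_fun setT (uz k i : sub_sigma E (wseed i) -> seed (Cl i)).
  exact: (uz_sub (rd := rd)).
have := aggregate_variance Emeas EI ET Eind (samples_seeds k) (s_mz st) (z - zs x') (- gamma par) n0 wl0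
  worker_disj wseed_disj worker_samples wseed_seeds hCl laws' mu
  (fun i => mvec_Dz (@subset_refl _ (worker i))) (fun i => (oracle_z i).1) (fun i => (oracle_z i).2).
(* Only an inequality, because of the clipping; z* lies in the ball, so the unclipped point has the
   larger error. *)
have E0 w : enorm (s_z (nx w) - zs (s_x (nx w))) ^+ 2 <= enorm (z - zs x' + (- gamma par) *:
    (vmean (s_mz st) + vmean (fun i => cmap (Dz i w - s_mz st i) (uz k i w)))) ^+ 2.
  rewrite nxE nx_z; have zr := zstar_le n0 cont sc rho_ge x'; move: (zs x') zr (_ + vmean _) => u zr v.
  by apply: le_trans (clip_nonexpansive _ rho_gt0 zr) _; rewrite scaleNr (addrAC z).
move=> H; apply: (le_trans _ (le_trans H _)).
  apply: le_integral_ge0 => w; first by rewrite lee_fin sqr_ge0.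
  by rewrite lee_fin; exact: E0.
rewrite lee_fin sqrrN; apply: lerD.
  have -> : z - zs x' + - gamma par *: vmean (fun i => mDz pb i x y z) =
      (z - gamma par *: vmean (fun i => mDz pb i x y z) - zs x) + (zs x - zs x').
    move: (zs x) (zs x') (vmean _) => u v v'.
    by apply/matrixP => i' j'; rewrite !mxE; ring.
  have H1 := z_contraction n0 q0 cont sc rho_ge x y z g0 gL.
  have gm2 : 0 < gamma par * mu_g c / 2 by rewrite divr_gt0.
  apply: le_trans (young _ (zs x - zs x') gm2) _.
  have H2 := zs_lipschitz_sqr dl x x'; rewrite (enormBC x) in H2.
  have gm01 : 0 < gamma par * mu_g c <= 1 by rewrite gm0.
  have g1 : 0 <= gamma par / mu_g c by rewrite divr_ge0 // ltW.
  exact: (young_shift_bound gm01 g1 (L1sq_ge0 c par) (sqr_ge0 _) (sqr_ge0 _) (sqr_ge0 _) H1 H2).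
apply: ler_wpM2l; first by rewrite divr_ge0 ?sqr_ge0.
rewrite lerD2l; apply: ler_wpM2l => //.
rewrite /errRz -mean_affine; apply: mean_le => i.
have -> : mDz pb i x y z - s_mz st i = (refz i x - s_mz st i) + (mDz pb i x y z - refz i x).
  by rewrite [RHS]addrC addrA subrK.
have c5 : 0 < 5^-1 :> R by rewrite invr_gt0.
apply: le_trans (young _ _ c5) _; rewrite invrK (enormBC (refz i x)).
have := mDz_ref n0 cont sc rho_ge i x y z; rewrite -/(errY st) -/(errZ st).
move: (enorm (s_mz st i - refz i x) ^+ 2) (enorm (mDz pb i x y z - refz i x) ^+ 2) => u v.
by lra.
Qed.

End OneStep.

(** * The Lyapunov function *)

Section Weights.
Context {R : realType} (c : constants R) (par : hyperparams R) (n : nat) (wu wl : R).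
Notation a := (alpha par).
Notation b := (beta par).
Notation g := (gamma par).
Notation t := (theta par).
Notation mu := (mu_g c).
Notation Lg := (L_g c).
Notation nn := (n%:R : R).
Notation w1 := (omega1 wl).

(** The squared sensitivity of the hypergradient to y: L2sq is the direct part. The part in
    kappa_g^2 L1sq arises since an error in y also displaces z by [step_Z], and [wtZ] times that
    coupling is 90 kappa_g^2 L1sq. *)
Definition Qsq := L2sq c par + 25 * kappa_g c ^+ 2 * L1sq c par.
(* [wtB], [wtW], ..., [wtT] multiply [errB], [errW], [errS], [errM], [errY],
   [errRy], [errZ], [errRz] in the Lyapunov function. [wtY] and [wtZ] are the
   sensitivity of the hypergradient divided by the contraction rates [b * mu]
   and [g * mu] of the inner iterations. *)
Definition wtB := 2 / t.
Definition wtW := 4 * wu * (1 + 2 * wu) * t.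
Definition wtS := 4 * (1 - t) / t.
Definition wtM := 4 * (1 + wu).
Definition wtY := 15 * Qsq / (b * mu).
Definition wtR := 36 * wl * (1 + 2 * wl) * Qsq * (b / (mu * nn)).
Definition wtZ := 30 * Lg ^+ 2 / (g * mu).
Definition wtT := 54 * wl * (1 + 2 * wl) * Lg ^+ 2 * (g / (mu * nn)).
Definition noise_level sigma :=
  (2 * t / nn + 4 * wu * (1 + 2 * wu) * t ^+ 3 + 4 * wu * t ^+ 2
   + (30 + 138 * wl) * Lg ^+ 2 * (g / (mu * nn))) * sigma1sq par sigma
  + (15 + 87 * wl) * Qsq * (b / (mu * nn)) * sigma ^+ 2.

Hypothesis a0 : 0 < a.
Hypothesis b0 : 0 < b.
Hypothesis g0 : 0 < g.
Hypothesis t01 : 0 < t <= 1.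
Hypothesis mu0 : 0 < mu.
Hypothesis muL : mu <= Lg.
Hypothesis n0 : (0 < n)%N.
Hypothesis wu0 : 0 <= wu.
Hypothesis wl0 : 0 <= wl.
Hypothesis hb : b * (96 * wl * w1 * Lg ^+ 2) <= mu * nn.
Hypothesis hg : g * (432 * wl * w1 * Lg ^+ 2) <= mu * nn.
Hypothesis hC3 : a <= C3 c par n wu wl.

Let nn0 : 0 < nn. Proof. by rewrite ltr0n. Qed.
Let Lg0 : 0 < Lg. Proof. exact: lt_le_trans mu0 muL. Qed.
Let t0 : 0 < t. Proof. by have [] := andP t01. Qed.
Let t1 : t <= 1. Proof. by have [] := andP t01. Qed.
Let L1 := L1sq_ge0 c par.
Let L2 := L2sq_ge0 c par.

Lemma Qsq_ge0 : 0 <= Qsq.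
Proof. by apply: addr_ge0 => //; rewrite mulr_ge0 // mulr_ge0 // sqr_ge0. Qed.

Lemma omega1_ge1 : 1 <= w1.
Proof. by rewrite /omega1 lerDl !mulr_ge0 // addr_ge0. Qed.

Let ltu : 0 < 1 + wu. Proof. by rewrite ltr_wpDr. Qed.
Let lt2 : 0 < 1 + 2 * wl. Proof. by rewrite ltr_wpDr // mulr_ge0. Qed.

(** The limit on beta in the form used below: the compression noise fed back per step is a fixed
    small fraction of the gain from contraction. *)
Lemma beta_ratio : wl * w1 * Lg ^+ 2 * (b / (mu * nn)) <= 96^-1.
Proof.
have H : 0 < mu * nn by rewrite mulr_gt0.
rewrite mulrA ler_pdivrMr //; move: hb; set Y := mu * nn; set W := wl * w1 * _.
have -> : b * (96 * wl * w1 * Lg ^+ 2) = 96 * (W * b) by rewrite /W; ring.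
by move=> H'; lra.
Qed.

Lemma gamma_ratio : wl * w1 * Lg ^+ 2 * (g / (mu * nn)) <= 432^-1.
Proof.
have H : 0 < mu * nn by rewrite mulr_gt0.
rewrite mulrA ler_pdivrMr //; move: hg; set Y := mu * nn; set W := wl * w1 * _.
have -> : g * (432 * wl * w1 * Lg ^+ 2) = 432 * (W * g) by rewrite /W; ring.
by move=> H'; lra.
Qed.

Let ub := beta_ratio.
Let ug := gamma_ratio.

Let u0 : 0 <= b / (mu * nn). Proof. by rewrite divr_ge0 ?mulr_ge0 // ltW. Qed.
Let v0 : 0 <= g / (mu * nn). Proof. by rewrite divr_ge0 ?mulr_ge0 // ltW. Qed.

Let drop1 (u k : R) : 0 <= u -> wl * w1 * Lg ^+ 2 * u <= k -> wl * Lg ^+ 2 * u <= k.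
Proof.
move=> u0' /(le_trans _); apply; apply: ler_wpM2r => //; apply: ler_wpM2r; first exact: sqr_ge0.
by rewrite ler_peMr // omega1_ge1.
Qed.

Let ub' := drop1 u0 ub.
Let ug' := drop1 v0 ug.

Lemma wtB_ge0 : 0 <= wtB. Proof. by rewrite divr_ge0 // ltW. Qed.
Lemma wtS_ge0 : 0 <= wtS. Proof. by rewrite divr_ge0 ?(ltW t0) // mulr_ge0 // subr_ge0. Qed.
Lemma wtW_ge0 : 0 <= wtW.
Proof. by apply: mulr_ge0 (ltW t0); apply: mulr_ge0; [exact: mulr_ge0|rewrite addr_ge0 // mulr_ge0]. Qed.
Lemma wtM_ge0 : 0 <= wtM. Proof. by rewrite mulr_ge0 // ltW. Qed.
Lemma wtY_ge0 : 0 <= wtY.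
Proof. by apply: divr_ge0; [exact: mulr_ge0 Qsq_ge0|rewrite mulr_ge0 // ltW]. Qed.
Lemma wtZ_ge0 : 0 <= wtZ.
Proof. by apply: divr_ge0; [exact: mulr_ge0 (ler0n R 30) (sqr_ge0 Lg)|rewrite mulr_ge0 // ltW]. Qed.
Lemma wtR_ge0 : 0 <= wtR.
Proof.
apply: mulr_ge0 => //; apply: mulr_ge0 Qsq_ge0; apply: mulr_ge0 (ltW lt2).
exact: mulr_ge0 (ler0n R 36) wl0.
Qed.
Lemma wtT_ge0 : 0 <= wtT.
Proof.
apply: mulr_ge0 => //; apply: mulr_ge0 (sqr_ge0 Lg); apply: mulr_ge0 (ltW lt2).
exact: mulr_ge0 (ler0n R 54) wl0.
Qed.

Lemma weightB : 2 + wtB * (1 - t) <= wtB.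
Proof. by rewrite /wtB mulrBr mulr1 divfK ?gt_eqF // addrC subrK. Qed.

Lemma weightW : wtW * (1 - t) + wtM * (wu * (1 + 2 * wu) / (1 + wu) * t ^+ 2) <= wtW.
Proof. by rewrite /wtW /wtM le_eqVlt; apply/orP; left; apply/eqP; field; rewrite gt_eqF. Qed.

Lemma weightM : 2 + wtM * (1 - (2 * (1 + wu))^-1) <= wtM.
Proof. by rewrite /wtM le_eqVlt; apply/orP; left; apply/eqP; field; rewrite gt_eqF. Qed.

(** The lag is charged once directly and once through the memory error. The factors 1 + wu cancel in
    the second charge, so the total is free of omega_u; this keeps omega_u out of [wtY] and
    [wtZ]. *)
Lemma weightSM : wtS + wtM * (1 + wu)^-1 = 4 / t.
Proof. by rewrite /wtS /wtM; field; rewrite !gt_eqF. Qed.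

Lemma weightS : (wtS + wtM * (1 + wu)^-1) * (1 - t) <= wtS.
Proof. by rewrite weightSM /wtS mulrAC. Qed.

(** Contraction of y earns 15 Qsq per step. The expenses are 12 L2sq for the lag, 90 kappa_g^2 L1sq
    passed on by z, and for compression at most (162/96) Qsq from the y-messages and (864/432) L1sq
    from the z-messages; they fit because Qsq contains 25 kappa_g^2 L1sq. *)
Lemma weightY : (wtS + wtM * (1 + wu)^-1) * (t * (3 * L2sq c par)) + wtY * (1 - b * mu)
  + wtY * (b ^+ 2 / nn) * wl * (6 * Lg ^+ 2) + wtR * (2 / (1 + 2 * wl)) * Lg ^+ 2
  + wtZ * (3 * (g / mu) * L1sq c par) + wtZ * (g ^+ 2 / nn) * wl * (18 * L1sq c par)
  + wtT * (2 / (1 + 2 * wl)) * (3 * L1sq c par) <= wtY.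
Proof.
have -> : (wtS + wtM * (1 + wu)^-1) * (t * (3 * L2sq c par)) = 12 * L2sq c par.
  by rewrite weightSM; field; rewrite gt_eqF.
have -> : wtY * (1 - b * mu) = wtY - 15 * Qsq.
  by rewrite /wtY; field; rewrite !gt_eqF.
have -> : wtY * (b ^+ 2 / nn) * wl * (6 * Lg ^+ 2) = 90 * (Qsq * (wl * Lg ^+ 2 * (b / (mu * nn)))).
  by rewrite /wtY; field; rewrite !gt_eqF.
have -> : wtR * (2 / (1 + 2 * wl)) * Lg ^+ 2 = 72 * (Qsq * (wl * Lg ^+ 2 * (b / (mu * nn)))).
  by rewrite /wtR; field; rewrite !gt_eqF.
have -> : wtZ * (3 * (g / mu) * L1sq c par) = 90 * (kappa_g c ^+ 2 * L1sq c par).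
  by rewrite /wtZ /kappa_g; field; rewrite !gt_eqF.
have -> : wtZ * (g ^+ 2 / nn) * wl * (18 * L1sq c par) =
    540 * (L1sq c par * (wl * Lg ^+ 2 * (g / (mu * nn)))).
  by rewrite /wtZ; field; rewrite !gt_eqF.
have -> : wtT * (2 / (1 + 2 * wl)) * (3 * L1sq c par) =
    324 * (L1sq c par * (wl * Lg ^+ 2 * (g / (mu * nn)))).
  by rewrite /wtT; field; rewrite !gt_eqF.
have H1 := ler_wpM2l Qsq_ge0 ub'; have H2 := ler_wpM2l L1 ug'.
have k1 : 1 <= kappa_g c ^+ 2 by rewrite exprn_ege1 // /kappa_g ler_pdivlMr // mul1r.
have H3 := ler_wpM2r L1 k1; rewrite mul1r in H3.
have H4 : Qsq = L2sq c par + 25 * (kappa_g c ^+ 2 * L1sq c par) by rewrite /Qsq mulrA.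
move: H1 H2 H3 H4 L1 L2; move: (Qsq * (wl * _ * _)) (L1sq c par * (wl * _ * _)) (kappa_g c ^+ 2 * _) wtY.
by move: (L1sq c par) (L2sq c par) Qsq => *; lra.
Qed.

Lemma weightZ : (wtS + wtM * (1 + wu)^-1) * (t * (3 * Lg ^+ 2)) + wtZ * (1 - g * mu / 2)
  + wtZ * (g ^+ 2 / nn) * wl * (18 * Lg ^+ 2) + wtT * (2 / (1 + 2 * wl)) * (3 * Lg ^+ 2) <= wtZ.
Proof.
have -> : (wtS + wtM * (1 + wu)^-1) * (t * (3 * Lg ^+ 2)) = 12 * Lg ^+ 2.
  by rewrite weightSM; field; rewrite gt_eqF.
have -> : wtZ * (1 - g * mu / 2) = wtZ - 15 * Lg ^+ 2.
  by rewrite /wtZ; field; rewrite !gt_eqF.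
have -> : wtZ * (g ^+ 2 / nn) * wl * (18 * Lg ^+ 2) =
    540 * (Lg ^+ 2 * (wl * Lg ^+ 2 * (g / (mu * nn)))).
  by rewrite /wtZ; field; rewrite !gt_eqF.
have -> : wtT * (2 / (1 + 2 * wl)) * (3 * Lg ^+ 2) =
    324 * (Lg ^+ 2 * (wl * Lg ^+ 2 * (g / (mu * nn)))).
  by rewrite /wtT; field; rewrite !gt_eqF.
have H2 := ler_wpM2l (sqr_ge0 Lg) ug'.
move: H2 (sqr_ge0 Lg); move: (Lg ^+ 2 * (wl * _ * _)) wtZ; move: (Lg ^+ 2) => *; lra.
Qed.

Lemma weightR : wtY * (b ^+ 2 / nn) * wl * (6 / 5) + wtR * (1 - (1 + 2 * wl)^-1) <= wtR.
Proof.
rewrite -subr_ge0 (_ : _ - _ = 18 * (wl * Qsq * (b / (mu * nn)))); last first.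
  by rewrite /wtY /wtR; field; rewrite !gt_eqF.
by rewrite mulr_ge0 // mulr_ge0 // mulr_ge0 // Qsq_ge0.
Qed.

Lemma weightT : wtZ * (g ^+ 2 / nn) * wl * (6 / 5) + wtT * (1 - (1 + 2 * wl)^-1) <= wtT.
Proof.
rewrite -subr_ge0 (_ : _ - _ = 18 * (wl * Lg ^+ 2 * (g / (mu * nn)))); last first.
  by rewrite /wtZ /wtT; field; rewrite !gt_eqF.
by rewrite mulr_ge0 // mulr_ge0 // mulr_ge0 // sqr_ge0.
Qed.

Lemma weight_noise sigma : (wtB * (t ^+ 2 / nn) + wtW * t ^+ 2 + wtM * (wu / (1 + wu) * t ^+ 2)
  + wtZ * (g ^+ 2 / nn) * (1 + wl) + wtT * (2 / (1 + 2 * wl))) * sigma1sq par sigma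
  + (wtY * (b ^+ 2 / nn) * (1 + wl) + wtR * (2 / (1 + 2 * wl))) * sigma ^+ 2 = noise_level sigma.
Proof.
rewrite /noise_level; congr (_ * _ + _ * _).
  by rewrite /wtB /wtW /wtM /wtZ /wtT; field; rewrite !gt_eqF.
by rewrite /wtY /wtR; field; rewrite !gt_eqF.
Qed.

(** The origin of C3: the left side collects all coefficients of the squared motion of x, and
    [step_Phi] supplies 1 / (2 alpha^2) of it. *)
Lemma weightX : wtB * (t^-1 * L_Phi c ^+ 2) + wtW * (3 / t * L5sq c par)
  + wtY * ((b * mu)^-1 * L_ystar c ^+ 2) + wtR * ((2 + 2 * wl) * L3sq c)
  + wtZ * (3 / (g * mu) * L_zstar c ^+ 2) + wtT * ((2 + 2 * wl) * (3 * L4sq c par))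
  <= (2 * a ^+ 2)^-1.
Proof.
move: hC3; rewrite /C3.
have W2 : 1 <= omega2 wu by rewrite /omega2 lerDl !mulr_ge0 // addr_ge0.
set A := (X in Num.sqrt (2 * X)) => hA.
(* A nonpositive radicand would make the square root 0 and C3 = 0 by the conventions for root and
   inverse, against 0 < alpha <= C3. *)
have A0 : 0 < 2 * A.
  rewrite ltNge; apply/negP => A0; move: hA; rewrite (ler0_sqrtr A0) invr0.
  by rewrite leNgt a0.
have hA' : (2 * A) <= a^-1 ^+ 2.
  rewrite -(sqr_sqrtr (ltW A0)); apply: sqr_le; first exact: sqrtr_ge0.
  by rewrite -[leLHS]invrK lef_pV2 ?posrE ?invr_gt0 ?sqrtr_gt0.
have -> : (2 * a ^+ 2)^-1 = a^-1 ^+ 2 / 2 by field; rewrite gt_eqF.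
rewrite ler_pdivlMr //; apply: le_trans hA'.
rewrite mulrC ler_pM2l // /A -/Qsq.
rewrite /A -subr_ge0.
have L30 : 0 <= L3sq c.
  by rewrite mulr_ge0 ?sqr_ge0 // addr_ge0 // mulr_ge0 // sqr_ge0.
have Y0 : 0 <= 1 + 3 * L_ystar c ^+ 2 by rewrite addr_ge0 // mulr_ge0 // sqr_ge0.
have Z0 : 0 <= 3 * Lg ^+ 2 * L_zstar c ^+ 2.
  by apply: mulr_ge0; [apply: mulr_ge0 => //; exact: sqr_ge0|exact: sqr_ge0].
have L40 : 0 <= L4sq c par by rewrite addr_ge0 // mulr_ge0.
have L50 : 0 <= L5sq c par by rewrite addr_ge0 // mulr_ge0.
have W20 : 0 <= omega2 wu - 1 by rewrite subr_ge0.
have Q0 := Qsq_ge0.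
have qy : 0 <= Qsq * (L_ystar c ^+ 2 / (b ^+ 2 * mu ^+ 2)).
  by apply: mulr_ge0 => //; apply: divr_ge0; [exact: sqr_ge0|rewrite mulr_ge0 // sqr_ge0].
have qz : 0 <= Lg ^+ 2 * (L_zstar c ^+ 2 / (g ^+ 2 * mu ^+ 2)).
  by apply: mulr_ge0; [exact: sqr_ge0|apply: divr_ge0; [exact: sqr_ge0|rewrite mulr_ge0 // sqr_ge0]].
have qr : 0 <= Qsq * L3sq c * (b / (mu * nn)) by rewrite mulr_ge0 // mulr_ge0.
have qt : 0 <= Lg ^+ 2 * L4sq c par * (g / (mu * nn)).
  by apply: mulr_ge0 => //; apply: mulr_ge0 => //; exact: sqr_ge0.
(* The bracket in C3 minus the collected coefficients, regrouped so that every term is a product of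
   nonnegative factors. *)
rewrite (_ : _ - _ = (2 / t * L_Phi c ^+ 2 / t) + 12 * wu * (5 + 4 * wu) * L5sq c par
  + (33 + 48 * (omega2 wu - 1)) * (Qsq * (L_ystar c ^+ 2 / (b ^+ 2 * mu ^+ 2)))
  + (54 + 144 * (omega2 wu - 1)) * (Lg ^+ 2 * (L_zstar c ^+ 2 / (g ^+ 2 * mu ^+ 2)))
  + wl * (120 + 936 * wl + 1008 * wl ^+ 2 + 192 * w1 * (omega2 wu - 1))
     * (Qsq * L3sq c * (b / (mu * nn)))
  + wl * (540 + 4212 * wl + 4536 * wl ^+ 2 + 864 * w1 * (omega2 wu - 1))
     * (Lg ^+ 2 * L4sq c par * (g / (mu * nn)))); last first.
  rewrite /wtB /wtW /wtY /wtR /wtZ /wtT /omega1.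
  move: (omega2 wu) => W.
  by field; rewrite !gt_eqF.
have w1p : 0 <= w1 by exact: le_trans omega1_ge1.
have P2 : 0 <= wl ^+ 2 by exact: sqr_ge0.
have PL : 0 <= L_Phi c ^+ 2 by exact: sqr_ge0.
move: (omega2 wu - 1) W20 (wl ^+ 2) P2 (L_Phi c ^+ 2) PL w1 w1p => W W20' q P2' f PL' w w0.
move: (Qsq * (L_ystar c ^+ 2 / _)) qy (Lg ^+ 2 * (L_zstar c ^+ 2 / _)) qz (Qsq * L3sq c * _) qr
  (Lg ^+ 2 * L4sq c par * _) qt (L5sq c par) L50
  => A1 A10 A2 A20 A3 A30 A4 A40 A5 A50.
have c1 : 0 <= 33 + 48 * W by lra.
have c2 : 0 <= 54 + 144 * W by lra.
have c3 : 0 <= 120 + 936 * wl + 1008 * q + 192 * w * W.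
  exact: addr_ge0 (addr_ge0 (addr_ge0 (ler0n R 120) (mulr_ge0 (ler0n R 936) wl0))
    (mulr_ge0 (ler0n R 1008) P2')) (mulr_ge0 (mulr_ge0 (ler0n R 192) w0) W20').
have c4 : 0 <= 540 + 4212 * wl + 4536 * q + 864 * w * W.
  exact: addr_ge0 (addr_ge0 (addr_ge0 (ler0n R 540) (mulr_ge0 (ler0n R 4212) wl0))
    (mulr_ge0 (ler0n R 4536) P2')) (mulr_ge0 (mulr_ge0 (ler0n R 864) w0) W20').
have c5 : 0 <= 12 * wu * (5 + 4 * wu).
  exact: mulr_ge0 (mulr_ge0 (ler0n R 12) wu0) (addr_ge0 (ler0n R 5) (mulr_ge0 (ler0n R 4) wu0)).
have c6 : 0 <= 2 / t * f / t.
  by apply: divr_ge0; [apply: mulr_ge0 => //; rewrite divr_ge0 // ltW|exact: ltW].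
apply: addr_ge0 (mulr_ge0 (mulr_ge0 wl0 c4) A40).
apply: addr_ge0 (mulr_ge0 (mulr_ge0 wl0 c3) A30).
apply: addr_ge0 (mulr_ge0 c2 A20); apply: addr_ge0 (mulr_ge0 c1 A10).
exact: addr_ge0 c6 (mulr_ge0 c5 A50).
Qed.

Hypothesis bL : b * (mu + Lg) <= 2.
Hypothesis gL : g * Lg <= 1.

Let ibm1 : 1 <= (b * mu)^-1.
Proof. by rewrite invf_ge1 ?mulr_gt0 //; move: bL muL b0; nra. Qed.

Let igm1 : 1 <= (g * mu)^-1.
Proof. by rewrite invf_ge1 ?mulr_gt0 //; move: gL muL g0; nra. Qed.

Let drop2 (u k : R) : 0 <= u -> wl * w1 * Lg ^+ 2 * u <= k -> wl * (1 + 2 * wl) * Lg ^+ 2 * u <= k.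
Proof.
move=> u0' /(le_trans _); apply; apply: ler_wpM2r => //; apply: ler_wpM2r; first exact: sqr_ge0.
apply: ler_wpM2l => //; rewrite /omega1 -subr_ge0 (_ : _ - _ = wl * (4 + 6 * wl)); last by ring.
by apply: mulr_ge0 => //; exact: addr_ge0 (ler0n R 4) (mulr_ge0 (ler0n R 6) wl0).
Qed.

Let ub2 := drop2 u0 ub.
Let ug2 := drop2 v0 ug.

Let L1Q : L1sq c par <= Qsq / 25.
Proof.
have k1 : 1 <= kappa_g c ^+ 2 by rewrite exprn_ege1 // /kappa_g ler_pdivlMr // mul1r.
have H3 := ler_wpM2r L1 k1; rewrite mul1r in H3.
rewrite ler_pdivlMr // /Qsq -[25 * _ * _]mulrA mulrC.
by apply: ler_wpDl => //; apply: ler_wpM2l.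
Qed.

Let L2Q : L2sq c par <= Qsq.
Proof. by rewrite /Qsq lerDl mulr_ge0 // mulr_ge0 // sqr_ge0. Qed.

Let wu2 : 0 <= wu * (1 + wu). Proof. by rewrite mulr_ge0 // ltW. Qed.

Let wtW_le : wtW <= 8 * (wu * (1 + wu)).
Proof.
rewrite /wtW; apply: le_trans (ler_piMr _ t1) _.
  by rewrite mulr_ge0 ?mulr_ge0 // addr_ge0 // mulr_ge0.
by rewrite -subr_ge0 (_ : _ - _ = 4 * wu) ?mulr_ge0 //; ring.
Qed.

(** With zero initial lag the inexactness of y^0 sits inside [errW], whose weight is at most 8 wu (1
    + wu). The part 36 wu (1 + wu) of [omega2] absorbs it, at the cost of the square of omega_u in
    the explicit bound. *)
Lemma init_weightY : wtW * (9 * L2sq c par) + wtY + wtR * (6 * Lg ^+ 2) + wtT * (18 * L1sq c par) <=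
  24 * omega2 wu * Qsq / (mu * b).
Proof.
have Q0 := Qsq_ge0.
have -> : 24 * omega2 wu * Qsq / (mu * b) =
    24 * (Qsq * (b * mu)^-1) + 864 * (wu * (1 + wu) * (Qsq * (b * mu)^-1)).
  by rewrite /omega2 (mulrC mu); ring.
have -> : wtY = 15 * (Qsq * (b * mu)^-1) by rewrite /wtY mulrA.
have -> : wtR * (6 * Lg ^+ 2) = 216 * (Qsq * (wl * (1 + 2 * wl) * Lg ^+ 2 * (b / (mu * nn)))).
  by rewrite /wtR; ring.
have -> : wtT * (18 * L1sq c par) =
    972 * (L1sq c par * (wl * (1 + 2 * wl) * Lg ^+ 2 * (g / (mu * nn)))).
  by rewrite /wtT; ring.
have H1 := ler_wpM2l Q0 ub2; have H2 := ler_wpM2l L1 ug2.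
have H3 : Qsq <= Qsq * (b * mu)^-1 by rewrite ler_peMr.
have H4 : wtW * (9 * L2sq c par) <= 72 * (wu * (1 + wu) * (Qsq * (b * mu)^-1)).
  have L20 : 0 <= 9 * L2sq c par by rewrite mulr_ge0.
  apply: le_trans (ler_wpM2r L20 wtW_le) _.
  have -> : 8 * (wu * (1 + wu)) * (9 * L2sq c par) = 72 * (wu * (1 + wu) * L2sq c par) by ring.
  apply: ler_wpM2l => //; apply: ler_wpM2l => //; exact: le_trans L2Q H3.
have H5 : 0 <= wu * (1 + wu) * (Qsq * (b * mu)^-1).
  by rewrite mulr_ge0 // mulr_ge0 // (le_trans ler01).
move: H1 H2 H3 H4 H5 L1Q Q0 L1.
move: (wtW * _) (Qsq * (wl * _ * _ * _)) (L1sq c par * (wl * _ * _ * _)) (wu * (1 + wu) * (Qsq / (b * mu))) (Qsq / (b * mu)).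
by move: (L1sq c par) Qsq => *; lra.
Qed.

Lemma init_weightZ : wtW * (9 * Lg ^+ 2) + wtZ + wtT * (18 * Lg ^+ 2) <=
  48 * omega2 wu * Lg ^+ 2 / (mu * g).
Proof.
have Q0 := sqr_ge0 Lg.
have -> : 48 * omega2 wu * Lg ^+ 2 / (mu * g) =
    48 * (Lg ^+ 2 * (g * mu)^-1) + 1728 * (wu * (1 + wu) * (Lg ^+ 2 * (g * mu)^-1)).
  by rewrite /omega2 (mulrC mu); ring.
have -> : wtZ = 30 * (Lg ^+ 2 * (g * mu)^-1) by rewrite /wtZ mulrA.
have -> : wtT * (18 * Lg ^+ 2) =
    972 * (Lg ^+ 2 * (wl * (1 + 2 * wl) * Lg ^+ 2 * (g / (mu * nn)))).
  by rewrite /wtT; ring.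
have H2 := ler_wpM2l Q0 ug2.
have H3 : Lg ^+ 2 <= Lg ^+ 2 * (g * mu)^-1 by rewrite ler_peMr.
have H4 : wtW * (9 * Lg ^+ 2) <= 72 * (wu * (1 + wu) * (Lg ^+ 2 * (g * mu)^-1)).
  have L20 : 0 <= 9 * Lg ^+ 2 by exact: mulr_ge0 (ler0n R 9) Q0.
  apply: le_trans (ler_wpM2r L20 wtW_le) _.
  have -> : 8 * (wu * (1 + wu)) * (9 * Lg ^+ 2) = 72 * (wu * (1 + wu) * Lg ^+ 2) by ring.
  by apply: ler_wpM2l => //; apply: ler_wpM2l.
have H5 : 0 <= wu * (1 + wu) * (Lg ^+ 2 * (g * mu)^-1).
  by rewrite mulr_ge0 //; apply: mulr_ge0 Q0 _; exact: le_trans ler01 igm1.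
move: H2 H3 H4 H5 Q0.
move: (wtW * _) (Lg ^+ 2 * (wl * _ * _ * _)) (wu * (1 + wu) * (Lg ^+ 2 / (g * mu))) (Lg ^+ 2 / (g * mu)).
by move: (Lg ^+ 2) => *; lra.
Qed.

Lemma init_weightW : wtW * (3 / 2) <= 12 * wu * (1 + wu) * t.
Proof.
rewrite -subr_ge0 /wtW (_ : _ - _ = 6 * wu * t); last by field.
by rewrite mulr_ge0 ?mulr_ge0 // ltW.
Qed.

Let w21 : 1 <= omega2 wu.
Proof. by rewrite /omega2 lerDl -mulrA; exact: mulr_ge0 (ler0n R 36) wu2. Qed.

Lemma init_weightR : wtR * (6 / 5) <= 48 * omega2 wu * wl * (1 + 4 * wl) * Qsq * (b / (mu * nn)).
Proof.
have Q0 : 0 <= wl * Qsq * (b / (mu * nn)) by rewrite mulr_ge0 // mulr_ge0 // Qsq_ge0.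
have -> : wtR * (6 / 5) = (wl * Qsq * (b / (mu * nn))) * (216 / 5 * (1 + 2 * wl)).
  by rewrite /wtR; field; rewrite !gt_eqF.
have -> : 48 * omega2 wu * wl * (1 + 4 * wl) * Qsq * (b / (mu * nn)) =
    (wl * Qsq * (b / (mu * nn))) * (48 * (omega2 wu * (1 + 4 * wl))) by ring.
apply: ler_wpM2l => //.
have H1 : 1 + 4 * wl <= omega2 wu * (1 + 4 * wl).
  by rewrite ler_peMl // addr_ge0 // mulr_ge0.
by move: wl0 H1; move: (omega2 wu * _) => e wl0' H1; lra.
Qed.

Lemma init_weightT : wtT * (6 / 5) <= 72 * omega2 wu * wl * (1 + 4 * wl) * Lg ^+ 2 * (g / (mu * nn)).
Proof.
have Q0 : 0 <= wl * Lg ^+ 2 * (g / (mu * nn)) by rewrite mulr_ge0 // mulr_ge0 // sqr_ge0.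
have -> : wtT * (6 / 5) = (wl * Lg ^+ 2 * (g / (mu * nn))) * (324 / 5 * (1 + 2 * wl)).
  by rewrite /wtT; field; rewrite !gt_eqF.
have -> : 72 * omega2 wu * wl * (1 + 4 * wl) * Lg ^+ 2 * (g / (mu * nn)) =
    (wl * Lg ^+ 2 * (g / (mu * nn))) * (72 * (omega2 wu * (1 + 4 * wl))) by ring.
apply: ler_wpM2l => //.
have H1 : 1 + 4 * wl <= omega2 wu * (1 + 4 * wl).
  by rewrite ler_peMl // addr_ge0 // mulr_ge0.
by move: wl0 H1; move: (omega2 wu * _) => e wl0' H1; lra.
Qed.

Lemma noise_level_le sigma : noise_level sigma <=
  48 * omega2 wu * (1 + 6 * wl * w1) * Qsq * (b / (mu * nn)) * sigma ^+ 2
  + (2 * t / nn + 36 * wu * (1 + wu) * t ^+ 2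
     + 72 * omega2 wu * (1 + 6 * wl * w1) * Lg ^+ 2 * (g / (mu * nn))) * sigma1sq par sigma.
Proof.
have s20 := sqr_ge0 sigma.
have s10 : 0 <= sigma1sq par sigma by apply: mulr_ge0 => //; rewrite addr_ge0 // sqr_ge0.
have wlw1 : wl <= wl * w1 by rewrite ler_peMr // omega1_ge1.
have H1 : 1 + 6 * wl * w1 <= omega2 wu * (1 + 6 * wl * w1).
  rewrite ler_peMl // addr_ge0 // -mulrA; apply: mulr_ge0 => //.
  exact: le_trans wlw1.
rewrite /noise_level [leRHS]addrC; apply: lerD; last first.
  apply: ler_wpM2r => //; apply: ler_wpM2r => //; apply: ler_wpM2r; first exact: Qsq_ge0.
  by rewrite -mulrA; move: wl0 wlw1 H1; rewrite -[6 * _ * _]mulrA; move: (wl * w1) (omega2 wu * _) => *; lra.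
apply: ler_wpM2r => //; apply: lerD; last first.
  apply: ler_wpM2r => //; apply: ler_wpM2r; first exact: sqr_ge0.
  by rewrite -mulrA; move: wl0 wlw1 H1; rewrite -[6 * _ * _]mulrA; move: (wl * w1) (omega2 wu * _) => *; lra.
rewrite -addrA lerD2l.
(* The noise of the per-worker momentum is of order theta^3; since theta <= 1 it joins the theta^2
   noise of the memories. *)
have t32 : t ^+ 3 <= t ^+ 2 by rewrite exprSr; apply: ler_piMr => //; exact: sqr_ge0.
have H2 : 0 <= 4 * wu * (1 + 2 * wu).
  by rewrite mulr_ge0 ?mulr_ge0 // addr_ge0 // mulr_ge0.
apply: le_trans (lerD (ler_wpM2l H2 t32) (lexx _)) _.
rewrite -subr_ge0 (_ : _ - _ = (28 * (wu * (1 + wu))) * t ^+ 2); last by ring.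
by apply: mulr_ge0 (sqr_ge0 _); exact: mulr_ge0 (ler0n R 28) wu2.
Qed.

End Weights.

(** Linear bookkeeping with all quantities abstract. Each weight inequality is multiplied by the
    error it governs, and the bound on S' by its total coefficient; their sum is exactly the
    difference of the two sides, which [ring] verifies. *)
Lemma weighted_drift {R : realType} (P P' G X ia B W S S' M Y Ry Z Rz s1 s2 t : R)
    (cB cW cS cM cY cR cZ cT kB kW kM kMW d kY kYX k kZ kZX eY eZ h q l lY l6 L1 L3 L4 mZ wl
     NB NW NM N : R) :
  0 <= X -> 0 <= B -> 0 <= W -> 0 <= S -> 0 <= M -> 0 <= Y -> 0 <= Ry -> 0 <= Z -> 0 <= Rz ->
  0 <= cS + cM * d ->
  P' <= P - G - X / ia + 2 * M + 2 * B ->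
  S' <= (1 - t) * S + t * (lY * Y + 3 * l * Z) ->
  2 + cB * (1 - t) <= cB ->
  cW * (1 - t) + cM * kMW <= cW ->
  2 + cM * (1 - kM) <= cM ->
  (cS + cM * d) * (1 - t) <= cS ->
  (cS + cM * d) * (t * lY) + cY * (1 - kY) + cY * eY * wl * l6 + cR * h * l + cZ * mZ
    + cZ * eZ * wl * (18 * L1) + cT * h * (3 * L1) <= cY ->
  (cS + cM * d) * (t * (3 * l)) + cZ * (1 - kZ) + cZ * eZ * wl * (18 * l) + cT * h * (3 * l) <= cZ ->
  cY * eY * wl * (6 / 5) + cR * (1 - k) <= cR ->
  cZ * eZ * wl * (6 / 5) + cT * (1 - k) <= cT ->
  cB * kB + cW * kW + cY * kYX + cR * (q * L3) + cZ * kZX + cT * (q * (3 * L4)) <= ia^-1 ->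
  cB * NB + cW * NW + cM * NM + cZ * (eZ * ((1 + wl) * s1)) + cT * (h * s1)
    + cY * (eY * ((1 + wl) * s2)) + cR * (h * s2) = N ->
  P' + cS * S' + cB * ((1 - t) * B + (kB * X + NB)) + cW * ((1 - t) * W + (kW * X + NW))
    + cM * ((1 - kM) * M + kMW * W + NM + d * S')
    + cY * ((1 - kY) * Y + kYX * X + eY * ((1 + wl) * s2 + wl * (6 / 5 * Ry + l6 * Y)))
    + cR * ((1 - k) * Ry + (h * (s2 + l * Y) + q * (L3 * X)))
    + cZ * ((1 - kZ) * Z + mZ * Y + kZX * X
            + eZ * ((1 + wl) * s1 + wl * (6 / 5 * Rz + 6 * (3 * L1 * Y + 3 * l * Z))))
    + cT * ((1 - k) * Rz + (h * (s1 + (3 * L1 * Y + 3 * l * Z)) + q * (3 * L4 * X)))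
  <= P + cS * S + cB * B + cW * W + cM * M + cY * Y + cR * Ry + cZ * Z + cT * Rz - G + N.
Proof.
move=> X0 B0 W0 S0 M0 Y0 Ry0 Z0 Rz0 c0 hP hS' hB hW hM hS hY hZ hR hT hX <-.
rewrite -subr_ge0.
rewrite -subr_ge0 in hP; rewrite -subr_ge0 in hS'; rewrite -subr_ge0 in hB.
rewrite -subr_ge0 in hW; rewrite -subr_ge0 in hM; rewrite -subr_ge0 in hS.
rewrite -subr_ge0 in hY; rewrite -subr_ge0 in hZ; rewrite -subr_ge0 in hR.
rewrite -subr_ge0 in hT; rewrite -subr_ge0 in hX.
have := addr_ge0 hP (mulr_ge0 c0 hS').
move=> /addr_ge0/(_ (mulr_ge0 hB B0))/addr_ge0/(_ (mulr_ge0 hW W0))/addr_ge0/(_ (mulr_ge0 hM M0)).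
move=> /addr_ge0/(_ (mulr_ge0 hS S0))/addr_ge0/(_ (mulr_ge0 hY Y0))/addr_ge0/(_ (mulr_ge0 hZ Z0)).
move=> /addr_ge0/(_ (mulr_ge0 hR Ry0))/addr_ge0/(_ (mulr_ge0 hT Rz0))/addr_ge0/(_ (mulr_ge0 hX X0)).
by move: (ia^-1) => j /le_trans; apply; rewrite le_eqVlt; apply/orP; left; apply/eqP; ring.
Qed.

(** Stated with sums on both sides, so that no possibly infinite integral is ever subtracted. *)
Lemma integral_add_le {d} {T : measurableType d} {R : realType} (P : probability T R)
    (F G V : T -> \bar R) (N : R) : 0 <= N ->
  measurable_fun setT F -> measurable_fun setT G -> measurable_fun setT V ->
  (forall t, 0 <= F t)%E -> (forall t, 0 <= G t)%E -> (forall t, 0 <= V t)%E ->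
  (forall t, F t + G t <= V t + N%:E)%E ->
  (\int[P]_t F t + \int[P]_t G t <= \int[P]_t V t + N%:E)%E.
Proof.
move=> N0 mF mG mV F0 G0 V0 H.
rewrite -ge0_integralD // -(integral_prob_cst P N) -ge0_integralD //.
by apply: le_integral_ge0 => t; rewrite ?adde_ge0.
Qed.

Section Lyapunov.
Context {R : realType} {n p q : nat} (pb : problem R n p q) (c : constants R)
  (Cu : 'I_n -> compressor R p) (Cl : 'I_n -> compressor R q) (rd : randomness pb Cu Cl)
  (par : hyperparams R) (ini : initial R n p q) (sigma wu wl : R).
Hypothesis n0 : (0 < n)%N.
Hypothesis q0 : (0 < q)%N.
Hypothesis reg : regular_losses pb.
Hypothesis cont : continuity_assumption pb c.
Hypothesis sc : strong_convexity_assumption pb c.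
Hypothesis noise : noise_assumption pb sigma.
Hypothesis dl : derived_lipschitz pb c.
Hypothesis hCu : forall i, omega_unbiased wu (Cu i).
Hypothesis hCl : forall i, omega_unbiased wl (Cl i).
Hypothesis fr : fresh_randomness rd.
Hypothesis rho_ge : C_f c / mu_g c <= rho par.
Hypothesis rho_gt0 : 0 < rho par.
Hypothesis a0 : 0 < alpha par.
Hypothesis b0 : 0 < beta par.
Hypothesis g0 : 0 < gamma par.
Hypothesis t01 : 0 < theta par <= 1.
Hypothesis dL : delta_l par = (1 + wl)^-1.
Hypothesis dU : delta_u par = (1 + wu)^-1.
Hypothesis aL : 2 * alpha par * L_Phi c <= 1.
Hypothesis aC : alpha par <= C3 c par n wu wl.
Hypothesis bL : beta par * (mu_g c + L_g c) <= 2.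
Hypothesis gL : gamma par * L_g c <= 1.
Hypothesis hb : beta par * (96 * wl * omega1 wl * L_g c ^+ 2) <= mu_g c * n%:R.
Hypothesis hg : gamma par * (432 * wl * omega1 wl * L_g c ^+ 2) <= mu_g c * n%:R.
Hypothesis Phi0 : forall x, 0 <= Phi pb x.
Hypothesis z0 : enorm (Defs.z0 ini) <= rho par.
Context (s0 : 'I_n -> 'cV[R]_p).

Notation P := (Pr rd).
Notation E := (@sources _ _ _ _ _ _ _ rd).
Notation ys := (ystar pb).
Notation zs := (zstar pb).
Notation nx := (@nxt _ _ _ _ pb Cu Cl par rd).

Definition lyap (st : state R n p q) (s : 'I_n -> 'cV[R]_p) :=
  2 / alpha par * Phi pb (s_x st) + wtS par * errS s + wtB par * errB pb st s
  + wtW par wu * errW pb st s + wtM wu * errM st s + wtY c par * errY pb st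
  + wtR c par n wl * errRy pb st + wtZ c par * errZ pb st + wtT c par n wl * errRz pb st.

Let mu0 := mu_gt0 sc.
Let muL := mu_le_Lg n0 q0 cont sc.
Let wu0 : 0 <= wu. Proof. by have [] := hCu (Ordinal n0). Qed.
Let wl0 : 0 <= wl. Proof. by have [] := hCl (Ordinal n0). Qed.
Let t0 : 0 < theta par. Proof. by have [] := andP t01. Qed.
Let t1 : theta par <= 1. Proof. by have [] := andP t01. Qed.
Let nn0 : 0 < n%:R :> R. Proof. by rewrite ltr0n. Qed.
Let Lg2 := sqr_ge0 (L_g c).
Let Q0 := Qsq_ge0 c par.
Let wtB0 := wtB_ge0 t01.
Let wtS0 := wtS_ge0 t01.
Let wtW0 := wtW_ge0 t01 wu0.
Let wtM0 := wtM_ge0 wu0.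
Let wtY0 := wtY_ge0 b0 mu0.
Let wtZ0 := wtZ_ge0 g0 mu0.
Let wtR0 := wtR_ge0 n b0 mu0 wl0.
Let wtT0 := wtT_ge0 n g0 mu0 wl0.

Let mean_ge0 (u : 'I_n -> R) : (forall i, 0 <= u i) -> 0 <= n%:R^-1 * \sum_i u i.
Proof. by move=> H; rewrite mulr_ge0 ?invr_ge0 // sumr_ge0. Qed.

Lemma errY_ge0 st : 0 <= errY pb st. Proof. exact: sqr_ge0. Qed.
Lemma errZ_ge0 st : 0 <= errZ pb st. Proof. exact: sqr_ge0. Qed.
Lemma errRy_ge0 st : 0 <= errRy pb st. Proof. by apply: mean_ge0 => i; exact: sqr_ge0. Qed.
Lemma errRz_ge0 st : 0 <= errRz pb st. Proof. by apply: mean_ge0 => i; exact: sqr_ge0. Qed.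
Lemma errS_ge0 (s : 'I_n -> 'cV[R]_p) : 0 <= errS s. Proof. by apply: mean_ge0 => i; exact: sqr_ge0. Qed.
Lemma errM_ge0 (st : state R n p q) s : 0 <= errM st s. Proof. by apply: mean_ge0 => i; exact: sqr_ge0. Qed.
Lemma errW_ge0 st s : 0 <= errW pb st s. Proof. by apply: mean_ge0 => i; exact: sqr_ge0. Qed.
Lemma errB_ge0 st s : 0 <= errB pb st s. Proof. exact: sqr_ge0. Qed.

Section LyapMeasurability.
Context {dT : measure_display} {T : measurableType dT} (st : T -> state R n p q)
  (s : T -> 'I_n -> 'cV[R]_p).
Hypothesis mst : mstate st.
Hypothesis ms : forall i, mvec (fun t => s t i).

Let mys : mvec (fun t => ys (s_x (st t))).
Proof. exact: mvec_lipschitz (ms_x mst) (ys_lipschitz dl). Qed.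

Let mzs : mvec (fun t => zs (s_x (st t))).
Proof. exact: mvec_lipschitz (ms_x mst) (zs_lipschitz dl). Qed.

Lemma mvec_mDx i (X : T -> 'cV[R]_p) (Y Z : T -> 'cV[R]_q) : mvec X -> mvec Y -> mvec Z ->
  mvec (fun t => mDx pb i (X t) (Y t) (Z t)).
Proof.
move=> mX mY mZ; apply: mvecD.
  apply: mvecM => // a b.
  exact: (@jmeas_hess_xy _ _ _ _ T (fun=> g_ pb i) (@differentiable2_jmeas R p q _ T _ (dg_ cont i).1)
    (fun=> dg_ cont i) a b _ _ id X Y (@measurable_id _ _ _) mX mY).
move=> a b; rewrite (ord1 b).
exact: (@jmeas_gradx _ _ _ _ T (fun=> f_ pb i) (@differentiable2_jmeas R p q _ T _ (df_ cont i))
  (fun=> df_ cont i) a _ _ id X Y (@measurable_id _ _ _) mX mY).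
Qed.

Let mrefx i : mvec (fun t => refx pb i (s_x (st t))).
Proof. exact: (mvec_mDx i (ms_x mst) mys mzs). Qed.

Let lip_meas d (h : 'cV[R]_p -> 'cV[R]_d) L : 0 <= L ->
  (forall x x', enorm (h x - h x') ^+ 2 <= L * enorm (x - x') ^+ 2) ->
  mvec (fun t => h (s_x (st t))).
Proof. by move=> L0 H; exact: mvec_lipschitz (ms_x mst) (lipschitz_of_sqr L0 H). Qed.

Let mrefy i : mvec (fun t => refy pb i (s_x (st t))).
Proof.
apply: lip_meas (refy_lipschitz cont dl i).
by rewrite mulr_ge0 ?sqr_ge0 // addr_ge0 // mulr_ge0 // sqr_ge0.
Qed.

Let mrefz i : mvec (fun t => refz pb i (s_x (st t))).
Proof.
apply: lip_meas (refz_lipschitz n0 cont sc dl rho_ge i).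
apply: mulr_ge0 => //; apply: addr_ge0.
  by apply: mulr_ge0 (L1sq_ge0 c par) _; rewrite addr_ge0 // mulr_ge0 // sqr_ge0.
by apply: mulr_ge0 (sqr_ge0 _); exact: mulr_ge0.
Qed.

Lemma mvec_drift i : mvec (fun t => drift pb par (st t) (s t) i).
Proof.
apply: mvecD; apply: mvecZ => //; apply: mvecB => //.
exact: (mvec_mDx i (ms_x mst) (ms_y mst) (ms_z mst)).
Qed.

Let mmean d (u : 'I_n -> T -> 'cV[R]_d) : (forall i, mvec (u i)) ->
  measurable_fun setT (fun t => n%:R^-1 * \sum_i enorm (u i t) ^+ 2).
Proof.
by move=> mu; apply: measurable_funM => //; apply: measurable_sum => i; exact: measurable_enorm2.
Qed.

Lemma measurable_errY : measurable_fun setT (fun t => errY pb (st t)).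
Proof. by apply: measurable_enorm2; apply: mvecB => //; exact: ms_y. Qed.

Lemma measurable_errZ : measurable_fun setT (fun t => errZ pb (st t)).
Proof. by apply: measurable_enorm2; apply: mvecB => //; exact: ms_z. Qed.

Lemma measurable_errRy : measurable_fun setT (fun t => errRy pb (st t)).
Proof. by apply: (mmean (u := fun i t => _)) => i; apply: mvecB => //; exact: ms_my. Qed.

Lemma measurable_errRz : measurable_fun setT (fun t => errRz pb (st t)).
Proof. by apply: (mmean (u := fun i t => _)) => i; apply: mvecB => //; exact: ms_mz. Qed.

Lemma measurable_errS : measurable_fun setT (fun t => errS (s t)).
Proof. exact: (mmean (u := fun i t => _)). Qed.

Lemma measurable_errM : measurable_fun setT (fun t => errM (st t) (s t)).
Proof.
apply: (mmean (u := fun i t => _)) => i; apply: mvecB; first exact: ms_mx.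
by apply: mvecB => //; exact: ms_hx.
Qed.

Let mw i : mvec (fun t => refx pb i (s_x (st t)) - s_hx (st t) i + s t i).
Proof. by apply: mvecD => //; apply: mvecB => //; exact: ms_hx. Qed.

Lemma measurable_errW : measurable_fun setT (fun t => errW pb (st t) (s t)).
Proof. exact: (mmean (u := fun i t => _) mw). Qed.

Lemma measurable_errB : measurable_fun setT (fun t => errB pb (st t) (s t)).
Proof. by apply: measurable_enorm2; exact: (mvec_vmean mw). Qed.

Lemma measurable_Phi : measurable_fun setT (fun t => Phi pb (s_x (st t))).
Proof. exact: differentiable2_measurable (dfbar cont) (ms_x mst) mys. Qed.

Lemma measurable_grad_Phi : measurable_fun setT (fun t => enorm (grad (Phi pb) (s_x (st t))) ^+ 2).
Proof.
by apply: measurable_enorm2; have [_ [LP _ _]] := dl; exact: mvec_lipschitz (ms_x mst) LP.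
Qed.

Lemma measurable_lyap : measurable_fun setT (fun t => lyap (st t) (s t)).
Proof.
have add (F G : T -> R) (a : R) : measurable_fun setT F -> measurable_fun setT G ->
    measurable_fun setT (fun t => F t + a * G t).
  by move=> mF mG; apply: measurable_funD => //; exact: measurable_funM.
rewrite /lyap; apply: (add _ _ _ _ measurable_errRz); apply: (add _ _ _ _ measurable_errZ).
apply: (add _ _ _ _ measurable_errRy); apply: (add _ _ _ _ measurable_errY).
apply: (add _ _ _ _ measurable_errM); apply: (add _ _ _ _ measurable_errW).
apply: (add _ _ _ _ measurable_errB); apply: (add _ _ _ _ measurable_errS).
by apply: measurable_funM => //; exact: measurable_Phi.
Qed.

End LyapMeasurability.

Lemma lyap_ge0 st s : 0 <= lyap st s.
Proof.
rewrite /lyap.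
apply: addr_ge0 (mulr_ge0 wtT0 (errRz_ge0 st)); apply: addr_ge0 (mulr_ge0 wtZ0 (errZ_ge0 st)).
apply: addr_ge0 (mulr_ge0 wtR0 (errRy_ge0 st)); apply: addr_ge0 (mulr_ge0 wtY0 (errY_ge0 st)).
apply: addr_ge0 (mulr_ge0 wtM0 (errM_ge0 st s)); apply: addr_ge0 (mulr_ge0 wtW0 (errW_ge0 st s)).
apply: addr_ge0 (mulr_ge0 wtB0 (errB_ge0 st s)); apply: addr_ge0 (mulr_ge0 wtS0 (errS_ge0 s)).
by apply: mulr_ge0 (Phi0 _); rewrite divr_ge0 // ltW.
Qed.

Definition bounded_mean (F : Om rd -> R) (b : R) :=
  [/\ measurable_fun setT F, (forall w, 0 <= F w) & (\int[P]_w (F w)%:E <= b%:E)%E].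

Lemma bounded_meanD F G a b k : 0 <= k -> bounded_mean F a -> bounded_mean G b ->
  bounded_mean (fun w => F w + k * G w) (a + k * b).
Proof.
move=> k0 [mF F0 Fa] [mG G0 Gb]; split.
- by apply: measurable_funD => //; exact: measurable_funM.
- by move=> w; rewrite addr_ge0 // mulr_ge0.
- exact: expect_le_add.
Qed.

Lemma one_step k st s : coherent par st ->
  (\int[P]_w (lyap (nx k st w) (drift pb par st s))%:E <=
    (lyap st s - enorm (grad (Phi pb) (s_x st)) ^+ 2 + noise_level c par n wu wl sigma)%:E)%E.
Proof.
move=> coh; have mn := mnx par reg hCu hCl fr k st.
set x' := s_x st - alpha par *: vmean (s_mx st).
set s' := drift pb par st s.
have ms' i : mvec (fun _ : Om rd => s' i) by exact: mvec_cst.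
(* Given the state, the next x and the next lag are deterministic, because x moves along the old
   averaged memory and [drift] uses mean directions. These two terms therefore enter as a
   constant. *)
have B0 : bounded_mean (fun=> 2 / alpha par * Phi pb x' + wtS par * errS s')
    (2 / alpha par * Phi pb x' + wtS par * errS s').
  split; [exact: measurable_cst|move=> _|by rewrite integral_prob_cst].
  apply: addr_ge0 (mulr_ge0 wtS0 (errS_ge0 _)).
  by apply: mulr_ge0 (Phi0 _); rewrite divr_ge0 // ltW.
have B1 := (And3 (measurable_errB mn ms') (fun w => errB_ge0 _ _)
    (step_B n0 reg cont sc noise dl fr k s coh t01) : bounded_mean (fun w => errB pb (nx k st w) s') _).
have B2 := (And3 (measurable_errW mn ms') (fun w => errW_ge0 _ _)
    (step_W n0 reg cont sc noise dl hCu hCl fr rho_ge k s coh t01) : bounded_mean (fun w => errW pb (nx k st w) s') _).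
have B3 := (And3 (measurable_errM mn ms') (fun w => errM_ge0 _ _)
    (step_M n0 reg noise hCu hCl fr k s coh t01 dU) : bounded_mean (fun w => errM (nx k st w) s') _).
have B4 := (And3 (measurable_errY mn) (fun w => errY_ge0 _)
    (step_Y n0 q0 reg cont sc noise dl hCl fr k coh b0 bL) : bounded_mean (fun w => errY pb (nx k st w)) _).
have B5 := (And3 (measurable_errRy mn) (fun w => errRy_ge0 _)
    (step_Ry n0 reg cont noise dl hCu hCl fr k coh dL) : bounded_mean (fun w => errRy pb (nx k st w)) _).
have B6 := (And3 (measurable_errZ mn) (fun w => errZ_ge0 _)
    (step_Z n0 q0 reg cont sc noise dl hCl fr rho_ge rho_gt0 k coh g0 gL) : bounded_mean (fun w => errZ pb (nx k st w)) _).
have B7 := (And3 (measurable_errRz mn) (fun w => errRz_ge0 _)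
    (step_Rz n0 reg cont sc noise dl hCu hCl fr rho_ge k coh dL) : bounded_mean (fun w => errRz pb (nx k st w)) _).
have [_ _ H] := bounded_meanD wtT0 (bounded_meanD wtZ0 (bounded_meanD wtR0 (bounded_meanD wtY0
  (bounded_meanD wtM0 (bounded_meanD wtW0 (bounded_meanD wtB0 B0 B1) B2) B3) B4) B5) B6) B7.
under eq_integral do rewrite /lyap (nxE k coh) -/x'.
apply: le_trans H _; rewrite lee_fin.
apply: weighted_drift (step_Phi n0 cont sc dl st s a0 aL) (step_S n0 cont sc rho_ge st s t01) _ _ _ _ _ _ _ _ _ _.
- exact: sqr_ge0.
- exact: errB_ge0.
- exact: errW_ge0.
- exact: errS_ge0.
- exact: errM_ge0.
- exact: errY_ge0.
- exact: errRy_ge0.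
- exact: errZ_ge0.
- exact: errRz_ge0.
- by apply: addr_ge0 wtS0 (mulr_ge0 wtM0 _); rewrite invr_ge0 addr_ge0.
- exact: weightB t01.
- exact: weightW.
- exact: weightM.
- exact: weightS.
- exact: (weightY b0 g0 t01 mu0 muL n0 wu0 wl0 hb hg).
- exact: (weightZ g0 t01 mu0 n0 wu0 wl0 hg).
- exact: (weightR b0 mu0 n0 wl0).
- exact: (weightT g0 mu0 n0 wl0).
- exact: (weightX a0 b0 g0 t01 mu0 n0 wu0 wl0 aC).
rewrite -(weight_noise b0 g0 t01 mu0 n0 wu0 wl0).
move: (sigma1sq par sigma) (wtB par) (wtW par wu) (wtM wu) (wtZ c par) (wtT c par n wl) (wtY c par)
  (wtR c par n wl) (beta par ^+ 2 / n%:R) (gamma par ^+ 2 / n%:R) (2 / (1 + 2 * wl)) => *.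
by ring.
Qed.

(** The lag follows the random trajectory but uses expected directions, so at time k it depends on
    the past sources only and is frozen together with the state. *)
Fixpoint lag k (w : Om rd) : 'I_n -> 'cV[R]_p :=
  if k is k'.+1 then drift pb par (efsoba par ini k' w) (lag k' w) else s0.

Notation ef := (@efsoba _ _ _ _ pb Cu Cl rd par ini).

Lemma coherent_efsoba k w : coherent par (ef k w).
Proof.
elim: k => [|k IH]; first by split.
exact: coherent_nxt.
Qed.

Lemma mvec_lag k i : @mvec _ (sub_sigma E (past k)) R _ _ (fun w => lag k w i).
Proof.
elim: k i => [|k IH] i; first exact: mvec_cst.
have H := mvec_drift (mstate_efsoba par reg hCu hCl rd ini k) IH i.
by move=> a b; apply: sub_sigma_mono (H a b); exact: past_mono.
Qed.

Lemma noise_level_ge0 : 0 <= noise_level c par n wu wl sigma.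
Proof.
have s20 : 0 <= sigma ^+ 2 by exact: sqr_ge0.
have s10 : 0 <= sigma1sq par sigma by apply: mulr_ge0 => //; rewrite addr_ge0 // sqr_ge0.
have b1 : 0 <= beta par / (mu_g c * n%:R) by rewrite divr_ge0 ?mulr_ge0 // ltW.
have g1 : 0 <= gamma par / (mu_g c * n%:R) by rewrite divr_ge0 ?mulr_ge0 // ltW.
have e1 : 0 <= theta par ^+ 3 by rewrite exprn_ge0 // ltW.
have e2 : 0 <= theta par ^+ 2 by rewrite exprn_ge0 // ltW.
have u2 : 0 <= 1 + 2 * wu by rewrite addr_ge0 // mulr_ge0.
have t2 : 0 <= 2 * theta par / n%:R by rewrite divr_ge0 // mulr_ge0 // ltW.
have k1 : 0 <= 30 + 138 * wl := addr_ge0 (ler0n R 30) (mulr_ge0 (ler0n R 138) wl0).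
have k2 : 0 <= 15 + 87 * wl := addr_ge0 (ler0n R 15) (mulr_ge0 (ler0n R 87) wl0).
apply: addr_ge0; last exact: mulr_ge0 (mulr_ge0 (mulr_ge0 k2 Q0) b1) s20.
apply: mulr_ge0 => //; apply: addr_ge0; last exact: mulr_ge0 (mulr_ge0 k1 Lg2) g1.
apply: addr_ge0; last exact: mulr_ge0 (mulr_ge0 (ler0n R 4) wu0) e2.
exact: addr_ge0 t2 (mulr_ge0 (mulr_ge0 (mulr_ge0 (ler0n R 4) wu0) u2) e1).
Qed.

Definition mean_lyap k := (\int[P]_w (lyap (ef k w) (lag k w))%:E)%E.
Definition mean_grad k := (\int[P]_w (enorm (grad (Phi pb) (s_x (ef k w))) ^+ 2)%:E)%E.

(** The outcome is duplicated: the first copy determines the state and the lag, the second the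
    randomness of iteration k. On the diagonal this is the Lyapunov value at time k + 1, which is
    the shape required by [freeze2]. *)
Definition next_lyap k (v : sub_sigma E (past k) * sub_sigma E (fresh k)) :=
  (lyap (nx k (ef k v.1) v.2) (drift pb par (ef k v.1) (lag k v.1)))%:E.

Lemma next_lyap_ge0 k v : (0 <= next_lyap (k := k) v)%E.
Proof. by rewrite lee_fin lyap_ge0. Qed.

Lemma measurable_next_lyap k : measurable_fun setT (@next_lyap k).
Proof.
have mk := mstate_efsoba par reg hCu hCl rd ini k.
apply/measurable_EFinP.
have m0 : measurable_fun setT (fst : sub_sigma E (past k) * sub_sigma E (fresh k) -> _).
  exact: measurable_fst.
have m1 := mstate_comp m0 mk.
apply: measurable_lyap; first exact: (mstate_nxt par reg hCu hCl m1 measurable_snd).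
by move=> i; have H := mvec_drift mk (@mvec_lag k) i; exact: (mvec_comp H m0).
Qed.

Lemma mean_lyapS k : mean_lyap k.+1 = (\int[P]_w \int[P]_v next_lyap (k := k) (w, v))%E.
Proof.
rewrite -(freeze2 (src_meas fr) (@src_setI _ _ _ _ _ _ _ rd)
  (@src_setT _ _ _ _ _ _ _ rd) (src_indep fr) (past_fresh k) (@measurable_next_lyap k)
  (@next_lyap_ge0 k)).
by apply: eq_integral => w _; exact: erefl.
Qed.

(** The gradient term stands on the left because the means are not yet known to be finite;
    finiteness emerges in [mean_telescope] from the deterministic start. *)
Lemma mean_step k : (mean_lyap k.+1 + mean_grad k <=
   mean_lyap k + (noise_level c par n wu wl sigma)%:E)%E.
Proof.
have mk := mstate_efsoba par reg hCu hCl rd ini k.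
rewrite mean_lyapS /mean_grad /mean_lyap.
have mF : measurable_fun [set: Om rd] (fun w => \int[P]_v next_lyap (k := k) (w, v))%E.
  apply: (measurable_sub_sigma (src_meas fr) (J := past k)).
  exact: (measurable_partial_integral P (src_meas fr) (@measurable_next_lyap k) (@next_lyap_ge0 k)).
have mG : measurable_fun [set: Om rd] (fun w => (enorm (grad (Phi pb) (s_x (ef k w))) ^+ 2)%:E).
  apply/measurable_EFinP; apply: (measurable_sub_sigma (src_meas fr) (J := past k)).
  exact: measurable_grad_Phi.
have mV : measurable_fun [set: Om rd] (fun w => (lyap (ef k w) (lag k w))%:E).
  apply/measurable_EFinP; apply: (measurable_sub_sigma (src_meas fr) (J := past k)).
  exact: measurable_lyap mk (@mvec_lag k).
have N0 := noise_level_ge0.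
apply: (integral_add_le P N0 mF mG mV) => w.
- by apply: integral_ge0 => v _; exact: next_lyap_ge0.
- by rewrite lee_fin sqr_ge0.
- by rewrite lee_fin lyap_ge0.
apply: le_trans (leeD2r _ (one_step k (lag k w) (coherent_efsoba k w))) _.
by rewrite -!EFinD lee_fin addrAC subrK.
Qed.

Lemma mean_telescope K : (\sum_(0 <= k < K) mean_grad k + mean_lyap K <=
   (lyap (init_state ini) s0 + K%:R * noise_level c par n wu wl sigma)%:E)%E.
Proof.
elim: K => [|K IH].
  have -> : mean_lyap 0 = (lyap (init_state ini) s0)%:E by exact: (integral_prob_cst P (lyap (init_state ini) s0)).
  by rewrite big_nil add0e mul0r addr0.
rewrite big_nat_recr //= -addeA (addeC (mean_grad K)).
apply: le_trans (leeD2l _ (mean_step K)) _; rewrite addeA.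
apply: le_trans (leeD2r _ IH) _.
rewrite -EFinD lee_fin; move: (lyap _ _) (noise_level _ _ _ _ _ _) => A B.
by rewrite -[K.+1%:R]natr1 mulrDl mul1r addrA.
Qed.

(** Valid for every initial lag [s0]. The explicit bound and the order are two instances of this
    inequality, with different choices of [s0]. *)
Lemma avg_sq_grad_lyap K : (0 < K)%N ->
  (avg_sq_grad rd par ini K <=
    (lyap (init_state ini) s0 / K%:R + noise_level c par n wu wl sigma)%:E)%E.
Proof.
move=> K0; have K0' : (0 : R) < K%:R by rewrite ltr0n.
rewrite /avg_sq_grad.
have -> : (lyap (init_state ini) s0 / K%:R + noise_level c par n wu wl sigma) =
    K%:R^-1 * (lyap (init_state ini) s0 + K%:R * noise_level c par n wu wl sigma).
  by field; rewrite gt_eqF.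
rewrite (EFinM K%:R^-1); apply: lee_wpmul2l; first by rewrite lee_fin invr_ge0 ltW.
apply: le_trans (mean_telescope K).
rewrite (eq_bigr mean_grad) => [|k _]; last by rewrite unlock.
by rewrite leeDl // integral_ge0 // => w _; rewrite lee_fin lyap_ge0.
Qed.

End Lyapunov.

(** * The finite-time bound *)

Lemma mean_vec_unbiased {d} {T : measurableType d} {R : realType} (P : probability T R) a
    (X : T -> 'cV[R]_a) M : unbiased P X M -> mean_vec P X = M.
Proof.
move=> H; apply/matrixP => i j; rewrite (ord1 j) mxE unlock.
by have [_ ->] := H i 0.
Qed.

Section InitialErrors.
Context {R : realType} {n p q : nat} (pb : problem R n p q) (c : constants R)
  (Cu : 'I_n -> compressor R p) (Cl : 'I_n -> compressor R q) (rd : randomness pb Cu Cl)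
  (par : hyperparams R) (ini : initial R n p q) (sigma wu wl : R).
Hypothesis n0 : (0 < n)%N.
Hypothesis setting : efsoba_setting rd c par ini sigma wu wl.
Hypothesis rho_ge : C_f c / mu_g c <= rho par.
Hypothesis mh0 : forall i, mx0 ini i = hx0 ini i.

Let reg : regular_losses pb. Proof. by have [[]] := setting. Qed.
Let cont : continuity_assumption pb c. Proof. by have [[]] := setting. Qed.
Let sc : strong_convexity_assumption pb c. Proof. by have [[]] := setting. Qed.
Let noise : noise_assumption pb sigma. Proof. by have [[]] := setting. Qed.
Let dl : derived_lipschitz pb c. Proof. by have [[]] := setting. Qed.
Let fr : fresh_randomness rd. Proof. by have [_ [[]]] := setting. Qed.
Let zr : enorm (z0 ini) <= rho par. Proof. by have [_ [_ [_ []]]] := setting. Qed.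

Notation x := (x0 ini).
Notation y := (y0 ini).
Notation z := (z0 ini).
Notation st0 := (init_state ini).
Notation dY := (Delta_y pb ini).
Notation dZ := (Delta_z pb ini).

Let coh : coherent par st0. Proof. by split. Qed.

Lemma mean_Dx0E i : mean_Dx0 rd ini i = mDx pb i x y z.
Proof. by apply: mean_vec_unbiased; have [] := oracle_x reg noise fr 0 coh i. Qed.

Lemma mean_Dy0E i : mean_Dy0 rd ini i = mDy pb i x y.
Proof. by apply: mean_vec_unbiased; have [] := oracle_y reg noise fr 0 st0 i. Qed.

Lemma mean_Dz0E i : mean_Dz0 rd ini i = mDz pb i x y z.
Proof. by apply: mean_vec_unbiased; have [] := oracle_z reg noise fr 0 coh i. Qed.

Lemma init_errRy : errRy pb st0 <= 6 / 5 * Delta_my rd ini + 6 * L_g c ^+ 2 * dY.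
Proof.
rewrite /errRy /Delta_my -(mean_affine n0); apply: mean_le => i /=.
rewrite mean_Dy0E.
have := mDy_ref cont i x y; rewrite -/dY.
move: (mDy pb i x y) (refy pb i x) => m r.
have -> : my0 ini i - r = (my0 ini i - m) + (m - r) by rewrite addrA subrK.
have c5 : 0 < 5^-1 :> R by rewrite invr_gt0.
have := young (my0 ini i - m) (m - r) c5; rewrite invrK (enormBC m (my0 ini i)).
move: (enorm _ ^+ 2) (enorm (my0 ini i - m) ^+ 2) (enorm (m - r) ^+ 2) dY => w u v l1.
rewrite -[6 * L_g c ^+ 2 * _]mulrA.
move: (L_g c ^+ 2 * l1) => ? ? ?.
by lra.
Qed.

Lemma init_errRz : errRz pb st0 <= 6 / 5 * Delta_mz rd ini
  + (18 * L1sq c par * dY + 18 * L_g c ^+ 2 * dZ).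
Proof.
rewrite /errRz /Delta_mz -(mean_affine n0); apply: mean_le => i /=.
rewrite mean_Dz0E.
have := mDz_ref n0 cont sc rho_ge i x y z; rewrite -/dY -/dZ.
move: (mDz pb i x y z) (refz pb i x) => m r.
have -> : mz0 ini i - r = (mz0 ini i - m) + (m - r) by rewrite addrA subrK.
have c5 : 0 < 5^-1 :> R by rewrite invr_gt0.
have := young (mz0 ini i - m) (m - r) c5; rewrite invrK (enormBC m (mz0 ini i)).
move: (enorm _ ^+ 2) (enorm (mz0 ini i - m) ^+ 2) (enorm (m - r) ^+ 2) dY dZ => w u v l1 l2.
rewrite -![3 * _ * _]mulrA -![18 * _ * _]mulrA.
move: (L1sq c par * l1) (L_g c ^+ 2 * l2) => ? ? ? ?.
by lra.
Qed.

Section NoLag.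
Let s (_ : 'I_n) : 'cV[R]_p := 0.

Lemma init_errS_nolag : errS s = 0.
Proof. by rewrite /errS big1 ?mulr0 // => i _; rewrite enorm0 expr0n. Qed.

Lemma init_errM_nolag : errM st0 s = 0.
Proof. by rewrite /errM big1 ?mulr0 // => i _; rewrite /= mh0 subr0 subrr enorm0 expr0n. Qed.

Lemma init_errB_nolag : errB pb st0 s = Delta_x pb ini.
Proof.
rewrite /errB /Delta_x (grad_PhiE n0 cont sc dl x) enormBC -vmeanB; congr (enorm (vmean _) ^+ 2).
by apply/funext => i; rewrite /s addr0.
Qed.

Lemma init_errW_nolag : errW pb st0 s <= 3 / 2 * Delta_h rd ini
  + (9 * L2sq c par * dY + 9 * L_g c ^+ 2 * dZ).
Proof.
rewrite /errW /Delta_h -(mean_affine n0); apply: mean_le => i /=.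
rewrite mean_Dx0E /s addr0 (enormBC (refx pb i x)).
have := mDx_ref n0 cont sc rho_ge i x y z; rewrite -/dY -/dZ.
move: (mDx pb i x y z) (refx pb i x) => m r.
have -> : hx0 ini i - r = (hx0 ini i - m) + (m - r) by rewrite addrA subrK.
have c5 : 0 < 2^-1 :> R by rewrite invr_gt0.
have := young (hx0 ini i - m) (m - r) c5; rewrite invrK.
move: (enorm _ ^+ 2) (enorm (hx0 ini i - m) ^+ 2) (enorm (m - r) ^+ 2) dY dZ => w u v l1 l2.
rewrite -![3 * _ * _]mulrA -![9 * _ * _]mulrA.
move: (L2sq c par * l1) (L_g c ^+ 2 * l2) => ? ? ? ?.
by lra.
Qed.

End NoLag.

Section Lag.
(* The correction that makes the momentum error vanish up to [Delta_h]. *)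
Definition lag0 i := mDx pb i x y z - refx pb i x.

Lemma init_errS_lag : errS lag0 <= 3 * L2sq c par * dY + 3 * L_g c ^+ 2 * dZ.
Proof.
rewrite /errS -[leRHS](mean_cst n0); apply: mean_le => i.
exact: (mDx_ref n0 cont sc rho_ge).
Qed.

Lemma init_errM_lag : errM st0 lag0 = errS lag0.
Proof.
by congr (_ * _); apply: eq_bigr => i _; rewrite /= mh0 opprB addrCA subrr addr0.
Qed.

Let wE i : refx pb i x - hx0 ini i + lag0 i = mDx pb i x y z - hx0 ini i.
Proof.
rewrite /lag0; move: (refx pb i x) (mDx pb i x y z) => u v.
by apply/matrixP => a b; rewrite !mxE; ring.
Qed.

Lemma init_errW_lag : errW pb st0 lag0 = Delta_h rd ini.
Proof.
by congr (_ * _); apply: eq_bigr => i _; rewrite /= wE mean_Dx0E enormBC.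
Qed.

Lemma init_errB_lag : errB pb st0 lag0 <= Delta_h rd ini.
Proof. by rewrite -init_errW_lag; exact: vmean_enorm_sqr. Qed.

End Lag.

End InitialErrors.

Lemma quot_oo_le {R : realType} (x a b : R) : 0 <= a -> 0 <= b ->
  (x%:E <= quot_oo a b)%E -> x * b <= a.
Proof.
move=> a0 b0; rewrite /quot_oo; case: eqP => [->|/eqP bn]; first by rewrite mulr0.
by rewrite lee_fin ler_pdivlMr // lt_neqAle eq_sym bn.
Qed.

Lemma finite_time_bound (R : realType) (c : constants R)
    (n p q : nat) (pb : problem R n p q)
    (Cu : 'I_n -> compressor R p) (Cl : 'I_n -> compressor R q)
    (rd : randomness pb Cu Cl) (par : hyperparams R) (ini : initial R n p q)
    (sigma wu wl : R) (K : nat) :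
  (0 < n)%N -> (0 < p)%N -> (0 < q)%N -> (0 < K)%N ->
  efsoba_setting rd c par ini sigma wu wl ->
  (forall x, 0 <= Phi pb x) ->
  theta par <= 1 ->
  ((beta par)%:E < mine (2 / (mu_g c + L_g c))%:E
     (quot_oo (mu_g c * n%:R) (96 * wl * omega1 wl * L_g c ^+ 2)))%E ->
  ((gamma par)%:E <= mine (quot_oo 1 (L_g c))
     (quot_oo (mu_g c * n%:R) (432 * wl * omega1 wl * L_g c ^+ 2)))%E ->
  C_f c / mu_g c <= rho par ->
  delta_l par = (1 + wl)^-1 ->
  delta_u par = (1 + wu)^-1 ->
  (forall i, mx0 ini i = hx0 ini i) ->
  alpha par <= Num.min (1 / (2 * L_Phi c)) (C3 c par n wu wl) ->
  (avg_sq_grad rd par ini K <=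
    (2 * Delta_Phi pb ini / (K%:R * alpha par)
     + 2 * Delta_x pb ini / (K%:R * theta par)
     + 12 * wu * (1 + wu) * theta par * Delta_h rd ini / K%:R
     + 24 * omega2 wu * (L2sq c par + 25 * kappa_g c ^+ 2 * L1sq c par)
         * Delta_y pb ini / (mu_g c * K%:R * beta par)
     + 48 * omega2 wu * L_g c ^+ 2 * Delta_z pb ini / (mu_g c * K%:R * gamma par)
     + 48 * omega2 wu * (1 + 6 * wl * omega1 wl)
         * (L2sq c par + 25 * kappa_g c ^+ 2 * L1sq c par) * beta par
         / (mu_g c * n%:R) * sigma ^+ 2
     + (2 * theta par / n%:R + 36 * wu * (1 + wu) * theta par ^+ 2
        + 72 * omega2 wu * (1 + 6 * wl * omega1 wl)
            * L_g c ^+ 2 * gamma par / (mu_g c * n%:R)) * sigma1sq par sigma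
     + 48 * omega2 wu * wl * (1 + 4 * wl)
         * (L2sq c par + 25 * kappa_g c ^+ 2 * L1sq c par) * beta par
         / (mu_g c * K%:R * n%:R ^+ 2)
         * \sum_(i < n) enorm (mean_Dy0 rd ini i - my0 ini i) ^+ 2
     + 72 * omega2 wu * wl * (1 + 4 * wl) * L_g c ^+ 2
         * gamma par / (mu_g c * K%:R * n%:R ^+ 2)
         * \sum_(i < n) enorm (mean_Dz0 rd ini i - mz0 ini i) ^+ 2)%:E)%E.
Proof.
move=> n0 p0 q0 K0 setting Phi0 t1 hbeta hgamma rho_ge dL dU mh0 halpha.
have [[reg cont sc noise dl] [[hCu hCl fr] [[a0 b0 g0 t0] [r0 _ _ z0]]]] := setting.
have mu0 := mu_gt0 sc; have muL := mu_le_Lg n0 q0 cont sc; have Lg0 := Lg_gt0 n0 q0 cont sc.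
have LP0 : 0 < L_Phi c by have [[]] := dl.
have wu0 : 0 <= wu by have [] := hCu (Ordinal n0).
have wl0 : 0 <= wl by have [] := hCl (Ordinal n0).
have w1 := omega1_ge1 wl0; have w10 := le_trans ler01 w1.
have nn0 : 0 < n%:R :> R by rewrite ltr0n.
have KK0 : 0 < K%:R :> R by rewrite ltr0n.
have mun : 0 <= mu_g c * n%:R by rewrite mulr_ge0 // ltW.
have Lw k : 0 <= k%:R * wl * omega1 wl * L_g c ^+ 2.
  by apply: mulr_ge0 (sqr_ge0 _); rewrite mulr_ge0 // mulr_ge0.
have t01 : 0 < theta par <= 1 by rewrite t0.
move: hbeta; rewrite lt_min lte_fin => /andP[hb1 /ltW /(quot_oo_le mun (Lw 96)) hb].
move: hgamma; rewrite le_min => /andP[/(quot_oo_le ler01 (ltW Lg0)) gL /(quot_oo_le mun (Lw 432)) hg].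
have bL : beta par * (mu_g c + L_g c) <= 2.
  by rewrite -ler_pdivlMr ?addr_gt0 // ltW.
move: halpha; rewrite le_min => /andP[aL aC].
have {}aL : 2 * alpha par * L_Phi c <= 1.
  by rewrite ler_pdivlMr ?mulr_gt0 // in aL; rewrite mulrAC mulrC.
(* Zero initial lag: since m_x^0 = h_x^0 the memory error vanishes, and the averaged momentum error
   is exactly Delta_x. *)
apply: le_trans (avg_sq_grad_lyap n0 q0 reg cont sc noise dl hCu hCl fr rho_ge r0 a0 b0 g0 t01
  dL dU aL aC bL gL hb hg Phi0 z0 (fun=> 0) K0) _.
rewrite lee_fin /lyap init_errS_nolag (init_errM_nolag mh0) (init_errB_nolag n0 setting) !mulr0 !addr0.
have hW := ler_wpM2l (wtW_ge0 t01 wu0) (init_errW_nolag n0 setting rho_ge).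
have hRy := ler_wpM2l (wtR_ge0 (c := c) n b0 mu0 wl0) (init_errRy n0 setting).
have hRz := ler_wpM2l (wtT_ge0 (c := c) n g0 mu0 wl0) (init_errRz n0 setting rho_ge).
have Y0 : 0 <= Delta_y pb ini by exact: sqr_ge0.
have Z0 : 0 <= Delta_z pb ini by exact: sqr_ge0.
have H0 : 0 <= Delta_h rd ini by rewrite mulr_ge0 ?invr_ge0 // sumr_ge0 // => i _; exact: sqr_ge0.
have My0 : 0 <= Delta_my rd ini by rewrite mulr_ge0 ?invr_ge0 // sumr_ge0 // => i _; exact: sqr_ge0.
have Mz0 : 0 <= Delta_mz rd ini by rewrite mulr_ge0 ?invr_ge0 // sumr_ge0 // => i _; exact: sqr_ge0.
have cY := ler_wpM2r Y0 (init_weightY b0 g0 t01 mu0 muL n0 wu0 wl0 hb hg bL).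
have cZ := ler_wpM2r Z0 (init_weightZ g0 t01 mu0 muL n0 wu0 wl0 hg gL).
have cH := ler_wpM2r H0 (init_weightW t01 wu0).
have cR := ler_wpM2r My0 (init_weightR (c := c) b0 mu0 n0 wu0 wl0).
have cT := ler_wpM2r Mz0 (init_weightT (c := c) g0 mu0 n0 wu0 wl0).
have cN := noise_level_le (c := c) n b0 g0 t01 mu0 wu0 wl0 sigma.
have -> : \sum_(i < n) enorm (mean_Dy0 rd ini i - my0 ini i) ^+ 2 = n%:R * Delta_my rd ini.
  by rewrite /Delta_my mulrA divff ?mul1r // gt_eqF.
have -> : \sum_(i < n) enorm (mean_Dz0 rd ini i - mz0 ini i) ^+ 2 = n%:R * Delta_mz rd ini.
  by rewrite /Delta_mz mulrA divff ?mul1r // gt_eqF.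
rewrite -/(Qsq c par) in cN cY cZ cR cT *.
move: hW hRy hRz cY cZ cH cR cT cN Y0 Z0 H0 My0 Mz0.
rewrite -[errY pb (init_state ini)]/(Delta_y pb ini) -[errZ pb (init_state ini)]/(Delta_z pb ini).
rewrite -[Phi pb (s_x (init_state ini))]/(Delta_Phi pb ini) /wtB.
move: (errW _ _ _) (errRy _ _) (errRz _ _) (Delta_y _ _) (Delta_z _ _) (Delta_h _ _) (Delta_my _ _)
  (Delta_mz _ _) (Delta_Phi _ _) (Delta_x _ _) => eW eR eT Y Z H My Mz dP dX.
move: (noise_level _ _ _ _ _ _) (wtW _ _) (wtY _ _) (wtR _ _ _ _) (wtZ _ _) (wtT _ _ _ _)
  (Qsq _ _) (sigma1sq _ _) (L1sq _ _) (L2sq _ _) (omega2 _) (omega1 _)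
  => N cW cY cR cZ cT Q s1 L1 L2 w2' w1'.
move=> hW hRy hRz kY kZ kH kR kT kN Y0 Z0 H0 My0 Mz0.
have V0 : 2 / alpha par * dP + 2 / theta par * dX + cW * eW + cY * Y + cR * eR + cZ * Z + cT * eT <=
    2 / alpha par * dP + 2 / theta par * dX + (12 * wu * (1 + wu) * theta par * H
    + 24 * w2' * Q / (mu_g c * beta par) * Y + 48 * w2' * L_g c ^+ 2 / (mu_g c * gamma par) * Z
    + 48 * w2' * wl * (1 + 4 * wl) * Q * (beta par / (mu_g c * n%:R)) * My
    + 72 * w2' * wl * (1 + 4 * wl) * L_g c ^+ 2 * (gamma par / (mu_g c * n%:R)) * Mz).
  apply: le_trans (lerD (lerD (lerD (lerD (lerD (lexx _) hW) (lexx _)) hRy) (lexx _)) hRz) _.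
  have := lerD (lerD (lerD (lerD kH kY) kZ) kR) kT.
  rewrite -(lerD2l (2 / alpha par * dP + 2 / theta par * dX)).
  by apply: le_trans; rewrite le_eqVlt; apply/orP; left; apply/eqP; ring.
have Ki : 0 <= K%:R^-1 :> R by rewrite invr_ge0 ltW.
apply: le_trans (lerD (ler_wpM2r Ki V0) kN) _.
by rewrite le_eqVlt; apply/orP; left; apply/eqP; field; rewrite !gt_eqF.
Qed.

(** * The order of convergence *)

Section RateLemmas.
Context {R : realType}.
Implicit Types q x t a b : R.

(** A square root sqrt(q / x) among the summands of 1 / t is precisely what makes the noise q t no
    larger than the initial-error term x / t. *)
Lemma sqrt_rate q x t : 0 <= q -> 0 < x -> 0 < t -> Num.sqrt (q / x) <= t^-1 ->
  q * t <= x / t.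
Proof.
move=> q0 x0 t0 H; have := sqr_le (sqrtr_ge0 _) H.
rewrite sqr_sqrtr ?divr_ge0 ?(ltW x0) // ler_pdivrMr // => H'.
rewrite -ler_pdivlMr //; apply: le_trans H' _.
by rewrite le_eqVlt; apply/orP; left; apply/eqP; field; rewrite gt_eqF.
Qed.

Lemma powR_third_cube x : 0 <= x -> (x `^ (3^-1)) ^+ 3 = x.
Proof.
move=> x0; rewrite -powR_mulrn ?powR_ge0 // -powRrM mulVf ?powRr1 //.
Qed.

Lemma powR_two_thirds_cube x : 0 <= x -> (x `^ (2 / 3)) ^+ 3 = x ^+ 2.
Proof.
move=> x0; rewrite -powR_mulrn ?powR_ge0 // -powRrM divfK // -powR_mulrn //.
Qed.

Lemma powR_three_halves_sqr x : 0 <= x -> (x `^ (3 / 2)) ^+ 2 = x ^+ 3.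
Proof.
move=> x0; rewrite -powR_mulrn ?powR_ge0 // -powRrM divfK // -powR_mulrn //.
Qed.

(** The analogue for noise of order t^2: the balance q t^2 = x / t is struck at the cube root. *)
Lemma cbrt_rate q x t : 0 <= q -> 0 < x -> 0 < t -> (q / x) `^ (3^-1) <= t^-1 ->
  q * t ^+ 2 <= x / t.
Proof.
move=> q0 x0 t0 H; have q1 : 0 <= q / x by rewrite divr_ge0 // ltW.
have : (q / x) <= t^-1 ^+ 3.
  by rewrite -{1}(powR_third_cube q1) ler_pXn2r // nnegrE ?powR_ge0 // invr_ge0 ltW.
rewrite ler_pdivrMr // => H'.
rewrite -ler_pdivlMr ?exprn_gt0 //; apply: le_trans H' _.
by rewrite le_eqVlt; apply/orP; left; apply/eqP; field; rewrite gt_eqF.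
Qed.

(** For k >= 1 the factor k may stand in for its square root; constants are immaterial in the
    order. *)
Lemma le_of_sqr a b k : 0 <= a -> 0 <= b -> 1 <= k -> a ^+ 2 <= k * b ^+ 2 -> a <= k * b.
Proof.
move=> a0 b0 k1 H; have k0 := le_trans ler01 k1.
rewrite -(@ler_pXn2r _ 2) ?nnegrE ?mulr_ge0 //; apply: le_trans H _.
rewrite exprMn; apply: ler_wpM2r; first exact: sqr_ge0.
by rewrite expr2 ler_peMr.
Qed.

Lemma le_of_cube a b k : 0 <= a -> 0 <= b -> 1 <= k -> a ^+ 3 <= k * b ^+ 3 -> a <= k * b.
Proof.
move=> a0 b0 k1 H; have k0 := le_trans ler01 k1.
rewrite -(@ler_pXn2r _ 3) ?nnegrE ?mulr_ge0 //; apply: le_trans H _.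
rewrite exprMn; apply: ler_wpM2r; first by rewrite exprn_ge0.
by rewrite exprSr ler_peMl // exprn_ege1.
Qed.

Lemma product_bound (W P S A B C i : R) : W <= 36 * P -> 0 <= P -> P <= S -> B <= C ->
  0 <= A -> 0 <= C -> 0 <= B -> 0 <= i -> P * i <= S -> W * (A * i + B) <= 36 * (A * S + C * S).
Proof.
move=> HW P0 PS BC A0 C0 B0 i0 HP.
apply: le_trans (ler_wpM2r (addr_ge0 (mulr_ge0 A0 i0) B0) HW) _; rewrite -mulrA ler_pM2l //.
rewrite mulrDr; apply: lerD; first by rewrite mulrCA; apply: ler_wpM2l.
apply: le_trans (ler_wpM2l P0 BC) _; rewrite mulrC; exact: ler_wpM2l.
Qed.

End RateLemmas.

Section SmoothnessBound.
Context {R : realType} (c : constants R) (par : hyperparams R) (n : nat) (wu wl : R).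
Notation b := (beta par).
Notation g := (gamma par).
Notation t := (theta par).
Notation mu := (mu_g c).
Notation Lg := (L_g c).
Notation nn := (n%:R : R).
Notation w1 := (omega1 wl).
Notation Q := (Qsq c par).
Notation p := (1 + wu).

Hypothesis b0 : 0 < b.
Hypothesis g0 : 0 < g.
Hypothesis t0 : 0 < t.
Hypothesis mu0 : 0 < mu.
Hypothesis muL : mu <= Lg.
Hypothesis n0 : (0 < n)%N.
Hypothesis wu0 : 0 <= wu.
Hypothesis wl0 : 0 <= wl.
Hypothesis LP0 : 0 < L_Phi c.
Hypothesis hb : b * (96 * wl * w1 * Lg ^+ 2) <= mu * nn.
Hypothesis hg : g * (432 * wl * w1 * Lg ^+ 2) <= mu * nn.

(** The magnitude of 1 / C3 up to a constant. The powers of omega_u are those of 1 / C3, one and not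
    two, because C3^-2 contains [omega2] linearly. *)
Definition rate_scale := t^-1 + p + p / b + p / g.

(** It depends on the problem constants and on rho only: neither n, nor the compression parameters,
    nor the other hyperparameters occur. *)
Definition C3_const :=
  8 * L_Phi c ^+ 2 + 144 * L5sq c par
  + 864 * Q * (4 * L_ystar c ^+ 2 / mu ^+ 2 + L3sq c / (6 * Lg ^+ 2))
  + 864 * Lg ^+ 2 * (12 * L_zstar c ^+ 2 / mu ^+ 2 + L4sq c par / (6 * Lg ^+ 2)).

Let Lg0 : 0 < Lg. Proof. exact: lt_le_trans mu0 muL. Qed.
Let nn0 : 0 < nn. Proof. by rewrite ltr0n. Qed.
Let p1 : 1 <= p. Proof. by rewrite lerDl. Qed.
Let L1 := L1sq_ge0 c par.
Let L2 := L2sq_ge0 c par.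
Let Q0 := Qsq_ge0 c par.
Let L30 : 0 <= L3sq c.
Proof. by rewrite mulr_ge0 ?sqr_ge0 // addr_ge0 // mulr_ge0 // sqr_ge0. Qed.
Let Z0 : 0 <= 3 * Lg ^+ 2 * L_zstar c ^+ 2.
Proof. by apply: mulr_ge0; [apply: mulr_ge0 => //; exact: sqr_ge0|exact: sqr_ge0]. Qed.
Let Y0 : 0 <= 1 + 3 * L_ystar c ^+ 2. Proof. by rewrite addr_ge0 // mulr_ge0 // sqr_ge0. Qed.
Let L40 : 0 <= L4sq c par. Proof. by rewrite addr_ge0 // mulr_ge0. Qed.
Let L50 : 0 <= L5sq c par. Proof. by rewrite addr_ge0 // mulr_ge0. Qed.
Let Ly2 : 0 <= L_ystar c ^+ 2. Proof. exact: sqr_ge0. Qed.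
Let Lz2 : 0 <= L_zstar c ^+ 2. Proof. exact: sqr_ge0. Qed.
Let mu2 : 0 < mu ^+ 2. Proof. by rewrite exprn_gt0. Qed.
Let Lg2 : 0 < Lg ^+ 2. Proof. by rewrite exprn_gt0. Qed.
Let w2 : 1 <= omega2 wu <= 36 * p ^+ 2.
Proof.
rewrite /omega2 lerDl; apply/andP; split.
  by rewrite mulr_ge0 ?addr_ge0 // mulr_ge0.
rewrite -subr_ge0 (_ : _ - _ = 35 + 36 * wu); last by ring.
exact: addr_ge0 (ler0n R 35) (mulr_ge0 (ler0n R 36) wu0).
Qed.

Let cy : 0 <= 4 * L_ystar c ^+ 2 / mu ^+ 2.
Proof. by rewrite divr_ge0 ?(ltW mu2) //; exact: mulr_ge0 (ler0n R 4) Ly2. Qed.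
Let cz : 0 <= 12 * L_zstar c ^+ 2 / mu ^+ 2.
Proof. by rewrite divr_ge0 ?(ltW mu2) //; exact: mulr_ge0 (ler0n R 12) Lz2. Qed.
Let cy' : 0 <= L3sq c / (6 * Lg ^+ 2).
Proof. by rewrite divr_ge0 //; exact: mulr_ge0 (ler0n R 6) (ltW Lg2). Qed.
Let cz' : 0 <= L4sq c par / (6 * Lg ^+ 2).
Proof. by rewrite divr_ge0 //; exact: mulr_ge0 (ler0n R 6) (ltW Lg2). Qed.

Lemma C3_const_ge0 : 0 <= C3_const.
Proof.
apply: addr_ge0; last first.
  by apply: mulr_ge0 (addr_ge0 cz cz'); exact: mulr_ge0 (ler0n R 864) (ltW Lg2).
apply: addr_ge0; last by apply: mulr_ge0 (addr_ge0 cy cy'); exact: mulr_ge0 (ler0n R 864) Q0.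
exact: addr_ge0 (mulr_ge0 (ler0n R 8) (sqr_ge0 _)) (mulr_ge0 (ler0n R 144) L50).
Qed.

Definition C3_radicand := 2 * (4 * L_Phi c ^+ 2 / t ^+ 2 + 72 * wu * (1 + wu) * L5sq c par
     + 12 * omega2 wu * Q * (4 * L_ystar c ^+ 2 / (b ^+ 2 * mu ^+ 2)
          + 16 * wl * w1 * L3sq c * b / (mu * n%:R))
     + 12 * omega2 wu * Lg ^+ 2 * (12 * L_zstar c ^+ 2 / (g ^+ 2 * mu ^+ 2)
          + 72 * wl * w1 * L4sq c par * g / (mu * n%:R))).

Let w10 : 0 <= w1. Proof. exact: le_trans ler01 (omega1_ge1 wl0). Qed.

(** The limit on beta swallows the factor wl * w1: what remains is 16/96 = 1/6. *)
Let ry : 16 * wl * w1 * L3sq c * b / (mu * nn) <= L3sq c / (6 * Lg ^+ 2).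
Proof.
have H := ler_wpM2l L30 (beta_ratio mu0 n0 hb).
rewrite ler_pdivlMr ?mulr_gt0 //.
have -> : 16 * wl * w1 * L3sq c * b / (mu * nn) * (6 * Lg ^+ 2) =
  96 * (L3sq c * (wl * w1 * Lg ^+ 2 * (b / (mu * nn)))) by ring.
by move: H; move: (wl * w1 * Lg ^+ 2 * (b / (mu * nn))) (L3sq c) => u v H; lra.
Qed.

Let rz : 72 * wl * w1 * L4sq c par * g / (mu * nn) <= L4sq c par / (6 * Lg ^+ 2).
Proof.
have H := ler_wpM2l L40 (gamma_ratio mu0 n0 hg).
rewrite ler_pdivlMr ?mulr_gt0 //.
have -> : 72 * wl * w1 * L4sq c par * g / (mu * nn) * (6 * Lg ^+ 2) =
  432 * (L4sq c par * (wl * w1 * Lg ^+ 2 * (g / (mu * nn)))) by ring.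
by move: H; move: (wl * w1 * Lg ^+ 2 * (g / (mu * nn))) (L4sq c par) => u v H; lra.
Qed.

Lemma rate_scale_ge : [/\ t^-1 <= rate_scale, p <= rate_scale, p / b <= rate_scale & p / g <= rate_scale].
Proof.
have H1 : 0 <= t^-1 by rewrite invr_ge0 ltW.
have H2 : 0 <= p by exact: le_trans p1.
have H3 : 0 <= p / b by rewrite divr_ge0 // ltW.
have H4 : 0 <= p / g by rewrite divr_ge0 // ltW.
by rewrite /rate_scale; split; move: H1 H2 H3 H4; move: (t^-1) (p / b) (p / g) => *; lra.
Qed.

Lemma C3_radicand_le : C3_radicand <= C3_const * rate_scale ^+ 2.
Proof.
have [r1 r2 r3 r4] := rate_scale_ge.
have [w21 w22] := andP w2.
have p0 : 0 <= p by exact: le_trans p1.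
have s1 := sqr_le (_ : 0 <= t^-1) r1; have {}s1 : t^-1 ^+ 2 <= rate_scale ^+ 2 by apply: s1; rewrite invr_ge0 ltW.
have s2 := sqr_le p0 r2.
have s3 : (p / b) ^+ 2 <= rate_scale ^+ 2 by apply: sqr_le r3; rewrite divr_ge0 // ltW.
have s4 : (p / g) ^+ 2 <= rate_scale ^+ 2 by apply: sqr_le r4; rewrite divr_ge0 // ltW.
have -> : C3_radicand = 8 * L_Phi c ^+ 2 * t^-1 ^+ 2 + 144 * L5sq c par * (wu * (1 + wu))
  + 24 * Q * (omega2 wu * (4 * L_ystar c ^+ 2 / mu ^+ 2 * b^-1 ^+ 2 + 16 * wl * w1 * L3sq c * b / (mu * n%:R)))
  + 24 * Lg ^+ 2 * (omega2 wu * (12 * L_zstar c ^+ 2 / mu ^+ 2 * g^-1 ^+ 2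
     + 72 * wl * w1 * L4sq c par * g / (mu * n%:R))).
  by rewrite /C3_radicand; field; rewrite !gt_eqF.
have -> : C3_const * rate_scale ^+ 2 = 8 * L_Phi c ^+ 2 * rate_scale ^+ 2
    + 144 * L5sq c par * rate_scale ^+ 2
    + 24 * Q * (36 * (4 * L_ystar c ^+ 2 / mu ^+ 2 * rate_scale ^+ 2
                      + L3sq c / (6 * Lg ^+ 2) * rate_scale ^+ 2))
    + 24 * Lg ^+ 2 * (36 * (12 * L_zstar c ^+ 2 / mu ^+ 2 * rate_scale ^+ 2
                      + L4sq c par / (6 * Lg ^+ 2) * rate_scale ^+ 2)).
  by rewrite /C3_const; ring.
apply: lerD; [apply: lerD; [apply: lerD|]|].
- by apply: ler_wpM2l s1; exact: mulr_ge0 (ler0n R 8) (sqr_ge0 _).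
- apply: ler_wpM2l; first exact: mulr_ge0 (ler0n R 144) L50.
  apply: le_trans s2; rewrite expr2; apply: ler_wpM2r => //.
  by rewrite lerDr.
- apply: ler_wpM2l; first exact: mulr_ge0 (ler0n R 24) Q0.
  apply: (product_bound w22 (sqr_ge0 p) s2 ry cy cy' _ (sqr_ge0 b^-1)); last by rewrite -exprMn.
  apply: divr_ge0; last by rewrite mulr_ge0 // ltW.
  apply: mulr_ge0 (ltW b0); apply: mulr_ge0 L30; apply: mulr_ge0 w10; exact: mulr_ge0 (ler0n R 16) wl0.
- apply: ler_wpM2l; first exact: mulr_ge0 (ler0n R 24) (ltW Lg2).
  apply: (product_bound w22 (sqr_ge0 p) s2 rz cz cz' _ (sqr_ge0 g^-1)); last by rewrite -exprMn.
  apply: divr_ge0; last by rewrite mulr_ge0 // ltW.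
  apply: mulr_ge0 (ltW g0); apply: mulr_ge0 L40; apply: mulr_ge0 w10; exact: mulr_ge0 (ler0n R 72) wl0.
Qed.

Lemma C3_gt0 : 0 < C3 c par n wu wl.
Proof.
rewrite /C3 invr_gt0 sqrtr_gt0 -/(Qsq c par) -/C3_radicand.
have w20 : 0 <= omega2 wu by have [/(le_trans ler01)] := andP w2.
have mn : 0 <= mu * nn by rewrite mulr_ge0 // ltW.
rewrite mulr_gt0 //; apply: ltr_wpDr.
  apply: mulr_ge0; first by apply: mulr_ge0 (ltW Lg2); exact: mulr_ge0 (ler0n R 12) w20.
  apply: addr_ge0; first by rewrite divr_ge0 //; [exact: mulr_ge0 (ler0n R 12) Lz2|rewrite mulr_ge0 // sqr_ge0].
  apply: divr_ge0 mn; apply: mulr_ge0 (ltW g0); apply: mulr_ge0 L40; apply: mulr_ge0 w10.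
  exact: mulr_ge0 (ler0n R 72) wl0.
apply: ltr_wpDr.
  apply: mulr_ge0; first by apply: mulr_ge0 Q0; exact: mulr_ge0 (ler0n R 12) w20.
  apply: addr_ge0; first by rewrite divr_ge0 //; [exact: mulr_ge0 (ler0n R 4) Ly2|rewrite mulr_ge0 // sqr_ge0].
  apply: divr_ge0 mn; apply: mulr_ge0 (ltW b0); apply: mulr_ge0 L30; apply: mulr_ge0 w10.
  exact: mulr_ge0 (ler0n R 16) wl0.
apply: ltr_wpDr.
  apply: mulr_ge0 L50; apply: mulr_ge0 (le_trans ler01 p1); exact: mulr_ge0 (ler0n R 72) wu0.
by rewrite divr_gt0 ?exprn_gt0 // mulr_gt0 // exprn_gt0.
Qed.

Lemma C3_inv_le : (C3 c par n wu wl)^-1 <= (1 + C3_const) * rate_scale.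
Proof.
rewrite /C3 invrK -/(Qsq c par) -/C3_radicand.
have rs0 : 0 <= rate_scale by have [_ /(le_trans (le_trans ler01 p1))] := rate_scale_ge.
have C0 := C3_const_ge0.
rewrite -(ger0_norm (mulr_ge0 (addr_ge0 ler01 C0) rs0)) -sqrtr_sqr; apply: ler_wsqrtr.
apply: le_trans C3_radicand_le _; rewrite exprMn; apply: ler_wpM2r; first exact: sqr_ge0.
by move: C3_const C0 => k k0; nra.
Qed.

Context (D dP dX dH dY dZ dMy dMz eS eB eR eT kk sigma : R).
Notation s1 := (sigma1sq par sigma).
Notation G := (rate_scale * D).
Hypothesis t1 : t <= 1.
Hypothesis a_inv : (alpha par)^-1 = 2 * L_Phi c + (C3 c par n wu wl)^-1.
Hypothesis dP0 : 0 <= dP <= D.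
Hypothesis dX0 : 0 <= dX <= D.
Hypothesis dH0 : 0 <= dH <= D.
Hypothesis dY0 : 0 <= dY <= D.
Hypothesis dZ0 : 0 <= dZ <= D.
Hypothesis dMy0 : 0 <= dMy <= D.
Hypothesis dMz0 : 0 <= dMz <= D.
Hypothesis kk0 : 0 <= kk.
Hypothesis eS_le : eS <= 3 * L2sq c par * dY + 3 * Lg ^+ 2 * dZ.
Hypothesis eB_le : eB <= dH.
Hypothesis eR_le : eR <= 6 / 5 * dMy + 6 * Lg ^+ 2 * dY.
Hypothesis eT_le : eT <= 6 / 5 * dMz + (18 * L1sq c par * dY + 18 * Lg ^+ 2 * dZ).
Hypothesis rate_h : 6 * wu * (1 + wu) * dH * t <= dX / t.
Hypothesis rate_x : kk * s1 * t <= nn * dX / t.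
Hypothesis rate_u : 18 * wu * (1 + wu) * kk * s1 * t ^+ 2 <= dX / t.
Hypothesis rate_y : 2 * kk * sigma ^+ 2 * (1 + 6 * wl * w1) * b <= nn * dY / b.
Hypothesis rate_z : kk * s1 * (1 + 6 * wl * w1) * g <= nn * dZ / g.

Let D0 : 0 <= D. Proof. by have [/le_trans] := andP dP0; apply. Qed.
Let p0 : 0 <= p := le_trans ler01 p1.
Let it0 : 0 <= t^-1. Proof. by rewrite invr_ge0 ltW. Qed.

Let scale_t (d : R) : 0 <= d <= D -> d / t <= G.
Proof.
move=> /andP[d0 dD]; have [r1 _ _ _] := rate_scale_ge; rewrite mulrC.
exact: ler_pM.
Qed.

Let scale_p (d : R) : 0 <= d <= D -> p * d <= G.
Proof. by move=> /andP[d0 dD]; have [_ r1 _ _] := rate_scale_ge; exact: ler_pM. Qed.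

Let scale_1 (d : R) : 0 <= d <= D -> d <= G.
Proof.
move=> dd; apply: le_trans (scale_p dd); have [d0 _] := andP dd.
by rewrite ler_peMl.
Qed.

Let scale_b (d : R) : 0 <= d <= D -> d / b <= G.
Proof.
move=> dd; have [_ _ r1 _] := rate_scale_ge; have [d0 dD] := andP dd; rewrite mulrC.
apply: ler_pM => //; first by rewrite invr_ge0 ltW.
by apply: le_trans r1; rewrite ler_peMl // invr_ge0 ltW.
Qed.

Let scale_g (d : R) : 0 <= d <= D -> d / g <= G.
Proof.
move=> dd; have [_ _ _ r1] := rate_scale_ge; have [d0 dD] := andP dd; rewrite mulrC.
apply: ler_pM => //; first by rewrite invr_ge0 ltW.
by apply: le_trans r1; rewrite ler_peMl // invr_ge0 ltW.
Qed.

Let G0 : 0 <= G.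
Proof. by apply: le_trans (scale_1 dP0); have [] := andP dP0. Qed.

Let t01 : 0 < t <= 1. Proof. by rewrite t0. Qed.

Lemma budget_Phi : 2 / alpha par * dP <= (4 * L_Phi c + 2 * (1 + C3_const)) * G.
Proof.
have [d0 dD] := andP dP0.
have -> : 2 / alpha par * dP = 4 * L_Phi c * dP + 2 * ((C3 c par n wu wl)^-1 * dP).
  by rewrite a_inv; ring.
rewrite [leRHS]mulrDl; apply: lerD.
  by apply: ler_wpM2l (scale_1 dP0); rewrite mulr_ge0 // ltW.
rewrite -mulrA ler_pM2l // mulrA; apply: ler_pM => //; last exact: C3_inv_le.
by rewrite invr_ge0; exact: ltW C3_gt0.
Qed.

Let eS_le' : eS <= 3 * (L2sq c par + Lg ^+ 2) * D.
Proof.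
have [y0 yD] := andP dY0; have [z0 zD] := andP dZ0.
apply: le_trans eS_le _.
have := ler_wpM2l (ler0n R 3) (lerD (ler_wpM2l L2 yD) (ler_wpM2l (ltW Lg2) zD)).
by congr (_ <= _); ring.
Qed.

Let wtS0 := wtS_ge0 t01.
Let wtM0 := wtM_ge0 wu0.
Let nni : 0 <= nn^-1. Proof. by rewrite invr_ge0 ltW. Qed.

(** Both the lag error and the memory error start at [errS] of the initial lag. The weight 4 (1 +
    wu) of the latter contributes a single power of 1 + omega_u, as the order permits. *)
Lemma budget_S : (wtS par + wtM wu) * eS <= 24 * (L2sq c par + Lg ^+ 2) * G.
Proof.
have c0 : 0 <= 3 * (L2sq c par + Lg ^+ 2) := mulr_ge0 (ler0n R 3) (addr_ge0 L2 (ltW Lg2)).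
have DD : 0 <= D <= D by rewrite D0 lexx.
apply: le_trans (ler_wpM2l (addr_ge0 wtS0 wtM0) eS_le') _.
rewrite mulrCA [leRHS](_ : _ = 3 * (L2sq c par + Lg ^+ 2) * (8 * G)); last by ring.
apply: ler_wpM2l => //; rewrite mulrDl.
have H1 : wtS par * D <= 4 * G.
  apply: le_trans (ler_wpM2l (ler0n R 4) (scale_t DD)).
  rewrite /wtS (_ : _ * D = 4 * (D / t) * (1 - t)); last by ring.
  by rewrite ler_piMr ?mulr_ge0 // gerBl ltW.
have H2 : wtM wu * D <= 4 * G.
  by apply: le_trans (ler_wpM2l (ler0n R 4) (scale_p DD)); rewrite /wtM mulrA.
by apply: le_trans (lerD H1 H2) _; rewrite -mulrDl; apply: ler_wpM2r => //; lra.
Qed.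

(** The amplified error starts at Delta_h alone, and the first square root in the prescribed 1 /
    theta bounds omega_u (1 + omega_u) theta Delta_h by Delta_x / theta. *)
Lemma budget_B : wtB par * eB + wtW par wu * dH <= 4 * G.
Proof.
have [h0 hD] := andP dH0.
have H1 : wtB par * eB <= 2 * G.
  apply: le_trans (ler_wpM2l (wtB_ge0 t01) eB_le) _.
  by rewrite /wtB -mulrA (mulrC t^-1); apply: ler_wpM2l => //; exact: scale_t.
have H2 : wtW par wu * dH <= 2 * G.
  apply: le_trans (_ : _ <= 2 * (dX / t)) _; last by apply: ler_wpM2l => //; exact: scale_t.
  apply: le_trans (_ : _ <= 2 * (6 * wu * (1 + wu) * dH * t)) _; last exact: ler_wpM2l.
  rewrite -subr_ge0 /wtW (_ : _ - _ = (8 + 4 * wu) * wu * (dH * t)); last by ring.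
  have k0 : 0 <= 8 + 4 * wu := addr_ge0 (ler0n R 8) (mulr_ge0 (ler0n R 4) wu0).
  exact: mulr_ge0 (mulr_ge0 k0 wu0) (mulr_ge0 h0 (ltW t0)).
by apply: le_trans (lerD H1 H2) _; rewrite -mulrDl; apply: ler_wpM2r => //; lra.
Qed.

Let mui : 0 <= mu^-1. Proof. by rewrite invr_ge0 ltW. Qed.

Lemma budget_Y : wtY c par * dY <= 15 * Q / mu * G.
Proof.
rewrite /wtY (_ : _ * dY = 15 * Q / mu * (dY / b)); last by field; rewrite !gt_eqF.
apply: ler_wpM2l (scale_b dY0); apply: mulr_ge0 mui; exact: mulr_ge0 (ler0n R 15) Q0.
Qed.

Lemma budget_Z : wtZ c par * dZ <= 30 * Lg ^+ 2 / mu * G.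
Proof.
rewrite /wtZ (_ : _ * dZ = 30 * Lg ^+ 2 / mu * (dZ / g)); last by field; rewrite !gt_eqF.
apply: ler_wpM2l (scale_g dZ0); apply: mulr_ge0 mui; exact: mulr_ge0 (ler0n R 30) (ltW Lg2).
Qed.

Let w1_ge : 1 + 2 * wl <= w1.
Proof.
rewrite /omega1 -subr_ge0 (_ : _ - _ = wl * (4 + 6 * wl)); last by ring.
by apply: mulr_ge0 => //; exact: addr_ge0 (ler0n R 4) (mulr_ge0 (ler0n R 6) wl0).
Qed.

(** The weight is bounded by a constant: wl (1 + 2 wl) <= wl * w1, and the limit on beta controls
    the latter. *)
Lemma budget_R : wtR c par n wl * eR <= Q / (2 * Lg ^+ 2) * (2 + 6 * Lg ^+ 2) * G.
Proof.
have [my0 myD] := andP dMy0; have [y0 yD] := andP dY0.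
have wtR0 := wtR_ge0 (c := c) n b0 mu0 wl0.
have H1 : wtR c par n wl <= Q / (2 * Lg ^+ 2).
  rewrite ler_pdivlMr ?mulr_gt0 // /wtR.
  have H := beta_ratio mu0 n0 hb.
  have u0 : 0 <= b / (mu * nn) by rewrite divr_ge0 ?mulr_ge0 // ltW.
  rewrite [leLHS](_ : _ = 72 * (Q * (wl * (1 + 2 * wl) * Lg ^+ 2 * (b / (mu * nn))))); last by ring.
  have H2 : wl * (1 + 2 * wl) * Lg ^+ 2 * (b / (mu * nn)) <= 96^-1.
    apply: le_trans H; apply: ler_wpM2r => //; apply: ler_wpM2r; first exact: ltW.
    exact: ler_wpM2l.
  by move: Q0 (ler_wpM2l Q0 H2); move: (wl * (1 + 2 * wl) * Lg ^+ 2 * (b / (mu * nn))) Q => u v v0 H3; lra.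
have H2 : eR <= (2 + 6 * Lg ^+ 2) * D.
  apply: le_trans eR_le _; rewrite [leRHS]mulrDl; apply: lerD.
    by apply: ler_pM => //; lra.
  by apply: ler_wpM2l yD; exact: mulr_ge0 (ler0n R 6) (ltW Lg2).
have k0 : 0 <= 2 + 6 * Lg ^+ 2 := addr_ge0 (ler0n R 2) (mulr_ge0 (ler0n R 6) (ltW Lg2)).
have DD : 0 <= D <= D by rewrite D0 lexx.
apply: le_trans (ler_wpM2l wtR0 H2) _; rewrite -[leRHS]mulrA.
apply: ler_pM => //; first exact: mulr_ge0.
by apply: ler_wpM2l => //; exact: scale_1.
Qed.

Lemma budget_T : wtT c par n wl * eT <= (2 + 18 * L1sq c par + 18 * Lg ^+ 2) * G.
Proof.
have [mz0 mzD] := andP dMz0; have [y0 yD] := andP dY0; have [z0 zD] := andP dZ0.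
have wtT0 := wtT_ge0 (c := c) n g0 mu0 wl0.
have H1 : wtT c par n wl <= 1.
  have H := gamma_ratio mu0 n0 hg.
  have u0 : 0 <= g / (mu * nn) by rewrite divr_ge0 ?mulr_ge0 // ltW.
  rewrite /wtT [leLHS](_ : _ = 54 * (wl * (1 + 2 * wl) * Lg ^+ 2 * (g / (mu * nn)))); last by ring.
  have H2 : wl * (1 + 2 * wl) * Lg ^+ 2 * (g / (mu * nn)) <= 432^-1.
    apply: le_trans H; apply: ler_wpM2r => //; apply: ler_wpM2r; first exact: ltW.
    exact: ler_wpM2l.
  by move: H2; move: (wl * (1 + 2 * wl) * Lg ^+ 2 * (g / (mu * nn))) => u H3; lra.
have k1 : 0 <= 18 * L1sq c par := mulr_ge0 (ler0n R 18) L1.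
have k2 : 0 <= 18 * Lg ^+ 2 := mulr_ge0 (ler0n R 18) (ltW Lg2).
have k0 : 0 <= 2 + 18 * L1sq c par + 18 * Lg ^+ 2 := addr_ge0 (addr_ge0 (ler0n R 2) k1) k2.
have H2 : eT <= (2 + 18 * L1sq c par + 18 * Lg ^+ 2) * D.
  apply: le_trans eT_le _; rewrite addrA [leRHS]mulrDl; apply: lerD (ler_wpM2l k2 zD).
  rewrite [leRHS]mulrDl.
  apply: lerD (ler_wpM2l k1 yD).
  by apply: ler_pM => //; lra.
have DD : 0 <= D <= D by rewrite D0 lexx.
apply: le_trans (ler_wpM2l wtT0 H2) _; rewrite -[leRHS]mul1r.
apply: ler_pM => //; first exact: mulr_ge0.
by apply: ler_wpM2l => //; exact: scale_1.
Qed.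

(** Each of the four noise sources, multiplied by the number of iterations, is dominated by an
    initial error divided by its parameter: this is the content of [rate_x], [rate_u], [rate_z] and
    [rate_y]. *)
Lemma budget_noise :
  kk * noise_level c par n wu wl sigma <= (3 + 30 * Lg ^+ 2 / mu + 15 * Q / mu) * G.
Proof.
have s20 := sqr_ge0 sigma.
have s10 : 0 <= s1 by apply: mulr_ge0 => //; rewrite addr_ge0 // sqr_ge0.
have wlw1 : wl <= wl * w1 by rewrite ler_peMr // omega1_ge1.
set e := 1 + 6 * wl * w1.
have e30 : 30 + 138 * wl <= 30 * e.
  by rewrite /e; move: wl0 wlw1; rewrite -[6 * _ * _]mulrA; move: (wl * w1) => *; lra.
have e15 : 15 + 87 * wl <= 15 * e.
  by rewrite /e; move: wl0 wlw1; rewrite -[6 * _ * _]mulrA; move: (wl * w1) => *; lra.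
have T1 : kk * (2 * t / nn * s1) <= 2 * G.
  apply: le_trans (ler_wpM2l (ler0n R 2) (scale_t dX0)).
  rewrite (_ : kk * _ = 2 * (nn^-1 * (kk * s1 * t))); last by ring.
  apply: ler_wpM2l => //; apply: le_trans (ler_wpM2l nni rate_x) _.
  by rewrite -[nn * dX / t]mulrA mulKf // gt_eqF.
have T2 : kk * ((4 * wu * (1 + 2 * wu) * t ^+ 3 + 4 * wu * t ^+ 2) * s1) <= G.
  apply: le_trans (scale_t dX0); apply: le_trans rate_u.
  have ks : 0 <= wu * (kk * s1 * t ^+ 2) by rewrite mulr_ge0 // mulr_ge0 ?sqr_ge0 // mulr_ge0.
  have ks' : 0 <= wu * wu * (kk * s1 * t ^+ 2) by rewrite -mulrA; exact: mulr_ge0.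
  have u1 : 0 <= 1 - t by rewrite subr_ge0.
  rewrite -subr_ge0 (_ : _ - _ = 10 * (wu * (kk * s1 * t ^+ 2)) + 10 * (wu * wu * (kk * s1 * t ^+ 2))
    + (4 * (wu * (kk * s1 * t ^+ 2)) + 8 * (wu * wu * (kk * s1 * t ^+ 2))) * (1 - t)); last by ring.
  apply: addr_ge0; first exact: addr_ge0 (mulr_ge0 (ler0n R 10) ks) (mulr_ge0 (ler0n R 10) ks').
  exact: mulr_ge0 (addr_ge0 (mulr_ge0 (ler0n R 4) ks) (mulr_ge0 (ler0n R 8) ks')) u1.
have T3 : kk * ((30 + 138 * wl) * Lg ^+ 2 * (g / (mu * nn)) * s1) <= 30 * Lg ^+ 2 / mu * G.
  have c0 : 0 <= 30 * Lg ^+ 2 / mu by apply: mulr_ge0 mui; exact: mulr_ge0 (ler0n R 30) (ltW Lg2).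
  apply: le_trans (ler_wpM2l c0 (scale_g dZ0)).
  have H := ler_wpM2l nni rate_z; rewrite -/e in H.
  rewrite -[nn * dZ / g]mulrA mulKf ?gt_eqF // in H.
  apply: le_trans (ler_wpM2l c0 H).
  rewrite (_ : kk * _ = (30 + 138 * wl) * (Lg ^+ 2 / mu * (nn^-1 * (kk * s1 * g)))); last by field; rewrite !gt_eqF.
  rewrite [leRHS](_ : _ = 30 * e * (Lg ^+ 2 / mu * (nn^-1 * (kk * s1 * g)))); last by ring.
  apply: ler_wpM2r e30; apply: mulr_ge0; first exact: mulr_ge0 (ltW Lg2) mui.
  exact: mulr_ge0 nni (mulr_ge0 (mulr_ge0 kk0 s10) (ltW g0)).
have T4 : kk * ((15 + 87 * wl) * Q * (b / (mu * nn)) * sigma ^+ 2) <= 15 * Q / mu * G.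
  have c0 : 0 <= 15 * Q / mu by apply: mulr_ge0 mui; exact: mulr_ge0 (ler0n R 15) Q0.
  apply: le_trans (ler_wpM2l c0 (scale_b dY0)).
  have H := ler_wpM2l nni rate_y; rewrite -/e in H.
  rewrite -[nn * dY / b]mulrA mulKf ?gt_eqF // in H.
  apply: le_trans (ler_wpM2l c0 H).
  have P0 : 0 <= Q / mu * (nn^-1 * (kk * sigma ^+ 2 * b)).
    exact: mulr_ge0 (mulr_ge0 Q0 mui) (mulr_ge0 nni (mulr_ge0 (mulr_ge0 kk0 s20) (ltW b0))).
  rewrite (_ : kk * _ = (15 + 87 * wl) * (Q / mu * (nn^-1 * (kk * sigma ^+ 2 * b)))); last by field; rewrite !gt_eqF.
  rewrite [leRHS](_ : _ = 30 * e * (Q / mu * (nn^-1 * (kk * sigma ^+ 2 * b)))); last by ring.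
  apply: ler_wpM2r => //; apply: le_trans e15 _; apply: ler_wpM2r; last by lra.
  exact: addr_ge0 ler01 (mulr_ge0 (mulr_ge0 (ler0n R 6) wl0) w10).
rewrite (_ : kk * _ = kk * (2 * t / nn * s1) + kk * ((4 * wu * (1 + 2 * wu) * t ^+ 3 + 4 * wu * t ^+ 2) * s1)
  + kk * ((30 + 138 * wl) * Lg ^+ 2 * (g / (mu * nn)) * s1)
  + kk * ((15 + 87 * wl) * Q * (b / (mu * nn)) * sigma ^+ 2)); last by rewrite /noise_level; ring.
apply: le_trans (lerD (lerD (lerD T1 T2) T3) T4) _.
by rewrite le_eqVlt; apply/orP; left; apply/eqP; ring.
Qed.

Definition rate_const := 4 * L_Phi c + 2 * (1 + C3_const) + 24 * (L2sq c par + Lg ^+ 2) + 4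
  + 15 * Q / mu + 30 * Lg ^+ 2 / mu + Q / (2 * Lg ^+ 2) * (2 + 6 * Lg ^+ 2)
  + (2 + 18 * L1sq c par + 18 * Lg ^+ 2) + (3 + 30 * Lg ^+ 2 / mu + 15 * Q / mu).

Lemma budget : 2 / alpha par * dP + wtS par * eS + wtB par * eB + wtW par wu * dH + wtM wu * eS
  + wtY c par * dY + wtR c par n wl * eR + wtZ c par * dZ + wtT c par n wl * eT
  + kk * noise_level c par n wu wl sigma <= rate_const * G.
Proof.
have := lerD (lerD (lerD (lerD (lerD (lerD (lerD budget_Phi budget_S) budget_B) budget_Y) budget_R)
  budget_Z) budget_T) budget_noise.
move: (noise_level _ _ _ _ _ _) => N H.
have -> : rate_const * G = (4 * L_Phi c + 2 * (1 + C3_const)) * G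
  + 24 * (L2sq c par + Lg ^+ 2) * G + 4 * G + 15 * Q / mu * G
  + Q / (2 * Lg ^+ 2) * (2 + 6 * Lg ^+ 2) * G + 30 * Lg ^+ 2 / mu * G
  + (2 + 18 * L1sq c par + 18 * Lg ^+ 2) * G + (3 + 30 * Lg ^+ 2 / mu + 15 * Q / mu) * G.
  by rewrite /rate_const; ring.
by apply: le_trans H; rewrite le_eqVlt; apply/orP; left; apply/eqP; ring.
Qed.

End SmoothnessBound.

(** * From the prescribed parameters to the five terms of the order *)

Section RateOrder.
Context {R : realType} (r mu Lg rho2 wu wl kk nn D sigma : R).
Hypothesis r1 : 1 <= r.
Hypothesis mu0 : 0 < mu.
Hypothesis Lg0 : 0 <= Lg.
Hypothesis rho20 : 0 <= rho2.
Hypothesis wu0 : 0 <= wu.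
Hypothesis wl0 : 0 <= wl.
Hypothesis kk0 : 0 < kk.
Hypothesis nn1 : 1 <= nn.
Hypothesis D0 : 0 < D.
Hypothesis sigma0 : 0 <= sigma.
Notation p := (1 + wu).
Notation w1 := (omega1 wl).

Definition order1 := p ^+ 2 * (1 + wl) `^ (3 / 2) * Num.sqrt D * sigma / Num.sqrt (nn * kk).
Definition order2 := wu `^ (3^-1) * p `^ (3^-1) * D `^ (2 / 3) * sigma `^ (2 / 3) / kk `^ (2 / 3).
Definition order3 := p * D / kk.
Definition order4 := p ^+ 2 * Num.sqrt (wl * (1 + wl)) * D / (Num.sqrt nn * kk).
Definition order5 := p ^+ 2 * wl ^+ 3 * D / (nn * kk).
Definition rate_order := order1 + order2 + order3 + order4 + order5.

Let nn0 : 0 < nn. Proof. exact: lt_le_trans ltr01 nn1. Qed.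
Let r0 : 0 < r. Proof. exact: lt_le_trans ltr01 r1. Qed.
Let p1 : 1 <= p. Proof. by rewrite lerDl. Qed.
Let p0 : 0 <= p := le_trans ler01 p1.
Let pp : p <= p ^+ 2. Proof. by rewrite expr2 ler_peMr. Qed.
Let pp1 : 1 <= p ^+ 2 := le_trans p1 pp.
Let wl1 : 0 <= wl * (1 + wl). Proof. by rewrite mulr_ge0 // addr_ge0. Qed.

(** This and the next two are K times the first, fourth and fifth terms of the order, stripped of
    the power of 1 + omega_u and, for the first, of (1 + omega_l)^(3/2). *)
Definition noise_unit := Num.sqrt D * sigma * kk / Num.sqrt (nn * kk).
Definition comp_unit := Num.sqrt (wl * (1 + wl)) * D / Num.sqrt nn.
Definition cube_unit := wl ^+ 3 * D / nn.
Notation A := noise_unit.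
Notation W := ((1 + wl) `^ (3 / 2)).

Lemma noise_unit_ge0 : 0 <= A.
Proof.
apply: mulr_ge0; last by rewrite invr_ge0 sqrtr_ge0.
by rewrite mulr_ge0 ?(ltW kk0) // mulr_ge0 // sqrtr_ge0.
Qed.

Lemma noise_unit_sqr : A ^+ 2 = D * sigma ^+ 2 * kk / nn.
Proof.
rewrite /A !exprMn exprVn (sqr_sqrtr (ltW D0)) sqr_sqrtr ?mulr_ge0 ?ltW //.
by field; rewrite !gt_eqF.
Qed.

Lemma W_ge1 : 1 <= W.
Proof.
by rewrite -{1}(powRr0 (1 + wl)) ler_powR ?lerDl.
Qed.

Lemma comp_unit_ge0 : 0 <= comp_unit.
Proof. by rewrite divr_ge0 ?sqrtr_ge0 // mulr_ge0 ?sqrtr_ge0 // ltW. Qed.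

Lemma cube_unit_ge0 : 0 <= cube_unit.
Proof. by rewrite divr_ge0 ?(ltW nn0) // mulr_ge0 ?(ltW D0) // exprn_ge0. Qed.

Lemma order_units : [/\ 0 <= order1, 0 <= order2, 0 <= order3 & 0 <= order4 /\ 0 <= order5].
Proof.
split; [| | |split].
- apply: divr_ge0; last exact: sqrtr_ge0.
  apply: mulr_ge0 => //; apply: mulr_ge0; last exact: sqrtr_ge0.
  exact: mulr_ge0 (sqr_ge0 _) (powR_ge0 _ _).
- apply: divr_ge0; last exact: powR_ge0.
  exact: mulr_ge0 (mulr_ge0 (mulr_ge0 (powR_ge0 _ _) (powR_ge0 _ _)) (powR_ge0 _ _)) (powR_ge0 _ _).
- exact: divr_ge0 (mulr_ge0 p0 (ltW D0)) (ltW kk0).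
- apply: divr_ge0 (mulr_ge0 (sqrtr_ge0 _) (ltW kk0)).
  exact: mulr_ge0 (mulr_ge0 (sqr_ge0 _) (sqrtr_ge0 _)) (ltW D0).
- apply: divr_ge0 (mulr_ge0 (ltW nn0) (ltW kk0)).
  exact: mulr_ge0 (mulr_ge0 (sqr_ge0 _) (exprn_ge0 _ wl0)) (ltW D0).
Qed.

Lemma rate_order_ge0 : 0 <= rate_order.
Proof. by have [? ? ? [? ?]] := order_units; rewrite /rate_order !addr_ge0. Qed.

Let orderE : kk * rate_order = p ^+ 2 * (W * A) + kk * order2 + p * D + p ^+ 2 * comp_unit + p ^+ 2 * cube_unit.
Proof.
have s1 : Num.sqrt (nn * kk) != 0 by rewrite gt_eqF // sqrtr_gt0 mulr_gt0.
have s2 : Num.sqrt nn != 0 by rewrite gt_eqF // sqrtr_gt0.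
rewrite /rate_order /order1 /order3 /order4 /order5 /noise_unit /comp_unit /cube_unit.
by move: order2 W => o2 w; field; rewrite s1 s2 !gt_eqF.
Qed.

Let U1 : 0 <= p ^+ 2 * (W * A).
Proof. exact: mulr_ge0 (sqr_ge0 _) (mulr_ge0 (powR_ge0 _ _) noise_unit_ge0). Qed.
Let U2 : 0 <= kk * order2.
Proof. by have [_ H _ _] := order_units; exact: mulr_ge0 (ltW kk0) H. Qed.
Let U3 : 0 <= p * D := mulr_ge0 p0 (ltW D0).
Let U4 : 0 <= p ^+ 2 * comp_unit := mulr_ge0 (sqr_ge0 _) comp_unit_ge0.
Let U5 : 0 <= p ^+ 2 * cube_unit := mulr_ge0 (sqr_ge0 _) cube_unit_ge0.
Notation U := (kk * rate_order).

Lemma order_noise : p * (W * A) <= U.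
Proof.
rewrite orderE; apply: le_trans (_ : p ^+ 2 * (W * A) <= _).
  by apply: ler_wpM2r pp; exact: mulr_ge0 (powR_ge0 _ _) noise_unit_ge0.
by move: U1 U2 U3 U4 U5; move: (p ^+ 2 * (W * A)) (kk * order2) (p * D) (p ^+ 2 * comp_unit) (p ^+ 2 * cube_unit) => *; lra.
Qed.

Lemma order_noise1 : A <= U.
Proof.
apply: le_trans order_noise; apply: le_trans (_ : W * A <= _).
  by rewrite ler_peMl ?W_ge1 // noise_unit_ge0.
by rewrite ler_peMl // mulr_ge0 ?powR_ge0 // noise_unit_ge0.
Qed.

Lemma order_cbrt : kk * order2 <= U.
Proof.
by rewrite orderE; move: U1 U2 U3 U4 U5; move: (p ^+ 2 * (W * A)) (kk * order2) (p * D) (p ^+ 2 * comp_unit) (p ^+ 2 * cube_unit) => *; lra.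
Qed.

Lemma order_det : p * D <= U.
Proof.
by rewrite orderE; move: U1 U2 U3 U4 U5; move: (p ^+ 2 * (W * A)) (kk * order2) (p * D) (p ^+ 2 * comp_unit) (p ^+ 2 * cube_unit) => *; lra.
Qed.

Lemma order_det1 : D <= U.
Proof. by apply: le_trans order_det; rewrite ler_peMl // ltW. Qed.

Lemma order_comp : p * comp_unit <= U.
Proof.
apply: le_trans (ler_wpM2r comp_unit_ge0 pp) _.
by rewrite orderE; move: U1 U2 U3 U4 U5; move: (p ^+ 2 * (W * A)) (kk * order2) (p * D) (p ^+ 2 * comp_unit) (p ^+ 2 * cube_unit) => *; lra.
Qed.

Lemma order_comp_cube : p * (comp_unit + cube_unit) <= U.
Proof.
apply: le_trans (ler_wpM2r (addr_ge0 comp_unit_ge0 cube_unit_ge0) pp) _; rewrite mulrDr.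
by rewrite orderE; move: U1 U2 U3 U4 U5; move: (p ^+ 2 * (W * A)) (kk * order2) (p * D) (p ^+ 2 * comp_unit) (p ^+ 2 * cube_unit) => *; lra.
Qed.

Let sqrt_le (q k y : R) : 0 <= y -> 1 <= k -> q <= k * y ^+ 2 -> Num.sqrt q <= k * y.
Proof.
move=> y0 k1 H; have [q0|qn] := leP 0 q; last by rewrite ler0_sqrtr ?(ltW qn) // mulr_ge0 // (le_trans ler01).
by apply: le_of_sqr (sqrtr_ge0 _) y0 k1 _; rewrite sqr_sqrtr.
Qed.

Lemma order_momentum (dH dX : R) : 0 < dX -> 0 <= dH <= D -> D <= r * dX ->
  D * Num.sqrt (6 * wu * (1 + wu) * dH / dX) <= 6 * r * U.
Proof.
move=> dX0 /andP[h0 hD] DX; have r6 : 1 <= 6 * r by move: r1; lra.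
apply: le_trans (_ : D * (6 * r * p) <= _); last first.
  rewrite [leLHS](_ : _ = 6 * r * (p * D)); last by ring.
  by apply: ler_wpM2l order_det; exact: le_trans r6.
apply: ler_wpM2l; first exact: ltW.
apply: sqrt_le => //; rewrite ler_pdivrMr //.
have H : dH <= r * dX := le_trans hD DX.
have k0 : 0 <= 6 * wu * (1 + wu) := mulr_ge0 (mulr_ge0 (ler0n R 6) wu0) p0.
apply: le_trans (ler_wpM2l k0 H) _.
rewrite -subr_ge0 (_ : _ - _ = 6 * p * (r * dX)); last by ring.
exact: mulr_ge0 (mulr_ge0 (ler0n R 6) p0) (mulr_ge0 (ltW r0) (ltW dX0)).
Qed.

(** Here Delta has to be comparable with the individual error d: after squaring, D / d <= r turns D
    / sqrt d into a multiple of sqrt D. *)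
Lemma noise_rate (M d w k : R) : 0 < d -> D <= r * d -> 0 <= M -> r * M <= k * w ^+ 2 -> 1 <= k -> 0 <= w ->
  D * Num.sqrt (kk * (M * sigma ^+ 2) / (nn * d)) <= k * (w * A).
Proof.
move=> d0 Dd M0 rM k1 w0.
have -> : D * Num.sqrt (kk * (M * sigma ^+ 2) / (nn * d)) =
    Num.sqrt (D ^+ 2 * (kk * (M * sigma ^+ 2) / (nn * d))).
  by rewrite (sqrtrM _ (sqr_ge0 D)) sqrtr_sqr (ger0_norm (ltW D0)).
apply: sqrt_le (mulr_ge0 w0 noise_unit_ge0) k1 _.
rewrite exprMn noise_unit_sqr.
have X0 : 0 <= D * sigma ^+ 2 * kk / nn.
  by apply: divr_ge0 (ltW nn0); apply: mulr_ge0 (ltW kk0); apply: mulr_ge0 (ltW D0) (sqr_ge0 _).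
rewrite [leRHS]mulrA; apply: le_trans (ler_wpM2r X0 rM).
rewrite [leLHS](_ : _ = D / d * (M * (D * sigma ^+ 2 * kk / nn))); last by field; rewrite !gt_eqF.
rewrite -[leRHS]mulrA; apply: ler_wpM2r; first exact: mulr_ge0.
by rewrite ler_pdivrMr.
Qed.

Lemma comp_rate (N d e k : R) : 0 < d -> D <= r * d -> 0 <= e <= D -> 0 <= N ->
  r * N <= k * (wl * (1 + wl)) -> 1 <= k ->
  D * Num.sqrt (N * e / (nn * d)) <= k * comp_unit.
Proof.
move=> d0 Dd /andP[e0 eD] N0 rN k1.
rewrite /comp_unit (_ : k * _ = D * (k * (Num.sqrt (wl * (1 + wl)) / Num.sqrt nn))); last by ring.
apply: ler_wpM2l; first exact: ltW.
apply: sqrt_le (divr_ge0 (sqrtr_ge0 _) (sqrtr_ge0 _)) k1 _.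
rewrite exprMn exprVn (sqr_sqrtr wl1) (sqr_sqrtr (ltW nn0)) [leRHS]mulrA ler_pdivlMr //.
apply: le_trans rN; rewrite [leLHS](_ : _ = e / d * N); last by field; rewrite !gt_eqF.
by apply: ler_wpM2r => //; rewrite ler_pdivrMr //; exact: le_trans eD Dd.
Qed.

(** wl * w1 has terms in wl, wl^2 and wl^3. The middle one is absorbed by the outer two; the linear
    one over n is at most sqrt(wl (1 + wl)) / sqrt n because n >= 1, and the cubic one is the last
    term of the order. *)
Lemma ratio_rate : wl * w1 / nn * D <= 9 * (comp_unit + cube_unit).
Proof.
have H1 : wl * w1 <= 9 * (wl + wl ^+ 3).
  rewrite -subr_ge0 /omega1 (_ : _ - _ = wl * (5 + 3 * (wl - 1) ^+ 2)); last by ring.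
  by apply: mulr_ge0 => //; exact: addr_ge0 (ler0n R 5) (mulr_ge0 (ler0n R 3) (sqr_ge0 _)).
have H2 : wl / nn * D <= comp_unit.
  rewrite /comp_unit [leRHS]mulrAC; apply: ler_wpM2r; first exact: ltW.
  apply: ler_pM => //; first by rewrite invr_ge0 ltW.
    rewrite -{1}(ger0_norm wl0) -sqrtr_sqr ler_wsqrtr // expr2 ler_wpM2l // lerDr //.
  rewrite lef_pV2 ?posrE ?sqrtr_gt0 // -{2}(sqr_sqrtr (ltW nn0)) expr2 ler_peMr ?sqrtr_ge0 //.
  by rewrite -sqrtr1 ler_wsqrtr.
have nD : 0 <= nn^-1 * D by rewrite mulr_ge0 ?invr_ge0 ?ltW.
rewrite -[leLHS]mulrA; apply: le_trans (ler_wpM2r nD H1) _; rewrite -[leLHS]mulrA ler_pM2l // mulrDl.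
apply: lerD; first by rewrite mulrA.
by rewrite /cube_unit mulrA mulrAC.
Qed.

Lemma cbrt_rate_order (dX : R) : 0 < dX -> D <= r * dX ->
  D * (18 * wu * (1 + wu) * kk * (sigma ^+ 2 * (1 + rho2)) / dX) `^ (3^-1) <=
  18 * r * (1 + rho2) * (kk * order2).
Proof.
move=> dX0 DX.
have rr1 : 1 <= 1 + rho2 by rewrite lerDl.
have rr0 := le_trans ler01 rr1.
have q0 : 0 <= 18 * wu * (1 + wu) * kk * (sigma ^+ 2 * (1 + rho2)) / dX.
  apply: divr_ge0 (ltW dX0); apply: mulr_ge0 (mulr_ge0 (sqr_ge0 _) rr0).
  exact: mulr_ge0 (mulr_ge0 (mulr_ge0 (ler0n R 18) wu0) p0) (ltW kk0).
apply: le_of_cube => //.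
- exact: mulr_ge0 (ltW D0) (powR_ge0 _ _).
- have H : 1 <= r * (1 + rho2) by rewrite -[leLHS]mulr1 ler_pM.
  by rewrite -mulrA; move: H; move: (r * _) => u; lra.
have o3 : (kk * order2) ^+ 3 = wu * p * D ^+ 2 * sigma ^+ 2 * kk.
  rewrite /order2 !exprMn exprVn !powR_third_cube // !powR_two_thirds_cube ?(ltW D0) ?(ltW kk0) //.
  by field; rewrite gt_eqF.
rewrite o3 exprMn powR_third_cube //.
rewrite [leLHS](_ : _ = D / dX * (18 * (1 + rho2) * (wu * p * D ^+ 2 * sigma ^+ 2 * kk))); last first.
  by field; rewrite gt_eqF.
rewrite [leRHS](_ : _ = r * (18 * (1 + rho2) * (wu * p * D ^+ 2 * sigma ^+ 2 * kk))); last by ring.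
apply: ler_wpM2r; last by rewrite ler_pdivrMr.
apply: mulr_ge0 (mulr_ge0 (ler0n R 18) rr0) _; apply: mulr_ge0 (ltW kk0).
exact: mulr_ge0 (mulr_ge0 (mulr_ge0 wu0 p0) (sqr_ge0 _)) (sqr_ge0 _).
Qed.

(** The origin of the exponent 3/2: the compressed noise factor is a cubic in omega_l and enters
    beta and gamma under a square root. *)
Let e36 : 1 + 6 * wl * w1 <= 36 * W ^+ 2.
Proof.
rewrite powR_three_halves_sqr ?addr_ge0 //.
rewrite -subr_ge0 /omega1 (_ : _ - _ = 35 + 102 * wl + 72 * wl ^+ 2); last by ring.
exact: addr_ge0 (addr_ge0 (ler0n R 35) (mulr_ge0 (ler0n R 102) wl0))
  (mulr_ge0 (ler0n R 72) (sqr_ge0 _)).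
Qed.

Let e0 : 0 <= 1 + 6 * wl * w1.
Proof.
apply: addr_ge0 => //; apply: mulr_ge0; first exact: mulr_ge0 (ler0n R 6) wl0.
exact: le_trans ler01 (omega1_ge1 wl0).
Qed.

Definition order_const := 2 + 6 * r + r * (1 + rho2) + 18 * r * (1 + rho2)
  + ((mu + Lg) / 2 + 864 * Lg ^+ 2 / mu + 8 * r + 72 * r)
  + (Lg + 3888 * Lg ^+ 2 / mu + 8 * r + 36 * r * (1 + rho2)).

(** Each summand of 1 / theta, 1 / beta and 1 / gamma, multiplied by Delta and, for the last two, by
    1 + omega_u, is matched with one or two terms of the order. *)
Lemma order_total (dX dH dY dMy dZ dMz t b g : R) :
  0 < dX -> 0 < dY -> 0 < dZ -> 0 <= dH <= D -> 0 <= dMy <= D -> 0 <= dMz <= D ->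
  D <= r * dX -> D <= r * dY -> D <= r * dZ ->
  t^-1 = 1 + Num.sqrt (6 * wu * (1 + wu) * dH / dX)
       + Num.sqrt (kk * (sigma ^+ 2 * (1 + rho2)) / (nn * dX))
       + (18 * wu * (1 + wu) * kk * (sigma ^+ 2 * (1 + rho2)) / dX) `^ (3^-1) ->
  b^-1 = (mu + Lg) / 2 + 96 * wl * w1 * Lg ^+ 2 / (mu * nn)
       + Num.sqrt (2 * wl * (1 + 4 * wl) * dMy / (nn * dY))
       + Num.sqrt (2 * kk * sigma ^+ 2 * (1 + 6 * wl * w1) / (nn * dY)) ->
  g^-1 = Lg + 432 * wl * w1 * Lg ^+ 2 / (mu * nn)
       + Num.sqrt (3 * wl * (1 + 4 * wl) * dMz / (2 * nn * dZ))
       + Num.sqrt (kk * (sigma ^+ 2 * (1 + rho2)) * (1 + 6 * wl * w1) / (nn * dZ)) ->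
  (t^-1 + p + p / b + p / g) * D <= order_const * (kk * rate_order).
Proof.
move=> dX0 dY0 dZ0 hH hMy hMz DX DY DZ tE bE gE.
have rr1 : 1 <= 1 + rho2 by rewrite lerDl.
have rr0 := le_trans ler01 rr1.
have rr : 1 <= r * (1 + rho2) by rewrite -[leLHS]mulr1 ler_pM.
have U0 : 0 <= U := le_trans (ltW D0) order_det1.
have T : t^-1 * D <= (1 + 6 * r + r * (1 + rho2) + 18 * r * (1 + rho2)) * U.
  have k1 := order_momentum dX0 hH DX.
  have k2 : D * Num.sqrt (kk * (sigma ^+ 2 * (1 + rho2)) / (nn * dX)) <= r * (1 + rho2) * U.
    rewrite (mulrC (sigma ^+ 2)).
    have := noise_rate dX0 DX rr0 (w := 1) (k := r * (1 + rho2)); rewrite expr1n mulr1 mul1r.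
    move=> /(_ (lexx _) rr ler01) /le_trans; apply.
    by apply: ler_wpM2l order_noise1; exact: le_trans rr.
  have k3 := cbrt_rate_order dX0 DX.
  have k3' : 18 * r * (1 + rho2) * (kk * order2) <= 18 * r * (1 + rho2) * U.
    by apply: ler_wpM2l order_cbrt; apply: mulr_ge0 rr0; exact: mulr_ge0 (ler0n R 18) (ltW r0).
  have := lerD (lerD (lerD order_det1 k1) k2) (le_trans k3 k3').
  by rewrite tE; congr (_ <= _); ring.
have C : p * (wl * w1 / nn * D) <= 9 * U.
  apply: le_trans (ler_wpM2l p0 ratio_rate) _; rewrite mulrCA.
  by apply: ler_wpM2l => //; exact: order_comp_cube.
have N1 (M d k : R) : 0 < d -> D <= r * d -> 0 <= M -> r * M <= k * W ^+ 2 -> 1 <= k ->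
    p * (D * Num.sqrt (kk * (M * sigma ^+ 2) / (nn * d))) <= k * U.
  move=> d0 Dd M0 rM k1; apply: le_trans (ler_wpM2l p0 (noise_rate d0 Dd M0 rM k1 (powR_ge0 _ _))) _.
  by rewrite mulrCA; apply: ler_wpM2l order_noise; exact: le_trans k1.
have N2 (N d e k : R) : 0 < d -> D <= r * d -> 0 <= e <= D -> 0 <= N ->
    r * N <= k * (wl * (1 + wl)) -> 1 <= k -> p * (D * Num.sqrt (N * e / (nn * d))) <= k * U.
  move=> d0 Dd he N0 rN k1; apply: le_trans (ler_wpM2l p0 (comp_rate d0 Dd he N0 rN k1)) _.
  by rewrite mulrCA; apply: ler_wpM2l order_comp; exact: le_trans k1.
have mui : 0 <= mu^-1 by rewrite invr_ge0 ltW.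
have Lmu : 0 <= Lg ^+ 2 / mu by apply: mulr_ge0 mui; exact: sqr_ge0.
have w4 : 0 <= 1 + 4 * wl := addr_ge0 ler01 (mulr_ge0 (ler0n R 4) wl0).
have w3 : 0 <= wl * (3 + 6 * wl).
  by apply: mulr_ge0 => //; exact: addr_ge0 (ler0n R 3) (mulr_ge0 (ler0n R 6) wl0).
have B : p / b * D <= ((mu + Lg) / 2 + 864 * Lg ^+ 2 / mu + 8 * r + 72 * r) * U.
  have k1 : (mu + Lg) / 2 * (p * D) <= (mu + Lg) / 2 * U.
    by apply: ler_wpM2l order_det; rewrite divr_ge0 // addr_ge0 // ltW.
  have k2 : 96 * (Lg ^+ 2 / mu) * (p * (wl * w1 / nn * D)) <= 96 * (Lg ^+ 2 / mu) * (9 * U).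
    by apply: ler_wpM2l C; exact: mulr_ge0 (ler0n R 96) Lmu.
  have k3 : p * (D * Num.sqrt (2 * wl * (1 + 4 * wl) * dMy / (nn * dY))) <= 8 * r * U.
    apply: N2 => //; first exact: mulr_ge0 (mulr_ge0 (ler0n R 2) wl0) w4.
      rewrite -subr_ge0 (_ : _ - _ = 2 * r * (wl * 3)); last by ring.
      exact: mulr_ge0 (mulr_ge0 (ler0n R 2) (ltW r0)) (mulr_ge0 wl0 (ler0n R 3)).
    by move: r1; lra.
  have k4 : p * (D * Num.sqrt (2 * kk * sigma ^+ 2 * (1 + 6 * wl * w1) / (nn * dY))) <= 72 * r * U.
    rewrite (_ : 2 * kk * sigma ^+ 2 * _ = kk * (2 * (1 + 6 * wl * w1) * sigma ^+ 2)); last by ring.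
    apply: N1 => //; first exact: mulr_ge0.
      rewrite mulrCA [leRHS](_ : _ = 2 * (r * (36 * W ^+ 2))); last by ring.
      by apply: ler_wpM2l => //; apply: ler_wpM2l e36; exact: ltW.
    by move: r1; lra.
  have := lerD (lerD (lerD k1 k2) k3) k4.
  by rewrite bE; congr (_ <= _); [field; rewrite !gt_eqF|ring].
have G : p / g * D <= (Lg + 3888 * Lg ^+ 2 / mu + 8 * r + 36 * r * (1 + rho2)) * U.
  have k1 : Lg * (p * D) <= Lg * U by exact: ler_wpM2l order_det.
  have k2 : 432 * (Lg ^+ 2 / mu) * (p * (wl * w1 / nn * D)) <= 432 * (Lg ^+ 2 / mu) * (9 * U).
    by apply: ler_wpM2l C; exact: mulr_ge0 (ler0n R 432) Lmu.
  have k3 : p * (D * Num.sqrt (3 * wl * (1 + 4 * wl) * dMz / (2 * nn * dZ))) <= 8 * r * U.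
    rewrite (_ : 3 * wl * (1 + 4 * wl) * dMz / _ = (3 / 2 * wl * (1 + 4 * wl)) * dMz / (nn * dZ)); last first.
      by field; rewrite !gt_eqF.
    have h32 : 0 <= 3 / 2 :> R by rewrite divr_ge0.
    apply: N2 => //; first exact: mulr_ge0 (mulr_ge0 h32 wl0) w4.
      rewrite -subr_ge0 (_ : _ - _ = r * (wl * (13 / 2 + 2 * wl))); last by field.
      have h13 : 0 <= 13 / 2 :> R by rewrite divr_ge0.
      exact: mulr_ge0 (ltW r0) (mulr_ge0 wl0 (addr_ge0 h13 (mulr_ge0 (ler0n R 2) wl0))).
    by move: r1; lra.
  have k4 : p * (D * Num.sqrt (kk * (sigma ^+ 2 * (1 + rho2)) * (1 + 6 * wl * w1) / (nn * dZ))) <=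
      36 * r * (1 + rho2) * U.
    rewrite (_ : kk * (sigma ^+ 2 * _) * _ = kk * ((1 + rho2) * (1 + 6 * wl * w1) * sigma ^+ 2)); last by ring.
    apply: N1 => //; first exact: mulr_ge0.
      rewrite [leLHS]mulrA [leRHS](_ : _ = r * (1 + rho2) * (36 * W ^+ 2)); last by ring.
      by apply: ler_wpM2l e36; exact: le_trans rr.
    by move: rr; rewrite -[36 * r * _]mulrA; move: (r * _) => u; lra.
  have := lerD (lerD (lerD k1 k2) k3) k4.
  by rewrite gE; congr (_ <= _); [field; rewrite !gt_eqF|ring].
have := lerD (lerD (lerD T order_det) B) G.
by rewrite /order_const; congr (_ <= _); ring.
Qed.

End RateOrder.

Lemma ler_inv_ratio {R : realType} (a m b : R) : 0 < m -> 0 < b -> a / m <= b^-1 -> b * a <= m.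
Proof. by move=> m0 b0; rewrite ler_pdivrMr // ler_pdivlMl. Qed.

Lemma ler_sum4 {R : realType} (s u v w o : R) : 0 <= u -> 0 <= v -> 0 <= w -> 0 <= o ->
  s = u + v + w + o -> [/\ u <= s, v <= s, w <= s & o <= s].
Proof. by move=> *; split; lra. Qed.

Section Rate.
Context {R : realType} (c : constants R).

(** The constant in the order must be fixed before the run. [rate_const] reads the hyperparameters
    only through rho, which is prescribed by the problem constants, so a dummy record with that rho
    represents them all. *)
Definition ref_par : hyperparams R := Hyperparams 0 0 0 0 (C_f c / mu_g c) 0 0.

Lemma rate_const_ref (par : hyperparams R) : rho par = C_f c / mu_g c ->
  rate_const c par = rate_const c ref_par.
Proof.
by move=> H; rewrite /rate_const /C3_const /Qsq /L5sq /L4sq /L2sq /L1sq H.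
Qed.

(** The absolute values and the summand 1 make the factor positive for every r and every record of
    constants, including those that no problem satisfies. *)
Definition order_factor (r : R) : R :=
  1 + `|rate_const c ref_par| * `|order_const r (mu_g c) (L_g c) ((C_f c / mu_g c) ^+ 2)|.

Lemma order_factor_gt0 r : 0 < order_factor r.
Proof. by rewrite ltr_wpDr // mulr_ge0. Qed.

Section Rates.
Variables (r : R) (n p q : nat) (pb : problem R n p q)
  (Cu : 'I_n -> compressor R p) (Cl : 'I_n -> compressor R q)
  (rd : randomness pb Cu Cl) (par : hyperparams R) (ini : initial R n p q)
  (sigma wu wl : R) (K : nat).
Notation dX := (Delta_x pb ini).
Notation dY := (Delta_y pb ini).
Notation dZ := (Delta_z pb ini).
Notation D := (Delta_max rd ini).
Notation w1 := (omega1 wl).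

Lemma Delta_max_ge0 : (forall x, 0 <= Phi pb x) ->
  [/\ 0 <= Delta_Phi pb ini <= D, 0 <= dX <= D, 0 <= Delta_h rd ini <= D &
    [/\ 0 <= dY <= D, 0 <= dZ <= D, 0 <= Delta_my rd ini <= D & 0 <= Delta_mz rd ini <= D]].
Proof.
move=> Phi0; have mean0 m (v : 'I_n -> 'cV[R]_m) : 0 <= n%:R^-1 * \sum_(i < n) enorm (v i) ^+ 2.
  by rewrite mulr_ge0 ?invr_ge0 // sumr_ge0 // => i _; exact: sqr_ge0.
by split; [| | |split]; rewrite ?mean0 ?sqr_ge0 ?Phi0 /Delta_max ?le_max ?lexx ?orbT.
Qed.

Lemma convergence_rate :
  (0 < n)%N -> (0 < p)%N -> (0 < q)%N -> (0 < K)%N ->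
  efsoba_setting rd c par ini sigma wu wl ->
  (forall x, 0 <= Phi pb x) ->
  0 < dX -> 0 < dY -> 0 < dZ ->
  D <= r * dX -> D <= r * dY -> D <= r * dZ ->
  (forall i, mx0 ini i = hx0 ini i) ->
  alpha par = (2 * L_Phi c + (C3 c par n wu wl)^-1)^-1 ->
  rho par = C_f c / mu_g c ->
  delta_l par = (1 + wl)^-1 ->
  delta_u par = (1 + wu)^-1 ->
  beta par =
    ((mu_g c + L_g c) / 2
     + 96 * wl * omega1 wl * L_g c ^+ 2 / (mu_g c * n%:R)
     + Num.sqrt (2 * wl * (1 + 4 * wl) * Delta_my rd ini / (n%:R * dY))
     + Num.sqrt (2 * K%:R * sigma ^+ 2 * (1 + 6 * wl * omega1 wl) / (n%:R * dY)))^-1 ->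
  gamma par =
    (L_g c
     + 432 * wl * omega1 wl * L_g c ^+ 2 / (mu_g c * n%:R)
     + Num.sqrt (3 * wl * (1 + 4 * wl) * Delta_mz rd ini / (2 * n%:R * dZ))
     + Num.sqrt (K%:R * sigma1sq par sigma * (1 + 6 * wl * omega1 wl) / (n%:R * dZ)))^-1 ->
  theta par =
    (1 + Num.sqrt (6 * wu * (1 + wu) * Delta_h rd ini / dX)
     + Num.sqrt (K%:R * sigma1sq par sigma / (n%:R * dX))
     + (18 * wu * (1 + wu) * K%:R * sigma1sq par sigma / dX) `^ (3^-1))^-1 ->
  (avg_sq_grad rd par ini K <= (order_factor r * rate_order wu wl K%:R n%:R D sigma)%:E)%E.
Proof.
move=> n0 p0 q0 K0 setting Phi0 dX0 dY0 dZ0 DX DY DZ mh0 aE rhoE dL dU bE gE tE.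
have [[reg cont sc noise dl] [[hCu hCl fr] [[a0 b0 g0 t0] [r0 _ _ z0]]]] := setting.
have mu0 := mu_gt0 sc; have muL := mu_le_Lg n0 q0 cont sc; have Lg0 := Lg_gt0 n0 q0 cont sc.
have LP0 : 0 < L_Phi c by have [[]] := dl.
have wu0 : 0 <= wu by have [] := hCu (Ordinal n0).
have wl0 : 0 <= wl by have [] := hCl (Ordinal n0).
have sigma0 : 0 <= sigma by have [] := noise.
have w10 := le_trans ler01 (omega1_ge1 wl0).
have nn0 : 0 < n%:R :> R by rewrite ltr0n.
have nn1 : 1 <= n%:R :> R by rewrite ler1n.
have KK0 : 0 < K%:R :> R by rewrite ltr0n.
have [hP hX hH [hY hZ hMy hMz]] := Delta_max_ge0 Phi0.
have D0 : 0 < D by case/andP: hX => _; exact: lt_le_trans.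
(* Forced by Delta_x <= Delta <= r Delta_x with Delta_x > 0. *)
have r1 : 1 <= r.
  by rewrite -(ler_pM2r dX0) mul1r; apply: le_trans DX; case/andP: hX.
have rho20 : 0 <= (C_f c / mu_g c) ^+ 2 by exact: sqr_ge0.
have s10 : 0 <= sigma1sq par sigma by apply: mulr_ge0 (sqr_ge0 _) _; rewrite addr_ge0 // sqr_ge0.
have p0' : 0 <= 1 + wu by rewrite addr_ge0.
have e0 : 0 <= 1 + 6 * wl * w1.
  by apply: addr_ge0 => //; exact: mulr_ge0 (mulr_ge0 (ler0n R 6) wl0) w10.
have c0 := C3_gt0 n b0 g0 t0 mu0 muL wu0 wl0 LP0.
have aI : (alpha par)^-1 = 2 * L_Phi c + (C3 c par n wu wl)^-1 by rewrite aE invrK.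
have bI := congr1 GRing.inv bE; rewrite invrK in bI.
have gI := congr1 GRing.inv gE; rewrite invrK in gI.
have tI := congr1 GRing.inv tE; rewrite invrK in tI.
have Lw k : 0 <= k%:R * wl * w1 * L_g c ^+ 2 / (mu_g c * n%:R).
  by apply: divr_ge0 (mulr_ge0 (ltW mu0) (ltW nn0)); apply: mulr_ge0 (sqr_ge0 _); rewrite mulr_ge0 // mulr_ge0.
have mun : 0 < mu_g c * n%:R by exact: mulr_gt0.
have nX : 0 < n%:R * dX by exact: mulr_gt0.
have nY : 0 < n%:R * dY by exact: mulr_gt0.
have nZ : 0 < n%:R * dZ by exact: mulr_gt0.
have mL : 0 <= (mu_g c + L_g c) / 2 by rewrite divr_ge0 // addr_ge0 // ltW.
have [b1 b2 _ b3] := ler_sum4 mL (Lw 96%N) (sqrtr_ge0 _) (sqrtr_ge0 _) bI.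
have [g1 g2 _ g3] := ler_sum4 (ltW Lg0) (Lw 432%N) (sqrtr_ge0 _) (sqrtr_ge0 _) gI.
have [t1 t2 t3 t4] := ler_sum4 ler01 (sqrtr_ge0 _) (sqrtr_ge0 _) (powR_ge0 _ _) tI.
have t01 : theta par <= 1 by rewrite -[theta par]invrK invf_le1 // invr_gt0.
have hb := ler_inv_ratio mun b0 b2; have hg := ler_inv_ratio mun g0 g2.
have bL : beta par * (mu_g c + L_g c) <= 2 by exact: ler_inv_ratio b0 b1.
have gL : gamma par * L_g c <= 1 by rewrite -ler_pdivlMl // mulr1.
have ci : 0 < (C3 c par n wu wl)^-1 by rewrite invr_gt0.
have LP2 : 0 <= 2 * L_Phi c by rewrite mulr_ge0 // ltW.
have aL : 2 * alpha par * L_Phi c <= 1.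
  rewrite mulrAC mulrC -ler_pdivlMl // mulr1 aI lerDl; exact: ltW.
have aC : alpha par <= C3 c par n wu wl.
  by rewrite -lef_pV2 ?posrE // aI lerDr.
have rho_ge : C_f c / mu_g c <= rho par by rewrite rhoE.
have tt : 0 < theta par <= 1 by rewrite t0.
(* The initial lag is now the inexactness of (y^0, z^0), so that the amplified momentum error starts
   at Delta_h. *)
apply: le_trans (avg_sq_grad_lyap n0 q0 reg cont sc noise dl hCu hCl fr rho_ge r0 a0 b0 g0 tt
  dL dU aL aC bL gL hb hg Phi0 z0 (lag0 pb ini) K0) _.
rewrite lee_fin.
have rate_h : 6 * wu * (1 + wu) * Delta_h rd ini * theta par <= dX / theta par.
  apply: sqrt_rate t2 => //; case/andP: hH => h0 _.
  exact: mulr_ge0 (mulr_ge0 (mulr_ge0 (ler0n R 6) wu0) p0') h0.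
have rate_x : K%:R * sigma1sq par sigma * theta par <= n%:R * dX / theta par.
  by apply: sqrt_rate t3 => //; exact: mulr_ge0 (ltW KK0) s10.
have rate_u : 18 * wu * (1 + wu) * K%:R * sigma1sq par sigma * theta par ^+ 2 <= dX / theta par.
  apply: cbrt_rate t4 => //.
  exact: mulr_ge0 (mulr_ge0 (mulr_ge0 (mulr_ge0 (ler0n R 18) wu0) p0') (ltW KK0)) s10.
have rate_y : 2 * K%:R * sigma ^+ 2 * (1 + 6 * wl * w1) * beta par <= n%:R * dY / beta par.
  apply: sqrt_rate b3 => //.
  exact: mulr_ge0 (mulr_ge0 (mulr_ge0 (ler0n R 2) (ltW KK0)) (sqr_ge0 _)) e0.
have rate_z : K%:R * sigma1sq par sigma * (1 + 6 * wl * w1) * gamma par <= n%:R * dZ / gamma par.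
  by apply: sqrt_rate g3 => //; exact: mulr_ge0 (mulr_ge0 (ltW KK0) s10) e0.
have H := budget b0 g0 t0 mu0 muL n0 wu0 wl0 LP0 hb hg t01 aI hP hX hH hY hZ hMy hMz (ltW KK0)
  (init_errS_lag n0 setting rho_ge) (init_errB_lag setting) (init_errRy n0 setting)
  (init_errRz n0 setting rho_ge) rate_h rate_x rate_u rate_y rate_z.
rewrite rate_const_ref // in H.
rewrite /sigma1sq rhoE in tI gI.
have T := order_total r1 mu0 (ltW Lg0) rho20 wu0 wl0 KK0 nn1 D0 sigma0 dX0 dY0 dZ0 hH hMy hMz
  DX DY DZ tI bI gI.
rewrite -/(rate_scale par wu) in T.
have O0 : 0 <= rate_order wu wl K%:R n%:R D sigma by exact: rate_order_ge0.
have S0 : 0 <= rate_scale par wu * D.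
  apply: mulr_ge0 (ltW D0); rewrite /rate_scale.
  by rewrite !addr_ge0 ?divr_ge0 ?invr_ge0 // ltW.
have main : lyap pb c par wu wl (init_state ini) (lag0 pb ini)
    + K%:R * noise_level c par n wu wl sigma <=
    order_factor r * (K%:R * rate_order wu wl K%:R n%:R D sigma).
  have E : lyap pb c par wu wl (init_state ini) (lag0 pb ini) =
      2 / alpha par * Delta_Phi pb ini + wtS par * errS (lag0 pb ini)
      + wtB par * errB pb (init_state ini) (lag0 pb ini) + wtW par wu * Delta_h rd ini
      + wtM wu * errS (lag0 pb ini) + wtY c par * dY + wtR c par n wl * errRy pb (init_state ini)
      + wtZ c par * dZ + wtT c par n wl * errRz pb (init_state ini).
    by rewrite /lyap -(init_errW_lag setting) (init_errM_lag pb mh0).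
  rewrite E; apply: le_trans H _.
  apply: le_trans (ler_wpM2r S0 (ler_norm _)) _.
  apply: le_trans (ler_wpM2l (normr_ge0 _) T) _.
  have KO : 0 <= K%:R * rate_order wu wl K%:R n%:R D sigma := mulr_ge0 (ltW KK0) O0.
  rewrite /order_factor [leRHS]mulrDl mul1r -[X in _ <= _ + X]mulrA.
  apply: le_trans (_ : `|rate_const c ref_par| * (`|order_const r (mu_g c) (L_g c) ((C_f c / mu_g c) ^+ 2)| *
    (K%:R * rate_order wu wl K%:R n%:R D sigma)) <= _); last by rewrite lerDr.
  by apply: ler_wpM2l => //; apply: ler_wpM2r => //; exact: ler_norm.
rewrite -(ler_pM2l KK0) [leRHS]mulrCA; apply: le_trans main.
by rewrite mulrDr mulrCA mulfV ?mulr1 // gt_eqF.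
Qed.

End Rates.
End Rate.

Theorem theoremB26 (R : realType) (c : constants R) :
  (forall (n p q : nat) (pb : problem R n p q)
      (Cu : 'I_n -> compressor R p) (Cl : 'I_n -> compressor R q)
      (rd : randomness pb Cu Cl) (par : hyperparams R) (ini : initial R n p q)
      (sigma omega_u omega_l : R) (K : nat),
    (0 < n)%N -> (0 < p)%N -> (0 < q)%N -> (0 < K)%N ->
    efsoba_setting rd c par ini sigma omega_u omega_l ->
    (forall x, 0 <= Phi pb x) ->
    theta par <= 1 ->
    ((beta par)%:E < mine (2 / (mu_g c + L_g c))%:E
       (quot_oo (mu_g c * n%:R)
          (96 * omega_l * omega1 omega_l * L_g c ^+ 2)))%E ->
    ((gamma par)%:E <= mine (quot_oo 1 (L_g c))
       (quot_oo (mu_g c * n%:R)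
          (432 * omega_l * omega1 omega_l * L_g c ^+ 2)))%E ->
    C_f c / mu_g c <= rho par ->
    delta_l par = (1 + omega_l)^-1 ->
    delta_u par = (1 + omega_u)^-1 ->
    (forall i, mx0 ini i = hx0 ini i) ->
    alpha par <= Num.min (1 / (2 * L_Phi c)) (C3 c par n omega_u omega_l) ->
    (avg_sq_grad rd par ini K <=
      (2 * Delta_Phi pb ini / (K%:R * alpha par)
       + 2 * Delta_x pb ini / (K%:R * theta par)
       + 12 * omega_u * (1 + omega_u) * theta par * Delta_h rd ini / K%:R
       + 24 * omega2 omega_u * (L2sq c par + 25 * kappa_g c ^+ 2 * L1sq c par)
           * Delta_y pb ini / (mu_g c * K%:R * beta par)
       + 48 * omega2 omega_u * L_g c ^+ 2 * Delta_z pb ini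
           / (mu_g c * K%:R * gamma par)
       + 48 * omega2 omega_u * (1 + 6 * omega_l * omega1 omega_l)
           * (L2sq c par + 25 * kappa_g c ^+ 2 * L1sq c par) * beta par
           / (mu_g c * n%:R) * sigma ^+ 2
       + (2 * theta par / n%:R
          + 36 * omega_u * (1 + omega_u) * theta par ^+ 2
          + 72 * omega2 omega_u * (1 + 6 * omega_l * omega1 omega_l)
              * L_g c ^+ 2 * gamma par / (mu_g c * n%:R)) * sigma1sq par sigma
       + 48 * omega2 omega_u * omega_l * (1 + 4 * omega_l)
           * (L2sq c par + 25 * kappa_g c ^+ 2 * L1sq c par) * beta par
           / (mu_g c * K%:R * n%:R ^+ 2)
           * \sum_(i < n) enorm (mean_Dy0 rd ini i - my0 ini i) ^+ 2
       + 72 * omega2 omega_u * omega_l * (1 + 4 * omega_l) * L_g c ^+ 2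
           * gamma par / (mu_g c * K%:R * n%:R ^+ 2)
           * \sum_(i < n) enorm (mean_Dz0 rd ini i - mz0 ini i) ^+ 2)%:E)%E)
  /\
  (forall r : R, exists C : R, 0 < C /\
    forall (n p q : nat) (pb : problem R n p q)
      (Cu : 'I_n -> compressor R p) (Cl : 'I_n -> compressor R q)
      (rd : randomness pb Cu Cl) (par : hyperparams R) (ini : initial R n p q)
      (sigma omega_u omega_l : R) (K : nat),
    (0 < n)%N -> (0 < p)%N -> (0 < q)%N -> (0 < K)%N ->
    efsoba_setting rd c par ini sigma omega_u omega_l ->
    (forall x, 0 <= Phi pb x) ->
    0 < Delta_x pb ini -> 0 < Delta_y pb ini -> 0 < Delta_z pb ini ->
    Delta_max rd ini <= r * Delta_x pb ini ->
    Delta_max rd ini <= r * Delta_y pb ini ->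
    Delta_max rd ini <= r * Delta_z pb ini ->
    (forall i, mx0 ini i = hx0 ini i) ->
    alpha par = (2 * L_Phi c + (C3 c par n omega_u omega_l)^-1)^-1 ->
    rho par = C_f c / mu_g c ->
    delta_l par = (1 + omega_l)^-1 ->
    delta_u par = (1 + omega_u)^-1 ->
    beta par =
      ((mu_g c + L_g c) / 2
       + 96 * omega_l * omega1 omega_l * L_g c ^+ 2 / (mu_g c * n%:R)
       + Num.sqrt (2 * omega_l * (1 + 4 * omega_l) * Delta_my rd ini
                     / (n%:R * Delta_y pb ini))
       + Num.sqrt (2 * K%:R * sigma ^+ 2 * (1 + 6 * omega_l * omega1 omega_l)
                     / (n%:R * Delta_y pb ini)))^-1 ->
    gamma par =
      (L_g c
       + 432 * omega_l * omega1 omega_l * L_g c ^+ 2 / (mu_g c * n%:R)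
       + Num.sqrt (3 * omega_l * (1 + 4 * omega_l) * Delta_mz rd ini
                     / (2 * n%:R * Delta_z pb ini))
       + Num.sqrt (K%:R * sigma1sq par sigma * (1 + 6 * omega_l * omega1 omega_l)
                     / (n%:R * Delta_z pb ini)))^-1 ->
    theta par =
      (1 + Num.sqrt (6 * omega_u * (1 + omega_u) * Delta_h rd ini
                       / Delta_x pb ini)
       + Num.sqrt (K%:R * sigma1sq par sigma / (n%:R * Delta_x pb ini))
       + (18 * omega_u * (1 + omega_u) * K%:R * sigma1sq par sigma
            / Delta_x pb ini) `^ (3^-1))^-1 ->
    (avg_sq_grad rd par ini K <=
      (C *
       ((1 + omega_u) ^+ 2 * (1 + omega_l) `^ (3 / 2)
          * Num.sqrt (Delta_max rd ini) * sigma / Num.sqrt (n%:R * K%:R)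
        + omega_u `^ (3^-1) * (1 + omega_u) `^ (3^-1)
            * (Delta_max rd ini) `^ (2 / 3) * sigma `^ (2 / 3)
            / K%:R `^ (2 / 3)
        + (1 + omega_u) * Delta_max rd ini / K%:R
        + (1 + omega_u) ^+ 2 * Num.sqrt (omega_l * (1 + omega_l))
            * Delta_max rd ini / (Num.sqrt n%:R * K%:R)
        + (1 + omega_u) ^+ 2 * omega_l ^+ 3 * Delta_max rd ini
            / (n%:R * K%:R)))%:E)%E).
Proof.
split=> [n p q pb Cu Cl rd par ini sigma wu wl K|r]; first exact: finite_time_bound.
exists (order_factor c r); split=> [|n p q pb Cu Cl rd par ini sigma wu wl K].
  exact: order_factor_gt0.
exact: convergence_rate.
Qed.
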